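(* Let $s>1/2$, let $R_s(x)=\sum_{n=1}^\infty n^{-2s}e^{2\pi i n^2 x}$ on $\mathbb T$, and for $p>0$ let $\eta_s(p)=\sup\{\sigma : R_s\in B^{\sigma/p}_{p,\infty}\}$. Then $R_s$ satisfies the multifractal formalism in dimension 1, that is, \[ d_s(\alpha)=\inf_{p>0}\{\alpha p-\eta_s(p)+1\} \] for all values of $\alpha$ in the range where $\alpha\mapsto d_s(\alpha)$ is increasing, namely for all $\alpha\le s-1/4$.
   Context: $\mathbb T=\mathbb R/\mathbb Z$, $e_n(x)=e^{2\pi i n x}$. Besov spaces on $\mathbb T$: for $f=\sum_n \hat f_n e_n$, let $P_0f=\hat f_0$ and $P_kf=\sum_{2^{k-1}\le |n|<2^{k}}\hat f_n e_n$ for $k\ge1$; then $f\in B^{\sigma}_{p,\infty}$ iff $\sup_k 2^{k\sigma}\|P_kf\|_{L^p(\mathbb T)}<\infty$. A function $f$ is $\alpha$-Hölder at $x_0$, $f\in C^\alpha(x_0)$, if there is a polynomial $P$ of degree at most $\alpha$ and $C>0$ with $|f(x_0+h)-P(h)|\le C|h|^\alpha$ for small $h$; the Hölder exponent is $\alpha_f(x_0)=\sup\{\alpha: f\in C^\alpha(x_0)\}$. The spectrum of singularities of $R_s$ is $d_s(\alpha)=\dim_{\mathcal H}\{x:\alpha_{R_s}(x)=\alpha\}$ (Hausdorff dimension, with the convention $\dim_{\mathcal H}\emptyset=-\infty$). By a known result of Jaffard, $d_s(\alpha)=4\alpha-4s+2$ for $\alpha\in[s-1/2,s-1/4]$, $d_s(2s-1/2)=0$,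 and $d_s(\alpha)=-\infty$ otherwise. *)

(* Defs.v *)
From Stdlib Require Import Reals ZArith.
From Coquelicot Require Import Coquelicot.
Open Scope R_scope.

Definition e_ (n : Z) (x : R) : C :=
  (cos (2 * PI * IZR n * x), sin (2 * PI * IZR n * x)).

(* power with the convention 0^y = 0 for y > 0 (used for L^p norms, p > 0) *)
Definition rpow (x y : R) : R := if Rle_dec x 0 then 0 else Rpower x y.

Definition Riemann_fn (s : R) (x : R) : C :=
  (Series (fun n : nat => Rpower (INR (S n)) (-2 * s) * cos (2 * PI * INR (S n * S n) * x)),
   Series (fun n : nat => Rpower (INR (S n)) (-2 * s) * sin (2 * PI * INR (S n * S n) * x))).

Definition fourier_coef (f : R -> C) (n : Z) : C :=
  RInt (V := C_R_CompleteNormedModule) (fun x => Cmult (f x) (e_ (- n) x)) 0 1.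

Definition LP_block (f : R -> C) (k : nat) (x : R) : C :=
  match k with
  | O => fourier_coef f 0%Z
  | S k' =>
      sum_n_m (G := C_AbelianMonoid)
        (fun m : nat =>
           Cplus (Cmult (fourier_coef f (Z.of_nat m)) (e_ (Z.of_nat m) x))
                 (Cmult (fourier_coef f (- Z.of_nat m)) (e_ (- Z.of_nat m) x)))
        (2 ^ k') (2 ^ (S k') - 1)
  end.

Definition Lp_norm (p : R) (g : R -> C) : R :=
  rpow (RInt (fun x => rpow (Cmod (g x)) p) 0 1) (/ p).

Definition in_Besov (sigma p : R) (f : R -> C) : Prop :=
  exists M : R, forall k : nat,
    Rpower 2 (INR k * sigma) * Lp_norm p (LP_block f k) <= M.

Definition eta_s (s p : R) : Rbar :=
  Rbar_lub (fun z => exists sigma : R, z = Finite sigma /\ in_Besov (sigma / p) p (Riemann_fn s)).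

(* |h|^alpha with |0|^alpha = 0 if alpha > 0 and 1 otherwise (for alpha < 0 the
   value at h = 0 is irrelevant up to enlarging the constant C) *)
Definition hpow (h alpha : R) : R :=
  if Req_EM_T h 0 then (if Rlt_dec 0 alpha then 0 else 1) else Rpower (Rabs h) alpha.

Definition polyC (a : nat -> C) (N : nat) (h : R) : C :=
  match N with
  | O => RtoC 0
  | S N' => sum_n (G := C_AbelianMonoid) (fun j => Cmult (a j) (RtoC (h ^ j))) N'
  end.

Definition Holder_at (alpha : R) (f : R -> C) (x0 : R) : Prop :=
  exists (N : nat) (a : nat -> C) (Cst delta : R),
    INR N - 1 <= alpha /\ 0 < Cst /\ 0 < delta /\
    forall h : R, Rabs h < delta ->
      Cmod (Cminus (f (x0 + h)) (polyC a N h)) <= Cst * hpow h alpha.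

Definition holder_exponent (f : R -> C) (x0 : R) : Rbar :=
  Rbar_lub (fun z => exists alpha : R, z = Finite alpha /\ Holder_at alpha f x0).

(* diameter, with diam(empty) = 0 *)
Definition diam (U : R -> Prop) : Rbar :=
  Rbar_lub (fun z => z = Finite 0 \/
                     exists x y : R, U x /\ U y /\ z = Finite (Rabs (x - y))).

Definition dpow (d t : R) : R :=
  if Req_EM_T d 0 then (if Req_EM_T t 0 then 1 else 0) else Rpower d t.

Definition hausdorff_content (t delta : R) (E : R -> Prop) : Rbar :=
  Rbar_glb (fun v => exists U : nat -> R -> Prop,
     (forall i, Rbar_le (diam (U i)) (Finite delta)) /\
     (forall x, E x -> exists i, U i x) /\
     v = Lim_seq (sum_n (fun i => dpow (real (diam (U i))) t))).

Definition hausdorff_measure (t : R) (E : R -> Prop) : Rbar :=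
  Rbar_lub (fun v => exists delta : R, 0 < delta /\ v = hausdorff_content t delta E).

Definition hausdorff_dim (E : R -> Prop) : Rbar :=
  Rbar_glb (fun z => ((~ exists x, E x) /\ z = m_infty) \/
    ((exists x, E x) /\
     exists t : R, z = Finite t /\ 0 <= t /\ hausdorff_measure t E = Finite 0)).

(* spectrum of singularities d_s(alpha) = dim_H { x in T : alpha_{R_s}(x) = alpha } ;
   T is represented by the fundamental domain [0,1). *)
Definition spectrum (s alpha : R) : Rbar :=
  hausdorff_dim (fun x => 0 <= x < 1 /\ holder_exponent (Riemann_fn s) x = Finite alpha).

(* Main.v *)
Require Import Defs.
From Stdlib Require Import Reals Lra Lia ZArith List ClassicalEpsilon Cantor Znumtheory.
From Coquelicot Require Import Coquelicot.
Import ListNotations.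
Open Scope R_scope.

(* For [y] close to [a/q], Weyl differencing bounds a block of [R_s] by [N^(1-2s) / sqrt q] up to logarithms, and
   with nonnegative weights and odd [q] this order is attained near [a/q].

   Integrating the fourth power of the pointwise bound gives [eta_s(4) >= 4s - 1]; conversely the coherent peak at
   [x = 0] gives [eta_s(p) <= p(s - 1/2) + 1], and comparing the L^2 norm with the moments of order [p] and 4 gives
   [eta_s(p) <= p(s - 1/4)]. As also [eta_s(p) >= p(s - 1/2)], the infimum is attained at [p = 4] and equals
   [4 alpha - 4 s + 2] if [alpha >= s - 1/2], and is [-oo] otherwise.

   If [|x - a/q| >= c q^(-tau)] for all [a/q], the block bounds around [x] sum up to exponent at least
   [s - 1/2 + 1/(2 tau)] at [x]. If [|x - a/q| <= q^(-tau)] for infinitely many odd [q], a smooth band-limited kernel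
   composed with iterated second differences annihilates Taylor polynomials and isolates a quadratic sum at [a/q],
   so the exponent is at most that value. The points that are not [tau]-Diophantine form a null set in every dimension
   above [2/tau]. Conversely, a Cantor set of odd-denominator approximable points is not covered by countably many sets
   of dimension below [2/tau]; taking among these the sets [exponent <= alpha - 1/n] leaves points of exponent exactly
   [alpha], and shows that they have dimension at least [2/tau]. *)

(** * Finite sums *)

(** All the exponents involved are suprema, so factors polynomial in the block index are absorbed,
    and logarithms can be kept as harmonic numbers throughout. In the moment estimates, pointwise
    inequalities between powers, once integrated, do the work of Hölder's inequality.

    The upper bound for the pointwise exponent meets one obstacle: a Taylor polynomial is not
    periodic, so a periodic band-limited kernel integrated over one period does not kill it.
    Symmetric second differences in the position do, and they multiply each [cos (2 PI n^2 y + ph)]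
    by a real factor of fixed sign. Up to a global sign the weights therefore stay nonnegative, as
    the lower bound for quadratic sums at odd [q] requires.

    The lower bound for the dimension has to avoid countably many sets whose dimensions approach the
    critical one. The construction carries the total load of their covers from level to level and
    selects a point by averaging, where one could also use a Frostman measure. Each denominator
    scale exceeds every fixed power of the inverse of the current interval length at late levels, so
    one construction serves all gauges [r^t] with [t < 2/tau]. *)

Fixpoint rsum (f : nat -> R) (n : nat) : R :=
  match n with O => 0 | S m => rsum f m + f m end.

Lemma rsum_S f n : rsum f (S n) = rsum f n + f n.
Proof. reflexivity. Qed.

Lemma rsum_ext f g n : (forall i, (i < n)%nat -> f i = g i) -> rsum f n = rsum g n.
Proof. intros H; induction n; simpl; auto. rewrite IHn, H; auto. Qed.

Lemma rsum_le f g n : (forall i, (i < n)%nat -> f i <= g i) -> rsum f n <= rsum g n.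
Proof.
  intros H; induction n; simpl; [lra|].
  specialize (H n (Nat.lt_succ_diag_r n)) as H1.
  assert (rsum f n <= rsum g n) by (apply IHn; auto). lra.
Qed.

Lemma rsum_0 n : rsum (fun _ => 0) n = 0.
Proof. induction n; simpl; lra. Qed.

Lemma rsum_const c n : rsum (fun _ => c) n = INR n * c.
Proof. induction n; [simpl; lra|]. rewrite S_INR; simpl. lra. Qed.

Lemma rsum_plus f g n : rsum (fun i => f i + g i) n = rsum f n + rsum g n.
Proof. induction n; simpl; lra. Qed.

Lemma rsum_scal c f n : rsum (fun i => c * f i) n = c * rsum f n.
Proof. induction n; simpl; lra. Qed.

Lemma rsum_scalr c f n : rsum (fun i => f i * c) n = rsum f n * c.
Proof. induction n; simpl; lra. Qed.

Lemma rsum_minus f g n : rsum (fun i => f i - g i) n = rsum f n - rsum g n.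
Proof. induction n; simpl; lra. Qed.

Lemma rsum_abs f n : Rabs (rsum f n) <= rsum (fun i => Rabs (f i)) n.
Proof.
  induction n; simpl; [rewrite Rabs_R0; lra|].
  eapply Rle_trans; [apply Rabs_triang|]. lra.
Qed.

Lemma rsum_ge0 f n : (forall i, (i < n)%nat -> 0 <= f i) -> 0 <= rsum f n.
Proof. intros H. rewrite <- (rsum_0 n). apply rsum_le; auto. Qed.

Lemma rsum_bound f c n : (forall i, (i < n)%nat -> f i <= c) -> rsum f n <= INR n * c.
Proof. intros H. rewrite <- rsum_const. apply rsum_le; auto. Qed.

Lemma rsum_eq0 f n : (forall i, (i < n)%nat -> f i = 0) -> rsum f n = 0.
Proof. intros H. rewrite (rsum_ext f (fun _ => 0)); auto. apply rsum_0. Qed.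

Lemma rsum_split f n m : rsum f (n + m) = rsum f n + rsum (fun i => f (n + i)%nat) m.
Proof.
  induction m; [rewrite Nat.add_0_r; simpl; lra|].
  rewrite Nat.add_succ_r; simpl. lra.
Qed.

Lemma rsum_Sl f n : rsum f (S n) = f O + rsum (fun i => f (S i)) n.
Proof. change (S n) with (1 + n)%nat. rewrite rsum_split. simpl. lra. Qed.

Lemma rsum_mono f n m : (n <= m)%nat -> (forall i, (n <= i < m)%nat -> 0 <= f i) -> rsum f n <= rsum f m.
Proof.
  intros H H0. replace m with (n + (m - n))%nat by lia. rewrite rsum_split.
  assert (0 <= rsum (fun i => f (n + i)%nat) (m - n)) by (apply rsum_ge0; intros; apply H0; lia).
  lra.
Qed.

Lemma rsum_supp f n m : (n <= m)%nat -> (forall i, (n <= i < m)%nat -> f i = 0) -> rsum f m = rsum f n.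
Proof.
  intros H H0. replace m with (n + (m - n))%nat by lia. rewrite rsum_split.
  rewrite (rsum_eq0 _ (m - n)); [lra|]. intros; apply H0; lia.
Qed.

Lemma rsum_swap f n m :
  rsum (fun i => rsum (fun j => f i j) m) n = rsum (fun j => rsum (fun i => f i j) n) m.
Proof.
  induction n; simpl; [rewrite rsum_0; auto|]. rewrite IHn, <- rsum_plus. auto.
Qed.

Lemma rsum_rev f n : rsum f n = rsum (fun i => f (n - 1 - i)%nat) n.
Proof.
  induction n; [auto|]. rewrite (rsum_Sl (fun i => f (S n - 1 - i)%nat)).
  replace (S n - 1 - 0)%nat with n by lia. change (rsum f (S n)) with (rsum f n + f n). rewrite IHn.
  rewrite Rplus_comm. f_equal. apply rsum_ext; intros; f_equal; lia.
Qed.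

Lemma rsum_le1 f n i : (forall j, (j < n)%nat -> 0 <= f j) -> (i < n)%nat -> f i <= rsum f n.
Proof.
  intros H Hi. replace n with (i + S (n - i - 1))%nat by lia.
  rewrite rsum_split. rewrite rsum_Sl. rewrite Nat.add_0_r.
  assert (0 <= rsum f i) by (apply rsum_ge0; intros; apply H; lia).
  assert (0 <= rsum (fun j => f (i + S j)%nat) (n - i - 1)) by (apply rsum_ge0; intros; apply H; lia).
  lra.
Qed.

Lemma rsum_delta n i c : (i < n)%nat -> rsum (fun j => if Nat.eqb j i then c else 0) n = c.
Proof.
  intros H. replace n with (i + S (n - i - 1))%nat by lia.
  rewrite rsum_split, rsum_Sl, Nat.add_0_r, Nat.eqb_refl.
  rewrite rsum_eq0, rsum_eq0; [lra| |]; intros j Hj;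
    [destruct (Nat.eqb_spec (i + S j) i)|destruct (Nat.eqb_spec j i)]; auto; lia.
Qed.

Lemma rsum_mul f g n m : rsum f n * rsum g m = rsum (fun i => rsum (fun j => f i * g j) m) n.
Proof.
  rewrite <- rsum_scalr. apply rsum_ext; intros. rewrite rsum_scal. auto.
Qed.

Lemma rsum_tele f n : rsum (fun i => f (S i) - f i) n = f n - f O.
Proof. induction n; simpl; lra. Qed.

Lemma rsum_sum_n f n : sum_n f n = rsum f (S n).
Proof.
  induction n. rewrite sum_O; simpl; lra.
  rewrite sum_Sn, IHn. reflexivity.
Qed.

(** The reindexing behind Weyl differencing: a pair [m < n] is recorded by [m] and the difference
    [S h]. *)
Lemma rsum_triangle (b : nat -> nat -> R) B :
  rsum (fun n => rsum (fun m => b m n) n) B =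
  rsum (fun h => rsum (fun m => b m (m + S h)%nat) (B - S h)) B.
Proof.
  induction B; [reflexivity|].
  rewrite rsum_S, IHB.
  rewrite (rsum_ext (fun h => rsum (fun m => b m (m + S h)%nat) (S B - S h))
     (fun h => rsum (fun m => b m (m + S h)%nat) (B - S h) +
        (if Nat.ltb h B then b (B - S h)%nat B else 0))).
  - rewrite rsum_plus, !rsum_S.
    replace (B - S B)%nat with 0%nat by lia. rewrite Nat.ltb_irrefl. change (rsum (fun m => b m (m + S B)%nat) 0) with 0.
    rewrite (rsum_rev (fun m => b m B)).
    rewrite (rsum_ext (fun i => b (B - 1 - i)%nat B) (fun h => if Nat.ltb h B then b (B - S h)%nat B else 0)).
    lra. intros i Hi. apply Nat.ltb_lt in Hi as ->. f_equal; lia.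
  - intros h Hh. destruct (Nat.ltb_spec h B).
    + replace (S B - S h)%nat with (S (B - S h)) by lia. simpl. f_equal. f_equal; lia.
    + replace (S B - S h)%nat with 0%nat by lia. replace (B - S h)%nat with 0%nat by lia. simpl; lra.
Qed.

Lemma rsum_sym (a : nat -> nat -> R) B :
  (forall n m, a n m = a m n) ->
  rsum (fun n => rsum (fun m => a n m) B) B =
  rsum (fun n => a n n) B + 2 * rsum (fun h => rsum (fun m => a m (m + S h)%nat) (B - S h)) B.
Proof.
  intros Hs. rewrite <- (rsum_triangle a).
  induction B; [simpl; lra|].
  simpl. rewrite rsum_plus, IHB.
  rewrite (rsum_ext (fun n => a B n) (fun i => a i B)) by (intros; apply Hs). lra.
Qed.

Definition lsum {A} (f : A -> R) (l : list A) : R := fold_right (fun a s => f a + s) 0 l.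

Lemma lsum_rsum f n : lsum f (seq 0 n) = rsum f n.
Proof.
  assert (H : forall n k, lsum f (seq k n) = rsum (fun i => f (k + i)%nat) n).
  { clear n; induction n; intros k; [reflexivity|].
    rewrite rsum_Sl. simpl. rewrite IHn, Nat.add_0_r. f_equal. apply rsum_ext; intros; f_equal; lia. }
  rewrite H. reflexivity.
Qed.

Lemma lsum_app {A} (f : A -> R) l l' : lsum f (l ++ l') = lsum f l + lsum f l'.
Proof. induction l; simpl; [lra|]. unfold lsum in *. lra. Qed.

Lemma lsum_ge0 {A} (f : A -> R) l : (forall a, In a l -> 0 <= f a) -> 0 <= lsum f l.
Proof.
  induction l; simpl; intros H; [lra|]. pose proof (H a (or_introl eq_refl)).
  assert (0 <= lsum f l) by auto. unfold lsum in *; lra.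
Qed.

Lemma lsum_map {A B} (f : B -> R) (g : A -> B) l : lsum f (map g l) = lsum (fun a => f (g a)) l.
Proof. induction l; simpl; auto. unfold lsum in *. rewrite IHl. auto. Qed.

Lemma lsum_incl {A} (f : A -> R) l l' :
  NoDup l -> incl l l' -> (forall a, In a l' -> 0 <= f a) -> lsum f l <= lsum f l'.
Proof.
  intros Hn. revert l'. induction Hn as [|a l Ha Hn IH]; intros l' Hi Hp.
  - apply lsum_ge0; auto.
  - destruct (in_split a l') as [l1 [l2 E]]; [apply Hi; left; auto|]. subst.
    assert (lsum f l <= lsum f (l1 ++ l2)).
    { apply IH. intros b Hb. assert (Hb' : In b (l1 ++ a :: l2)) by (apply Hi; right; auto).
      apply in_app_or in Hb'. apply in_or_app. destruct Hb' as [|[|]]; auto. subst. contradiction.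
      intros b Hb. apply Hp. apply in_or_app. apply in_app_or in Hb. destruct Hb; [left|right; right]; auto. }
    rewrite lsum_app in *. simpl. unfold lsum in *; lra.
Qed.

(** Plays the part of a change of variables: permutations of residues, even or odd subsequences and
    shifted windows are all injections into a longer range of nonnegative terms. *)
Lemma rsum_inj_le (f : nat -> R) (s : nat -> nat) n m :
  (forall i j, (i < n)%nat -> (j < n)%nat -> s i = s j -> i = j) ->
  (forall i, (i < n)%nat -> (s i < m)%nat) -> (forall i, 0 <= f i) ->
  rsum (fun i => f (s i)) n <= rsum f m.
Proof.
  intros Hi Hb Hf. rewrite <- !lsum_rsum, <- lsum_map.
  apply lsum_incl; auto.
  - apply NoDup_map_NoDup_ForallPairs; [|apply seq_NoDup].
    intros i j Hii Hj. apply in_seq in Hii. apply in_seq in Hj. apply Hi; lia.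
  - intros x Hx. apply in_map_iff in Hx. destruct Hx as [i [<- Hx]]. apply in_seq in Hx.
    apply in_seq. specialize (Hb i). lia.
Qed.

(** * Harmonic numbers, and the sine near integer multiples of PI *)

Definition harm (n : nat) : R := rsum (fun i => / INR (S i)) n.

Lemma harm_ge0 n : 0 <= harm n.
Proof. apply rsum_ge0; intros. left. apply Rinv_0_lt_compat, lt_0_INR; lia. Qed.

Lemma harm_mono n m : (n <= m)%nat -> harm n <= harm m.
Proof. intros; apply rsum_mono; auto. intros. left. apply Rinv_0_lt_compat, lt_0_INR; lia. Qed.

Lemma harm_ge1 n : (1 <= n)%nat -> 1 <= harm n.
Proof. intros. eapply Rle_trans; [|apply (harm_mono 1 n); auto]. unfold harm; simpl; lra. Qed.

(** The terms with [2^k < i <= 2^(k+1)] contribute at most 1. *)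
Lemma harm_pow2 k : harm (2 ^ k) <= INR (S k).
Proof.
  induction k. unfold harm; simpl; lra.
  replace (2 ^ S k)%nat with (2 ^ k + 2 ^ k)%nat by (simpl; lia).
  unfold harm. rewrite rsum_split. fold (harm (2 ^ k)).
  assert (rsum (fun i => / INR (S (2 ^ k + i))) (2 ^ k) <= INR (2 ^ k) * / INR (2 ^ k)).
  { apply rsum_bound. intros. apply Rinv_le_contravar. apply lt_0_INR.
    assert (2 ^ k <> 0)%nat by (apply Nat.pow_nonzero; lia). lia. apply le_INR; lia. }
  rewrite Rinv_r in H. rewrite (S_INR (S k)). lra.
  apply not_0_INR. apply Nat.pow_nonzero; lia.
Qed.

(** With [v = PI * u] in [0, 2], the Taylor bound [v - v^3 / 6] is at least [v / 3], and [PI > 3];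
    oddness gives the other sign. *)
Lemma sin_pi_ge u : Rabs u <= 1 / 2 -> Rabs u <= Rabs (sin (PI * u)).
Proof.
  assert (Hp : 3 < PI <= 4) by (split; [pose proof PI2_3_2; lra | apply PI_4]).
  assert (H : forall u, 0 <= u <= 1 / 2 -> u <= sin (PI * u)).
  { clear u; intros u Hu.
    destruct (sin_bound (PI * u) 0) as [H _]; [nra|nra|].
    unfold sin_approx, sin_term in H. simpl in H.
    assert (PI * u - (PI * u) ^ 3 / 6 <= sin (PI * u)) by (eapply Rle_trans; [|apply H]; right; field).
    assert (0 <= PI * u <= 2) by nra.
    assert (3 * u <= PI * u) by nra.
    set (v := PI * u) in *.
    assert (v * v <= 4) by nra.
    assert (v ^ 3 <= 4 * v) by (replace (v ^ 3) with (v * (v * v)) by ring; nra).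
    lra. }
  intros Hu. unfold Rabs at 1; destruct (Rcase_abs u) as [Hn|Hn].
  - rewrite Rabs_left in Hu by auto. rewrite <- (Ropp_involutive u) at 2.
    rewrite <- Ropp_mult_distr_r, sin_neg, Rabs_Ropp.
    eapply Rle_trans; [|apply Rle_abs]. apply H; lra.
  - rewrite Rabs_right in Hu by auto. eapply Rle_trans; [|apply Rle_abs]. apply H; lra.
Qed.

Lemma cos_plus_Z x (m : Z) : cos (x + 2 * PI * IZR m) = cos x.
Proof.
  destruct (Z_le_gt_dec 0 m).
  - rewrite <- (Z2Nat.id m), <- INR_IZR_INZ by auto.
    replace (x + 2 * PI * INR (Z.to_nat m)) with (x + 2 * INR (Z.to_nat m) * PI) by ring. apply cos_period.
  - rewrite <- (cos_period (x + 2 * PI * IZR m) (Z.to_nat (- m))).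
    rewrite INR_IZR_INZ, Z2Nat.id, opp_IZR by lia. f_equal; ring.
Qed.

Lemma sin_plus_Z x (m : Z) : sin (x + 2 * PI * IZR m) = sin x.
Proof.
  destruct (Z_le_gt_dec 0 m).
  - rewrite <- (Z2Nat.id m), <- INR_IZR_INZ by auto.
    replace (x + 2 * PI * INR (Z.to_nat m)) with (x + 2 * INR (Z.to_nat m) * PI) by ring. apply sin_period.
  - rewrite <- (sin_period (x + 2 * PI * IZR m) (Z.to_nat (- m))).
    rewrite INR_IZR_INZ, Z2Nat.id, opp_IZR by lia. f_equal; ring.
Qed.

Lemma Rabs_sin_shift x (m : Z) : Rabs (sin (PI * (x - IZR m))) = Rabs (sin (PI * x)).
Proof.
  assert (H : forall y, Rabs (sin (y + PI)) = Rabs (sin y)) by (intros; rewrite neg_sin, Rabs_Ropp; auto).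
  assert (Hn : forall n y, Rabs (sin (y + INR n * PI)) = Rabs (sin y)).
  { induction n; intros y. simpl. f_equal; f_equal; ring. rewrite S_INR.
    replace (y + (INR n + 1) * PI) with ((y + INR n * PI) + PI) by ring. rewrite H; auto. }
  destruct (Z_le_gt_dec 0 m).
  - rewrite <- (Hn (Z.to_nat m)). rewrite INR_IZR_INZ, Z2Nat.id by auto. f_equal; f_equal; ring.
  - rewrite <- (Hn (Z.to_nat (-m)) (PI * x)). rewrite INR_IZR_INZ, Z2Nat.id, opp_IZR by lia. f_equal; f_equal; ring.
Qed.

(** * Quadratic exponential sums *)

(* [A2 g B y] is the squared modulus of the sum of [g n * exp (2 i PI n^2 y)] over [n < B]. *)
Definition FC (g : nat -> R) (B : nat) (y : R) : R :=
  rsum (fun n => g n * cos (2 * PI * INR (n * n) * y)) B.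
Definition FS (g : nat -> R) (B : nat) (y : R) : R :=
  rsum (fun n => g n * sin (2 * PI * INR (n * n) * y)) B.
Definition A2 (g : nat -> R) (B : nat) (y : R) : R := FC g B y ^ 2 + FS g B y ^ 2.

(** What summation by parts asks of an amplitude, with a single constant for size and variation. The
    last step of the variation sum leads to [g B = 0], so the jump at the end of the support is
    counted. *)
Definition BV (g : nat -> R) (B : nat) (V : R) : Prop :=
  0 <= V /\ (forall n, Rabs (g n) <= V) /\ (forall n, (B <= n)%nat -> g n = 0) /\
  rsum (fun n => Rabs (g (S n) - g n)) B <= V.

(** The phase is [2 PI ((n + h)^2 - n^2) y]: differencing has made it linear in [n]. *)
Definition inner (g : nat -> R) (B h : nat) (y : R) : R :=
  rsum (fun n => g n * g (n + h)%nat *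
     cos (INR n * (4 * PI * INR h * y) + 2 * PI * INR (h * h) * y)) B.

Lemma weyl_identity g B y : (forall n, (B <= n)%nat -> g n = 0) ->
  A2 g B y = rsum (fun n => g n * g n) B + 2 * rsum (fun h => inner g B (S h) y) B.
Proof.
  intros Hs. unfold A2, FC, FS.
  rewrite <- !Rsqr_pow2. unfold Rsqr. rewrite !rsum_mul, <- rsum_plus.
  rewrite (rsum_ext _ (fun i => rsum (fun j => g i * g j *
     cos (2 * PI * INR (j * j) * y - 2 * PI * INR (i * i) * y)) B)).
  2:{ intros i _. rewrite <- rsum_plus. apply rsum_ext; intros j _. rewrite cos_minus. ring. }
  rewrite rsum_sym.
  2:{ intros n m. rewrite (Rmult_comm (g n)). f_equal. rewrite <- cos_neg. f_equal; ring. }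
  f_equal.
  - apply rsum_ext; intros. rewrite Rminus_diag, cos_0; ring.
  - f_equal. apply rsum_ext; intros h Hh. unfold inner.
    (* Extending the range to [B] costs nothing, since [g (m + S h)] vanishes from [m = B - S h]
       on. *)
    rewrite (rsum_supp _ (B - S h) B); [|lia|].
    + apply rsum_ext; intros m _. f_equal. f_equal.
      replace ((m + S h) * (m + S h))%nat with (m * m + (2 * (m * S h) + S h * S h))%nat by ring.
      rewrite !plus_INR, !mult_INR. change (INR 2) with (1 + 1). ring.
    + intros i Hi. rewrite (Hs (i + S h)%nat) by lia. ring.
Qed.

(** The factor [2 sin (th / 2)] turns each cosine into a difference of consecutive values of [s].
    The bound is kept in product form so that it also covers a vanishing sine. *)
Lemma summation_by_parts (a : nat -> R) th ph N :
  Rabs (rsum (fun n => a n * cos (INR n * th + ph)) N) * (2 * Rabs (sin (th / 2))) <=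
  Rabs (a O) + Rabs (a N) + rsum (fun n => Rabs (a (S n) - a n)) N.
Proof.
  set (s := fun n => sin ((INR n - / 2) * th + ph)).
  assert (E : rsum (fun n => a n * cos (INR n * th + ph)) N * (2 * sin (th / 2)) =
     a N * s N - a O * s O - rsum (fun n => (a (S n) - a n) * s (S n)) N).
  { induction N; [simpl; ring|]. rewrite !rsum_S, Rmult_plus_distr_r, IHN.
    assert (cos (INR N * th + ph) * (2 * sin (th / 2)) = s (S N) - s N).
    { unfold s. rewrite S_INR.
      replace ((INR N + 1 - / 2) * th + ph) with ((INR N * th + ph) + th / 2) by field.
      replace ((INR N - / 2) * th + ph) with ((INR N * th + ph) - th / 2) by field.
      rewrite sin_plus, sin_minus. ring. }
    rewrite (Rmult_assoc (a N)), H. ring. }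
  replace 2 with (Rabs 2) at 1 by (apply Rabs_right; lra).
  rewrite <- !Rabs_mult, E.
  assert (Hs : forall n, Rabs (s n) <= 1) by (intros; apply Rabs_le, SIN_bound).
  assert (Hm : forall x n, Rabs (x * s n) <= Rabs x).
  { intros. rewrite Rabs_mult. pose proof (Rabs_pos x). pose proof (Hs n). nra. }
  assert (Rabs (rsum (fun n => (a (S n) - a n) * s (S n)) N) <= rsum (fun n => Rabs (a (S n) - a n)) N).
  { eapply Rle_trans; [apply rsum_abs|]. apply rsum_le; intros; apply Hm. }
  unfold Rminus at 1 2.
  eapply Rle_trans; [apply Rabs_triang|]. eapply Rle_trans; [apply Rplus_le_compat_r, Rabs_triang|].
  rewrite !Rabs_Ropp. pose proof (Hm (a N) N). pose proof (Hm (a O) O). lra.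
Qed.

(** The 3 is one [V^2] for the boundary term at 0 and two for the variation of a product of two
    amplitudes; the boundary term at [B] vanishes. *)
Lemma inner_sin g B V h y : BV g B V ->
  Rabs (inner g B h y) * (2 * Rabs (sin (PI * (2 * INR h * y)))) <= 3 * V ^ 2.
Proof.
  intros (HV & Hb & Hs & Ht). unfold inner.
  eapply Rle_trans.
  - replace (PI * (2 * INR h * y)) with (4 * PI * INR h * y / 2) by field.
    apply summation_by_parts with (a := fun n => g n * g (n + h)%nat).
  - rewrite (Hs B) by lia. rewrite Rmult_0_l, Rabs_R0.
    assert (T : forall n, Rabs (g (S n) * g (S n + h)%nat - g n * g (n + h)%nat) <=
       Rabs (g (S n) - g n) * V + V * Rabs (g (h + S n)%nat - g (h + n)%nat)).
    { intros n. replace (S n + h)%nat with (h + S n)%nat by lia. rewrite (Nat.add_comm n h).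
      replace (g (S n) * g (h + S n)%nat - g n * g (h + n)%nat) with
        ((g (S n) - g n) * g (h + S n)%nat + g n * (g (h + S n)%nat - g (h + n)%nat)) by ring.
      eapply Rle_trans; [apply Rabs_triang|]. rewrite !Rabs_mult.
      pose proof (Hb (h + S n)%nat). pose proof (Hb n). pose proof (Rabs_pos (g (S n) - g n)).
      pose proof (Rabs_pos (g (h + S n)%nat - g (h + n)%nat)). nra. }
    assert (T2 : rsum (fun n => Rabs (g (h + S n)%nat - g (h + n)%nat)) B <= V).
    { eapply Rle_trans; [|apply Ht].
      rewrite <- (rsum_supp (fun n => Rabs (g (S n) - g n)) B (h + B)) by
        (try lia; intros; rewrite !Hs by lia; rewrite Rminus_0_r, Rabs_R0; auto).
      rewrite rsum_split.
      assert (0 <= rsum (fun n => Rabs (g (S n) - g n)) h) by (apply rsum_ge0; intros; apply Rabs_pos).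
      rewrite (rsum_ext (fun n => Rabs (g (h + S n)%nat - g (h + n)%nat))
         (fun i => Rabs (g (S (h + i)) - g (h + i)%nat))); [lra|].
      intros; rewrite Nat.add_succ_r; auto. }
    assert (rsum (fun n => Rabs (g (S n) * g (S n + h)%nat - g n * g (n + h)%nat)) B <= V * V + V * V).
    { eapply Rle_trans; [apply rsum_le; intros; apply T|]. rewrite rsum_plus, rsum_scal, rsum_scalr. nra. }
    assert (Rabs (g O * g (0 + h)%nat) <= V * V).
    { rewrite Rabs_mult. pose proof (Hb O). pose proof (Hb (0 + h)%nat).
      apply Rmult_le_compat; auto; apply Rabs_pos. }
    simpl pow. lra.
Qed.

Lemma inner_triv g B V h y : BV g B V -> Rabs (inner g B h y) <= INR B * V ^ 2.
Proof.
  intros (HV & Hb & Hs & Ht). unfold inner. eapply Rle_trans; [apply rsum_abs|]. apply rsum_bound.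
  intros n _. rewrite !Rabs_mult.
  assert (Rabs (cos (INR n * (4 * PI * INR h * y) + 2 * PI * INR (h * h) * y)) <= 1) by (apply Rabs_le, COS_bound).
  pose proof (Hb n). pose proof (Hb (n + h)%nat). pose proof (Rabs_pos (g n)). pose proof (Rabs_pos (g (n + h)%nat)).
  assert (Rabs (g n) * Rabs (g (n + h)%nat) <= V * V) by (apply Rmult_le_compat; auto).
  assert (0 <= Rabs (g n) * Rabs (g (n + h)%nat)) by nra.
  simpl. pose proof (Rabs_pos (cos (INR n * (4 * PI * INR h * y) + 2 * PI * INR (h * h) * y))). nra.
Qed.

(* An upper bound for [1 / (q || rho/q ||)], set to [0] on the class [rho = 0]. *)
Definition kap (q : nat) (r : Z) : R :=
  if Z.eqb r 0 then 0 else / IZR r + / IZR (Z.of_nat q - r).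

Lemma kap_ge0 q r : (0 <= r < Z.of_nat q)%Z -> 0 <= kap q r.
Proof.
  intros H. unfold kap. destruct (Z.eqb_spec r 0); [lra|].
  assert (0 < / IZR r) by (apply Rinv_0_lt_compat, IZR_lt; lia).
  assert (0 < / IZR (Z.of_nat q - r)) by (apply Rinv_0_lt_compat, IZR_lt; lia). lra.
Qed.

Lemma kap_full q : rsum (fun r => kap q (Z.of_nat r)) q <= 2 * harm q.
Proof.
  destruct q as [|q]; [unfold harm; simpl; lra|].
  rewrite rsum_Sl. unfold kap at 1. simpl Z.of_nat at 1. rewrite Z.eqb_refl.
  rewrite (rsum_ext _ (fun i => / INR (S i) + / INR (S (q - 1 - i)))).
  - rewrite rsum_plus. rewrite <- (rsum_rev (fun i => / INR (S i))).
    fold (harm q). pose proof (harm_mono q (S q)). lra || (assert (harm q <= harm (S q)) by (apply harm_mono; lia); lra).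
  - intros i Hi. unfold kap. destruct (Z.eqb_spec (Z.of_nat (S i)) 0); [lia|].
    rewrite <- INR_IZR_INZ. f_equal. f_equal. rewrite INR_IZR_INZ. f_equal. lia.
Qed.

(** Since [a] is invertible modulo [q], the map [h -> h a mod q] is injective on any [q] consecutive
    integers. *)
Lemma kap_block q (a : Z) h0 : (1 <= q)%nat -> Z.gcd a (Z.of_nat q) = 1%Z ->
  rsum (fun h => kap q (Z.of_nat (h0 + h) * a mod Z.of_nat q)) q <= 2 * harm q.
Proof.
  intros Hq Hg. eapply Rle_trans; [|apply kap_full].
  set (s := fun h => Z.to_nat (Z.of_nat (h0 + h) * a mod Z.of_nat q)).
  assert (Hm : forall h, (0 <= Z.of_nat (h0 + h) * a mod Z.of_nat q < Z.of_nat q)%Z) by (intros; apply Z.mod_pos_bound; lia).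
  (* [kap q r] is negative for [r > q], whereas [rsum_inj_le] wants a function nonnegative
     everywhere; on genuine residues the truncation changes nothing. *)
  rewrite (rsum_ext _ (fun h => (fun r => Rmax 0 (kap q (Z.of_nat r))) (s h))).
  2:{ intros h _. unfold s. rewrite Z2Nat.id by apply Hm. rewrite Rmax_right; auto. apply kap_ge0, Hm. }
  rewrite (rsum_ext (fun r => kap q (Z.of_nat r)) (fun r => Rmax 0 (kap q (Z.of_nat r)))).
  2:{ intros h Hh. rewrite Rmax_right; auto. apply kap_ge0. lia. }
  apply (rsum_inj_le (fun r => Rmax 0 (kap q (Z.of_nat r))) s).
  - assert (K : forall i j, (i < j)%nat -> (j < q)%nat -> s i = s j -> False).
    { intros i j Hij Hj E. unfold s in E. apply Z2Nat.inj in E; try apply Hm.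
      assert (D : (Z.of_nat q | Z.of_nat (j - i) * a)%Z).
      { replace (Z.of_nat (j - i) * a)%Z with (Z.of_nat (h0 + j) * a - Z.of_nat (h0 + i) * a)%Z by (rewrite <- Z.mul_sub_distr_r; f_equal; lia).
        apply Z.mod_divide; [lia|]. rewrite Zminus_mod, E, Z.sub_diag. apply Z.mod_0_l; lia. }
      rewrite Z.mul_comm in D. apply Z.gauss in D; [|rewrite Z.gcd_comm; auto].
      apply Z.divide_pos_le in D; lia. }
    intros i j Hi Hj E. destruct (Nat.lt_trichotomy i j) as [H|[H|H]]; auto; exfalso; eauto.
  - intros i _. unfold s. specialize (Hm i). lia.
  - intros; apply Rmax_l.
Qed.

Lemma kap_sum q (a : Z) M : (1 <= q)%nat -> Z.gcd a (Z.of_nat q) = 1%Z ->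
  rsum (fun h => kap q (Z.of_nat h * a mod Z.of_nat q)) M <= (INR M / INR q + 1) * (2 * harm q).
Proof.
  intros Hq Hg.
  assert (Hb : forall m, rsum (fun h => kap q (Z.of_nat h * a mod Z.of_nat q)) (m * q) <= INR m * (2 * harm q)).
  { induction m; [simpl; lra|]. replace (S m * q)%nat with (m * q + q)%nat by lia. rewrite rsum_split, S_INR.
    pose proof (kap_block q a (m * q) Hq Hg). lra. }
  assert (Hqp : 0 < INR q) by (apply lt_0_INR; lia).
  pose proof (Nat.div_mod_eq M q). pose proof (Nat.mod_upper_bound M q).
  eapply Rle_trans; [apply (rsum_mono _ M (S (M / q) * q)); [nia|]|].
  - intros; apply kap_ge0, Z.mod_pos_bound; lia.
  - eapply Rle_trans; [apply Hb|]. apply Rmult_le_compat_r; [pose proof (harm_ge0 q); lra|].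
    rewrite S_INR. apply Rplus_le_compat_r. apply Rle_div_r; auto. rewrite <- mult_INR. apply le_INR. lia.
Qed.

(** Source of the saving [1/q]: the multiples of [q] carry only that fraction of the harmonic
    sum. *)
Lemma mult_sum q M : (1 <= q)%nat ->
  rsum (fun h => if Z.eqb (Z.of_nat (S h) mod Z.of_nat q) 0 then / INR (S h) else 0) M <= harm M / INR q.
Proof.
  intros Hq. assert (Hqp : 0 < INR q) by (apply lt_0_INR; lia).
  set (f := fun h => if Z.eqb (Z.of_nat (S h) mod Z.of_nat q) 0 then / INR (S h) else 0).
  assert (E : forall m, rsum f (m * q) = harm m / INR q).
  { induction m; [unfold harm; simpl; unfold Rdiv; ring|].
    replace (S m * q)%nat with (m * q + q)%nat by lia. rewrite rsum_split, IHm.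
    unfold harm. rewrite rsum_S. unfold Rdiv at 2. rewrite Rmult_plus_distr_r. f_equal.
    rewrite (rsum_ext _ (fun j => if Nat.eqb j (q - 1) then / INR (S m) * / INR q else 0)).
    apply rsum_delta; lia.
    intros i Hi. unfold f. destruct (Nat.eqb_spec i (q - 1)).
    - replace (S (m * q + i))%nat with (S m * q)%nat by nia.
      rewrite Nat2Z.inj_mul, Z.mod_mul by lia. rewrite Z.eqb_refl, mult_INR, Rinv_mult. auto.
    - replace (Z.of_nat (S (m * q + i))) with (Z.of_nat (S i) + Z.of_nat m * Z.of_nat q)%Z by lia.
      rewrite Z.mod_add, Z.mod_small by lia. destruct (Z.eqb_spec (Z.of_nat (S i)) 0); auto; lia. }
  assert (Hf : forall h, 0 <= f h).
  { intros h; unfold f; destruct Z.eqb; [|lra]. left. apply Rinv_0_lt_compat, lt_0_INR; lia. }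
  pose proof (Nat.div_mod_eq M q). pose proof (Nat.mod_upper_bound M q).
  (* the incomplete last block contains no multiple of [q] *)
  rewrite (rsum_supp f (M / q * q) M) by
   (try nia; intros i Hi; unfold f;
    replace (Z.of_nat (S i)) with (Z.of_nat (S i - M / q * q) + Z.of_nat (M / q) * Z.of_nat q)%Z by nia;
    rewrite Z.mod_add, Z.mod_small by nia; destruct (Z.eqb_spec (Z.of_nat (S i - M / q * q)) 0); auto; lia).
  rewrite E. apply Rmult_le_compat_r; [left; apply Rinv_0_lt_compat; auto|].
  apply harm_mono. apply Nat.Div0.div_le_upper_bound. nia.
Qed.

(** Pigeonhole: the [N + 1] fractional parts of [0, y, ..., N y] fall into [N] boxes, and two in the
    same box give numerator and denominator by subtraction. *)
Lemma dirichlet y N : (1 <= N)%nat -> exists (a : Z) (q : nat),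
  (1 <= q <= N)%nat /\ Rabs (INR q * y - IZR a) <= / INR N /\ Z.gcd a (Z.of_nat q) = 1%Z.
Proof.
  intros HN. assert (HNp : 0 < INR N) by (apply lt_0_INR; lia).
  set (fr := fun i => INR i * y - IZR (Int_part (INR i * y))).
  assert (Hfr : forall i, 0 <= fr i < 1).
  { intros i; unfold fr. destruct (base_Int_part (INR i * y)). lra. }
  set (box := fun i => Z.to_nat (Int_part (INR N * fr i))).
  assert (Hbox : forall i, INR (box i) <= INR N * fr i < INR (box i) + 1).
  { intros i; unfold box. destruct (base_Int_part (INR N * fr i)).
    assert (0 <= INR N * fr i) by (specialize (Hfr i); nra).
    assert (-1 < Int_part (INR N * fr i))%Z by (apply lt_IZR; lra).
    rewrite INR_IZR_INZ, Z2Nat.id by lia. lra. }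
  assert (Hlt : forall i, (box i < N)%nat).
  { intros i. apply INR_lt. specialize (Hbox i). specialize (Hfr i). nra. }
  assert (exists i j, (i < j <= N)%nat /\ box i = box j) as (i & j & Hij & E).
  { apply NNPP; intros Hne.
    assert (NoDup (map box (seq 0 (S N)))).
    { apply NoDup_map_NoDup_ForallPairs; [|apply seq_NoDup]. intros i j Hi Hj E.
      apply in_seq in Hi. apply in_seq in Hj. destruct (Nat.lt_trichotomy i j) as [H|[H|H]]; auto; exfalso; apply Hne.
      exists i, j; split; [lia|auto]. exists j, i; split; [lia|auto]. }
    apply NoDup_incl_length with (l' := seq 0 N) in H.
    rewrite length_map, !length_seq in H. lia.
    intros b Hb. apply in_map_iff in Hb. destruct Hb as [i [<- _]]. apply in_seq. specialize (Hlt i); lia. }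
  set (q0 := (j - i)%nat). set (a0 := (Int_part (INR j * y) - Int_part (INR i * y))%Z).
  assert (H0 : Rabs (INR q0 * y - IZR a0) <= / INR N).
  { unfold q0, a0. rewrite minus_INR, minus_IZR by lia.
    replace ((INR j - INR i) * y - (IZR (Int_part (INR j * y)) - IZR (Int_part (INR i * y)))) with (fr j - fr i) by (unfold fr; ring).
    pose proof (Hbox i). pose proof (Hbox j). rewrite E in H.
    apply Rmult_le_reg_l with (INR N); auto. rewrite Rinv_r by lra.
    rewrite <- (Rabs_right (INR N)) at 1 by lra. rewrite <- Rabs_mult. apply Rabs_le. lra. }
  assert (Hq0 : (1 <= q0 <= N)%nat) by (unfold q0; lia).
  (* Dividing by the gcd makes the fraction reduced; it decreases the denominator and divides the
     error by [d >= 1]. *)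
  set (d := Z.gcd a0 (Z.of_nat q0)).
  destruct (Z.gcd_divide_l a0 (Z.of_nat q0)) as [a1 Ha1]. destruct (Z.gcd_divide_r a0 (Z.of_nat q0)) as [q1 Hq1].
  fold d in Ha1, Hq1.
  assert (Hd : (0 < d)%Z). { assert (0 <= d)%Z by apply Z.gcd_nonneg. assert (d <> 0)%Z by nia. lia. }
  assert (Hq1p : (0 < q1)%Z) by nia.
  exists a1, (Z.to_nat q1). split; [|split].
  - split; [lia|]. apply Nat2Z.inj_le. rewrite Z2Nat.id by lia. nia.
  - rewrite INR_IZR_INZ, Z2Nat.id by lia. rewrite (INR_IZR_INZ q0), Hq1, Ha1, !mult_IZR in H0.
    replace (IZR q1 * IZR d * y - IZR a1 * IZR d) with ((IZR q1 * y - IZR a1) * IZR d) in H0 by ring.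
    rewrite Rabs_mult in H0. assert (1 <= IZR d) by (apply IZR_le; lia).
    rewrite (Rabs_right (IZR d)) in H0 by lra. pose proof (Rabs_pos (IZR q1 * y - IZR a1)). nra.
  - rewrite Z2Nat.id by lia. pose proof (Z.gcd_mul_mono_r_nonneg a1 q1 d).
    rewrite <- Ha1, <- Hq1 in H. fold d in H. nia.
Qed.

(** The smaller of [u] and [1 - u] is at most 1/2 and is bounded by the sine through [sin_pi_ge].
    Adding the two inverses gives one formula for both cases, matching the shape of [kap]. *)
Lemma sin_pi_inv u : 0 < u < 1 -> 1 <= Rabs (sin (PI * u)) * (/ u + / (1 - u)).
Proof.
  intros Hu. assert (0 < / u) by (apply Rinv_0_lt_compat; lra). assert (0 < / (1 - u)) by (apply Rinv_0_lt_compat; lra).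
  assert (u * / u = 1) by (apply Rinv_r; lra). assert ((1 - u) * / (1 - u) = 1) by (apply Rinv_r; lra).
  destruct (Rle_dec u (1 / 2)).
  - assert (u <= Rabs (sin (PI * u))). { rewrite <- (Rabs_right u) at 1 by lra. apply sin_pi_ge. rewrite Rabs_right; lra. }
    nra.
  - assert (1 - u <= Rabs (sin (PI * u))).
    { rewrite <- (Rabs_sin_shift u 1), <- (Rabs_right (1 - u)) at 1 by lra. rewrite Rabs_minus_sym.
      apply sin_pi_ge. rewrite Rabs_left; lra. }
    nra.
Qed.

(** * Weyl sums in the neighbourhood of a fraction a/q *)

Section Arc.
Variables (g : nat -> R) (B N q : nat) (V : R) (a : Z) (b y : R).
Hypothesis Hg : BV g B V.
Hypothesis HBN : (B <= N)%nat.
Hypothesis HN : (1 <= N)%nat.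
Hypothesis Hq : (1 <= q)%nat.
Hypothesis Hgcd : Z.gcd a (Z.of_nat q) = 1%Z.
Hypothesis Hy : y = IZR a / INR q + b.
Hypothesis Hb : Rabs b <= / (4 * INR N * INR q).

(** A difference [h] is resonant when this residue vanishes: then the phase increment [2 h y] is an
    integer plus [2 h b]. *)
Let rho (h : nat) : Z := (Z.of_nat (2 * h) * a mod Z.of_nat q)%Z.

(** The arc width [1 / (4 N q)] is chosen for this: the perturbation stays below half the spacing
    [1/q] of the residues. *)
Lemma arc_hb h : (1 <= h <= N)%nat -> Rabs (2 * INR h * b) <= / (2 * INR q).
Proof.
  intros Hh. assert (0 < INR q) by (apply lt_0_INR; lia). assert (0 < INR N) by (apply lt_0_INR; lia).
  assert (0 <= INR h <= INR N) by (split; [apply pos_INR|apply le_INR; lia]).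
  rewrite Rabs_mult, Rabs_right by nra.
  apply Rle_trans with (2 * INR N * / (4 * INR N * INR q)).
  - apply Rmult_le_compat; auto; try nra. apply Rabs_pos.
  - right. field. lra.
Qed.

Lemma arc_phase h : 2 * INR h * y = IZR (rho h) / INR q + 2 * INR h * b + IZR (Z.of_nat (2 * h) * a / Z.of_nat q).
Proof.
  assert (0 < INR q) by (apply lt_0_INR; lia).
  rewrite Hy. pose proof (Z.div_mod (Z.of_nat (2 * h) * a) (Z.of_nat q)) as E. fold (rho h) in E.
  assert (E' : 2 * INR h * IZR a = INR q * IZR (Z.of_nat (2 * h) * a / Z.of_nat q) + IZR (rho h)).
  { rewrite (INR_IZR_INZ q), <- mult_IZR, <- plus_IZR, <- E by lia.
    rewrite mult_IZR, <- INR_IZR_INZ, mult_INR. simpl; ring. }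
  apply Rmult_eq_reg_l with (INR q); [|lra]. field_simplify; try lra.
Qed.

(** The fractional part [u] of [2 h y] lies within [1 / (2 q)] of [rho / q], and [rho] and [q - rho]
    are at least 1. So [u] and [1 - u] lose at most a factor 2, which cancels the 2 in
    [inner_sin]. *)
Lemma inner_nonres h : (1 <= h <= N)%nat -> rho h <> 0%Z ->
  Rabs (inner g B h y) <= 3 * V ^ 2 * (INR q * kap q (rho h)).
Proof.
  intros Hh Hr. assert (Hqp : 0 < INR q) by (apply lt_0_INR; lia).
  assert (Hrb : (0 <= rho h < Z.of_nat q)%Z) by (apply Z.mod_pos_bound; lia).
  assert (H1 : 1 <= IZR (rho h)) by (apply IZR_le; lia).
  assert (H2 : IZR (rho h) <= INR q - 1).
  { rewrite INR_IZR_INZ, <- minus_IZR. apply IZR_le; lia. }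
  pose proof (arc_hb h Hh) as Hhb. apply Rabs_le_between in Hhb.
  set (u := IZR (rho h) / INR q + 2 * INR h * b).
  assert (Eu : INR q * u = IZR (rho h) + INR q * (2 * INR h * b)) by (unfold u; field; lra).
  assert (Hqb : - (1/2) <= INR q * (2 * INR h * b) <= 1/2).
  { assert (INR q * / (2 * INR q) = 1 / 2) by (field; lra). nra. }
  assert (Hu1 : IZR (rho h) / 2 <= INR q * u) by lra.
  assert (Hu2 : (INR q - IZR (rho h)) / 2 <= INR q * (1 - u)) by lra.
  assert (Hu : 0 < u < 1) by (split; nra).
  pose proof (sin_pi_inv u Hu) as Hs.
  assert (Es : Rabs (sin (PI * (2 * INR h * y))) = Rabs (sin (PI * u))).
  { rewrite arc_phase. fold u. rewrite <- (Rabs_sin_shift _ (Z.of_nat (2 * h) * a / Z.of_nat q)). f_equal; f_equal; ring. }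
  pose proof (inner_sin g B V h y Hg) as Hi. rewrite Es in Hi.
  assert (Hk : / u + / (1 - u) <= 2 * (INR q * kap q (rho h))).
  { unfold kap. destruct (Z.eqb_spec (rho h) 0); [contradiction|].
    rewrite minus_IZR, <- INR_IZR_INZ.
    assert (/ u <= 2 * INR q * / IZR (rho h)).
    { apply Rle_trans with (/ (IZR (rho h) / (2 * INR q))). apply Rinv_le_contravar.
      apply Rdiv_lt_0_compat; lra. apply Rle_div_l; lra. right; field; lra. }
    assert (/ (1 - u) <= 2 * INR q * / (INR q - IZR (rho h))).
    { apply Rle_trans with (/ ((INR q - IZR (rho h)) / (2 * INR q))). apply Rinv_le_contravar.
      apply Rdiv_lt_0_compat; lra. apply Rle_div_l; lra. right; field; lra. }
    lra. }
  pose proof (Rabs_pos (inner g B h y)). pose proof (Rabs_pos (sin (PI * u))).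
  set (I := Rabs (inner g B h y)) in *. set (S := Rabs (sin (PI * u))) in *. set (K := INR q * kap q (rho h)) in *.
  assert (1 <= S * (2 * K)) by nra.
  assert (I <= I * (S * (2 * K))) by nra.
  assert (0 <= K) by nra. nra.
Qed.

(** Only [2 h b] survives in the phase, and its sine is at least [2 h |b|]. The factor [|b|] stays
    on the left to allow [b = 0]. *)
Lemma inner_res h : (1 <= h <= N)%nat -> rho h = 0%Z ->
  Rabs (inner g B h y) * Rabs b <= 3 / 2 * V ^ 2 * / INR (2 * h).
Proof.
  intros Hh Hr. pose proof (arc_hb h Hh) as Hhb. assert (Hqp : 1 <= INR q) by (apply (le_INR 1); lia).
  assert (Hhp : 0 < INR h) by (apply lt_0_INR; lia).
  assert (Es : Rabs (sin (PI * (2 * INR h * y))) = Rabs (sin (PI * (2 * INR h * b)))).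
  { rewrite arc_phase, Hr. rewrite <- (Rabs_sin_shift _ (Z.of_nat (2 * h) * a / Z.of_nat q)). f_equal; f_equal.
    unfold Rdiv; ring. }
  pose proof (inner_sin g B V h y Hg) as Hi. rewrite Es in Hi.
  assert (Rabs (2 * INR h * b) <= Rabs (sin (PI * (2 * INR h * b)))).
  { apply sin_pi_ge. eapply Rle_trans; [apply Hhb|]. apply Rle_trans with (/ 2); [|lra]. apply Rinv_le_contravar; lra. }
  rewrite Rabs_mult, (Rabs_right (2 * INR h)) in H by nra.
  rewrite mult_INR; simpl (INR 2).
  pose proof (Rabs_pos (inner g B h y)). pose proof (Rabs_pos b).
  apply Rmult_le_reg_r with (INR h); auto.
  replace (3 / 2 * V ^ 2 * / ((1 + 1) * INR h) * INR h) with (3 / 4 * V ^ 2) by (field; lra).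
  nra.
Qed.

Lemma sum_nonres :
  rsum (fun h => if Z.eqb (rho (S h)) 0 then 0 else Rabs (inner g B (S h) y)) B <=
  6 * V ^ 2 * ((INR (2 * B + 1) + INR q) * harm q).
Proof.
  assert (Hqp : 0 < INR q) by (apply lt_0_INR; lia). pose proof (pow2_ge_0 V).
  set (f := fun h => kap q (Z.of_nat h * a mod Z.of_nat q)).
  apply Rle_trans with (rsum (fun h => 3 * V ^ 2 * INR q * f (2 * (S h))%nat) B).
  - apply rsum_le. intros h Hh. unfold f. destruct (Z.eqb_spec (rho (S h)) 0) as [E|E].
    + assert (0 <= kap q (rho (S h))) by (apply kap_ge0, Z.mod_pos_bound; lia). unfold rho in *.
      apply Rmult_le_pos; auto. nra.
    + rewrite (Rmult_assoc (3 * V ^ 2)). apply inner_nonres; auto. lia.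
  - rewrite rsum_scal.
    assert (rsum (fun h => f (2 * S h)%nat) B <= rsum f (2 * B + 1)).
    { apply (rsum_inj_le f (fun h => 2 * S h)%nat); try (intros; lia).
      intros; apply kap_ge0, Z.mod_pos_bound; lia. }
    pose proof (kap_sum q a (2 * B + 1) Hq Hgcd). fold f in H1.
    apply Rle_trans with (3 * V ^ 2 * INR q * ((INR (2 * B + 1) / INR q + 1) * (2 * harm q))).
    + apply Rmult_le_compat_l; [nra|lra].
    + right. field. lra.
Qed.

(** For even [q] one only gets divisibility of [2 h], not of [h]; this is why the resonant sums are
    written with [/ INR (2 * S h)]. *)
Lemma rho_0_divide h : rho h = 0%Z -> Z.eqb (Z.of_nat (2 * h) mod Z.of_nat q) 0 = true.
Proof.
  intros E. apply Z.eqb_eq. apply Z.mod_divide; [lia|]. apply Z.mod_divide in E; [|lia].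
  rewrite Z.mul_comm in E. apply Z.gauss in E; auto. rewrite Z.gcd_comm; auto.
Qed.

Lemma sum_res_inv :
  rsum (fun h => if Z.eqb (rho (S h)) 0 then / INR (2 * S h) else 0) B <= harm (2 * N) / INR q.
Proof.
  eapply Rle_trans; [|apply mult_sum; auto].
  set (f := fun h => if Z.eqb (Z.of_nat (S h) mod Z.of_nat q) 0 then / INR (S h) else 0).
  assert (Hf : forall h, 0 <= f h).
  { intros h; unfold f; destruct Z.eqb; [|lra]. left. apply Rinv_0_lt_compat, lt_0_INR; lia. }
  apply Rle_trans with (rsum (fun h => f (2 * h + 1)%nat) B).
  - apply rsum_le. intros h Hh. destruct (Z.eqb_spec (rho (S h)) 0) as [E|E]; [|apply Hf].
    unfold f. replace (S (2 * h + 1)) with (2 * S h)%nat by lia. rewrite rho_0_divide; auto. lra.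
  - apply (rsum_inj_le f (fun h => 2 * h + 1)%nat); auto; intros; lia.
Qed.

(** The two estimates differ in the resonant terms only: the first bounds them trivially and yields
    [N^2 / q], the second uses their sine and yields [1 / (q |b|)]. *)
Lemma arc_bounds :
  (q <= 4 * N)%nat ->
  A2 g B y <= 100 * V ^ 2 * harm (4 * N) * (INR N + INR N ^ 2 / INR q) /\
  A2 g B y * (INR q * Rabs b) <= 100 * V ^ 2 * harm (4 * N) * (INR N * (INR q * Rabs b) + 1).
Proof.
  intros HqN. assert (Hqp : 0 < INR q) by (apply lt_0_INR; lia). assert (HNp : 1 <= INR N) by (apply (le_INR 1); lia).
  pose proof Hg as (HV & Hgb & Hs & Ht).
  rewrite (weyl_identity g B y Hs).
  assert (HH : 1 <= harm (4 * N)) by (apply harm_ge1; lia).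
  assert (Hsq : rsum (fun n => g n * g n) B <= INR N * V ^ 2).
  { eapply Rle_trans; [apply rsum_bound with (c := V ^ 2)|].
    - intros i _. replace (g i * g i) with (Rabs (g i) * Rabs (g i)) by (rewrite <- Rabs_mult; apply Rabs_right; nra).
      pose proof (Hgb i). pose proof (Rabs_pos (g i)). simpl; nra.
    - apply Rmult_le_compat_r; [apply pow2_ge_0|apply le_INR; auto]. }
  set (Sn := rsum (fun h => if Z.eqb (rho (S h)) 0 then 0 else Rabs (inner g B (S h) y)) B).
  set (Sr := rsum (fun h => if Z.eqb (rho (S h)) 0 then Rabs (inner g B (S h) y) else 0) B).
  assert (Hdec : rsum (fun h => inner g B (S h) y) B <= Sn + Sr).
  { unfold Sn, Sr. rewrite <- rsum_plus. apply rsum_le. intros h _. pose proof (Rle_abs (inner g B (S h) y)).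
    destruct Z.eqb; lra. }
  assert (Hn : Sn <= 42 * V ^ 2 * (INR N * harm (4 * N))).
  { eapply Rle_trans; [apply sum_nonres|]. pose proof (harm_mono q (4 * N) HqN). pose proof (harm_ge0 q).
    assert (INR (2 * B + 1) + INR q <= 7 * INR N).
    { replace 7 with (INR 7) by (simpl; lra). rewrite <- plus_INR, <- mult_INR. apply le_INR. lia. }
    pose proof (pow2_ge_0 V). pose proof (pos_INR (2 * B + 1)).
    assert ((INR (2 * B + 1) + INR q) * harm q <= 7 * INR N * harm (4 * N)) by (apply Rmult_le_compat; lra).
    nra. }
  assert (H2N : harm (2 * N) <= harm (4 * N)) by (apply harm_mono; lia).
  pose proof (harm_ge0 (2 * N)). pose proof (pow2_ge_0 V) as HV2.
  pose proof sum_res_inv as Hinv.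
  set (Si := rsum (fun h => if Z.eqb (rho (S h)) 0 then / INR (2 * S h) else 0) B) in *.
  assert (Hiq : 0 < / INR q) by (apply Rinv_0_lt_compat; auto).
  assert (Hinv' : Si * INR q <= harm (4 * N)).
  { apply Rle_trans with (harm (2 * N) / INR q * INR q). apply Rmult_le_compat_r; lra.
    replace (harm (2 * N) / INR q * INR q) with (harm (2 * N)) by (field; lra). lra. }
  (* As [h <= N], one has [1 <= 2 N / (2 h)]. So the number of resonant differences is controlled,
     up to a logarithm, by the sum [Si] that the second estimate uses as well. *)
  assert (Hr1 : Sr <= INR N * V ^ 2 * (2 * INR N) * Si).
  { unfold Sr, Si. rewrite <- rsum_scal. apply rsum_le. intros h Hh. destruct Z.eqb; [|lra].
    eapply Rle_trans; [apply inner_triv, Hg|].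
    assert (INR B <= INR N) by (apply le_INR; auto).
    assert (1 <= 2 * INR N * / INR (2 * S h)).
    { apply Rmult_le_reg_r with (INR (2 * S h)); [apply lt_0_INR; lia|].
      rewrite Rmult_assoc, Rinv_l by (apply not_0_INR; lia). rewrite Rmult_1_l, Rmult_1_r.
      rewrite mult_INR. simpl (INR 2). assert (INR (S h) <= INR N) by (apply le_INR; lia). lra. }
    assert (0 <= INR N * V ^ 2) by (apply Rmult_le_pos; lra).
    assert (INR B * V ^ 2 <= INR N * V ^ 2) by (apply Rmult_le_compat_r; auto).
    eapply Rle_trans; [eassumption|]. rewrite (Rmult_assoc (INR N * V ^ 2)). rewrite <- (Rmult_1_r (INR N * V ^ 2)) at 1.
    apply Rmult_le_compat_l; auto. }
  assert (Hr2 : Sr * Rabs b <= 3 / 2 * V ^ 2 * Si).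
  { unfold Sr, Si. rewrite <- rsum_scal, <- rsum_scalr. apply rsum_le. intros h Hh.
    destruct (Z.eqb_spec (rho (S h)) 0); [|lra]. apply inner_res; auto. lia. }
  set (H4 := harm (4 * N)) in *.
  assert (HSi : Si <= H4 / INR q) by (apply Rle_div_r; auto).
  split.
  - assert (Sr <= 2 * (V ^ 2 * H4) * (INR N ^ 2 / INR q)).
    { eapply Rle_trans; [apply Hr1|]. apply Rle_trans with (INR N * V ^ 2 * (2 * INR N) * (H4 / INR q)).
      { apply Rmult_le_compat_l; auto. repeat apply Rmult_le_pos; auto; lra. }
      right. field. lra. }
    assert (INR N * V ^ 2 <= V ^ 2 * H4 * INR N).
    { rewrite (Rmult_comm (INR N)). rewrite Rmult_assoc. apply Rmult_le_compat_l; auto. nra. }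
    assert (0 <= V ^ 2 * H4 * INR N) by (repeat apply Rmult_le_pos; lra).
    assert (0 <= V ^ 2 * H4 * (INR N ^ 2 / INR q)).
    { repeat apply Rmult_le_pos; lra. }
    lra.
  - pose proof (Rabs_pos b).
    assert (E0 : 0 <= INR q * Rabs b) by nra.
    assert (INR N * V ^ 2 <= V ^ 2 * H4 * INR N).
    { rewrite (Rmult_comm (INR N)). rewrite Rmult_assoc. apply Rmult_le_compat_l; auto. nra. }
    assert (F1 : (rsum (fun n => g n * g n) B + 2 * Sn) * (INR q * Rabs b) <= 85 * (V ^ 2 * H4 * INR N) * (INR q * Rabs b)).
    { apply Rmult_le_compat_r; lra. }
    assert (F2 : Sr * (INR q * Rabs b) <= 3 / 2 * V ^ 2 * H4).
    { replace (Sr * (INR q * Rabs b)) with (Sr * Rabs b * INR q) by ring.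
      apply Rle_trans with (3 / 2 * V ^ 2 * Si * INR q). apply Rmult_le_compat_r; lra.
      rewrite Rmult_assoc. apply Rmult_le_compat_l; [nra|auto]. }
    assert (F3 : rsum (fun h => inner g B (S h) y) B * (INR q * Rabs b) <= (Sn + Sr) * (INR q * Rabs b)) by (apply Rmult_le_compat_r; lra).
    assert (0 <= V ^ 2 * H4) by nra.
    assert (0 <= V ^ 2 * H4 * INR N * (INR q * Rabs b)) by (repeat apply Rmult_le_pos; lra).
    lra.
Qed.

End Arc.

(** Dirichlet's theorem of order [4 N] produces exactly the arc width and the range [q <= 4 N]
    required above. *)
Lemma pointwise_bound g B N V y : BV g B V -> (B <= N)%nat -> (1 <= N)%nat ->
  exists (a : Z) (q : nat), (1 <= q <= 4 * N)%nat /\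
   Rabs (y - IZR a / INR q) <= / (4 * INR N * INR q) /\
   A2 g B y <= 100 * V ^ 2 * harm (4 * N) * (INR N + INR N ^ 2 / INR q) /\
   A2 g B y * (INR q * Rabs (y - IZR a / INR q)) <=
      100 * V ^ 2 * harm (4 * N) * (INR N * (INR q * Rabs (y - IZR a / INR q)) + 1).
Proof.
  intros Hg HB HN. destruct (dirichlet y (4 * N)) as (a & q & Hq & Hd & Hgcd); [lia|].
  exists a, q. split; auto. assert (Hqp : 0 < INR q) by (apply lt_0_INR; lia).
  assert (HNp : 0 < INR N) by (apply lt_0_INR; lia).
  assert (Hb : Rabs (y - IZR a / INR q) <= / (4 * INR N * INR q)).
  { replace (y - IZR a / INR q) with ((INR q * y - IZR a) * / INR q) by (field; lra).
    rewrite Rabs_mult, (Rabs_right (/ INR q)) by (left; apply Rinv_0_lt_compat; auto).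
    rewrite Rinv_mult. apply Rmult_le_compat_r; [left; apply Rinv_0_lt_compat; auto|].
    rewrite mult_INR in Hd. simpl (INR 4) in Hd. replace 4 with (1+1+1+1) by ring. auto. }
  split; auto. apply (arc_bounds g B N q V a (y - IZR a / INR q) y); auto; try lia. ring.
Qed.

(** At [a/q] itself every resonant inner sum has all its cosines equal to 1, so it is a sum of
    nonnegative products. There are about [H/q] useful resonant differences up to [H], each worth
    [H g0^2]; the non-resonant ones are subtracted as an error. *)
Lemma quadratic_sum_lower g B V q a H n1 g0 :
  BV g B V -> (forall n, 0 <= g n) -> (1 <= q)%nat -> Nat.Odd q -> Z.gcd a (Z.of_nat q) = 1%Z ->
  (q <= H)%nat -> (n1 + 2 * H <= B)%nat -> 0 <= g0 ->
  (forall n, (n1 <= n < n1 + 2 * H)%nat -> g0 <= g n) ->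
  g0 ^ 2 * INR H ^ 2 / INR q - 12 * V ^ 2 * ((INR (2 * B + 1) + INR q) * harm q) <= A2 g B (IZR a / INR q).
Proof.
  intros Hg Hpos Hq Hodd Hgcd HqH HB Hg0 Hlow. assert (Hqp : 0 < INR q) by (apply lt_0_INR; lia).
  assert (HBp : 0 < INR B) by (apply lt_0_INR; lia).
  set (y := IZR a / INR q).
  assert (Hn := sum_nonres g B B q V a 0 y Hg (Nat.le_refl _) ltac:(lia) Hq Hgcd ltac:(unfold y; ring)
     ltac:(rewrite Rabs_R0; left; apply Rinv_0_lt_compat; nra)).
  destruct Hg as (HV & Hgb & Hs & Ht). rewrite (weyl_identity g B y Hs).
  set (rho := fun h => (Z.of_nat (2 * h) * a mod Z.of_nat q)%Z) in *.
  assert (Hsq : 0 <= rsum (fun n => g n * g n) B) by (apply rsum_ge0; intros; specialize (Hpos i); nra).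
  (* Here [q] odd matters: from [q | 2 h a] one gets [q | h], so that both [2 n h a / q] and
     [h^2 a / q] are integers. *)
  assert (Hval : forall h, rho h = 0%Z -> inner g B h y = rsum (fun n => g n * g (n + h)%nat) B).
  { intros h E. unfold inner. apply rsum_ext. intros n _.
    assert (E2 : exists m, (Z.of_nat h = m * Z.of_nat q)%Z).
    { apply Z.mod_divide in E; [|lia]. rewrite Z.mul_comm in E. apply Z.gauss in E; [|rewrite Z.gcd_comm; auto].
      rewrite Nat2Z.inj_mul in E. apply Z.gauss in E; [auto|].
      destruct Hodd as [k Hk]. apply Z.bezout_1_gcd. exists 1%Z, (- Z.of_nat k)%Z. lia. }
    destruct E2 as [m Em].
    assert (Em' : INR h = IZR m * INR q) by (rewrite !INR_IZR_INZ, <- mult_IZR; f_equal; auto).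
    replace (INR n * (4 * PI * INR h * y) + 2 * PI * INR (h * h) * y)
      with (0 + 2 * PI * IZR (2 * Z.of_nat n * m * a + Z.of_nat h * m * a)).
    rewrite cos_plus_Z, cos_0; ring.
    rewrite plus_IZR, !mult_IZR, <- !INR_IZR_INZ, mult_INR, Em'. unfold y. field. lra. }
  set (f := fun h => if Z.eqb (rho (S h)) 0 then inner g B (S h) y else 0).
  assert (Hf : forall h, 0 <= f h).
  { intros h; unfold f. destruct (Z.eqb_spec (rho (S h)) 0); [|lra]. rewrite Hval; auto.
    apply rsum_ge0; intros. apply Rmult_le_pos; auto. }
  assert (Hdec : rsum f B - rsum (fun h => if Z.eqb (rho (S h)) 0 then 0 else Rabs (inner g B (S h) y)) B <=
     rsum (fun h => inner g B (S h) y) B).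
  { rewrite <- rsum_minus. apply rsum_le. intros h _. unfold f.
    pose proof (Rle_abs (- inner g B (S h) y)). rewrite Rabs_Ropp in H0. destruct Z.eqb; lra. }
  assert (Hmain : INR (H / q) * (INR H * g0 ^ 2) <= rsum f B).
  (* Only the differences [q, 2 q, ...] up to [H] are kept. Index [S i * q - 1] of [f] stands for
     the difference [S i * q]. *)
  { eapply Rle_trans; [|apply (rsum_inj_le f (fun i => S i * q - 1)%nat (H / q)); auto].
    - rewrite <- rsum_const. apply rsum_le. intros i Hi. unfold f.
      assert (Hiq : (S i * q <= H)%nat).
      { pose proof (Nat.Div0.mul_div_le H q). nia. }
      replace (S (S i * q - 1)) with (S i * q)%nat by nia.
      assert (E : rho (S i * q)%nat = 0%Z).
      { unfold rho. apply Z.mod_divide; [lia|]. exists (Z.of_nat (2 * S i) * a)%Z. rewrite !Nat2Z.inj_mul. ring. }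
      rewrite E, Z.eqb_refl, Hval by auto.
      apply Rle_trans with (rsum (fun j => g (n1 + j)%nat * g (n1 + j + S i * q)%nat) H).
      + rewrite <- rsum_const. apply rsum_le. intros j Hj.
        assert (g0 <= g (n1 + j)%nat) by (apply Hlow; lia).
        assert (g0 <= g (n1 + j + S i * q)%nat) by (apply Hlow; lia). replace (g0 ^ 2) with (g0 * g0) by ring. apply Rmult_le_compat; auto.
      + apply (rsum_inj_le (fun n => g n * g (n + S i * q)%nat) (fun j => n1 + j)%nat); try (intros; lia).
        intros; apply Rmult_le_pos; auto.
    - intros i j _ _ E. nia.
    - intros i Hi. pose proof (Nat.Div0.mul_div_le H q). nia. }
  (* Since [H >= q], rounding [H / q] down loses at most a factor 2. *)
  assert (Hfl : INR H / (2 * INR q) <= INR (H / q)).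
  { apply Rle_div_l; [lra|]. pose proof (Nat.div_mod_eq H q). pose proof (Nat.mod_upper_bound H q).
    assert (1 <= H / q)%nat by (apply Nat.div_le_lower_bound; lia).
    replace 2 with (INR 2) by (simpl; lra). rewrite <- !mult_INR. apply le_INR. nia. }
  assert (g0 ^ 2 * INR H ^ 2 / INR q <= 2 * (INR (H / q) * (INR H * g0 ^ 2))).
  { apply Rle_trans with (2 * (INR H / (2 * INR q) * (INR H * g0 ^ 2))).
    - right. field. lra.
    - apply Rmult_le_compat_l; [lra|]. apply Rmult_le_compat_r; auto.
      apply Rmult_le_pos; [apply pos_INR|apply pow2_ge_0]. }
  lra.
Qed.

(** * Fourier series and dyadic blocks of the Riemann function *)

(** Equalities coming from Coquelicot are typed in the carrier of a structure; exposing [R] lets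
    [ring] and [field] work. *)
Ltac toR := match goal with |- @eq _ ?a ?b => change (@eq R a b) end.

Definition wt (s : R) (n : nat) : R :=
  match n with O => 0 | S _ => Rpower (INR n) (-2 * s) end.

Lemma Rpower_pos x y : 0 < Rpower x y.
Proof. apply exp_pos. Qed.

Lemma wt_0 s : wt s 0 = 0.
Proof. reflexivity. Qed.

Lemma wt_ge0 s n : 0 <= wt s n.
Proof. destruct n; simpl wt; [lra|]. left; apply Rpower_pos. Qed.

Lemma is_derive_Rpower c x : 0 < x -> is_derive (fun t => Rpower t c) x (c * Rpower x (c - 1)).
Proof. intros Hx. apply is_derive_Reals. apply derivable_pt_lim_power; auto. Qed.

Lemma Rpower_neg_anti c x y : c <= 0 -> 0 < x <= y -> Rpower y c <= Rpower x c.
Proof.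
  intros Hc Hxy. replace c with (- (- c)) by ring. rewrite !(Rpower_Ropp _ (- c)).
  apply Rinv_le_contravar; [apply Rpower_pos|]. apply Rle_Rpower_l; lra.
Qed.

(** Comparison with the integral of [t^(-2 s)]: the mean value theorem gives [(2 s - 1) c^(-2 s)]
    with [c] at most the larger index. *)
Lemma wt_tele s n : 1 / 2 < s ->
  wt s (S (S n)) <= / (2 * s - 1) * (Rpower (INR (S n)) (1 - 2 * s) - Rpower (INR (S (S n))) (1 - 2 * s)).
Proof.
  intros Hs. set (x := INR (S n)). assert (Hx : 1 <= x) by (apply (le_INR 1); lia).
  unfold wt. rewrite (S_INR (S n)). fold x.
  destruct (MVT_gen (fun t => Rpower t (1 - 2 * s)) x (x + 1) (fun t => (1 - 2 * s) * Rpower t (1 - 2 * s - 1))) as (c & Hc & E).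
  - intros t Ht. rewrite Rmin_left, Rmax_right in Ht by lra. apply is_derive_Rpower; lra.
  - intros t Ht. rewrite Rmin_left, Rmax_right in Ht by lra. apply derivable_continuous_pt.
    exists ((1 - 2 * s) * Rpower t (1 - 2 * s - 1)). apply derivable_pt_lim_power; lra.
  - rewrite Rmin_left, Rmax_right in Hc by lra.
    replace (Rpower x (1 - 2 * s) - Rpower (x + 1) (1 - 2 * s)) with ((2 * s - 1) * Rpower c (1 - 2 * s - 1)) by lra.
    rewrite <- Rmult_assoc, Rinv_l, Rmult_1_l by lra.
    replace (1 - 2 * s - 1) with (-2 * s) by ring. apply Rpower_neg_anti; lra.
Qed.

Lemma wt_sum_bound s N : 1 / 2 < s -> rsum (wt s) N <= 1 + / (2 * s - 1).
Proof.
  intros Hs. assert (0 < / (2 * s - 1)) by (apply Rinv_0_lt_compat; lra).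
  destruct N as [|[|N]]; [simpl; lra|simpl; lra|].
  rewrite rsum_Sl, rsum_Sl. unfold wt at 1 2. simpl INR. unfold Rpower at 1. rewrite ln_1, Rmult_0_r, exp_0.
  apply Rle_trans with (0 + (1 + rsum (fun i => / (2 * s - 1) * (Rpower (INR (S i)) (1 - 2 * s) - Rpower (INR (S (S i))) (1 - 2 * s))) N)).
  - repeat apply Rplus_le_compat_l. apply rsum_le. intros; apply wt_tele; auto.
  - rewrite rsum_scal.
    set (F := fun j => - Rpower (INR (S j)) (1 - 2 * s)).
    rewrite (rsum_ext _ (fun i => F (S i) - F i)) by (intros; unfold F; ring).
    rewrite rsum_tele. unfold F. simpl (INR 1). unfold Rpower at 2. rewrite ln_1, Rmult_0_r, exp_0.
    pose proof (Rpower_pos (INR (S N)) (1 - 2 * s)). nra.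
Qed.

Lemma ex_series_bounded (a : nat -> R) M : (forall n, 0 <= a n) -> (forall n, rsum a n <= M) -> ex_series a.
Proof.
  intros Ha HM. destruct (ex_finite_lim_seq_incr (sum_n a) M) as [l Hl].
  - intros n. rewrite sum_Sn. unfold plus; simpl. specialize (Ha (S n)); lra.
  - intros n. rewrite rsum_sum_n; auto.
  - exists l. exact Hl.
Qed.

Lemma rsum_le_Series (a : nat -> R) n : (forall n, 0 <= a n) -> ex_series a -> rsum a n <= Series a.
Proof.
  intros Ha He. pose proof (Series_correct a He) as H.
  apply (is_lim_seq_incr_compare (sum_n a) (Series a)) with (n := n) in H.
  - rewrite rsum_sum_n in H. specialize (Ha n). simpl in H; lra.
  - intros m. rewrite sum_Sn. unfold plus; simpl. specialize (Ha (S m)); lra.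
Qed.

Lemma wt_ex s : 1 / 2 < s -> ex_series (fun n => wt s (S n)).
Proof.
  intros Hs. apply ex_series_bounded with (1 + / (2 * s - 1)). intros; apply wt_ge0.
  intros n. pose proof (wt_sum_bound s (S n) Hs). rewrite rsum_Sl, wt_0 in H. lra.
Qed.

(* Phase [ph = 0] gives real parts and [ph = - PI / 2] imaginary parts. *)
Definition ftrig (s ph x : R) : R := Series (fun n => wt s (S n) * cos (2 * PI * INR (S n * S n) * x + ph)).
Definition FP (g : nat -> R) (B : nat) (ph y : R) : R :=
  rsum (fun n => g n * cos (2 * PI * INR (n * n) * y + ph)) B.

Lemma ftrig_term_le s ph x n : Rabs (wt s (S n) * cos (2 * PI * INR (S n * S n) * x + ph)) <= wt s (S n).
Proof.
  rewrite Rabs_mult, (Rabs_right (wt s (S n))) by (apply Rle_ge, wt_ge0).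
  assert (Rabs (cos (2 * PI * INR (S n * S n) * x + ph)) <= 1) by (apply Rabs_le, COS_bound).
  pose proof (wt_ge0 s (S n)). nra.
Qed.

Lemma ftrig_ex s ph x : 1 / 2 < s -> ex_series (fun n => wt s (S n) * cos (2 * PI * INR (S n * S n) * x + ph)).
Proof.
  intros Hs. apply (ex_series_le (K := R_AbsRing) (V := R_CompleteNormedModule)) with (fun n => wt s (S n)).
  - intros n. apply ftrig_term_le.
  - apply wt_ex; auto.
Qed.

(** [FP (wt s) N] uses the indices [n < N], of which [n = 0] has weight 0; this removes [pred N]
    terms from the series that starts at 1. *)
Definition tail (s : R) (N : nat) : R := Series (fun n => wt s (S n)) - rsum (fun n => wt s (S n)) (pred N).

Lemma tail_lim s eps : 1 / 2 < s -> 0 < eps -> exists N0, forall N, (N0 <= N)%nat -> tail s N < eps.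
Proof.
  intros Hs He. pose proof (Series_correct _ (wt_ex s Hs)) as H.
  assert (H' : is_lim_seq (sum_n (fun n => wt s (S n))) (Series (fun n => wt s (S n)))) by exact H.
  apply is_lim_seq_spec in H'. destruct (H' (mkposreal eps He)) as [N0 HN0]. exists (S (S N0)). intros N HN.
  unfold tail. specialize (HN0 (pred (pred N)) ltac:(lia)). rewrite rsum_sum_n in HN0.
  replace (S (pred (pred N))) with (pred N) in HN0 by lia. change (pos (mkposreal eps He)) with eps in HN0. apply Rabs_lt_between in HN0.
  lra.
Qed.

Lemma ftrig_tail s ph N x : 1 / 2 < s -> (1 <= N)%nat -> Rabs (ftrig s ph x - FP (wt s) N ph x) <= tail s N.
Proof.
  intros Hs HN. unfold ftrig, tail, FP. destruct N as [|N]; [lia|]. rewrite rsum_Sl, wt_0, Rmult_0_l, Rplus_0_l.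
  (* Removing no term is treated apart, because [Series_incr_n] asks for a positive number of
     removed terms. *)
  simpl pred. destruct N as [|N].
  - simpl rsum. rewrite !Rminus_0_r. eapply Rle_trans; [apply Series_Rabs|].
    + apply (ex_series_le (K := R_AbsRing) (V := R_CompleteNormedModule)) with (b := fun n => wt s (S n)); [|apply wt_ex; auto].
      intros n. eapply Rle_trans; [right; apply Rabs_Rabsolu|]. apply ftrig_term_le.
    + apply Series_le; [|apply wt_ex; auto]. intros n; split; [apply Rabs_pos|apply ftrig_term_le].
  - rewrite (Series_incr_n _ (S N)) by (try lia; apply ftrig_ex; auto).
    rewrite (Series_incr_n (fun n => wt s (S n)) (S N)) by (try lia; apply wt_ex; auto).
    simpl pred. rewrite <- !sum_n_Reals, !rsum_sum_n.
    match goal with |- Rabs (?a + ?b - ?c) <= _ => replace (a + b - c) with b by ring end.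
    match goal with |- _ <= ?a + ?b - ?c => replace (a + b - c) with b by ring end.
    eapply Rle_trans; [apply Series_Rabs|].
    + apply (ex_series_le (K := R_AbsRing) (V := R_CompleteNormedModule)) with (b := fun n => wt s (S (S N + n))).
      2:{ apply (ex_series_incr_n (fun n => wt s (S n)) (S N)). apply wt_ex; auto. }
      intros n. eapply Rle_trans; [right; apply Rabs_Rabsolu|]. apply ftrig_term_le.
    + apply Series_le. intros n; split; [apply Rabs_pos|apply ftrig_term_le].
      apply (ex_series_incr_n (fun n => wt s (S n)) (S N)). apply wt_ex; auto.
Qed.

Lemma continuous_rsum (f : nat -> R -> R) n x :
  (forall i, (i < n)%nat -> continuous (f i) x) -> continuous (fun t => rsum (fun i => f i t) n) x.
Proof.
  induction n; intros H; simpl. apply continuous_const.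
  apply (continuous_plus (V := R_NormedModule)); auto.
Qed.

Lemma continuous_ctrig c ph x : continuous (fun t => cos (c * t + ph)) x.
Proof. apply (ex_derive_continuous (K := R_AbsRing) (V := R_NormedModule)). auto_derive; auto. Qed.

Lemma FP_continuous g B ph x : continuous (FP g B ph) x.
Proof.
  apply continuous_rsum. intros i _. apply (ex_derive_continuous (K := R_AbsRing) (V := R_NormedModule)). auto_derive; auto.
Qed.

Lemma ftrig_continuous s ph x : 1 / 2 < s -> continuous (ftrig s ph) x.
Proof.
  intros Hs. apply continuity_pt_filterlim. intros eps He.
  destruct (tail_lim s (eps / 3)) as [N0 HN0]; auto; [lra|].
  set (N := S N0). specialize (HN0 N ltac:(unfold N; lia)).
  pose proof (FP_continuous (wt s) N ph x) as Hc. apply continuity_pt_filterlim in Hc.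
  destruct (Hc (eps / 3)) as (d & Hd & Hdx); [lra|].
  exists d; split; auto. intros t Ht. specialize (Hdx t Ht). unfold dist in *; simpl in *. unfold R_dist in *.
  pose proof (ftrig_tail s ph N x Hs ltac:(unfold N; lia)). pose proof (ftrig_tail s ph N t Hs ltac:(unfold N; lia)).
  replace (ftrig s ph t - ftrig s ph x) with
    ((ftrig s ph t - FP (wt s) N ph t) + (FP (wt s) N ph t - FP (wt s) N ph x) - (ftrig s ph x - FP (wt s) N ph x)) by ring.
  unfold Rminus at 1. eapply Rle_lt_trans; [apply Rabs_triang|]. rewrite Rabs_Ropp.
  eapply Rle_lt_trans; [apply Rplus_le_compat_r, Rabs_triang|]. lra.
Qed.

Lemma Riemann_fn_fst s x : fst (Riemann_fn s x) = ftrig s 0 x.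
Proof. unfold Riemann_fn, ftrig. cbn [fst]. apply Series_ext. intros n. unfold wt. rewrite Rplus_0_r. auto. Qed.

Lemma Riemann_fn_snd s x : snd (Riemann_fn s x) = ftrig s (- (PI / 2)) x.
Proof.
  unfold Riemann_fn, ftrig. cbn [snd]. apply Series_ext. intros n. unfold wt. f_equal.
  rewrite cos_plus, cos_neg, sin_neg, cos_PI2, sin_PI2. ring.
Qed.

Lemma is_RInt_eqR (f : R -> R) a b (l l' : R) : is_RInt f a b l -> l = l' -> is_RInt f a b l'.
Proof. intros H <-; exact H. Qed.

Lemma is_RInt_const_eq (c a b l : R) : (b - a) * c = l -> is_RInt (fun _ : R => c) a b l.
Proof. intros <-. apply (is_RInt_const (V := R_NormedModule)). Qed.

Lemma is_RInt_rsum (f : nat -> R -> R) (l : nat -> R) n a b :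
  (forall i, (i < n)%nat -> is_RInt (f i) a b (l i)) ->
  is_RInt (fun x => rsum (fun i => f i x) n) a b (rsum l n).
Proof.
  induction n; intros H; simpl.
  - apply is_RInt_const_eq; ring.
  - apply (is_RInt_plus (V := R_NormedModule)); auto.
Qed.

Lemma ex_RInt_cont (f : R -> R) a b : (forall x, continuous f x) -> ex_RInt f a b.
Proof. intros H. apply (ex_RInt_continuous (V := R_CompleteNormedModule)). intros; apply H. Qed.

Lemma is_RInt_cos (m : Z) ph a :
  is_RInt (fun t => cos (2 * PI * IZR m * t + ph)) a (a + 1) (if Z.eqb m 0 then cos ph else 0).
Proof.
  destruct (Z.eqb_spec m 0) as [->|Hm].
  - apply (is_RInt_ext (fun _ => cos ph)). intros; f_equal; ring.
    apply is_RInt_const_eq; ring.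
  - pose proof PI_RGT_0. assert (IZR m <> 0) by (apply not_0_IZR; auto).
    assert (H1 : 2 * PI * IZR m <> 0) by (apply Rmult_integral_contrapositive_currified; auto; apply Rgt_not_eq; lra).
    replace 0 with (minus (sin (2 * PI * IZR m * (a + 1) + ph) / (2 * PI * IZR m)) (sin (2 * PI * IZR m * a + ph) / (2 * PI * IZR m))).
    + apply (is_RInt_derive (V := R_CompleteNormedModule) (fun t => sin (2 * PI * IZR m * t + ph) / (2 * PI * IZR m))).
      * intros x _. auto_derive; auto. field. repeat split; auto; apply PI_neq0.
      * intros; apply continuous_ctrig.
    + unfold minus, plus, opp; simpl.
      replace (2 * PI * IZR m * (a + 1) + ph) with (2 * PI * IZR m * a + ph + 2 * PI * IZR m) by ring.
      rewrite sin_plus_Z. ring.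
Qed.

Lemma RInt_le_const (f : R -> R) a b M : a <= b -> (forall x, continuous f x) ->
  (forall x, a <= x <= b -> Rabs (f x) <= M) -> Rabs (RInt f a b) <= (b - a) * M.
Proof.
  intros Hab Hc HM. apply (norm_RInt_le_const (V := R_NormedModule) f a b (RInt f a b) M); auto.
  apply (RInt_correct (V := R_CompleteNormedModule)). apply ex_RInt_cont; auto.
Qed.

(* Term-by-term integration against a kernel [kap] that only sees finitely many of the frequencies. *)
Lemma ftrig_integral s ph (kap : R -> R) MK y a (l : nat -> R) N1 : 1 / 2 < s -> 0 < MK ->
  (forall x, continuous kap x) -> (forall x, a <= x <= a + 1 -> Rabs (kap x) <= MK) ->
  (forall n, is_RInt (fun t => cos (2 * PI * INR (n * n) * (y + t) + ph) * kap t) a (a + 1) (l n)) ->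
  (forall n, (N1 <= n)%nat -> l n = 0) ->
  RInt (fun t => ftrig s ph (y + t) * kap t) a (a + 1) = rsum (fun n => wt s n * l n) N1.
Proof.
  intros Hs HMK Hk Hk1 Hl Hz. set (I := RInt _ _ _).
  assert (HI : forall N, (1 <= N)%nat -> (N1 <= N)%nat -> Rabs (I - rsum (fun n => wt s n * l n) N1) <= tail s N * MK).
  { intros N HN HN1. rewrite <- (rsum_supp (fun n => wt s n * l n) N1 N) by (auto; intros; rewrite Hz by lia; ring).
    assert (HF : is_RInt (fun t => FP (wt s) N ph (y + t) * kap t) a (a + 1) (rsum (fun n => wt s n * l n) N)).
    { apply (is_RInt_ext (fun t => rsum (fun n => wt s n * (cos (2 * PI * INR (n * n) * (y + t) + ph) * kap t)) N)).
      - intros t _. unfold FP. rewrite <- rsum_scalr. apply rsum_ext; intros; ring.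
      - apply (is_RInt_rsum (fun n t => wt s n * (cos (2 * PI * INR (n * n) * (y + t) + ph) * kap t))).
        intros n _. apply (is_RInt_scal (V := R_NormedModule) _ a (a + 1) (wt s n)). apply Hl. }
    rewrite <- (is_RInt_unique _ _ _ _ HF). unfold I.
    assert (Hsh : forall x, continuous (fun t => ftrig s ph (y + t)) x).
    { intros x. apply (continuous_comp (fun t => y + t) (ftrig s ph)). apply (ex_derive_continuous (K := R_AbsRing) (V := R_NormedModule)); auto_derive; auto.
      apply ftrig_continuous; auto. }
    assert (Hsh2 : forall x, continuous (fun t => FP (wt s) N ph (y + t)) x).
    { intros x. apply (continuous_comp (fun t => y + t) (FP (wt s) N ph)). apply (ex_derive_continuous (K := R_AbsRing) (V := R_NormedModule)); auto_derive; auto.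
      apply FP_continuous; auto. }
    assert (C1 : forall x, continuous (fun t => ftrig s ph (y + t) * kap t) x).
    { intros x. apply (continuous_mult (K := R_AbsRing)); auto. }
    assert (C2 : forall x, continuous (fun t => FP (wt s) N ph (y + t) * kap t) x).
    { intros x. apply (continuous_mult (K := R_AbsRing)); auto. }
    rewrite <- (RInt_minus (V := R_CompleteNormedModule)) by (apply ex_RInt_cont; auto).
    replace (tail s N * MK) with ((a + 1 - a) * (tail s N * MK)) by ring. apply RInt_le_const; [lra| |].
    - intros x. apply (continuous_minus (V := R_NormedModule)); auto.
    - intros x Hx. unfold minus, plus, opp; simpl.
      replace (ftrig s ph (y + x) * kap x + - (FP (wt s) N ph (y + x) * kap x)) with
        ((ftrig s ph (y + x) - FP (wt s) N ph (y + x)) * kap x) by ring.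
      rewrite Rabs_mult. pose proof (ftrig_tail s ph N (y + x) Hs HN). specialize (Hk1 x Hx).
      pose proof (Rabs_pos (kap x)). pose proof (Rabs_pos (ftrig s ph (y + x) - FP (wt s) N ph (y + x))).
      apply Rmult_le_compat; auto. }
  destruct (Req_dec I (rsum (fun n => wt s n * l n) N1)) as [|Hne]; auto. exfalso.
  destruct (tail_lim s (Rabs (I - rsum (fun n => wt s n * l n) N1) / MK)) as [N0 HN0]; auto.
  apply Rdiv_lt_0_compat; auto. apply Rabs_pos_lt; lra.
  specialize (HN0 (S (N0 + N1)) ltac:(lia)). specialize (HI (S (N0 + N1)) ltac:(lia) ltac:(lia)).
  apply Rle_div_l in HI; auto. lra.
Qed.

Lemma is_RInt_cos_cos (k m : Z) y ph ps a :
  is_RInt (fun t => cos (2 * PI * IZR k * (y + t) + ph) * cos (2 * PI * IZR m * t + ps)) a (a + 1)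
    (/ 2 * ((if Z.eqb k m then cos (2 * PI * IZR k * y + ph - ps) else 0) +
            (if Z.eqb k (- m) then cos (2 * PI * IZR k * y + ph + ps) else 0))).
Proof.
  apply (is_RInt_ext (fun t => / 2 * (cos (2 * PI * IZR (k - m) * t + (2 * PI * IZR k * y + ph - ps)) +
     cos (2 * PI * IZR (k + m) * t + (2 * PI * IZR k * y + ph + ps))))).
  - intros t _. rewrite minus_IZR, plus_IZR.
    replace (2 * PI * (IZR k - IZR m) * t + (2 * PI * IZR k * y + ph - ps)) with
      ((2 * PI * IZR k * (y + t) + ph) - (2 * PI * IZR m * t + ps)) by ring.
    replace (2 * PI * (IZR k + IZR m) * t + (2 * PI * IZR k * y + ph + ps)) with
      ((2 * PI * IZR k * (y + t) + ph) + (2 * PI * IZR m * t + ps)) by ring.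
    set (u := 2 * PI * IZR k * (y + t) + ph). set (v := 2 * PI * IZR m * t + ps).
    rewrite cos_minus, cos_plus. toR. field.
  - apply (is_RInt_scal (V := R_NormedModule)). apply (is_RInt_plus (V := R_NormedModule)).
    + replace (Z.eqb k m) with (Z.eqb (k - m) 0) by (destruct (Z.eqb_spec (k - m) 0), (Z.eqb_spec k m); auto; lia).
      apply is_RInt_cos.
    + replace (Z.eqb k (- m)) with (Z.eqb (k + m) 0) by (destruct (Z.eqb_spec (k + m) 0), (Z.eqb_spec k (- m)); auto; lia).
      apply is_RInt_cos.
Qed.

(** * Fourier coefficients and Littlewood-Paley blocks *)

Definition coef (s : R) (m : Z) : R :=
  rsum (fun n => if Z.eqb (Z.of_nat (n * n)) m then wt s n else 0) (S (Z.abs_nat m)).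

Lemma ftrig_fourier s ph ps (m : Z) : 1 / 2 < s ->
  is_RInt (fun t => ftrig s ph t * cos (2 * PI * IZR m * t + ps)) 0 1
   (/ 2 * (cos (ph - ps) * coef s m + cos (ph + ps) * coef s (- m))).
Proof.
  intros Hs.
  set (kap := fun t => cos (2 * PI * IZR m * t + ps)).
  set (l := fun n => / 2 * ((if Z.eqb (Z.of_nat (n * n)) m then cos (ph - ps) else 0) +
            (if Z.eqb (Z.of_nat (n * n)) (- m) then cos (ph + ps) else 0))).
  assert (Hk : forall x, continuous kap x) by (intros; apply continuous_ctrig).
  assert (E : RInt (fun t => ftrig s ph (0 + t) * kap t) 0 (0 + 1) = rsum (fun n => wt s n * l n) (S (Z.abs_nat m))).
  { apply ftrig_integral with (MK := 1); auto; [lra| | |].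
    - intros; apply Rabs_le, COS_bound.
    - intros n. pose proof (is_RInt_cos_cos (Z.of_nat (n * n)) m 0 ph ps 0) as H.
      rewrite <- INR_IZR_INZ in H. unfold kap, l.
      replace (2 * PI * INR (n * n) * 0 + ph - ps) with (ph - ps) in H by ring.
      replace (2 * PI * INR (n * n) * 0 + ph + ps) with (ph + ps) in H by ring. exact H.
    - intros n Hn. unfold l. destruct (Z.eqb_spec (Z.of_nat (n * n)) m); [nia|].
      destruct (Z.eqb_spec (Z.of_nat (n * n)) (- m)); [nia|]. ring. }
  replace (/ 2 * (cos (ph - ps) * coef s m + cos (ph + ps) * coef s (- m))) with (RInt (fun t => ftrig s ph (0 + t) * kap t) 0 (0 + 1)).
  - rewrite Rplus_0_l.
    apply (is_RInt_ext (fun t => ftrig s ph (0 + t) * kap t)). intros; rewrite Rplus_0_l; auto.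
    apply (RInt_correct (V := R_CompleteNormedModule)). apply ex_RInt_cont. intros x.
    apply (continuous_mult (K := R_AbsRing)); auto.
    apply (continuous_comp (fun t => 0 + t) (ftrig s ph)). apply (ex_derive_continuous (K := R_AbsRing) (V := R_NormedModule)); auto_derive; auto.
    apply ftrig_continuous; auto.
  - rewrite E. unfold coef. replace (Z.abs_nat (- m)) with (Z.abs_nat m) by lia.
    rewrite <- !rsum_scal, <- rsum_plus, <- rsum_scal. apply rsum_ext. intros n _. unfold l.
    destruct Z.eqb, Z.eqb; ring.
Qed.

Lemma fourier_coef_Riemann s m : 1 / 2 < s -> fourier_coef (Riemann_fn s) m = (coef s m, 0).
Proof.
  intros Hs. unfold fourier_coef. apply (is_RInt_unique (V := C_R_CompleteNormedModule)).
  apply (is_RInt_fct_extend_pair (U := R_NormedModule) (V := R_NormedModule)).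
  - apply (is_RInt_ext (fun t => plus (ftrig s 0 t * cos (2 * PI * IZR (- m) * t + 0))
        (opp (ftrig s (- (PI / 2)) t * cos (2 * PI * IZR (- m) * t + - (PI / 2)))))).
    + intros t _. unfold Cmult; cbn [fst snd]. rewrite Riemann_fn_fst, Riemann_fn_snd. unfold e_; cbn [fst snd].
      rewrite Rplus_0_r. rewrite (cos_plus _ (- (PI / 2))), cos_neg, sin_neg, cos_PI2, sin_PI2.
      unfold plus, opp; simpl. toR. ring.
    + eapply is_RInt_eqR.
      * apply (is_RInt_plus (V := R_NormedModule)); [|apply (is_RInt_opp (V := R_NormedModule))]; apply ftrig_fourier; auto.
      (* The contributions of [coef s (- m)] to the two products cancel in the real part, those of
         [coef s m] add up. *)
      * rewrite Z.opp_involutive. replace (- (PI / 2) + - (PI / 2)) with (- PI) by field.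
        replace (- (PI / 2) - - (PI / 2)) with 0 by ring. rewrite Rminus_0_r, Rplus_0_r, cos_neg, cos_PI, cos_0.
        unfold plus, opp; simpl. toR. field.
  - apply (is_RInt_ext (fun t => plus (ftrig s 0 t * cos (2 * PI * IZR (- m) * t + - (PI / 2)))
        (ftrig s (- (PI / 2)) t * cos (2 * PI * IZR (- m) * t + 0)))).
    + intros t _. unfold Cmult; cbn [fst snd]. rewrite Riemann_fn_fst, Riemann_fn_snd. unfold e_; cbn [fst snd].
      rewrite Rplus_0_r. rewrite (cos_plus _ (- (PI / 2))), cos_neg, sin_neg, cos_PI2, sin_PI2.
      unfold plus, opp; simpl. toR. ring.
    + eapply is_RInt_eqR.
      * apply (is_RInt_plus (V := R_NormedModule)); apply ftrig_fourier; auto.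
      * replace (0 - - (PI / 2)) with (PI / 2) by ring. replace (0 + - (PI / 2)) with (- (PI / 2)) by ring.
        rewrite Rminus_0_r, Rplus_0_r, cos_neg, cos_PI2. unfold plus; simpl. toR. field.
Qed.

(* [gk s k] is the part of the coefficients with [2^k <= n^2 < 2^(k+1)], i.e. the block [P_(k+1)]. *)
Definition gk (s : R) (k n : nat) : R :=
  if andb (Nat.leb (2 ^ k) (n * n)) (Nat.ltb (n * n) (2 ^ S k)) then wt s n else 0.
Definition Bk (k : nat) : nat := S (Nat.sqrt (2 ^ S k)).

Lemma gk_supp s k n : (Bk k <= n)%nat -> gk s k n = 0.
Proof.
  intros H. unfold gk, Bk in *. pose proof (Nat.sqrt_spec (2 ^ S k) ltac:(lia)).
  destruct (Nat.leb_spec (2 ^ k) (n * n)), (Nat.ltb_spec (n * n) (2 ^ S k)); auto. nia.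
Qed.

Lemma gk_ge0 s k n : 0 <= gk s k n.
Proof. unfold gk. destruct andb; [apply wt_ge0|lra]. Qed.

Lemma Bk_le k : (Bk k <= S (2 ^ S k))%nat.
Proof. unfold Bk. pose proof (Nat.sqrt_le_lin (2 ^ S k)). lia. Qed.

Lemma csum_pair (f : nat -> C) (F G : nat -> R) a n :
  (forall i, (i <= n)%nat -> f (a + i)%nat = (F i, G i)) ->
  sum_n_m (G := C_AbelianMonoid) f a (a + n) = (rsum F (S n), rsum G (S n)).
Proof.
  induction n; intros H.
  - rewrite Nat.add_0_r, sum_n_n. rewrite <- (Nat.add_0_r a) at 1. rewrite H by lia. simpl. f_equal; ring.
  - rewrite Nat.add_succ_r. rewrite sum_n_Sm by lia. rewrite IHn by (intros; apply H; lia).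
    rewrite <- Nat.add_succ_r, H by lia. reflexivity.
Qed.

Lemma coef_neg s m : (0 < m)%Z -> coef s (- m) = 0.
Proof. intros H. apply rsum_eq0. intros i _. destruct (Z.eqb_spec (Z.of_nat (i * i)) (- m)); auto. nia. Qed.

(** Written as a double sum over frequencies and integers [n], then exchanged: each [n] meets the
    single frequency [n^2]. *)
Lemma coef_block s k ph x :
  rsum (fun i => coef s (Z.of_nat (2 ^ k + i)) * cos (2 * PI * INR (2 ^ k + i) * x + ph)) (2 ^ k) =
  FP (gk s k) (Bk k) ph x.
Proof.
  assert (H2 : (2 ^ S k = 2 ^ k + 2 ^ k)%nat) by (simpl; lia).
  set (M := S (2 ^ S k)).
  transitivity (FP (gk s k) M ph x).
  2:{ unfold FP. apply rsum_supp. apply Bk_le. intros i Hi. rewrite gk_supp by lia. ring. }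
  rewrite (rsum_ext _ (fun i => rsum (fun n => if Nat.eqb i (n * n - 2 ^ k) then (if Nat.leb (2 ^ k) (n * n) then wt s n * cos (2 * PI * INR (n * n) * x + ph) else 0) else 0) M)).
  - rewrite rsum_swap. apply rsum_ext. intros n Hn. unfold gk.
    destruct (Nat.leb_spec (2 ^ k) (n * n)); cbn [andb].
    + destruct (Nat.ltb_spec (n * n) (2 ^ S k)).
      * apply rsum_delta. lia.
      * rewrite rsum_eq0; [ring|]. intros i Hi. destruct (Nat.eqb_spec i (n * n - 2 ^ k)); auto; lia.
    + rewrite rsum_eq0; [ring|]. intros i Hi. destruct Nat.eqb; auto.
  - intros i Hi. unfold coef. rewrite <- rsum_scalr. symmetry.
    rewrite (rsum_supp _ (S (Z.abs_nat (Z.of_nat (2 ^ k + i)))) M).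
    + apply rsum_ext. intros n _.
      destruct (Nat.eqb_spec i (n * n - 2 ^ k)), (Nat.leb_spec (2 ^ k) (n * n)), (Z.eqb_spec (Z.of_nat (n * n)) (Z.of_nat (2 ^ k + i)));
       try ring; try lia.
      replace (2 ^ k + i)%nat with (n * n)%nat by lia. auto.
    + unfold M. lia.
    + intros n Hn. destruct (Nat.eqb_spec i (n * n - 2 ^ k)), (Nat.leb_spec (2 ^ k) (n * n)); auto. nia.
Qed.

Lemma LP_block_Riemann s k x : 1 / 2 < s ->
  LP_block (Riemann_fn s) (S k) x = (FP (gk s k) (Bk k) 0 x, FP (gk s k) (Bk k) (- (PI / 2)) x).
Proof.
  intros Hs. unfold LP_block.
  assert (Hp : (2 ^ k <> 0)%nat) by (apply Nat.pow_nonzero; lia).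
  assert (H2 : (2 ^ S k = 2 ^ k + 2 ^ k)%nat) by (simpl; lia).
  replace (2 ^ S k - 1)%nat with (2 ^ k + (2 ^ k - 1))%nat by lia.
  rewrite (csum_pair _ (fun i => coef s (Z.of_nat (2 ^ k + i)) * cos (2 * PI * INR (2 ^ k + i) * x + 0))
     (fun i => coef s (Z.of_nat (2 ^ k + i)) * cos (2 * PI * INR (2 ^ k + i) * x + - (PI / 2)))).
  - replace (S (2 ^ k - 1)) with (2 ^ k)%nat by lia. rewrite !coef_block. auto.
  - intros i Hi. rewrite !fourier_coef_Riemann by auto. rewrite coef_neg by lia.
    rewrite (cos_plus _ (- (PI / 2))), cos_neg, sin_neg, cos_PI2, sin_PI2, Rplus_0_r.
    unfold e_, Cmult, Cplus; cbn [fst snd]. rewrite <- INR_IZR_INZ. f_equal; ring.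
Qed.

Lemma LP_block0_Riemann s x : 1 / 2 < s -> LP_block (Riemann_fn s) 0 x = (0, 0).
Proof. intros Hs. unfold LP_block. rewrite fourier_coef_Riemann by auto. unfold coef; simpl. f_equal. ring. Qed.

(** The least [n] with [n^2 >= 2^K]: the first [K] blocks exhaust exactly the indices below it. *)
Definition Mk (K : nat) : nat := S (Nat.sqrt (2 ^ K - 1)).

Lemma gk_total s K n : rsum (fun k => gk s k n) K = if Nat.ltb n (Mk K) then wt s n else 0.
Proof.
  unfold Mk. assert (E : Nat.ltb n (S (Nat.sqrt (2 ^ K - 1))) = Nat.ltb (n * n) (2 ^ K)).
  { pose proof (Nat.sqrt_spec (2 ^ K - 1) ltac:(lia)). assert (2 ^ K <> 0)%nat by (apply Nat.pow_nonzero; lia).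
    destruct (Nat.ltb_spec n (S (Nat.sqrt (2 ^ K - 1)))), (Nat.ltb_spec (n * n) (2 ^ K)); auto; nia. }
  rewrite E; clear E. induction K.
  - simpl. destruct n as [|n]; [reflexivity|]. destruct (Nat.ltb_spec (S n * S n) 1); auto. nia.
  - rewrite rsum_S, IHK. unfold gk. assert (2 ^ K <= 2 ^ S K)%nat by (simpl; lia).
    destruct (Nat.ltb_spec (n * n) (2 ^ K)), (Nat.leb_spec (2 ^ K) (n * n)), (Nat.ltb_spec (n * n) (2 ^ S K)); cbn [andb]; try ring; lia.
Qed.

Lemma blocks_partial s ph x K : rsum (fun k => FP (gk s k) (Bk k) ph x) K = FP (wt s) (Mk K) ph x.
Proof.
  set (M := (S (2 ^ S K))).
  assert (HM : forall k, (k <= K)%nat -> (2 ^ S k <= 2 ^ S K)%nat) by (intros; apply Nat.pow_le_mono_r; lia).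
  rewrite (rsum_ext _ (fun k => FP (gk s k) M ph x)).
  2:{ intros k Hk. symmetry. apply rsum_supp. pose proof (Bk_le k). specialize (HM k ltac:(lia)). unfold M; lia.
      intros; rewrite gk_supp by lia; ring. }
  unfold FP. rewrite rsum_swap.
  rewrite (rsum_ext _ (fun n => (if Nat.ltb n (Mk K) then wt s n else 0) * cos (2 * PI * INR (n * n) * x + ph))).
  2:{ intros n _. rewrite rsum_scalr. rewrite gk_total. auto. }
  rewrite (rsum_supp _ (Mk K) M).
  - apply rsum_ext. intros i Hi. apply Nat.ltb_lt in Hi as ->. auto.
  - unfold Mk, M. pose proof (Nat.sqrt_le_lin (2 ^ K - 1)). specialize (HM K ltac:(lia)). simpl in *. lia.
  - intros i Hi. destruct (Nat.ltb_spec i (Mk K)); [lia|ring].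
Qed.

(** A partial sum over blocks is a partial sum of the original series, cut at [Mk K], and [Mk K]
    tends to infinity. *)
Lemma blocks_series s ph x : 1 / 2 < s -> is_series (fun k => FP (gk s k) (Bk k) ph x) (ftrig s ph x).
Proof.
  intros Hs. apply (is_lim_seq_spec _ (Finite (ftrig s ph x))). intros eps.
  destruct (tail_lim s eps Hs (cond_pos eps)) as [N0 HN0].
  exists (N0 * N0)%nat. intros K HK. rewrite rsum_sum_n, blocks_partial.
  rewrite Rabs_minus_sym. eapply Rle_lt_trans; [apply ftrig_tail; auto; unfold Mk; lia|].
  apply HN0. unfold Mk. assert (N0 <= Nat.sqrt (2 ^ S K - 1))%nat; [|lia].
  apply Nat.sqrt_le_square. assert (K < 2 ^ K)%nat by (apply Nat.pow_gt_lin_r; lia). simpl; lia.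
Qed.

(** * Lower bounds for the Hölder exponent *)

Definition pw (k : nat) (c : R) : R := Rpower 2 (INR k * c).

Lemma pw_pos k c : 0 < pw k c. Proof. apply Rpower_pos. Qed.
Lemma pw_plus k a b : pw k (a + b) = pw k a * pw k b.
Proof. unfold pw. rewrite <- Rpower_plus. f_equal; ring. Qed.
Lemma pw_0 k : pw k 0 = 1.
Proof. unfold pw. rewrite Rmult_0_r. apply Rpower_O; lra. Qed.
Lemma pw_le k a b : a <= b -> pw k a <= pw k b.
Proof. intros. apply Rle_Rpower; [lra|]. pose proof (pos_INR k). nra. Qed.
Lemma pw_mult k a b : pw k (a * b) = Rpower (pw k a) b.
Proof. unfold pw. rewrite Rpower_mult. f_equal; ring. Qed.
Lemma pw_nat k : INR (2 ^ k) = pw k 1.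
Proof.
  unfold pw. rewrite Rmult_1_r, Rpower_pow by lra. rewrite pow_INR. auto.
Qed.
Lemma Rpower_2k k c : Rpower (INR (2 ^ k)) c = pw k c.
Proof. rewrite pw_nat, <- pw_mult. f_equal; ring. Qed.
Lemma pw_pow k a j : pw k a ^ j = pw k (INR j * a).
Proof. rewrite <- Rpower_pow by apply pw_pos. rewrite <- pw_mult. f_equal; ring. Qed.
Lemma pw_ge1 k c : 0 <= c -> 1 <= pw k c.
Proof. intros. rewrite <- (pw_0 k). apply pw_le; auto. Qed.

Lemma Bk_sqr k : INR (Bk k) ^ 2 <= 6 * pw k 1.
Proof.
  rewrite <- pw_nat. unfold Bk. pose proof (Nat.sqrt_spec (2 ^ S k) ltac:(lia)).
  assert (1 <= 2 ^ k)%nat by (assert (2 ^ k <> 0)%nat by (apply Nat.pow_nonzero; lia); lia).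
  replace 6 with (INR 6) by (simpl; ring). rewrite <- pow_INR, <- mult_INR. apply le_INR.
  simpl in *. nia.
Qed.

Lemma Bk_le_pw k : INR (Bk k) <= 3 * pw k (1 / 2).
Proof.
  apply Rsqr_incr_0_var; [|pose proof (pw_pos k (1/2)); lra]. rewrite !Rsqr_pow2.
  eapply Rle_trans; [apply Bk_sqr|]. rewrite Rpow_mult_distr, pw_pow.
  replace (INR 2 * (1 / 2)) with 1 by (simpl; field). pose proof (pw_pos k 1). lra.
Qed.

Lemma harm_Bk k : harm (4 * Bk k) <= 5 * INR (S k).
Proof.
  eapply Rle_trans; [apply (harm_mono _ (2 ^ (k + 4)))|].
  - pose proof (Bk_le k). rewrite Nat.pow_add_r. rewrite Nat.pow_succ_r' in H. change (2 ^ 4)%nat with 16%nat. assert (2 ^ k <> 0)%nat by (apply Nat.pow_nonzero; lia). lia.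
  - eapply Rle_trans; [apply harm_pow2|]. replace 5 with (INR 5) by (simpl; ring). rewrite <- mult_INR. apply le_INR; lia.
Qed.

Lemma unimodal_TV (g : nat -> R) c G B :
  (forall n, 0 <= g n <= G) -> (forall n, (n < c)%nat -> g n <= g (S n)) ->
  (forall n, (c <= n)%nat -> g (S n) <= g n) -> rsum (fun n => Rabs (g (S n) - g n)) B <= 2 * G.
Proof.
  intros Hg Hi Hd.
  assert (H1 : forall n, (n <= c)%nat -> rsum (fun n => Rabs (g (S n) - g n)) n <= g n).
  { induction n; intros Hn; [simpl; apply Hg|]. rewrite rsum_S. specialize (Hi n ltac:(lia)).
    rewrite Rabs_right by lra. specialize (IHn ltac:(lia)). lra. }
  assert (H2 : forall n, rsum (fun n => Rabs (g (S n) - g n)) (c + n) <= 2 * g c - g (c + n)%nat).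
  { induction n. rewrite Nat.add_0_r. specialize (H1 c (le_n _)). lra.
    rewrite Nat.add_succ_r, rsum_S. specialize (Hd (c + n)%nat ltac:(lia)). rewrite Rabs_left1 by lra. lra. }
  destruct (le_lt_dec B c).
  - specialize (H1 B l). pose proof (Hg B). lra.
  - specialize (H2 (B - c)%nat). replace (c + (B - c))%nat with B in H2 by lia. pose proof (Hg B). pose proof (Hg c). lra.
Qed.

(** Amplitudes of the [j]-th derivative of a block; the quarter turn produced by each derivative
    goes into the phase instead. *)
Definition gkj (s : R) (k j n : nat) : R := gk s k n * (2 * PI * INR (n * n)) ^ j.

Definition in_block (k n : nat) : Prop := (2 ^ k <= n * n < 2 ^ S k)%nat.
Lemma in_block_dec k n : {in_block k n} + {~ in_block k n}.
Proof. unfold in_block. destruct (le_dec (2 ^ k) (n * n)); [destruct (lt_dec (n * n) (2 ^ S k))|]; [left; lia|right; lia|right; lia]. Qed.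

Lemma gk_in s k n : in_block k n -> gk s k n = Rpower (INR (n * n)) (- s).
Proof.
  intros [H1 H2]. unfold gk. apply Nat.leb_le in H1 as E1. apply Nat.ltb_lt in H2 as E2. rewrite E1, E2. cbn [andb].
  assert (2 ^ k <> 0)%nat by (apply Nat.pow_nonzero; lia).
  destruct n as [|n]; [lia|]. assert (0 < INR (S n)) by (apply lt_0_INR; lia).
  unfold wt. rewrite mult_INR, <- Rpower_mult_distr, <- Rpower_plus by auto. f_equal; ring.
Qed.
Lemma gk_out s k n : ~ in_block k n -> gk s k n = 0.
Proof.
  intros H. unfold gk, in_block in *. destruct (Nat.leb_spec (2 ^ k) (n * n)), (Nat.ltb_spec (n * n) (2 ^ S k)); auto. lia.
Qed.

Lemma gkj_in s k j n : in_block k n -> gkj s k j n = (2 * PI) ^ j * Rpower (INR (n * n)) (INR j - s).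
Proof.
  intros H. unfold gkj. rewrite gk_in by auto. rewrite Rpow_mult_distr.
  assert (2 ^ k <> 0)%nat by (apply Nat.pow_nonzero; lia).
  assert (0 < INR (n * n)) by (apply lt_0_INR; destruct H; lia).
  unfold Rminus. rewrite Rpower_plus, Rpower_pow by auto. ring.
Qed.
Lemma gkj_out s k j n : ~ in_block k n -> gkj s k j n = 0.
Proof. intros; unfold gkj; rewrite gk_out by auto; ring. Qed.

(** On a block the amplitude is proportional to [(n^2)^(j - s)], hence monotone, and with its two
    cut-offs unimodal. The factor [2^j] inside [(4 PI)^j] allows for [n^2] up to [2^(k+1)]. *)
Lemma gkj_BV s k j : 0 <= s -> BV (gkj s k j) (Bk k) (2 * ((4 * PI) ^ j * pw k (INR j - s))).
Proof.
  intros Hs0. pose proof PI_RGT_0 as Hpi.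
  set (G := (4 * PI) ^ j * pw k (INR j - s)).
  assert (H2k : (2 ^ k <> 0)%nat) by (apply Nat.pow_nonzero; lia).
  assert (HG0 : 0 < G) by (apply Rmult_lt_0_compat; [apply pow_lt; lra|apply pw_pos]).
  assert (Hpj : 0 < (2 * PI) ^ j) by (apply pow_lt; lra).
  assert (Hg0 : forall n, 0 <= gkj s k j n).
  { intros n. unfold gkj. apply Rmult_le_pos; [apply gk_ge0|]. apply pow_le. pose proof (pos_INR (n * n)). nra. }
  assert (Hpos : forall n, in_block k n -> 0 < INR (n * n)) by (intros n [H _]; apply lt_0_INR; lia).
  assert (HGb : forall n, 0 <= gkj s k j n <= G).
  { intros n; split; auto. destruct (in_block_dec k n) as [H|H]; [|rewrite gkj_out by auto; lra].
    rewrite gkj_in by auto. unfold G. replace (4 * PI) with (2 * PI * 2) by ring. rewrite (Rpow_mult_distr (2 * PI) 2), Rmult_assoc.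
    apply Rmult_le_compat_l; [lra|]. assert (1 <= 2 ^ j) by (apply pow_R1_Rle; lra).
    pose proof (pw_pos k (INR j - s)). pose proof (Hpos n H). destruct H as [L1 L2]. apply le_INR in L1. apply lt_INR in L2.
    assert (0 < INR (2 ^ k)) by (apply lt_0_INR; lia).
    destruct (Rle_dec (INR j) s).
    - apply Rle_trans with (pw k (INR j - s)); [|nra]. rewrite <- Rpower_2k. apply Rpower_neg_anti; lra.
    - apply Rle_trans with (Rpower (INR (2 ^ S k)) (INR j - s)); [apply Rle_Rpower_l; lra|].
      replace (INR (2 ^ S k)) with (2 * INR (2 ^ k)) by (simpl Nat.pow; rewrite Nat.add_0_r, plus_INR; ring).
      rewrite <- Rpower_mult_distr, Rpower_2k by lra. apply Rmult_le_compat_r; [lra|].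
      rewrite <- Rpower_pow by lra. apply Rle_Rpower; [lra|].
      lra. }
  split; [lra|]. split; [|split].
  - intros n. rewrite Rabs_right by (apply Rle_ge; auto). specialize (HGb n). lra.
  - intros n Hn. unfold gkj. rewrite gk_supp by auto. ring.
  (* The peak is at the left end of the block if [j <= s], at the right end otherwise. *)
  - destruct (Rle_dec (INR j) s) as [Hj|Hj].
    + apply (unimodal_TV _ (Mk k)); auto.
      * intros n Hn. rewrite gkj_out; auto. intros [H _].
        unfold Mk in Hn. pose proof (Nat.sqrt_spec (2 ^ k - 1) ltac:(lia)). nia.
      * intros n Hn. destruct (in_block_dec k (S n)) as [H|H]; [|rewrite gkj_out by auto; auto].
        assert (in_block k n).
        { unfold in_block, Mk in *. pose proof (Nat.sqrt_spec (2 ^ k - 1) ltac:(lia)). nia. }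
        rewrite !gkj_in by auto. apply Rmult_le_compat_l; [lra|]. apply Rpower_neg_anti; [lra|].
        split; [apply Hpos; auto|apply le_INR; nia].
    + apply (unimodal_TV _ (Nat.sqrt (2 ^ S k - 1))); auto; intros n Hn;
        assert (1 <= 2 ^ S k)%nat by (simpl; lia); pose proof (Nat.sqrt_spec (2 ^ S k - 1) ltac:(lia)).
      * destruct (in_block_dec k n) as [H1|H1]; [|rewrite (gkj_out s k j n) by auto; auto].
        assert (in_block k (S n)) by (unfold in_block in *; nia).
        rewrite !gkj_in by auto. apply Rmult_le_compat_l; [lra|]. apply Rle_Rpower_l; [lra|].
        split; [apply Hpos; auto|apply le_INR; nia].
      * rewrite (gkj_out s k j (S n)); auto. intros [_ H1]. nia.
Qed.

Lemma FP_sq_le g B ph y : FP g B ph y ^ 2 <= A2 g B y.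
Proof.
  assert (E : FP g B ph y = cos ph * FC g B y - sin ph * FS g B y).
  { unfold FP, FC, FS. rewrite <- !rsum_scal, <- rsum_minus. apply rsum_ext; intros. rewrite cos_plus. ring. }
  rewrite E. unfold A2. pose proof (sin2_cos2 ph) as H. unfold Rsqr in H.
  pose proof (pow2_ge_0 (sin ph * FC g B y + cos ph * FS g B y)).
  replace ((cos ph * FC g B y - sin ph * FS g B y) ^ 2) with
   ((sin ph * sin ph + cos ph * cos ph) * (FC g B y ^ 2 + FS g B y ^ 2) - (sin ph * FC g B y + cos ph * FS g B y) ^ 2) by ring.
  rewrite H. lra.
Qed.

Lemma A2_FP g B y : A2 g B y = FP g B 0 y ^ 2 + FP g B (- (PI / 2)) y ^ 2.
Proof.
  unfold A2. f_equal; f_equal.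
  - unfold FC, FP. apply rsum_ext; intros. rewrite Rplus_0_r; auto.
  - unfold FS, FP. apply rsum_ext; intros. rewrite cos_plus, cos_neg, sin_neg, cos_PI2, sin_PI2. ring.
Qed.

Lemma FP_triv g B V ph y : BV g B V -> Rabs (FP g B ph y) <= INR B * V.
Proof.
  intros (HV & Hb & _). unfold FP. eapply Rle_trans; [apply rsum_abs|]. apply rsum_bound.
  intros i _. rewrite Rabs_mult. assert (Rabs (cos (2 * PI * INR (i * i) * y + ph)) <= 1) by (apply Rabs_le, COS_bound).
  pose proof (Hb i). pose proof (Rabs_pos (g i)). pose proof (Rabs_pos (cos (2 * PI * INR (i * i) * y + ph))). nra.
Qed.

(* The pointwise form of "two-microlocal regularity [gam] at [x0]" used for all blocks. *)
Definition local_bound (gam C x0 : R) : Prop :=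
  forall k g V y ph, BV g (Bk k) V ->
   Rabs (FP g (Bk k) ph y) <= C * V * INR (S k) * (pw k (1 / 2 - gam) + pw k (1 / 2) * rpow (Rabs (y - x0)) gam).

Lemma rpow_ge0 x y : 0 <= rpow x y.
Proof. unfold rpow. destruct Rle_dec; [lra|]. left; apply Rpower_pos. Qed.

Lemma local_bound_0 x0 : local_bound 0 3 x0.
Proof.
  intros k g V y ph Hg. eapply Rle_trans; [apply (FP_triv g (Bk k) V); auto|].
  assert (HV : 0 <= V) by apply Hg. pose proof (Bk_le_pw k). rewrite Rminus_0_r.
  assert (1 <= INR (S k)) by (apply (le_INR 1); lia). pose proof (pw_pos k (1/2)).
  pose proof (rpow_ge0 (Rabs (y - x0)) 0).
  apply Rle_trans with (3 * V * 1 * (pw k (1 / 2))); [nra|].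
  apply Rmult_le_compat; try nra.
Qed.

Definition dioph (tau c x0 : R) : Prop :=
  forall (a : Z) (q : nat), (1 <= q)%nat -> c * Rpower (INR q) (- tau) <= Rabs (x0 - IZR a / INR q).

(** The two bounds of [pointwise_bound] balance at [q = 2^(k / tau)]. For larger [q], [N^2 / q] is
    at most of order [2^(k (1 - 1/tau))]; for smaller [q], if [y] is still badly approximated,
    [1 / (q |b|) <= (2 / c) q^(tau - 1)] is of that order too. If [y] is well approximated by [a/q],
    the distance to [x0] must pay for it. *)
Lemma dioph_A2 tau c x0 : 2 <= tau -> 0 < c -> dioph tau c x0 ->
  exists C, 0 < C /\ forall k g V y, BV g (Bk k) V ->
   A2 g (Bk k) y <= C * V ^ 2 * INR (S k) * (pw k (1 - / tau) + pw k 1 * rpow (Rabs (y - x0)) (/ tau)).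
Proof.
  intros Ht Hc Hd. set (D := 1 + 2 / c + Rpower (2 / c) (/ tau)).
  assert (H2c : 0 < 2 / c) by (apply Rdiv_lt_0_compat; lra).
  assert (HD : 0 < D) by (unfold D; pose proof (Rpower_pos (2 / c) (/ tau)); lra).
  (* [500] is the factor 100 of the Weyl bound times the 5 of [harm_Bk]; [9] adds the 3 of
     [Bk_le_pw] and the 6 of [Bk_sqr]. [D] dominates the constants of the three cases. *)
  exists (500 * (9 * D)). split; [lra|]. intros k g V y Hg.
  assert (Hit : 0 < / tau <= / 2) by (split; [apply Rinv_0_lt_compat; lra|apply Rinv_le_contravar; lra]).
  destruct (pointwise_bound g (Bk k) (Bk k) V y Hg (le_n _) ltac:(unfold Bk; lia)) as (a & q & Hq & Hb & H1 & H2).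
  set (b := Rabs (y - IZR a / INR q)) in *.
  set (P := pw k (1 - / tau)). set (Y := pw k 1 * rpow (Rabs (y - x0)) (/ tau)).
  assert (HP : 0 < P) by apply pw_pos.
  assert (HY : 0 <= Y) by (apply Rmult_le_pos; [left; apply pw_pos|apply rpow_ge0]).
  assert (HV : 0 <= V) by apply Hg.
  set (K := 100 * V ^ 2 * harm (4 * Bk k)) in *.
  assert (HK : 0 <= K).
  { unfold K. pose proof (harm_ge0 (4 * Bk k)). pose proof (pow2_ge_0 V). nra. }
  assert (HK2 : K <= 500 * V ^ 2 * INR (S k)).
  { unfold K. pose proof (harm_Bk k). pose proof (pow2_ge_0 V). nra. }
  assert (Hqp : 1 <= INR q) by (apply (le_INR 1); lia).
  assert (HN : INR (Bk k) <= 3 * P).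
  { eapply Rle_trans; [apply Bk_le_pw|]. unfold P. assert (pw k (1/2) <= pw k (1 - / tau)) by (apply pw_le; lra). lra. }
  pose proof (Bk_sqr k) as HB2. pose proof (pw_pos k 1) as Hpk.
  assert (Hrp := Rpower_pos (2 / c) (/ tau)).
  assert (HD1 : 1 * (P + Y) <= D * (P + Y)) by (apply Rmult_le_compat_r; unfold D; lra).
  assert (HD2 : 2 / c * P <= D * (P + Y)) by (apply Rmult_le_compat; unfold D; lra).
  assert (HD3 : Rpower (2 / c) (/ tau) * Y <= D * (P + Y)) by (apply Rmult_le_compat; unfold D; lra).
  enough (A2 g (Bk k) y <= K * (9 * D * (P + Y))).
  { eapply Rle_trans; [apply H|].
    apply Rle_trans with (500 * V ^ 2 * INR (S k) * (9 * D * (P + Y))); [|right; ring].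
    apply Rmult_le_compat_r; auto. apply Rmult_le_pos; lra. }
  assert (Hpow : Rpower (INR q) (- tau) * Rpower (INR q) tau = 1).
  { rewrite <- Rpower_plus. replace (- tau + tau) with 0 by ring. apply Rpower_O; lra. }
  pose proof (Rpower_pos (INR q) (- tau)). pose proof (Rpower_pos (INR q) tau).
  destruct (Rle_dec (c / 2 * Rpower (INR q) (- tau)) b) as [Hcase|Hcase].
  - (* [y] itself is badly approximated by [a/q] *)
    destruct (Rle_dec (pw k (/ tau)) (INR q)) as [Hbig|Hsmall].
    + eapply Rle_trans; [apply H1|]. apply Rmult_le_compat_l; auto.
      assert (INR (Bk k) ^ 2 / INR q <= 6 * P).
      { apply Rle_div_l; [lra|]. apply Rle_trans with (6 * (P * pw k (/ tau))).
        - unfold P. rewrite <- pw_plus. replace (1 - / tau + / tau) with 1 by ring. auto.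
        - rewrite Rmult_assoc. apply Rmult_le_compat_l; [lra|]. apply Rmult_le_compat_l; lra. }
      lra.
    + apply Rnot_le_lt in Hsmall.
      assert (Hb0 : 0 < b).
      { eapply Rlt_le_trans; [|apply Hcase]. apply Rmult_lt_0_compat; lra. }
      assert (Hqb : 0 < INR q * b) by (apply Rmult_lt_0_compat; lra).
      assert (Hinv : 1 <= 2 / c * P * (INR q * b)).
      { assert (Hq1 : Rpower (INR q) (tau - 1) <= P).
        { apply Rle_trans with (Rpower (pw k (/ tau)) (tau - 1)); [apply Rle_Rpower_l; lra|].
          rewrite <- pw_mult. apply pw_le. right. field. lra. }
        assert (E : c / 2 * Rpower (INR q) (1 - tau) <= INR q * b).
        { replace (1 - tau) with (1 + - tau) by ring. rewrite Rpower_plus, Rpower_1 by lra. nra. }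
        assert (E2 : Rpower (INR q) (1 - tau) * Rpower (INR q) (tau - 1) = 1).
        { rewrite <- Rpower_plus. replace (1 - tau + (tau - 1)) with 0 by ring. apply Rpower_O; lra. }
        pose proof (Rpower_pos (INR q) (tau - 1)). pose proof (Rpower_pos (INR q) (1 - tau)).
        apply Rle_trans with (2 / c * P * (c / 2 * Rpower (INR q) (1 - tau))).
        - replace (2 / c * P * (c / 2 * Rpower (INR q) (1 - tau))) with (P * Rpower (INR q) (1 - tau)) by (field; lra). nra.
        - apply Rmult_le_compat_l; auto. nra. }
      apply Rmult_le_reg_r with (INR q * b); auto. eapply Rle_trans; [apply H2|].
      rewrite Rmult_assoc. apply Rmult_le_compat_l; auto.
      apply Rle_trans with ((3 * P + 2 / c * P) * (INR q * b)); [nra|].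
      apply Rmult_le_compat_r; lra.
  - (* [a/q] is so close to [y] that it is at distance at most [2|y - x0|] from [x0] *)
    apply Rnot_le_lt in Hcase. specialize (Hd a q ltac:(lia)).
    assert (Htri : Rabs (x0 - IZR a / INR q) <= Rabs (y - x0) + b).
    { unfold b. rewrite (Rabs_minus_sym y x0). eapply Rle_trans; [|apply Rabs_triang]. right; f_equal; ring. }
    assert (Hyx : c / 2 * Rpower (INR q) (- tau) <= Rabs (y - x0)) by lra.
    assert (Hyx0 : 0 < Rabs (y - x0)) by nra.
    eapply Rle_trans; [apply H1|]. apply Rmult_le_compat_l; auto.
    assert (Hq1 : / INR q <= Rpower (2 / c) (/ tau) * rpow (Rabs (y - x0)) (/ tau)).
    { unfold rpow. destruct Rle_dec; [lra|]. rewrite Rpower_mult_distr by auto.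
      apply Rle_trans with (Rpower (Rpower (INR q) (- tau)) (/ tau)).
      - rewrite Rpower_mult. replace (- tau * / tau) with (- (1)) by (field; lra).
        rewrite Rpower_Ropp, Rpower_1 by lra. lra.
      - apply Rle_Rpower_l; [lra|]. split; [auto|].
        apply Rle_trans with (2 / c * (c / 2 * Rpower (INR q) (- tau))); [right; field; lra|].
        apply Rmult_le_compat_l; lra. }
    assert (INR (Bk k) ^ 2 / INR q <= 6 * (Rpower (2 / c) (/ tau) * Y)).
    { unfold Rdiv, Y. apply Rle_trans with (6 * pw k 1 * (Rpower (2 / c) (/ tau) * rpow (Rabs (y - x0)) (/ tau))); [|right; unfold Rdiv; ring].
      apply Rmult_le_compat; auto. apply pow2_ge_0. left; apply Rinv_0_lt_compat; lra. }
    lra.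
Qed.

Lemma local_bound_dioph tau c x0 : 2 <= tau -> 0 < c -> dioph tau c x0 ->
  exists C, 0 < C /\ local_bound (/ (2 * tau)) C x0.
Proof.
  intros Ht Hc Hd. destruct (dioph_A2 tau c x0 Ht Hc Hd) as (C & HC & HA).
  exists (1 + C). split; [lra|]. intros k g V y ph Hg. specialize (HA k g V y Hg).
  set (u := pw k (1 / 2 - / (2 * tau))). set (v := pw k (1 / 2) * rpow (Rabs (y - x0)) (/ (2 * tau))).
  assert (Hu : 0 < u) by apply pw_pos.
  assert (Hv : 0 <= v) by (apply Rmult_le_pos; [left; apply pw_pos|apply rpow_ge0]).
  assert (HV : 0 <= V) by apply Hg.
  assert (E1 : pw k (1 - / tau) = u ^ 2).
  { unfold u. rewrite pw_pow. f_equal. simpl. field. lra. }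
  assert (E2 : pw k 1 * rpow (Rabs (y - x0)) (/ tau) = v ^ 2).
  { unfold v. rewrite Rpow_mult_distr, pw_pow. f_equal. f_equal; simpl; field.
    unfold rpow. destruct Rle_dec; [simpl; ring|]. simpl. rewrite Rmult_1_r, <- Rpower_plus. f_equal. field. lra. }
  rewrite E1, E2 in HA.
  assert (1 <= INR (S k)) by (apply (le_INR 1); lia). pose proof (FP_sq_le g (Bk k) ph y).
  assert (Hp : 0 <= (1 + C) * V * INR (S k) * (u + v)) by (repeat apply Rmult_le_pos; lra).
  rewrite <- (Rabs_right ((1 + C) * V * INR (S k) * (u + v))) by lra.
  apply Rsqr_le_abs_0. rewrite !Rsqr_pow2. eapply Rle_trans; [apply H0|]. eapply Rle_trans; [apply HA|].
  replace (((1 + C) * V * INR (S k) * (u + v)) ^ 2) with ((1 + C) ^ 2 * V ^ 2 * INR (S k) ^ 2 * (u + v) ^ 2) by ring.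
  pose proof (pow2_ge_0 V).
  apply Rmult_le_compat; try nra.
  apply Rmult_le_pos; [|lra]. nra.
  apply Rmult_le_compat; try nra.
Qed.

(** * From block bounds to a Taylor expansion at a point *)

Lemma is_derive_rsum (f df : nat -> R -> R) n x :
  (forall i, (i < n)%nat -> is_derive (f i) x (df i x)) ->
  is_derive (fun t => rsum (fun i => f i t) n) x (rsum (fun i => df i x) n).
Proof.
  induction n; intros H; simpl. apply (is_derive_const (K := R_AbsRing) (V := R_NormedModule)).
  apply (is_derive_plus (K := R_AbsRing) (V := R_NormedModule)); auto.
Qed.

Lemma is_derive_eqR (f : R -> R) x (l l' : R) : is_derive f x l -> l = l' -> is_derive f x l'.
Proof. intros H <-; exact H. Qed.

Lemma MVT_abs (f df : R -> R) h M : (forall t, Rabs t <= Rabs h -> is_derive f t (df t)) ->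
  (forall t, Rabs t <= Rabs h -> Rabs (df t) <= M) -> Rabs (f h - f 0) <= M * Rabs h.
Proof.
  intros Hd HM.
  assert (Hr : forall t, Rmin 0 h <= t <= Rmax 0 h -> Rabs t <= Rabs h).
  { intros t Ht. unfold Rmin, Rmax in Ht. destruct (Rle_dec 0 h).
    - rewrite (Rabs_right h), Rabs_right by lra. lra.
    - rewrite (Rabs_left h), Rabs_left1 by lra. lra. }
  destruct (MVT_gen f 0 h df) as (c & Hc & E).
  - intros t Ht. apply Hd, Hr. lra.
  - intros t Ht. apply derivable_continuous_pt. exists (df t). apply is_derive_Reals. apply Hd, Hr; lra.
  - rewrite E, Rabs_mult, Rminus_0_r. apply Rmult_le_compat_r; [apply Rabs_pos|]. apply HM, Hr; auto.
Qed.

Lemma taylor_rem K : forall (F : nat -> R -> R) x0 M h,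
  (forall j y, is_derive (F j) y (F (S j) y)) ->
  (forall t, Rabs t <= Rabs h -> Rabs (F K (x0 + t)) <= M) ->
  Rabs (F O (x0 + h) - rsum (fun j => F j x0 / INR (fact j) * h ^ j) K) <= M * Rabs h ^ K.
Proof.
  induction K; intros F x0 M h Hd HM.
  - simpl. rewrite Rminus_0_r, Rmult_1_r. apply HM; lra.
  - set (G := fun t => F O (x0 + t) - rsum (fun j => F j x0 / INR (fact j) * t ^ j) (S K)).
    set (dG := fun t => F 1%nat (x0 + t) - rsum (fun j => F (S j) x0 / INR (fact j) * t ^ j) K).
    assert (HG : forall t, is_derive G t (dG t)).
    { intros t. unfold G, dG. apply (is_derive_minus (K := R_AbsRing) (V := R_NormedModule)).
      - eapply is_derive_eqR. apply (is_derive_comp (F O) (fun t => x0 + t)). apply Hd.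
        auto_derive; auto. unfold scal; simpl; unfold mult; simpl. toR. ring.
      - eapply is_derive_eqR.
        apply (is_derive_rsum (fun j t => F j x0 / INR (fact j) * t ^ j) (fun j t => F j x0 / INR (fact j) * (INR j * t ^ pred j))).
        intros i _. auto_derive; auto. ring.
        rewrite rsum_Sl. simpl (INR 0). rewrite Rmult_0_l, Rmult_0_r, Rplus_0_l.
        apply rsum_ext. intros j _. simpl pred. rewrite fact_simpl, mult_INR. field.
        split; [apply INR_fact_neq_0|apply not_0_INR; lia]. }
    assert (HdG : forall t, Rabs t <= Rabs h -> Rabs (dG t) <= M * Rabs h ^ K).
    { intros t Ht. unfold dG. assert (0 <= M) by (eapply Rle_trans; [apply Rabs_pos|apply (HM 0)]; rewrite Rabs_R0; apply Rabs_pos).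
      eapply Rle_trans; [apply (IHK (fun j => F (S j)) x0 M t)|].
      - intros; apply Hd.
      - intros u Hu. apply HM. lra.
      - apply Rmult_le_compat_l; auto. apply pow_incr. split; [apply Rabs_pos|auto]. }
    pose proof (MVT_abs G dG h (M * Rabs h ^ K) (fun t _ => HG t) HdG).
    assert (G0 : G 0 = 0).
    { unfold G. rewrite rsum_Sl. rewrite (rsum_eq0 _ K) by (intros; simpl; ring). rewrite Rplus_0_r. simpl. field. }
    rewrite G0, Rminus_0_r in H. unfold G in H. simpl pow. lra.
Qed.

(** From [1 + u <= exp u], spending [eps / 2] on one factor and [eps / 2] on the rest. All
    logarithmic losses are absorbed here. *)
Lemma poly_pw A : forall eps, 0 < eps -> exists M, 0 < M /\ forall k, INR (S k) ^ A <= M * pw k eps.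
Proof.
  assert (H1 : forall eps, 0 < eps -> exists M, 0 < M /\ forall k, INR (S k) <= M * pw k eps).
  { intros eps He. assert (Hl : 0 < ln 2) by (rewrite <- ln_1; apply ln_increasing; lra).
    set (a := eps * ln 2). assert (Ha : 0 < a) by (apply Rmult_lt_0_compat; auto).
    exists (1 + / a). assert (0 < / a) by (apply Rinv_0_lt_compat; auto). split; [lra|]. intros k.
    replace (pw k eps) with (exp (INR k * a)) by (unfold pw, Rpower, a; f_equal; ring).
    pose proof (exp_ineq1_le (INR k * a)). rewrite S_INR. pose proof (pos_INR k).
    assert (/ a * (INR k * a) = INR k) by (field; lra).
    apply Rle_trans with ((1 + / a) * (1 + INR k * a)); [nra|]. apply Rmult_le_compat_l; lra. }
  induction A; intros eps He.
  - exists 1. split; [lra|]. intros k. simpl. rewrite Rmult_1_l. apply pw_ge1; lra.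
  - destruct (IHA (eps / 2)) as (M & HM & H); [lra|]. destruct (H1 (eps / 2)) as (M' & HM' & H'); [lra|].
    exists (M' * M). split; [nra|]. intros k. specialize (H k). specialize (H' k).
    replace eps with (eps / 2 + eps / 2) by field. rewrite pw_plus. rewrite <- tech_pow_Rmult.
    replace (M' * M * (pw k (eps / 2) * pw k (eps / 2))) with ((M' * pw k (eps / 2)) * (M * pw k (eps / 2))) by ring.
    apply Rmult_le_compat; auto. apply pos_INR. apply pow_le, pos_INR.
Qed.

Lemma ex_series_pw eps : 0 < eps -> ex_series (fun k => INR (S k) * pw k (- eps)).
Proof.
  intros He. destruct (poly_pw 1 (eps / 2)) as (M & HM & H); [lra|].
  apply (ex_series_le (K := R_AbsRing) (V := R_CompleteNormedModule)) with (fun k => M * (Rpower 2 (- (eps / 2))) ^ k).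
  - intros k. eapply Rle_trans; [right; apply Rabs_right, Rle_ge, Rmult_le_pos; [apply pos_INR|left; apply pw_pos]|].
    specialize (H k). rewrite pow_1 in H.
    replace (Rpower 2 (- (eps / 2)) ^ k) with (pw k (- (eps / 2))).
    2:{ rewrite <- Rpower_pow by apply Rpower_pos. unfold pw. rewrite Rpower_mult. f_equal; ring. }
    replace (- eps) with (- (eps / 2) + - (eps / 2)) by field. rewrite pw_plus.
    assert (pw k (eps / 2) * pw k (- (eps / 2)) = 1) by (rewrite <- pw_plus, <- (pw_0 k); f_equal; ring).
    pose proof (pw_pos k (- (eps / 2))). pose proof (pos_INR (S k)).
    rewrite <- Rmult_assoc. apply Rmult_le_compat_r; [lra|].
    apply Rle_trans with (M * pw k (eps / 2) * pw k (- (eps / 2))); [apply Rmult_le_compat_r; lra|]. rewrite Rmult_assoc, H0. lra.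
  - apply (ex_series_scal_l (K := R_AbsRing) (V := R_NormedModule)). apply ex_series_geom.
    rewrite Rabs_right by (left; apply Rpower_pos).
    rewrite <- (Rpower_O 2) by lra. apply Rpower_lt; lra.
Qed.

Lemma Rpower_small_le k H c : 0 <= c -> 0 < H -> H * pw k 1 <= 1 -> Rpower H c <= pw k (- c).
Proof.
  intros Hc HH Hs. replace (- c) with (-1 * c) by ring. rewrite pw_mult. apply Rle_Rpower_l; auto. split; auto.
  apply Rmult_le_reg_r with (pw k 1); [apply pw_pos|]. rewrite <- pw_plus. replace (-1 + 1) with 0 by ring. rewrite pw_0; auto.
Qed.

Lemma Rpower_large_le k H c : 0 <= c -> 0 < H -> 1 <= H * pw k 1 -> Rpower H (- c) <= pw k c.
Proof.
  intros Hc HH Hs. rewrite Rpower_Ropp. replace c with (1 * c) at 2 by ring. rewrite pw_mult.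
  rewrite <- (Rinv_inv (Rpower (pw k 1) c)). apply Rinv_le_contravar.
  - apply Rinv_0_lt_compat, Rpower_pos.
  - rewrite <- Rpower_Ropp. replace (- c) with (-1 * c) by ring. rewrite <- Rpower_mult. apply Rle_Rpower_l; auto.
    replace (- (1)) with (-1) by ring. split; [apply Rpower_pos|].
    replace (-1) with (- (1)) by ring. rewrite Rpower_Ropp, Rpower_1 by apply pw_pos.
    apply Rmult_le_reg_r with (pw k 1); [apply pw_pos|]. rewrite Rinv_l by (apply Rgt_not_eq, pw_pos). auto.
Qed.

Lemma is_series_zero : is_series (fun _ : nat => 0) 0.
Proof.
  change (is_lim_seq (sum_n (fun _ : nat => 0)) (Finite 0)).
  apply (is_lim_seq_ext (fun _ => 0)); [|apply is_lim_seq_const]. intros m. rewrite rsum_sum_n, rsum_0; auto.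
Qed.

(** [F k j] is the [j]-th derivative of the [k]-th block. In the application [sig = s - 1/2]:
    amplitudes of order [2^(-k s)] times about [2^(k/2)] terms. *)
Section Synth.
Variables (F : nat -> nat -> R -> R) (f : R -> R) (x0 sig gam bet C : R) (K : nat).
Hypothesis Hder : forall k j y, is_derive (F k j) y (F k (S j) y).
Hypothesis Hbd : forall k j y, (j <= K)%nat -> Rabs (y - x0) <= 1 ->
  Rabs (F k j y) <= C * INR (S k) * pw k (INR j - sig) * (pw k (- gam) + rpow (Rabs (y - x0)) gam).
Hypothesis Hf : forall y, is_series (fun k => F k 0%nat y) (f y).
Hypothesis HC : 0 < C.
Hypothesis Hgam : 0 <= gam <= bet.
Hypothesis Hbet : bet < sig + gam.
Hypothesis HK : INR K - 1 <= bet < INR K.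

Let Rm (h : R) (k : nat) : R := F k O (x0 + h) - rsum (fun j => F k j x0 / INR (fact j) * h ^ j) K.

Lemma block_at_x0 k j : (j <= K)%nat -> Rabs (F k j x0) <= C * INR (S k) * pw k (INR j - sig - gam).
Proof.
  intros Hj. eapply Rle_trans; [apply Hbd; auto; rewrite Rminus_diag, Rabs_R0; lra|].
  rewrite Rminus_diag, Rabs_R0. unfold rpow. destruct Rle_dec; [|lra].
  rewrite Rplus_0_r, Rmult_assoc, <- pw_plus. right; f_equal.
Qed.

(** If [|h| 2^k <= 1], the Taylor formula of order [K] applies, and the surplus
    [(|h| 2^k)^(K - bet)] is at most 1. Otherwise the block and its Taylor terms are bounded one by
    one, using [gam <= bet] for the block and [j <= K - 1 <= bet] for the terms. Both cases leave
    the summable factor [2^(-k (sig + gam - bet))]. *)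
Lemma remainder_bound h k : h <> 0 -> Rabs h <= 1 ->
  Rabs (Rm h k) <= C * (2 + INR K) * Rpower (Rabs h) bet * (INR (S k) * pw k (- (sig + gam - bet))).
Proof.
  intros Hh0 Hh1. set (H := Rabs h) in *. assert (HH : 0 < H) by (apply Rabs_pos_lt; auto).
  assert (HS : 0 < INR (S k)) by (apply lt_0_INR; lia).
  set (e := sig + gam - bet). set (Q := Rpower H bet * pw k (- e)).
  assert (HQ : 0 < Q) by (apply Rmult_lt_0_compat; [apply Rpower_pos|apply pw_pos]).
  assert (HKp : 0 <= INR K) by apply pos_INR.
  destruct (Rle_dec (H * pw k 1) 1) as [Hs|Hl].
  - eapply Rle_trans; [apply (taylor_rem K (F k) x0 (2 * C * INR (S k) * pw k (INR K - sig - gam)) h); auto|].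
    + intros t Ht. eapply Rle_trans; [apply Hbd; auto; replace (x0 + t - x0) with t by ring; fold H in Ht; lra|].
      replace (x0 + t - x0) with t by ring.
      assert (rpow (Rabs t) gam <= pw k (- gam)).
      { unfold rpow. destruct Rle_dec; [left; apply pw_pos|]. apply Rpower_small_le; try lra.
        apply Rle_trans with (H * pw k 1); auto. apply Rmult_le_compat_r; auto. left; apply pw_pos. }
      replace (INR K - sig - gam) with (INR K - sig + - gam) by ring. rewrite pw_plus.
      replace (2 * C * INR (S k) * (pw k (INR K - sig) * pw k (- gam))) with (C * INR (S k) * pw k (INR K - sig) * (2 * pw k (- gam))) by ring.
      apply Rmult_le_compat_l; [|lra]. apply Rmult_le_pos; [nra|left; apply pw_pos].
    + fold H. rewrite <- Rpower_pow by auto. replace (INR K) with (bet + (INR K - bet)) at 2 by ring. rewrite Rpower_plus.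
      assert (E : Rpower H (INR K - bet) <= pw k (- (INR K - bet))) by (apply Rpower_small_le; lra).
      apply Rle_trans with (2 * C * INR (S k) * (pw k (INR K - sig - gam) * (Rpower H bet * pw k (- (INR K - bet))))).
      * rewrite (Rmult_assoc (2 * C * INR (S k))). apply Rmult_le_compat_l; [nra|]. apply Rmult_le_compat_l; [left; apply pw_pos|].
        apply Rmult_le_compat_l; [left; apply Rpower_pos|auto].
      * replace (pw k (INR K - sig - gam) * (Rpower H bet * pw k (- (INR K - bet)))) with Q.
        2:{ unfold Q, e. replace (- (sig + gam - bet)) with ((INR K - sig - gam) + (- (INR K - bet))) by ring. rewrite pw_plus. ring. }
        replace (C * (2 + INR K) * Rpower H bet * (INR (S k) * pw k (- e))) with ((2 + INR K) * C * INR (S k) * Q) by (unfold Q; ring).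
        apply Rmult_le_compat_r; [lra|]. apply Rmult_le_compat_r; [lra|]. nra.
  - apply Rnot_le_lt in Hl.
    assert (T0 : Rabs (F k O (x0 + h)) <= 2 * (C * INR (S k) * Q)).
    { eapply Rle_trans; [apply Hbd; [lia|replace (x0 + h - x0) with h by ring; auto]|].
      replace (x0 + h - x0) with h by ring. fold H. simpl (INR 0). rewrite Rminus_0_l.
      unfold rpow. destruct Rle_dec; [lra|].
      assert (E1 : pw k (- sig) * pw k (- gam) <= Q).
      { unfold Q, e. replace (- (sig + gam - bet)) with (- sig + (- gam + bet)) by ring. rewrite !pw_plus.
        assert (Rpower H (- bet) <= pw k bet) by (apply Rpower_large_le; lra).
        assert (Rpower H bet * Rpower H (- bet) = 1) by (rewrite <- Rpower_plus; replace (bet + - bet) with 0 by ring; apply Rpower_O; auto).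
        pose proof (Rpower_pos H bet). assert (1 <= Rpower H bet * pw k bet) by (rewrite <- H1; apply Rmult_le_compat_l; lra).
        pose proof (pw_pos k (- sig)). pose proof (pw_pos k (- gam)).
        replace (Rpower H bet * (pw k (- sig) * (pw k (- gam) * pw k bet))) with (pw k (- sig) * pw k (- gam) * (Rpower H bet * pw k bet)) by ring.
        rewrite <- (Rmult_1_r (pw k (- sig) * pw k (- gam))) at 1. apply Rmult_le_compat_l; auto. nra. }
      assert (E2 : pw k (- sig) * Rpower H gam <= Q).
      { unfold Q, e. replace gam with (bet + - (bet - gam)) at 1 by ring. rewrite Rpower_plus.
        assert (Rpower H (- (bet - gam)) <= pw k (bet - gam)) by (apply Rpower_large_le; lra).
        replace (- (sig + gam - bet)) with (- sig + (bet - gam)) by ring. rewrite (pw_plus k (- sig)).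
        pose proof (Rpower_pos H bet). pose proof (pw_pos k (- sig)).
        replace (pw k (- sig) * (Rpower H bet * Rpower H (- (bet - gam)))) with (Rpower H bet * pw k (- sig) * Rpower H (- (bet - gam))) by ring.
        rewrite <- Rmult_assoc. apply Rmult_le_compat_l; auto. nra. }
      rewrite Rmult_assoc. rewrite Rmult_plus_distr_l.
      replace (2 * (C * INR (S k) * Q)) with (C * INR (S k) * (Q + Q)) by ring.
      apply Rmult_le_compat_l; [nra|lra]. }
    assert (Tj : forall j, (j < K)%nat -> Rabs (F k j x0 / INR (fact j) * h ^ j) <= C * INR (S k) * Q).
    { intros j Hj. unfold Rdiv. rewrite !Rabs_mult, <- RPow_abs. fold H.
      assert (Hfa : 0 < Rabs (/ INR (fact j)) <= 1).
      { assert (1 <= INR (fact j)) by (apply (le_INR 1), lt_O_fact). rewrite Rabs_right by (left; apply Rinv_0_lt_compat; lra).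
        split; [apply Rinv_0_lt_compat; lra|]. rewrite <- Rinv_1. apply Rinv_le_contravar; lra. }
      assert (HjK : INR j <= bet) by (assert (INR (S j) <= INR K) by (apply le_INR; lia); rewrite S_INR in *; lra).
      assert (E : H ^ j <= Rpower H bet * pw k (bet - INR j)).
      { rewrite <- Rpower_pow by auto. replace (INR j) with (bet + - (bet - INR j)) at 1 by ring. rewrite Rpower_plus.
        apply Rmult_le_compat_l; [left; apply Rpower_pos|]. apply Rpower_large_le; lra. }
      pose proof (block_at_x0 k j ltac:(lia)) as Hb.
      assert (0 <= H ^ j) by (apply pow_le; lra). pose proof (Rabs_pos (F k j x0)).
      assert (Hp : 0 <= Rabs (F k j x0) * H ^ j) by (apply Rmult_le_pos; auto).
      apply Rle_trans with (Rabs (F k j x0) * H ^ j); [nra|].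
      apply Rle_trans with (C * INR (S k) * pw k (INR j - sig - gam) * (Rpower H bet * pw k (bet - INR j))).
      - apply Rmult_le_compat; auto.
      - right. unfold Q, e. replace (- (sig + gam - bet)) with ((INR j - sig - gam) + (bet - INR j)) by ring. rewrite pw_plus. ring. }
    unfold Rm. unfold Rminus. eapply Rle_trans; [apply Rabs_triang|]. rewrite Rabs_Ropp.
    assert (Rabs (rsum (fun j => F k j x0 / INR (fact j) * h ^ j) K) <= INR K * (C * INR (S k) * Q)).
    { eapply Rle_trans; [apply rsum_abs|]. apply rsum_bound; auto. }
    replace (C * (2 + INR K) * Rpower H bet * (INR (S k) * pw k (- e))) with (2 * (C * INR (S k) * Q) + INR K * (C * INR (S k) * Q)) by (unfold Q; ring).
    lra.
Qed.

Lemma is_series_rsum (u : nat -> nat -> R) (l : nat -> R) n :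
  (forall j, (j < n)%nat -> is_series (u j) (l j)) -> is_series (fun k => rsum (fun j => u j k) n) (rsum l n).
Proof.
  induction n; intros H; simpl.
  - apply is_series_zero.
  - apply (is_series_plus (V := R_NormedModule)); auto.
Qed.

Lemma holder_synth : exists (a : nat -> R) (C' : R), 0 < C' /\ forall h, Rabs h <= 1 ->
   Rabs (f (x0 + h) - rsum (fun j => a j * h ^ j) K) <= C' * hpow h bet.
Proof.
  set (e := sig + gam - bet). assert (He : 0 < e) by (unfold e; lra).
  pose proof (ex_series_pw e He) as Hex. set (S0 := Series (fun k => INR (S k) * pw k (- e))).
  assert (Hterm : forall k, 0 <= INR (S k) * pw k (- e)) by (intros; apply Rmult_le_pos; [apply pos_INR|left; apply pw_pos]).
  assert (HS0 : 0 <= S0).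
  { eapply Rle_trans; [|apply (rsum_le_Series _ 0 Hterm Hex)]. simpl; lra. }
  (* The polynomial is the sum over the blocks of their Taylor polynomials; the series converge
     because [j <= bet < sig + gam]. *)
  set (a := fun j => Series (fun k => F k j x0) / INR (fact j)).
  assert (Ha : forall j, (j < K)%nat -> is_series (fun k => F k j x0) (Series (fun k => F k j x0))).
  { intros j Hj. apply Series_correct.
    apply (ex_series_le (K := R_AbsRing) (V := R_CompleteNormedModule)) with (fun k => C * (INR (S k) * pw k (- e))).
    - intros k. eapply Rle_trans; [apply block_at_x0; lia|]. rewrite Rmult_assoc. apply Rmult_le_compat_l; [lra|].
      apply Rmult_le_compat_l; [apply pos_INR|]. apply pw_le. unfold e.
      assert (INR (S j) <= INR K) by (apply le_INR; lia). rewrite S_INR in *. lra.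
    - apply (ex_series_scal_l (K := R_AbsRing) (V := R_NormedModule)); auto. }
  assert (HK0 : 0 < INR K) by lra. assert (HK1 : (0 < K)%nat) by (apply INR_lt; simpl; auto).
  set (C' := C * (2 + INR K) * S0 + 1).
  assert (HC' : 0 < C') by (unfold C'; assert (0 <= C * (2 + INR K) * S0) by (repeat apply Rmult_le_pos; lra); lra).
  exists a, C'. split; auto. intros h Hh.
  assert (Hser : is_series (Rm h) (f (x0 + h) - rsum (fun j => a j * h ^ j) K)).
  { unfold Rm. apply (is_series_minus (V := R_NormedModule)); [apply Hf|].
    apply (is_series_rsum (fun j k => F k j x0 / INR (fact j) * h ^ j) (fun j => a j * h ^ j)).
    intros j Hj. unfold a.
    apply (is_series_ext (fun k => scal (/ INR (fact j) * h ^ j) (F k j x0))).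
    - intros k. unfold scal; simpl; unfold mult; simpl. unfold Rdiv. toR. ring.
    - replace (Series (fun k => F k j x0) / INR (fact j) * h ^ j) with (scal (/ INR (fact j) * h ^ j) (Series (fun k => F k j x0))).
      apply (is_series_scal_l (K := R_AbsRing) (V := R_NormedModule)). apply Ha; auto.
      unfold scal; simpl; unfold mult; simpl. unfold Rdiv. toR. ring. }
  destruct (Req_dec h 0) as [->|Hh0].
  - assert (E : f (x0 + 0) - rsum (fun j => a j * 0 ^ j) K = 0).
    { rewrite <- (is_series_unique _ _ Hser). rewrite (Series_ext _ (fun _ => 0)).
      apply is_series_unique, is_series_zero.
      intros k. unfold Rm. destruct K as [|K']; [lia|]. rewrite rsum_Sl, rsum_eq0 by (intros; simpl; ring).
      rewrite Rplus_0_r. simpl. field. }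
    rewrite E, Rabs_R0. apply Rmult_le_pos; [lra|]. unfold hpow. destruct Req_EM_T; [|lra]. destruct Rlt_dec; lra.
  - unfold hpow. destruct Req_EM_T; [contradiction|].
    rewrite <- (is_series_unique _ _ Hser).
    assert (Hb : ex_series (fun k => C * (2 + INR K) * Rpower (Rabs h) bet * (INR (S k) * pw k (- e)))) by (apply (ex_series_scal_l (K := R_AbsRing) (V := R_NormedModule)); auto).
    eapply Rle_trans; [apply Series_Rabs|].
    + apply (ex_series_le (K := R_AbsRing) (V := R_CompleteNormedModule)) with (2 := Hb). intros k.
      eapply Rle_trans; [right; apply Rabs_Rabsolu|]. apply remainder_bound; auto.
    + eapply Rle_trans; [apply Series_le with (2 := Hb)|].
      * intros k; split; [apply Rabs_pos|]. apply remainder_bound; auto.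
      * rewrite Series_scal_l. fold S0. unfold C'. pose proof (Rpower_pos (Rabs h) bet). nra.
Qed.
End Synth.

Lemma Cmod_le_add z : Cmod z <= Rabs (fst z) + Rabs (snd z).
Proof.
  unfold Cmod. pose proof (Rabs_pos (fst z)). pose proof (Rabs_pos (snd z)).
  apply Rsqr_incr_0_var; [|lra]. rewrite Rsqr_sqrt by (pose proof (pow2_ge_0 (fst z)); pose proof (pow2_ge_0 (snd z)); lra).
  unfold Rsqr. rewrite <- (pow2_abs (fst z)), <- (pow2_abs (snd z)). nra.
Qed.

Lemma Holder_at_Riemann s gam C x0 bet : 1 / 2 < s -> 0 < C -> local_bound gam C x0 ->
  0 <= gam <= bet -> bet < s - 1 / 2 + gam -> Holder_at bet (Riemann_fn s) x0.
Proof.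
  intros Hs HC Hl Hg Hb.
  destruct (nfloor_ex bet) as [K0 HK0]; [lra|]. set (K := S K0).
  assert (HK : INR K - 1 <= bet < INR K) by (unfold K; rewrite S_INR; lra).
  pose proof PI_RGT_0 as Hpi. assert (3 < PI) by (pose proof PI2_3_2; lra).
  set (CC := C * 2 * (4 * PI) ^ K). assert (HCC : 0 < CC) by (unfold CC; apply Rmult_lt_0_compat; [lra|apply pow_lt; lra]).
  assert (Hsyn : forall ph, exists (a : nat -> R) (C' : R), 0 < C' /\ forall h, Rabs h <= 1 ->
     Rabs (ftrig s ph (x0 + h) - rsum (fun j => a j * h ^ j) K) <= C' * hpow h bet).
  { intros ph.
    (* Each derivative adds [PI / 2] to the phase, so all derivatives have the form [FP] and the
       same local bound applies to them. *)
    apply (holder_synth (fun k j y => FP (gkj s k j) (Bk k) (ph + INR j * (PI / 2)) y) (ftrig s ph) x0 (s - 1 / 2) gam bet CC K); auto.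
    - intros k j y. unfold FP. eapply is_derive_eqR.
      apply (is_derive_rsum (fun n y => gkj s k j n * cos (2 * PI * INR (n * n) * y + (ph + INR j * (PI / 2))))
         (fun n y => gkj s k j n * (- (2 * PI * INR (n * n)) * sin (2 * PI * INR (n * n) * y + (ph + INR j * (PI / 2)))))).
      + intros i _. auto_derive; auto. ring.
      + apply rsum_ext. intros n _. rewrite S_INR.
        replace (2 * PI * INR (n * n) * y + (ph + (INR j + 1) * (PI / 2))) with (PI / 2 + (2 * PI * INR (n * n) * y + (ph + INR j * (PI / 2)))) by ring.
        rewrite <- (Ropp_involutive (cos (PI / 2 + _))). rewrite <- sin_cos. unfold gkj. simpl pow. ring.
    - intros k j y Hj Hy. eapply Rle_trans; [apply (Hl k (gkj s k j) _ y _ (gkj_BV s k j ltac:(lra)))|].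
      assert (E1 : (4 * PI) ^ j <= (4 * PI) ^ K) by (apply Rle_pow; [lra|auto]).
      replace (1 / 2 - gam) with (1 / 2 + - gam) by ring. rewrite (pw_plus k (1 / 2)).
      replace (INR j - (s - 1 / 2)) with (INR j - s + 1 / 2) by ring. rewrite (pw_plus k (INR j - s)).
      pose proof (pw_pos k (INR j - s)). pose proof (pw_pos k (1 / 2)). pose proof (pw_pos k (- gam)). pose proof (rpow_ge0 (Rabs (y - x0)) gam).
      assert (0 < INR (S k)) by (apply lt_0_INR; lia).
      set (T := C * 2 * INR (S k) * (pw k (INR j - s) * pw k (1 / 2)) * (pw k (- gam) + rpow (Rabs (y - x0)) gam)).
      assert (0 <= T) by (unfold T; repeat apply Rmult_le_pos; nra).
      apply Rle_trans with ((4 * PI) ^ j * T); [right; unfold T; ring|].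
      apply Rle_trans with ((4 * PI) ^ K * T); [apply Rmult_le_compat_r; auto|]. right; unfold T, CC; ring.
    - intros y. apply (is_series_ext (fun k => FP (gk s k) (Bk k) ph y)); [|apply blocks_series; auto].
      intros k. unfold FP. apply rsum_ext. intros n _. unfold gkj. simpl (INR 0). rewrite Rmult_0_l, Rplus_0_r. simpl pow. toR. ring. }
  destruct (Hsyn 0) as (a & Ca & HCa & Ha). destruct (Hsyn (- (PI / 2))) as (b & Cb & HCb & Hb').
  exists K, (fun j => (a j, b j)), (Ca + Cb), 1. split; [lra|]. split; [lra|]. split; [lra|].
  intros h Hh.
  assert (E : polyC (fun j => (a j, b j)) K h = (rsum (fun j => a j * h ^ j) K, rsum (fun j => b j * h ^ j) K)).
  { unfold K, polyC, sum_n. change K0 with (0 + K0)%nat at 1.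
    apply (csum_pair _ (fun j => a j * h ^ j) (fun j => b j * h ^ j)). intros i _. rewrite Nat.add_0_l.
    unfold Cmult, RtoC; cbn [fst snd]. f_equal; ring. }
  rewrite E. eapply Rle_trans; [apply Cmod_le_add|].
  unfold Cminus, Cplus, Copp; cbn [fst snd]. rewrite Riemann_fn_fst, Riemann_fn_snd.
  specialize (Ha h ltac:(lra)). specialize (Hb' h ltac:(lra)). unfold Rminus in Ha, Hb'. lra.
Qed.

Lemma Rbar_lub_spec E : Rbar_is_lub E (Rbar_lub E).
Proof. exact (proj2_sig (Rbar_ex_lub E)). Qed.

Lemma Rbar_glb_spec E : Rbar_is_glb E (Rbar_glb E).
Proof. exact (proj2_sig (Rbar_ex_glb E)). Qed.

(** An exponent is a supremum, so only values just below [hi] count. This makes room for the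
    condition [gam <= bet] of the synthesis. *)
Lemma holder_exponent_ge f x0 lo hi : lo < hi ->
  (forall bet, lo < bet < hi -> Holder_at bet f x0) -> Rbar_le hi (holder_exponent f x0).
Proof.
  intros Hlh H. unfold holder_exponent. set (E := fun z : Rbar => _).
  pose proof (proj1 (Rbar_lub_spec E)) as Hub.
  assert (Hb : forall b, lo < b < hi -> Rbar_le b (Rbar_lub E)).
  { intros b Hb. apply Hub. exists b; split; auto. }
  destruct (Rbar_lub E) as [l| |]; simpl in *; auto.
  - destruct (Rle_dec hi l); auto. exfalso. specialize (Hb ((Rmax lo l + hi) / 2)).
    assert (Rmax lo l < hi) by (apply Rmax_lub_lt; lra). pose proof (Rmax_l lo l). pose proof (Rmax_r lo l).
    specialize (Hb ltac:(lra)). lra.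
  - apply (Hb ((lo + hi) / 2)). lra.
Qed.

Lemma exponent_ge_local s gam C x0 : 1 / 2 < s -> 0 < C -> 0 <= gam -> local_bound gam C x0 ->
  Rbar_le (s - 1 / 2 + gam) (holder_exponent (Riemann_fn s) x0).
Proof.
  intros Hs HC Hg Hl. apply holder_exponent_ge with gam; [lra|].
  intros b Hb. apply (Holder_at_Riemann s gam C); auto; lra.
Qed.

Lemma exponent_ge_global s x0 : 1 / 2 < s -> Rbar_le (s - 1 / 2) (holder_exponent (Riemann_fn s) x0).
Proof.
  intros Hs. rewrite <- (Rplus_0_r (s - 1 / 2)). apply (exponent_ge_local s 0 3); auto; try lra. apply local_bound_0.
Qed.

Lemma exponent_ge_dioph s tau c x0 : 1 / 2 < s -> 2 <= tau -> 0 < c -> dioph tau c x0 ->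
  Rbar_le (s - 1 / 2 + / (2 * tau)) (holder_exponent (Riemann_fn s) x0).
Proof.
  intros Hs Ht Hc Hd. destruct (local_bound_dioph tau c x0 Ht Hc Hd) as (C & HC & Hl).
  apply (exponent_ge_local s _ C); auto. left; apply Rinv_0_lt_compat; lra.
Qed.

(** * Upper bounds for the Hölder exponent *)

(* Coefficients of [(1 + z + ... + z^(L-1))^i]. *)
Fixpoint kernel_coef (L i m : nat) : R :=
  match i with
  | O => if Nat.eqb m 0 then 1 else 0
  | S i' => rsum (fun j => if Nat.leb j m then kernel_coef L i' (m - j) else 0) L
  end.

Lemma kernel_coef_S L i m : kernel_coef L (S i) m = rsum (fun j => if Nat.leb j m then kernel_coef L i (m - j) else 0) L.
Proof. reflexivity. Qed.

Lemma kernel_coef_ge0 L i m : 0 <= kernel_coef L i m.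
Proof.
  revert m; induction i; intros m. simpl; destruct Nat.eqb; lra.
  rewrite kernel_coef_S. apply rsum_ge0. intros j _. destruct Nat.leb; auto. lra.
Qed.

Lemma kernel_coef_supp L i m : (i * L < m)%nat -> kernel_coef L i m = 0.
Proof.
  revert m; induction i; intros m H. simpl; destruct (Nat.eqb_spec m 0); auto; lia.
  rewrite kernel_coef_S. apply rsum_eq0. intros j Hj. destruct (Nat.leb_spec j m); auto. apply IHi. simpl in H. nia.
Qed.

Lemma kernel_coef_1 L m : kernel_coef L 1 m = if Nat.ltb m L then 1 else 0.
Proof.
  rewrite kernel_coef_S. rewrite (rsum_ext _ (fun j => if Nat.eqb j m then 1 else 0)).
  - destruct (Nat.ltb_spec m L). apply rsum_delta; auto.
    apply rsum_eq0. intros j Hj. destruct (Nat.eqb_spec j m); auto; lia.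
  - intros j _. destruct (Nat.leb_spec j m), (Nat.eqb_spec j m); simpl; auto; try lia.
    + replace (m - j)%nat with 0%nat by lia. auto.
    + destruct (Nat.eqb_spec (m - j) 0); auto; lia.
Qed.

Lemma kernel_coef_le L i m : kernel_coef L (S i) m <= INR L ^ i.
Proof.
  revert m; induction i; intros m. rewrite kernel_coef_1. simpl. destruct Nat.ltb; lra.
  rewrite kernel_coef_S. rewrite <- tech_pow_Rmult. apply rsum_bound. intros j _. destruct Nat.leb; auto.
  apply pow_le, pos_INR.
Qed.

(** Convolution with the indicator of [L] consecutive integers: shifting the window by one adds one
    value of the preceding power and drops another, both between 0 and [L^i]. *)
Lemma kernel_coef_lip L i m : (1 <= L)%nat -> Rabs (kernel_coef L (S (S i)) (S m) - kernel_coef L (S (S i)) m) <= INR L ^ i.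
Proof.
  intros HL. rewrite !(kernel_coef_S L (S i)). destruct L as [|L]; [lia|].
  rewrite rsum_Sl, rsum_S. cbn [Nat.leb]. rewrite Nat.sub_0_r.
  rewrite (rsum_ext (fun i0 => if Nat.leb i0 m then kernel_coef (S L) (S i) (S m - S i0) else 0)
    (fun j => if Nat.leb j m then kernel_coef (S L) (S i) (m - j) else 0)) by (intros; simpl; auto).
  match goal with |- Rabs (?a + ?b - (?b + ?c)) <= _ => replace (a + b - (b + c)) with (a - c) by ring end.
  pose proof (kernel_coef_le (S L) i (S m)). pose proof (kernel_coef_ge0 (S L) (S i) (S m)).
  pose proof (pow_le (INR (S L)) i (pos_INR _)).
  destruct Nat.leb.
  - pose proof (kernel_coef_le (S L) i (m - L)). pose proof (kernel_coef_ge0 (S L) (S i) (m - L)). apply Rabs_le; lra.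
  - apply Rabs_le; lra.
Qed.

Lemma kernel_coef_at0 L i : (1 <= L)%nat -> kernel_coef L (S (S i)) 0 <= INR L ^ i.
Proof.
  intros HL. rewrite kernel_coef_S. destruct L as [|L]; [lia|]. rewrite rsum_Sl, rsum_eq0.
  - simpl Nat.leb. cbv iota. rewrite Nat.sub_0_r, Rplus_0_r. apply kernel_coef_le.
  - intros j _. destruct (Nat.leb_spec (S j) 0); auto; lia.
Qed.

(** Only the shifts [j < l] are kept in each of the [i] convolutions; the index then stays
    nonnegative and ends below [L], where the first power equals 1. *)
Lemma kernel_coef_lower L l i m : (l <= L)%nat -> (i * l <= m < L)%nat -> INR l ^ i <= kernel_coef L (S i) m.
Proof.
  intros Hl. revert m; induction i; intros m Hm. rewrite kernel_coef_1. destruct (Nat.ltb_spec m L); simpl; [lra|lia].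
  rewrite kernel_coef_S, <- tech_pow_Rmult.
  apply Rle_trans with (rsum (fun j => if Nat.leb j m then kernel_coef L (S i) (m - j) else 0) l).
  - rewrite <- rsum_const. apply rsum_le. intros j Hj. destruct (Nat.leb_spec j m); [|nia]. apply IHi. nia.
  - apply rsum_mono; auto. intros j _. destruct Nat.leb; [apply kernel_coef_ge0|lra].
Qed.

(** * Powers of the Dirichlet kernel *)

Definition dirichlet_cos (L : nat) (t : R) : R := rsum (fun j => cos (2 * PI * INR j * t)) L.
Definition dirichlet_sin (L : nat) (t : R) : R := rsum (fun j => sin (2 * PI * INR j * t)) L.
Definition dirichlet_sq (L : nat) (t : R) : R := dirichlet_cos L t ^ 2 + dirichlet_sin L t ^ 2.
Definition kernel_cos (L i : nat) (t : R) : R := rsum (fun m => kernel_coef L i m * cos (2 * PI * INR m * t)) (S (i * L)).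
Definition kernel_sin (L i : nat) (t : R) : R := rsum (fun m => kernel_coef L i m * sin (2 * PI * INR m * t)) (S (i * L)).

Lemma kernel_coef_conv L i (h : nat -> R) :
  rsum (fun m => kernel_coef L (S i) m * h m) (S (S i * L)) =
  rsum (fun j => rsum (fun m => kernel_coef L i m * h (m + j)%nat) (S (i * L))) L.
Proof.
  rewrite (rsum_ext _ (fun m => rsum (fun j => if Nat.leb j m then kernel_coef L i (m - j) * h m else 0) L)).
  - rewrite rsum_swap. apply rsum_ext. intros j Hj.
    replace (S (S i * L)) with (j + (S (S i * L) - j))%nat by nia. rewrite rsum_split.
    rewrite rsum_eq0, Rplus_0_l.
    + rewrite (rsum_supp _ (S (i * L))).
      * apply rsum_ext. intros m _. destruct (Nat.leb_spec j (j + m)); [|lia].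
        replace (j + m - j)%nat with m by lia. rewrite (Nat.add_comm j). auto.
      * nia.
      * intros m Hm. destruct Nat.leb; auto. rewrite kernel_coef_supp by lia. ring.
    + intros m Hm. destruct (Nat.leb_spec j m); auto; lia.
  - intros m _. rewrite kernel_coef_S, <- rsum_scalr. apply rsum_ext. intros j _. destruct Nat.leb; ring.
Qed.

(** [kernel_cos] and [kernel_sin] are the real and imaginary parts of the [i]-th power of
    [1 + z + ... + z^(L-1)] at [z = exp (2 i PI t)], by induction through the convolution rule. *)
Lemma U_modulus L i t : kernel_cos L i t ^ 2 + kernel_sin L i t ^ 2 = dirichlet_sq L t ^ i.
Proof.
  induction i.
  - unfold kernel_cos, kernel_sin. simpl. rewrite Rmult_0_r, Rmult_0_l, cos_0, sin_0. ring.
  - change (dirichlet_sq L t ^ S i) with (dirichlet_sq L t * dirichlet_sq L t ^ i). rewrite <- IHi. unfold dirichlet_sq.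
    assert (E1 : kernel_cos L (S i) t = kernel_cos L i t * dirichlet_cos L t - kernel_sin L i t * dirichlet_sin L t).
    { unfold kernel_cos at 1. rewrite (kernel_coef_conv L i (fun m => cos (2 * PI * INR m * t))).
      unfold dirichlet_cos, dirichlet_sin. rewrite <- !rsum_scal, <- rsum_minus. apply rsum_ext. intros j _.
      unfold kernel_cos, kernel_sin. rewrite <- !rsum_scalr, <- rsum_minus. apply rsum_ext. intros m _.
      rewrite plus_INR. replace (2 * PI * (INR m + INR j) * t) with (2 * PI * INR m * t + 2 * PI * INR j * t) by ring.
      rewrite cos_plus. ring. }
    assert (E2 : kernel_sin L (S i) t = kernel_sin L i t * dirichlet_cos L t + kernel_cos L i t * dirichlet_sin L t).
    { unfold kernel_sin at 1. rewrite (kernel_coef_conv L i (fun m => sin (2 * PI * INR m * t))).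
      unfold dirichlet_cos, dirichlet_sin. rewrite <- !rsum_scal, <- rsum_plus. apply rsum_ext. intros j _.
      unfold kernel_cos, kernel_sin. rewrite <- !rsum_scalr, <- rsum_plus. apply rsum_ext. intros m _.
      rewrite plus_INR. replace (2 * PI * (INR m + INR j) * t) with (2 * PI * INR m * t + 2 * PI * INR j * t) by ring.
      rewrite sin_plus. ring. }
    rewrite E1, E2. ring.
Qed.

(** Real part of [z^L (1 + ... + z^(L-1))^r]; the factor [z^L] pushes the spectrum away from
    frequency 0. *)
Definition Ker (L r : nat) (t : R) : R := rsum (fun m => kernel_coef L r m * cos (2 * PI * INR (L + m) * t)) (S (r * L)).

Lemma dirichlet_sq_ge0 L t : 0 <= dirichlet_sq L t.
Proof. unfold dirichlet_sq. pose proof (pow2_ge_0 (dirichlet_cos L t)). pose proof (pow2_ge_0 (dirichlet_sin L t)). lra. Qed.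

(** An even power makes the modulus an integral power of [dirichlet_sq], so no square root
    appears. *)
Lemma Ker_le L p t : Rabs (Ker L (2 * p) t) <= dirichlet_sq L t ^ p.
Proof.
  set (r := (2 * p)%nat).
  assert (E : Ker L r t = cos (2 * PI * INR L * t) * kernel_cos L r t - sin (2 * PI * INR L * t) * kernel_sin L r t).
  { unfold Ker, kernel_cos, kernel_sin. rewrite <- !rsum_scal, <- rsum_minus. apply rsum_ext. intros m _.
    rewrite plus_INR. replace (2 * PI * (INR L + INR m) * t) with (2 * PI * INR L * t + 2 * PI * INR m * t) by ring.
    rewrite cos_plus. ring. }
  assert (HD : 0 <= dirichlet_sq L t ^ p) by (apply pow_le, dirichlet_sq_ge0).
  rewrite <- (Rabs_right (dirichlet_sq L t ^ p)) by lra. apply Rsqr_le_abs_0. rewrite !Rsqr_pow2, <- pow_mult, Nat.mul_comm.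
  fold r. rewrite <- (U_modulus L r t), E.
  set (c := cos (2 * PI * INR L * t)). set (d := sin (2 * PI * INR L * t)).
  assert (H : d * d + c * c = 1) by apply sin2_cos2.
  pose proof (pow2_ge_0 (d * kernel_cos L r t + c * kernel_sin L r t)).
  replace ((c * kernel_cos L r t - d * kernel_sin L r t) ^ 2) with
   ((d * d + c * c) * (kernel_cos L r t ^ 2 + kernel_sin L r t ^ 2) - (d * kernel_cos L r t + c * kernel_sin L r t) ^ 2) by ring.
  rewrite H. lra.
Qed.

Lemma dirichlet_sq_le_sq L t : dirichlet_sq L t <= INR L ^ 2.
Proof.
  unfold dirichlet_sq, dirichlet_cos, dirichlet_sin. rewrite <- !Rsqr_pow2; unfold Rsqr. rewrite !rsum_mul, <- rsum_plus.
  apply Rle_trans with (rsum (fun _ => INR L * 1) L); [|rewrite rsum_const; right; ring].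
  apply rsum_le. intros i _. rewrite <- rsum_plus. apply rsum_bound. intros j _. rewrite <- cos_minus. apply COS_bound.
Qed.

(** Geometric sum: multiplied by [2 sin (PI t)], the kernel becomes a difference of two points of
    the unit circle, of squared modulus at most 4. *)
Lemma dirichlet_sq_sin L t : dirichlet_sq L t * sin (PI * t) ^ 2 <= 1.
Proof.
  set (s := fun n => sin ((INR n - / 2) * (2 * PI * t))). set (c := fun n => cos ((INR n - / 2) * (2 * PI * t))).
  assert (E1 : forall L, 2 * sin (PI * t) * dirichlet_cos L t = s L - s O).
  { clear L; induction L; [unfold dirichlet_cos; simpl; ring|]. unfold dirichlet_cos in *. rewrite rsum_S, Rmult_plus_distr_l, IHL.
    unfold s. rewrite S_INR.
    replace ((INR L + 1 - / 2) * (2 * PI * t)) with (2 * PI * INR L * t + PI * t) by field.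
    replace ((INR L - / 2) * (2 * PI * t)) with (2 * PI * INR L * t - PI * t) by field.
    rewrite (sin_plus (2 * PI * INR L * t)), (sin_minus (2 * PI * INR L * t)). ring. }
  assert (E2 : forall L, 2 * sin (PI * t) * dirichlet_sin L t = c O - c L).
  { clear L; induction L; [unfold dirichlet_sin; simpl; ring|]. unfold dirichlet_sin in *. rewrite rsum_S, Rmult_plus_distr_l, IHL.
    unfold c. rewrite S_INR.
    replace ((INR L + 1 - / 2) * (2 * PI * t)) with (2 * PI * INR L * t + PI * t) by field.
    replace ((INR L - / 2) * (2 * PI * t)) with (2 * PI * INR L * t - PI * t) by field.
    rewrite (cos_plus (2 * PI * INR L * t)), (cos_minus (2 * PI * INR L * t)). ring. }
  assert (E : dirichlet_sq L t * sin (PI * t) ^ 2 * 4 = (s L - s O) ^ 2 + (c O - c L) ^ 2).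
  { unfold dirichlet_sq. rewrite <- E1, <- E2. ring. }
  assert (H1 : forall n, s n ^ 2 + c n ^ 2 = 1) by (intros n; rewrite <- !Rsqr_pow2; apply sin2_cos2).
  pose proof (H1 L). pose proof (H1 O). pose proof (pow2_ge_0 (s L + s O)). pose proof (pow2_ge_0 (c L + c O)). nra.
Qed.

Lemma continuous_auto_rsum (g : nat -> R) (w : nat -> R) B t :
  continuous (fun t => rsum (fun n => g n * cos (w n * t)) B) t.
Proof.
  apply continuous_rsum. intros i _.
  apply (ex_derive_continuous (K := R_AbsRing) (V := R_NormedModule)). auto_derive; auto.
Qed.

Lemma Ker_continuous L r t : continuous (Ker L r) t.
Proof. apply (continuous_auto_rsum (kernel_coef L r) (fun m => 2 * PI * INR (L + m))). Qed.

Lemma dirichlet_sq_expand L t : dirichlet_sq L t = rsum (fun i => rsum (fun j => cos (2 * PI * IZR (Z.of_nat i - Z.of_nat j) * t + 0)) L) L.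
Proof.
  unfold dirichlet_sq, dirichlet_cos, dirichlet_sin. rewrite <- !Rsqr_pow2; unfold Rsqr. rewrite !rsum_mul, <- rsum_plus.
  apply rsum_ext. intros i _. rewrite <- rsum_plus. apply rsum_ext. intros j _.
  rewrite minus_IZR, <- !INR_IZR_INZ, Rplus_0_r.
  replace (2 * PI * (INR i - INR j) * t) with (2 * PI * INR i * t - 2 * PI * INR j * t) by ring.
  rewrite cos_minus. auto.
Qed.

Lemma dirichlet_sq_integral L a : is_RInt (dirichlet_sq L) a (a + 1) (INR L).
Proof.
  apply (is_RInt_ext (fun t => rsum (fun i => rsum (fun j => cos (2 * PI * IZR (Z.of_nat i - Z.of_nat j) * t + 0)) L) L)).
  - intros t _. rewrite dirichlet_sq_expand. auto.
  - eapply is_RInt_eqR.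
    + apply (is_RInt_rsum (fun i t => rsum (fun j => cos (2 * PI * IZR (Z.of_nat i - Z.of_nat j) * t + 0)) L)
        (fun i => rsum (fun j => if Z.eqb (Z.of_nat i - Z.of_nat j) 0 then cos 0 else 0) L)).
      intros i _. apply (is_RInt_rsum (fun j t => cos (2 * PI * IZR (Z.of_nat i - Z.of_nat j) * t + 0))
         (fun j => if Z.eqb (Z.of_nat i - Z.of_nat j) 0 then cos 0 else 0)).
      intros j _. apply is_RInt_cos.
    + rewrite (rsum_ext _ (fun _ => 1)). rewrite rsum_const; ring.
      intros i Hi. rewrite (rsum_ext _ (fun j => if Nat.eqb j i then 1 else 0)). apply rsum_delta; auto.
      intros j _. rewrite cos_0. destruct (Z.eqb_spec (Z.of_nat i - Z.of_nat j) 0), (Nat.eqb_spec j i); auto; lia.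
Qed.

(* Transform of the kernel: [Ker] has spectrum in [L .. (r + 1) L], so only [n^2] in that range survives. *)
Definition g0 (L r n : nat) : R := if Nat.leb L (n * n) then kernel_coef L r (n * n - L) else 0.

(** The factor 1/2 arises because a cosine has two frequencies of opposite sign, and [n^2] can match
    only the positive one. *)
Lemma Ker_transform s ph L r y a : 1 / 2 < s -> (1 <= L)%nat ->
  RInt (fun t => ftrig s ph (y + t) * Ker L r t) a (a + 1) =
  / 2 * FP (fun n => wt s n * g0 L r n) (S (S r * L)) ph y.
Proof.
  intros Hs HL.
  assert (HM : exists M, 0 < M /\ forall x, Rabs (Ker L r x) <= M).
  { exists (rsum (fun m => Rabs (kernel_coef L r m)) (S (r * L)) + 1). split.
    - assert (0 <= rsum (fun m => Rabs (kernel_coef L r m)) (S (r * L))) by (apply rsum_ge0; intros; apply Rabs_pos). lra.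
    - intros x. unfold Ker. eapply Rle_trans; [apply rsum_abs|].
      assert (rsum (fun m => Rabs (kernel_coef L r m * cos (2 * PI * INR (L + m) * x))) (S (r * L)) <= rsum (fun m => Rabs (kernel_coef L r m)) (S (r * L))).
      { apply rsum_le. intros m _. rewrite Rabs_mult.
        assert (Rabs (cos (2 * PI * INR (L + m) * x)) <= 1) by (apply Rabs_le, COS_bound). pose proof (Rabs_pos (kernel_coef L r m)). nra. }
      lra. }
  destruct HM as (M & HM & HMb).
  set (l := fun n => / 2 * (g0 L r n * cos (2 * PI * INR (n * n) * y + ph))).
  rewrite (ftrig_integral s ph (Ker L r) M y a l (S (S r * L))); auto.
  - unfold FP, l. rewrite <- rsum_scal. apply rsum_ext. intros; ring.
  - intros; apply Ker_continuous.
  - intros n.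
    apply (is_RInt_ext (fun t => rsum (fun m => kernel_coef L r m * (cos (2 * PI * INR (n * n) * (y + t) + ph) * cos (2 * PI * IZR (Z.of_nat (L + m)) * t + 0))) (S (r * L)))).
    { intros t _. unfold Ker. rewrite <- rsum_scal. apply rsum_ext. intros m _. rewrite <- INR_IZR_INZ, Rplus_0_r. ring. }
    eapply is_RInt_eqR.
    + apply (is_RInt_rsum (fun m t => kernel_coef L r m * (cos (2 * PI * INR (n * n) * (y + t) + ph) * cos (2 * PI * IZR (Z.of_nat (L + m)) * t + 0)))
        (fun m => kernel_coef L r m * (/ 2 * ((if Z.eqb (Z.of_nat (n * n)) (Z.of_nat (L + m)) then cos (2 * PI * IZR (Z.of_nat (n * n)) * y + ph - 0) else 0) +
            (if Z.eqb (Z.of_nat (n * n)) (- Z.of_nat (L + m)) then cos (2 * PI * IZR (Z.of_nat (n * n)) * y + ph + 0) else 0))))).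
      intros m _. apply (is_RInt_scal (V := R_NormedModule) _ a (a + 1) (kernel_coef L r m)).
      rewrite (INR_IZR_INZ (n * n)). apply is_RInt_cos_cos.
    + unfold l, g0. rewrite <- (INR_IZR_INZ (n * n)), Rminus_0_r.
      destruct (Nat.leb_spec L (n * n)).
      * destruct (le_lt_dec (n * n - L) (r * L)).
        -- rewrite (rsum_ext _ (fun m => if Nat.eqb m (n * n - L) then / 2 * (kernel_coef L r (n * n - L) * cos (2 * PI * INR (n * n) * y + ph)) else 0)).
           apply rsum_delta; lia.
           intros m _. destruct (Z.eqb_spec (Z.of_nat (n * n)) (- Z.of_nat (L + m))); [lia|].
           destruct (Z.eqb_spec (Z.of_nat (n * n)) (Z.of_nat (L + m))), (Nat.eqb_spec m (n * n - L)); try lia; try ring.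
           subst m. ring.
        -- rewrite (kernel_coef_supp L r (n * n - L)) by lia. rewrite rsum_eq0; [ring|]. intros m Hm.
           destruct (Z.eqb_spec (Z.of_nat (n * n)) (- Z.of_nat (L + m))); [lia|].
           destruct (Z.eqb_spec (Z.of_nat (n * n)) (Z.of_nat (L + m))); [lia|ring].
      * rewrite rsum_eq0; [ring|]. intros m Hm.
           destruct (Z.eqb_spec (Z.of_nat (n * n)) (- Z.of_nat (L + m))); [lia|].
           destruct (Z.eqb_spec (Z.of_nat (n * n)) (Z.of_nat (L + m))); [lia|ring].
  - intros n Hn. unfold l, g0. destruct (Nat.leb_spec L (n * n)); [|ring]. rewrite kernel_coef_supp; [ring|]. simpl in Hn. nia.
Qed.

(** * Iterated symmetric second differences *)

Definition diff2 (eta : R) (f : R -> R) (u : R) : R := f (u + eta) + f (u - eta) - 2 * f u.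
Fixpoint iter_diff2 (K : nat) (eta : R) (f : R -> R) (u : R) : R :=
  match K with O => f u | S K' => iter_diff2 K' eta (diff2 eta f) u end.

Lemma iter_diff2_ext K eta : forall f g u, (forall v, f v = g v) -> iter_diff2 K eta f u = iter_diff2 K eta g u.
Proof.
  induction K; intros f g u H; simpl; auto. apply IHK. intros v; unfold diff2; rewrite !H; auto.
Qed.

Lemma iter_diff2_plus K eta : forall f g u, iter_diff2 K eta (fun v => f v + g v) u = iter_diff2 K eta f u + iter_diff2 K eta g u.
Proof.
  induction K; intros f g u; simpl; auto. rewrite <- IHK. apply iter_diff2_ext. intros v; unfold diff2; ring.
Qed.

Lemma iter_diff2_scal K eta c : forall f u, iter_diff2 K eta (fun v => c * f v) u = c * iter_diff2 K eta f u.
Proof.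
  induction K; intros f u; simpl; auto. rewrite <- IHK. apply iter_diff2_ext. intros v; unfold diff2; ring.
Qed.

Lemma iter_diff2_bound K eta M : 0 <= eta -> forall f u, (forall v, Rabs (v - u) <= INR K * eta -> Rabs (f v) <= M) ->
  Rabs (iter_diff2 K eta f u) <= 4 ^ K * M.
Proof.
  intros He. revert M; induction K; intros M f u H.
  - simpl. rewrite Rmult_1_l. apply H. rewrite Rminus_diag, Rabs_R0. simpl; lra.
  - simpl iter_diff2. replace (4 ^ S K * M) with (4 ^ K * (4 * M)) by (simpl; ring). apply IHK.
    intros v Hv. rewrite S_INR in H. apply Rabs_le_between in Hv. unfold diff2.
    assert (H1 : Rabs (f (v + eta)) <= M) by (apply H, Rabs_le; lra).
    assert (H2 : Rabs (f (v - eta)) <= M) by (apply H, Rabs_le; lra).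
    assert (H3 : Rabs (f v) <= M) by (apply H, Rabs_le; lra).
    apply Rabs_le_between in H1, H2, H3. apply Rabs_le; lra.
Qed.

(** [N] counts the coefficients, so the degree is below [N] and [isPoly 0] means the zero
    function. *)
Definition isPoly (N : nat) (f : R -> R) : Prop := exists a, forall u, f u = rsum (fun i => a i * u ^ i) N.

Lemma isPoly_mono N M f : (N <= M)%nat -> isPoly N f -> isPoly M f.
Proof.
  intros H (a & Ha). exists (fun i => if Nat.ltb i N then a i else 0). intros u. rewrite Ha.
  rewrite (rsum_supp _ N M); auto.
  - apply rsum_ext. intros i Hi. apply Nat.ltb_lt in Hi as ->. auto.
  - intros i Hi. destruct (Nat.ltb_spec i N); [lia|ring].
Qed.

Lemma isPoly_plus N f g : isPoly N f -> isPoly N g -> isPoly N (fun u => f u + g u).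
Proof.
  intros (a & Ha) (b & Hb). exists (fun i => a i + b i). intros u. rewrite Ha, Hb, <- rsum_plus.
  apply rsum_ext; intros; ring.
Qed.

Lemma isPoly_scal N c f : isPoly N f -> isPoly N (fun u => c * f u).
Proof.
  intros (a & Ha). exists (fun i => c * a i). intros u. rewrite Ha, <- rsum_scal. apply rsum_ext; intros; ring.
Qed.

Lemma isPoly_mulX N f : isPoly N f -> isPoly (S N) (fun u => u * f u).
Proof.
  intros (a & Ha). exists (fun i => match i with O => 0 | S j => a j end). intros u.
  rewrite Ha, rsum_Sl, <- rsum_scal, Rmult_0_l, Rplus_0_l. apply rsum_ext; intros; simpl; ring.
Qed.

Lemma isPoly_ext N f g : (forall u, f u = g u) -> isPoly N f -> isPoly N g.
Proof. intros H (a & Ha). exists a. intros u. rewrite <- H; auto. Qed.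

Lemma pow_shift_poly j c : isPoly j (fun u => (u + c) ^ j - u ^ j).
Proof.
  induction j. exists (fun _ => 0). intros; simpl; ring.
  apply (isPoly_ext _ (fun u => u * ((u + c) ^ j - u ^ j) + c * (((u + c) ^ j - u ^ j) + u ^ j))).
  - intros u; simpl; ring.
  - apply isPoly_plus. apply isPoly_mulX; auto. apply isPoly_scal. apply isPoly_plus.
    apply (isPoly_mono j); auto.
    exists (fun i => if Nat.eqb i j then 1 else 0). intros u. rewrite rsum_S, rsum_eq0.
    rewrite Nat.eqb_refl; ring. intros i Hi. destruct (Nat.eqb_spec i j); [lia|ring].
Qed.

(** Each of the two shift differences lowers the degree by one. That a second difference lowers it
    by two is not exploited: [K >= N] iterations are made anyway. *)
Lemma diff2_poly N eta f : isPoly (S N) f -> isPoly N (diff2 eta f).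
Proof.
  intros (a & Ha).
  apply (isPoly_ext _ (fun u => rsum (fun i => a i * (((u + eta) ^ i - u ^ i) + ((u + - eta) ^ i - u ^ i))) (S N))).
  - intros u. unfold diff2. rewrite !Ha. unfold Rminus. rewrite Ropp_mult_distr_l, <- rsum_scal, <- !rsum_plus.
    apply rsum_ext; intros; ring.
  - assert (H : forall m, (m <= S N)%nat -> isPoly N (fun u => rsum (fun i => a i * (((u + eta) ^ i - u ^ i) + ((u + - eta) ^ i - u ^ i))) m)).
    { induction m; intros Hm. simpl. exists (fun _ => 0). intros. rewrite rsum_eq0; auto. intros; ring.
      simpl. apply isPoly_plus. apply IHm; lia. apply isPoly_scal. apply (isPoly_mono m); [lia|].
      apply isPoly_plus; apply pow_shift_poly. }
    apply H; auto.
Qed.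

Lemma iter_diff2_poly K eta : forall N f u, (N <= K)%nat -> isPoly N f -> iter_diff2 K eta f u = 0.
Proof.
  induction K; intros N f u HN Hf.
  - replace N with 0%nat in Hf by lia. destruct Hf as (a & Ha). simpl. rewrite Ha. auto.
  - simpl. apply (IHK K); auto. apply diff2_poly. apply (isPoly_mono N); auto.
Qed.

Lemma iter_diff2_RInt K eta (kap : R -> R) a b : (forall t, continuous kap t) -> forall (F : R -> R) y, (forall t, continuous F t) ->
  iter_diff2 K eta (fun y => RInt (fun t => F (y + t) * kap t) a b) y = RInt (fun t => iter_diff2 K eta F (y + t) * kap t) a b.
Proof.
  intros Hk. induction K; intros F y HF; simpl; auto.
  assert (Hsh : forall (G : R -> R) (c x : R), (forall t, continuous G t) -> continuous (fun t : R => G (c + t)) x).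
  { intros G c x HG. apply (continuous_comp (fun t => c + t) G).
    apply (ex_derive_continuous (K := R_AbsRing) (V := R_NormedModule)); auto_derive; auto. apply HG. }
  assert (Hc : forall c x, continuous (fun t => F (c + t) * kap t) x).
  { intros c x. apply (continuous_mult (K := R_AbsRing)); auto. }
  rewrite <- IHK.
  - apply iter_diff2_ext. intros v. unfold diff2 at 1.
    rewrite <- (RInt_scal (V := R_CompleteNormedModule)) by (apply ex_RInt_cont; auto).
    rewrite <- (RInt_plus (V := R_CompleteNormedModule)) by (apply ex_RInt_cont; auto).
    rewrite <- (RInt_minus (V := R_CompleteNormedModule)).
    + apply RInt_ext. intros t _. unfold diff2, minus, plus, opp, scal; simpl; unfold mult; simpl. toR.
      replace (v + t + eta) with (v + eta + t) by ring. replace (v + t - eta) with (v - eta + t) by ring. ring.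
    + apply ex_RInt_cont. intros x. apply (continuous_plus (V := R_NormedModule)); auto.
    + apply ex_RInt_cont. intros x. apply (continuous_scal_r (K := R_AbsRing) (V := R_NormedModule)). auto.
  - intros t. unfold diff2. apply (continuous_minus (V := R_NormedModule)).
    + apply (continuous_plus (V := R_NormedModule)).
      * apply (continuous_comp (fun t => t + eta) F); [|apply HF].
        apply (ex_derive_continuous (K := R_AbsRing) (V := R_NormedModule)); auto_derive; auto.
      * apply (continuous_comp (fun t => t - eta) F); [|apply HF].
        apply (ex_derive_continuous (K := R_AbsRing) (V := R_NormedModule)); auto_derive; auto.
    + apply (continuous_scal_r (K := R_AbsRing) (V := R_NormedModule)); auto.
Qed.

(** Cosines are eigenfunctions of symmetric differences, with eigenvalue [- 4 sin^2 (PI n^2 eta)].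
    It is real, so the phase [ph] is preserved, and of constant sign. *)
Lemma iter_diff2_FP K eta : forall g B ph y,
  iter_diff2 K eta (FP g B ph) y = FP (fun n => g n * (- (4 * sin (PI * INR (n * n) * eta) ^ 2)) ^ K) B ph y.
Proof.
  induction K; intros g B ph y.
  - simpl. unfold FP. apply rsum_ext. intros; ring.
  - simpl iter_diff2. rewrite (iter_diff2_ext K eta _ (FP (fun n => g n * (- (4 * sin (PI * INR (n * n) * eta) ^ 2))) B ph)).
    + rewrite IHK. unfold FP. apply rsum_ext. intros n _. rewrite <- (tech_pow_Rmult _ K). ring.
    + intros v. unfold diff2, FP. rewrite <- rsum_scal, <- rsum_plus, <- rsum_minus. apply rsum_ext. intros n _.
      set (w := PI * INR (n * n) * eta).
      replace (2 * PI * INR (n * n) * (v + eta) + ph) with ((2 * PI * INR (n * n) * v + ph) + 2 * w) by (unfold w; ring).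
      replace (2 * PI * INR (n * n) * (v - eta) + ph) with ((2 * PI * INR (n * n) * v + ph) - 2 * w) by (unfold w; ring).
      rewrite cos_plus, cos_minus, cos_2a_sin. ring.
Qed.

Lemma polyC_comp a N h : polyC a N h = (rsum (fun j => fst (a j) * h ^ j) N, rsum (fun j => snd (a j) * h ^ j) N).
Proof.
  destruct N as [|N']; [reflexivity|]. unfold polyC, sum_n. change N' with (0 + N')%nat at 1.
  apply (csum_pair _ (fun j => fst (a j) * h ^ j) (fun j => snd (a j) * h ^ j)). intros i _. rewrite Nat.add_0_l.
  unfold Cmult, RtoC. cbn [fst snd]. f_equal; ring.
Qed.

Lemma ftrig_bounded s ph x : 1 / 2 < s -> Rabs (ftrig s ph x) <= Series (fun n => wt s (S n)).
Proof.
  intros Hs. unfold ftrig. eapply Rle_trans; [apply Series_Rabs|].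
  + apply (ex_series_le (K := R_AbsRing) (V := R_CompleteNormedModule)) with (b := fun n => wt s (S n)); [|apply wt_ex; auto].
    intros n. eapply Rle_trans; [right; apply Rabs_Rabsolu|]. apply ftrig_term_le.
  + apply Series_le; [|apply wt_ex; auto]. intros n; split; [apply Rabs_pos|apply ftrig_term_le].
Qed.

(** The radius 2 leaves room for a point [v] at distance at most 1 from [x0] and an integration
    variable of size at most 1/2. *)
Definition locpoly (s bet x0 C : R) (N : nat) (ph : R) (a : nat -> R) : Prop :=
  forall u, Rabs u <= 2 -> Rabs (ftrig s ph (x0 + u) - rsum (fun j => a j * u ^ j) N) <= C * hpow u bet.

(** Away from [x0] the function and the polynomial are bounded and [|u|^bet] is bounded below, so
    enlarging the constant replaces the unknown radius by 2. *)
Lemma Holder_real s bet x0 : 1 / 2 < s -> 0 < bet -> Holder_at bet (Riemann_fn s) x0 ->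
  exists N C a b, 0 < C /\ locpoly s bet x0 C N 0 a /\ locpoly s bet x0 C N (- (PI / 2)) b.
Proof.
  intros Hs Hb (N & a & C0 & d & _ & HC0 & Hd & H).
  assert (Hgen : forall ph (c : nat -> R), (forall h, Rabs h < d -> Rabs (ftrig s ph (x0 + h) - rsum (fun j => c j * h ^ j) N) <= C0 * hpow h bet) ->
     exists C, 0 < C /\ locpoly s bet x0 C N ph c).
  { intros ph c Hc. set (S0 := Series (fun n => wt s (S n))). set (S1 := rsum (fun j => Rabs (c j) * 2 ^ j) N).
    assert (HS1 : 0 <= S1) by (apply rsum_ge0; intros; apply Rmult_le_pos; [apply Rabs_pos|apply pow_le; lra]).
    assert (HS0 : 0 <= S0) by (eapply Rle_trans; [apply Rabs_pos|apply (ftrig_bounded s 0 0); auto]).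
    exists (C0 + (S0 + S1) / Rpower d bet). pose proof (Rpower_pos d bet) as Hdp.
    assert (Hq : 0 <= (S0 + S1) / Rpower d bet) by (apply Rdiv_le_0_compat; lra).
    split; [lra|]. intros u Hu. assert (Hh : 0 <= hpow u bet).
    { unfold hpow. destruct Req_EM_T. destruct Rlt_dec; lra. left; apply Rpower_pos. }
    destruct (Rlt_dec (Rabs u) d) as [Hl|Hl].
    - eapply Rle_trans; [apply Hc; auto|]. nra.
    - apply Rnot_lt_le in Hl.
      assert (E : Rabs (ftrig s ph (x0 + u) - rsum (fun j => c j * u ^ j) N) <= S0 + S1).
      { unfold Rminus. eapply Rle_trans; [apply Rabs_triang|]. rewrite Rabs_Ropp. apply Rplus_le_compat.
        apply ftrig_bounded; auto. eapply Rle_trans; [apply rsum_abs|]. apply rsum_le. intros j _.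
        rewrite Rabs_mult, <- RPow_abs. apply Rmult_le_compat_l; [apply Rabs_pos|]. apply pow_incr. split; [apply Rabs_pos|auto]. }
      eapply Rle_trans; [apply E|].
      assert (Hp : Rpower d bet <= hpow u bet).
      { unfold hpow. destruct (Req_EM_T u 0) as [->|]; [rewrite Rabs_R0 in Hl; lra|]. apply Rle_Rpower_l; lra. }
      assert ((S0 + S1) / Rpower d bet * Rpower d bet = S0 + S1) by (field; lra). nra. }
  destruct (Hgen 0 (fun j => fst (a j))) as (C1 & HC1 & H1).
  { intros h Hh. eapply Rle_trans; [|apply (H h Hh)]. eapply Rle_trans; [|apply Rmax_Cmod].
    eapply Rle_trans; [|apply Rmax_l]. rewrite polyC_comp. unfold Cminus, Cplus, Copp; cbn [fst snd].
    rewrite Riemann_fn_fst. unfold Rminus; lra. }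
  destruct (Hgen (- (PI / 2)) (fun j => snd (a j))) as (C2 & HC2 & H2).
  { intros h Hh. eapply Rle_trans; [|apply (H h Hh)]. eapply Rle_trans; [|apply Rmax_Cmod].
    eapply Rle_trans; [|apply Rmax_r]. rewrite polyC_comp. unfold Cminus, Cplus, Copp; cbn [fst snd].
    rewrite Riemann_fn_snd. unfold Rminus; lra. }
  assert (Hh : forall u, 0 <= hpow u bet).
  { intros u. unfold hpow. destruct Req_EM_T. destruct Rlt_dec; lra. left; apply Rpower_pos. }
  exists N, (C1 + C2), (fun j => fst (a j)), (fun j => snd (a j)). split; [lra|].
  split; intros u Hu; [specialize (H1 u Hu)|specialize (H2 u Hu)]; specialize (Hh u); nra.
Qed.

Lemma hpow_le u U bet : 0 < bet -> Rabs u <= U -> 0 < U -> hpow u bet <= Rpower U bet.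
Proof.
  intros Hb Hu HU. unfold hpow. destruct (Req_EM_T u 0).
  - destruct Rlt_dec; [left; apply Rpower_pos|lra].
  - apply Rle_Rpower_l; [lra|]. split; auto. apply Rabs_pos_lt; auto.
Qed.

(* The kernel decays fast enough to absorb the growth of [|v + t|^bet] away from [t = 0]. *)
Lemma kernel_weight L p bet v t : (1 <= L)%nat -> 0 < bet <= 2 * INR p -> Rabs t <= 1 / 2 ->
  hpow (v + t) bet * dirichlet_sq L t ^ p <= INR L ^ (2 * p) * Rpower (/ INR L + Rabs v) bet.
Proof.
  intros HL Hb Ht. assert (HLp : 1 <= INR L) by (apply (le_INR 1); auto).
  assert (HLi : 0 < / INR L) by (apply Rinv_0_lt_compat; lra). pose proof (Rabs_pos v) as Hv.
  set (W := / INR L + Rabs v). assert (HW : 0 < W) by (unfold W; lra).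
  assert (Hh : 0 <= hpow (v + t) bet).
  { unfold hpow. destruct Req_EM_T. destruct Rlt_dec; lra. left; apply Rpower_pos. }
  pose proof (dirichlet_sq_ge0 L t) as HD0. pose proof (Rabs_triang v t) as Htr.
  destruct (Rle_dec (Rabs t) (/ INR L)) as [Hs|Hs].
  - rewrite Rmult_comm. apply Rmult_le_compat; auto. apply pow_le; auto.
    + rewrite pow_mult. apply pow_incr. split; auto. apply dirichlet_sq_le_sq.
    + apply hpow_le; auto; [lra|unfold W; lra].
  - apply Rnot_le_lt in Hs. assert (Ht0 : 0 < Rabs t) by lra.
    assert (HtL : 1 <= INR L * Rabs t).
    { apply Rmult_le_reg_l with (/ INR L); auto. rewrite <- Rmult_assoc, Rinv_l by lra. lra. }
    assert (HD : dirichlet_sq L t <= / Rabs t ^ 2).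
    { pose proof (dirichlet_sq_sin L t). pose proof (sin_pi_ge t Ht). assert (0 < Rabs t ^ 2) by (apply pow_lt; auto).
      apply Rmult_le_reg_r with (Rabs t ^ 2); auto. rewrite Rinv_l by lra.
      assert (Rabs t ^ 2 <= sin (PI * t) ^ 2) by (rewrite <- (pow2_abs (sin (PI * t))); apply pow_incr; lra).
      eapply Rle_trans; [|apply H]. apply Rmult_le_compat_l; auto. }
    assert (HU : Rabs (v + t) <= (INR L * Rabs t) * W).
    { unfold W. rewrite Rmult_plus_distr_l. replace (INR L * Rabs t * / INR L) with (Rabs t) by (field; lra). nra. }
    assert (Hp1 : hpow (v + t) bet <= Rpower (INR L * Rabs t) bet * Rpower W bet).
    { rewrite Rpower_mult_distr by lra. apply hpow_le; auto; [lra|]. apply Rmult_lt_0_compat; lra. }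
    assert (Hp2 : Rpower (INR L * Rabs t) bet <= (INR L * Rabs t) ^ (2 * p)).
    { rewrite <- Rpower_pow by lra. apply Rle_Rpower; auto. rewrite mult_INR. simpl (INR 2). lra. }
    assert (Hp3 : dirichlet_sq L t ^ p <= (/ Rabs t) ^ (2 * p)).
    { rewrite pow_mult. apply pow_incr. split; auto. rewrite pow_inv. auto. }
    pose proof (Rpower_pos W bet). pose proof (Rpower_pos (INR L * Rabs t) bet).
    apply Rle_trans with ((INR L * Rabs t) ^ (2 * p) * Rpower W bet * (/ Rabs t) ^ (2 * p)).
    + apply Rmult_le_compat; auto. apply pow_le; auto.
      eapply Rle_trans; [apply Hp1|]. apply Rmult_le_compat_r; lra.
    + rewrite Rpow_mult_distr. right.
      replace (INR L ^ (2 * p) * Rabs t ^ (2 * p) * Rpower W bet * (/ Rabs t) ^ (2 * p)) with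
         (INR L ^ (2 * p) * Rpower W bet * ((Rabs t * / Rabs t) ^ (2 * p))) by (rewrite Rpow_mult_distr; ring).
      rewrite Rinv_r by lra. rewrite pow1. ring.
Qed.

(** The function is split into its Taylor polynomial, which the differences annihilate under the
    integral, and a rest of size [|u|^bet]. Of the [p + 1] factors [dirichlet_sq] that bound the
    kernel, [p] absorb the growth of the rest through [kernel_weight], and the last one has integral
    [L]. *)
Lemma transform_upper s bet x0 C N ph a L p K eta y : 1 / 2 < s -> 0 < C -> locpoly s bet x0 C N ph a ->
  (1 <= L)%nat -> 0 < bet <= 2 * INR p -> (N <= K)%nat -> 0 <= eta -> Rabs (y - x0) + INR K * eta <= 1 ->
  Rabs (iter_diff2 K eta (fun y => RInt (fun t => ftrig s ph (y + t) * Ker L (2 * S p) t) (- (1 / 2)) (- (1 / 2) + 1)) y) <=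
  4 ^ K * (C * INR L ^ (2 * p + 1) * Rpower (/ INR L + (Rabs (y - x0) + INR K * eta)) bet).
Proof.
  intros Hs HC Hl HL Hb HN He Hy.
  set (P := fun u => rsum (fun j => a j * (u - x0) ^ j) N).
  set (rho := fun u => ftrig s ph u - P u).
  assert (HPc : forall u, continuous P u).
  { intros u. apply continuous_rsum. intros i _. apply (ex_derive_continuous (K := R_AbsRing) (V := R_NormedModule)); auto_derive; auto. }
  assert (Hrc : forall u, continuous rho u).
  { intros u. apply (continuous_minus (V := R_NormedModule)); auto. apply ftrig_continuous; auto. }
  assert (Hsh : forall (G : R -> R) (c x : R), (forall t, continuous G t) -> continuous (fun t : R => G (c + t)) x).
  { intros G c x HG. apply (continuous_comp (fun t => c + t) G).
    apply (ex_derive_continuous (K := R_AbsRing) (V := R_NormedModule)); auto_derive; auto. apply HG. }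
  assert (HKc : forall t, continuous (Ker L (2 * S p)) t) by (intros; apply Ker_continuous).
  assert (Hmc : forall (G : R -> R) (c x : R), (forall t, continuous G t) -> continuous (fun t : R => G (c + t) * Ker L (2 * S p) t) x).
  { intros. apply (continuous_mult (K := R_AbsRing)); auto. }
  rewrite (iter_diff2_ext K eta _ (fun y => RInt (fun t => P (y + t) * Ker L (2 * S p) t) (- (1 / 2)) (- (1 / 2) + 1) +
     RInt (fun t => rho (y + t) * Ker L (2 * S p) t) (- (1 / 2)) (- (1 / 2) + 1))).
  2:{ intros v. rewrite <- (RInt_plus (V := R_CompleteNormedModule)) by (apply ex_RInt_cont; auto).
      apply RInt_ext. intros t _. unfold rho, plus; simpl. toR. ring. }
  rewrite iter_diff2_plus, iter_diff2_RInt by auto.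
  rewrite (RInt_ext _ (fun _ => 0)).
  2:{ intros t _. rewrite (iter_diff2_poly K eta N); auto. toR; ring.
      clear - N. unfold P.
      assert (H : forall m, isPoly m (fun u => rsum (fun j => a j * (u - x0) ^ j) m)).
      { induction m. exists (fun _ => 0). intros; reflexivity.
        simpl. apply isPoly_plus. apply (isPoly_mono m); auto. apply isPoly_scal.
        apply (isPoly_ext _ (fun u => ((u + - x0) ^ m - u ^ m) + u ^ m)). intros; unfold Rminus; ring.
        apply isPoly_plus. apply (isPoly_mono m); auto. apply pow_shift_poly.
        exists (fun i => if Nat.eqb i m then 1 else 0). intros u. rewrite rsum_S, rsum_eq0.
        rewrite Nat.eqb_refl; ring. intros i Hi. destruct (Nat.eqb_spec i m); [lia|ring]. }
      apply H. }
  rewrite RInt_const. unfold scal; simpl; unfold mult; simpl. rewrite Rmult_0_r, Rplus_0_l.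
  apply iter_diff2_bound; auto. intros v Hv.
  set (E := Rpower (/ INR L + (Rabs (y - x0) + INR K * eta)) bet).
  assert (HLp : 1 <= INR L) by (apply (le_INR 1); auto).
  assert (HLi : 0 < / INR L) by (apply Rinv_0_lt_compat; lra).
  assert (Hvx : Rabs (v - x0) <= Rabs (y - x0) + INR K * eta).
  { replace (v - x0) with ((v - y) + (y - x0)) by ring. eapply Rle_trans; [apply Rabs_triang|]. lra. }
  assert (Hpt : forall t, - (1 / 2) < t < - (1 / 2) + 1 -> Rabs (rho (v + t) * Ker L (2 * S p) t) <= (C * INR L ^ (2 * p) * E) * dirichlet_sq L t).
  { intros t Ht. assert (Hta : Rabs t <= 1 / 2) by (apply Rabs_le; lra).
    rewrite Rabs_mult. pose proof (Ker_le L (S p) t) as HK. simpl pow in HK.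
    assert (Hr : Rabs (rho (v + t)) <= C * hpow ((v - x0) + t) bet).
    { unfold rho, P. replace (v + t - x0) with ((v - x0) + t) by ring.
      replace (v + t) with (x0 + ((v - x0) + t)) by ring. apply Hl.
      eapply Rle_trans; [apply Rabs_triang|]. lra. }
    pose proof (kernel_weight L p bet (v - x0) t HL Hb Hta) as Hw.
    assert (HE : Rpower (/ INR L + Rabs (v - x0)) bet <= E).
    { apply Rle_Rpower_l; [lra|]. pose proof (Rabs_pos (v - x0)). lra. }
    pose proof (dirichlet_sq_ge0 L t). pose proof (Rabs_pos (rho (v + t))). pose proof (Rabs_pos (Ker L (2 * S p) t)).
    assert (HLpow : 0 <= INR L ^ (2 * p)) by (apply pow_le; lra).
    apply Rle_trans with (C * hpow (v - x0 + t) bet * (dirichlet_sq L t * dirichlet_sq L t ^ p)); [apply Rmult_le_compat; auto|].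
    replace (C * hpow (v - x0 + t) bet * (dirichlet_sq L t * dirichlet_sq L t ^ p)) with (C * dirichlet_sq L t * (hpow (v - x0 + t) bet * dirichlet_sq L t ^ p)) by ring.
    replace (C * INR L ^ (2 * p) * E * dirichlet_sq L t) with (C * dirichlet_sq L t * (INR L ^ (2 * p) * E)) by ring.
    apply Rmult_le_compat_l; [nra|]. eapply Rle_trans; [apply Hw|]. apply Rmult_le_compat_l; auto. }
  assert (Hex : ex_RInt (fun t => rho (v + t) * Ker L (2 * S p) t) (- (1 / 2)) (- (1 / 2) + 1)) by (apply ex_RInt_cont; auto).
  eapply Rle_trans; [apply abs_RInt_le; [lra|auto]|].
  eapply Rle_trans; [apply (RInt_le _ (fun t => scal (C * INR L ^ (2 * p) * E) (dirichlet_sq L t)))|].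
  - lra.
  - apply ex_RInt_cont. intros x. apply (continuous_comp _ Rabs); auto. apply continuous_Rabs.
  - eexists. apply (is_RInt_scal (V := R_NormedModule)). apply dirichlet_sq_integral.
  - intros t Ht. apply Hpt; auto.
  - right. apply is_RInt_unique. eapply is_RInt_eqR. apply (is_RInt_scal (V := R_NormedModule)). apply dirichlet_sq_integral.
    change (C * INR L ^ (2 * p) * E * INR L = C * INR L ^ (2 * p + 1) * E). rewrite pow_add, pow_1. ring.
Qed.

Lemma TV_mult (u v : nat -> R) U W B TU TW : (forall n, Rabs (u n) <= U) -> (forall n, Rabs (v n) <= W) ->
  rsum (fun n => Rabs (u (S n) - u n)) B <= TU -> rsum (fun n => Rabs (v (S n) - v n)) B <= TW ->
  rsum (fun n => Rabs (u (S n) * v (S n) - u n * v n)) B <= TU * W + U * TW.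
Proof.
  intros Hu Hv H1 H2.
  assert (0 <= U) by (eapply Rle_trans; [apply Rabs_pos|apply (Hu O)]).
  assert (0 <= W) by (eapply Rle_trans; [apply Rabs_pos|apply (Hv O)]).
  apply Rle_trans with (rsum (fun n => Rabs (u (S n) - u n) * W + U * Rabs (v (S n) - v n)) B).
  - apply rsum_le. intros n _. replace (u (S n) * v (S n) - u n * v n) with ((u (S n) - u n) * v (S n) + u n * (v (S n) - v n)) by ring.
    eapply Rle_trans; [apply Rabs_triang|]. rewrite !Rabs_mult. apply Rplus_le_compat.
    apply Rmult_le_compat_l; [apply Rabs_pos|auto]. apply Rmult_le_compat_r; [apply Rabs_pos|auto].
  - rewrite rsum_plus, rsum_scalr, rsum_scal. apply Rplus_le_compat. apply Rmult_le_compat_r; auto. apply Rmult_le_compat_l; auto.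
Qed.

Lemma FP_supp g B B' ph y : (B <= B')%nat -> (forall n, (B <= n)%nat -> g n = 0) -> FP g B' ph y = FP g B ph y.
Proof. intros HB Hs. apply rsum_supp; auto. intros i Hi. rewrite Hs by lia. ring. Qed.

(* [L] is of size [(8 r H)^2], so that the [2 H] indices [n] just below [8 r H] have [n^2] in the lower part of the
   spectrum of the kernel; [eta] keeps all the phases [n^2 eta] below [1/2] and bounded away from [0] there. *)
Section Weights.
Variables (s : R) (p K H : nat).
Hypothesis Hs : 1 / 2 < s.
Hypothesis HH : (1 <= H)%nat.
Let r := (2 * S p)%nat.
Let L := (32 * r * r * (H * H))%nat.
Let eta := / (8 * INR (r + 1) * INR L).
Let B := S (Nat.sqrt ((r + 1) * L)).
(** Order of magnitude of the weights: [L^(2 p + 1)] from the kernel coefficients, [L^(-s)] from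
    [wt] at [n^2] of order [L]. *)
Let GL := INR L ^ (2 * p + 1) * Rpower (INR L) (- s).
Let gw (n : nat) := (wt s n * g0 L r n) * (4 * sin (PI * INR (n * n) * eta) ^ 2) ^ K.

Lemma weight_L : (1 <= L)%nat. Proof. unfold L, r. nia. Qed.
Lemma weight_Lp : 1 <= INR L. Proof. apply (le_INR 1), weight_L. Qed.
Lemma weight_eta : 0 < eta.
Proof. apply Rinv_0_lt_compat. pose proof weight_Lp. assert (0 < INR (r + 1)) by (apply lt_0_INR; lia). nra. Qed.
Lemma weight_B2 : (B * B <= 4 * ((r + 1) * L))%nat.
Proof. unfold B. pose proof (Nat.sqrt_spec ((r + 1) * L) ltac:(lia)). pose proof weight_L. nia. Qed.

(** The factor [8 (r + 1)] in [eta] is chosen against [n^2 <= 4 (r + 1) L]. On this range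
    [sin (PI n^2 eta)] increases with [n], which makes the difference factor monotone. *)
Lemma weight_phase n : (n <= B)%nat -> INR (n * n) * eta <= 1 / 2.
Proof.
  intros Hn. pose proof weight_Lp. assert (0 < INR (r + 1)) by (apply lt_0_INR; lia).
  apply Rle_trans with (INR (4 * ((r + 1) * L)) * eta).
  - apply Rmult_le_compat_r; [left; apply weight_eta|]. apply le_INR. pose proof weight_B2. nia.
  - unfold eta. rewrite !mult_INR. right. simpl (INR 4). field. lra.
Qed.

(** Agrees with [wt s n] wherever [g0] is not zero; the maximum makes it monotone and bounded on the
    whole range, down to [n = 0]. *)
Let d (n : nat) := Rpower (INR (Nat.max (n * n) L)) (- s).
Let e (n : nat) := (4 * sin (PI * INR (n * n) * eta) ^ 2) ^ K.

Lemma weight_d n : 0 <= d n <= Rpower (INR L) (- s).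
Proof.
  split; [left; apply Rpower_pos|]. pose proof weight_Lp. apply Rpower_neg_anti; [lra|]. split; [lra|]. apply le_INR; lia.
Qed.

Lemma weight_dTV : rsum (fun n => Rabs (d (S n) - d n)) B <= Rpower (INR L) (- s).
Proof.
  pose proof weight_Lp.
  rewrite (rsum_ext _ (fun n => (fun m => - d m) (S n) - (fun m => - d m) n)).
  - rewrite (rsum_tele (fun m => - d m)). pose proof (weight_d 0). pose proof (weight_d B). lra.
  - intros n _. assert (d (S n) <= d n).
    { apply Rpower_neg_anti; [lra|]. split; [apply lt_0_INR; pose proof weight_L; lia|apply le_INR; nia]. }
    rewrite Rabs_left1 by lra. ring.
Qed.

Lemma weight_c n : 0 <= g0 L r n <= INR L ^ (2 * p + 1).
Proof.
  unfold g0. destruct Nat.leb; [|split; [lra|apply pow_le; pose proof weight_Lp; lra]].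
  split; [apply kernel_coef_ge0|]. unfold r. replace (2 * S p)%nat with (S (2 * p + 1)) by lia. apply kernel_coef_le.
Qed.

(** The kernel coefficients have increments at most [L^(2 p)] per unit of frequency, including the
    entrance at [L], and the frequencies [n^2] sweep a range of length at most [4 (r + 1) L]. *)
Lemma weight_cTV : rsum (fun n => Rabs (g0 L r (S n) - g0 L r n)) B <= 4 * INR (r + 1) * INR L ^ (2 * p + 1).
Proof.
  pose proof weight_L as HL. pose proof weight_Lp as HLp.
  set (cc := fun M => if Nat.leb L M then kernel_coef L r (M - L) else 0).
  assert (Hr : r = S (S (2 * p))) by (unfold r; lia).
  assert (H1 : forall M, Rabs (cc (S M) - cc M) <= INR L ^ (2 * p)).
  { intros M. unfold cc. rewrite Hr. destruct (Nat.leb_spec L (S M)), (Nat.leb_spec L M); try lia.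
    - replace (S M - L)%nat with (S (M - L)) by lia. apply kernel_coef_lip; auto.
    - replace (S M - L)%nat with 0%nat by lia. rewrite Rminus_0_r, Rabs_right by (apply Rle_ge, kernel_coef_ge0). apply kernel_coef_at0; auto.
    - rewrite Rminus_0_r, Rabs_R0. apply pow_le; lra. }
  assert (H2 : forall k M, Rabs (cc (M + k)%nat - cc M) <= INR k * INR L ^ (2 * p)).
  { induction k; intros M. rewrite Nat.add_0_r, Rminus_diag, Rabs_R0. simpl; lra.
    rewrite Nat.add_succ_r, S_INR. replace (cc (S (M + k)) - cc M) with ((cc (S (M + k)) - cc (M + k)%nat) + (cc (M + k)%nat - cc M)) by ring.
    eapply Rle_trans; [apply Rabs_triang|]. specialize (H1 (M + k)%nat). specialize (IHk M). lra. }
  apply Rle_trans with (rsum (fun n => (fun m => INR (m * m) * INR L ^ (2 * p)) (S n) - (fun m => INR (m * m) * INR L ^ (2 * p)) n) B).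
  - apply rsum_le. intros n _. change (g0 L r n) with (cc (n * n)%nat). change (g0 L r (S n)) with (cc (S n * S n)%nat).
    replace (S n * S n)%nat with (n * n + (2 * n + 1))%nat by ring. eapply Rle_trans; [apply H2|]. rewrite (plus_INR (n * n)). lra.
  - rewrite (rsum_tele (fun m => INR (m * m) * INR L ^ (2 * p))). simpl (INR (0 * 0)). rewrite Rmult_0_l, Rminus_0_r.
    apply Rle_trans with (INR (4 * ((r + 1) * L)) * INR L ^ (2 * p)).
    + apply Rmult_le_compat_r; [apply pow_le; lra|]. apply le_INR, weight_B2.
    + right. rewrite !mult_INR, pow_add, pow_1. simpl (INR 4). ring.
Qed.

Lemma weight_e n : 0 <= e n <= 4 ^ K.
Proof.
  unfold e. pose proof (pow2_ge_0 (sin (PI * INR (n * n) * eta))).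
  assert (sin (PI * INR (n * n) * eta) ^ 2 <= 1).
  { pose proof (SIN_bound (PI * INR (n * n) * eta)). nra. }
  split; [apply pow_le; lra|apply pow_incr; lra].
Qed.

Lemma weight_eTV : rsum (fun n => Rabs (e (S n) - e n)) B <= 4 ^ K.
Proof.
  pose proof PI_RGT_0. pose proof weight_eta.
  rewrite (rsum_ext _ (fun n => e (S n) - e n)).
  - rewrite rsum_tele. pose proof (weight_e B). pose proof (weight_e 0). lra.
  - intros n Hn. apply Rabs_right. enough (e n <= e (S n)) by lra. unfold e.
    assert (Hm : INR (n * n) * eta <= INR (S n * S n) * eta) by (apply Rmult_le_compat_r; [lra|apply le_INR; nia]).
    pose proof (weight_phase (S n) ltac:(lia)). assert (0 <= INR (n * n) * eta) by (apply Rmult_le_pos; [apply pos_INR|lra]).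
    apply pow_incr. split; [pose proof (pow2_ge_0 (sin (PI * INR (n * n) * eta))); lra|].
    apply Rmult_le_compat_l; [lra|]. apply pow_incr. rewrite !Rmult_assoc. split.
    + apply sin_ge_0; nra.
    + apply sin_incr_1; nra.
Qed.

Lemma weight_eq n : gw n = d n * g0 L r n * e n.
Proof.
  unfold gw. fold (e n). f_equal. unfold g0. destruct (Nat.leb_spec L (n * n)); [|ring].
  f_equal. unfold d. rewrite Nat.max_l by lia. pose proof weight_L. destruct n as [|n]; [simpl in *; lia|].
  assert (0 < INR (S n)) by (apply lt_0_INR; lia).
  unfold wt. rewrite mult_INR, <- Rpower_mult_distr, <- Rpower_plus by auto. f_equal; ring.
Qed.

Lemma weight_supp n : (B <= n)%nat -> gw n = 0.
Proof.
  intros Hn. rewrite weight_eq. unfold g0. destruct (Nat.leb_spec L (n * n)); [|ring]. rewrite kernel_coef_supp; [ring|].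
  unfold B in Hn. pose proof (Nat.sqrt_spec ((r + 1) * L) ltac:(lia)). nia.
Qed.

Lemma weight_GL : 0 < GL.
Proof. apply Rmult_lt_0_compat; [apply pow_lt; pose proof weight_Lp; lra|apply Rpower_pos]. Qed.

Lemma weight_BV : BV gw B (4 ^ K * (4 * INR r + 10) * GL).
Proof.
  pose proof weight_GL. assert (H4 : 0 < 4 ^ K) by (apply pow_lt; lra). pose proof (pos_INR r).
  assert (Hdc : forall n, Rabs (d n * g0 L r n) <= GL).
  { intros n. pose proof (weight_d n). pose proof (weight_c n). rewrite Rabs_right by (apply Rle_ge, Rmult_le_pos; lra).
    unfold GL. rewrite Rmult_comm. apply Rmult_le_compat; lra. }
  assert (He : forall n, Rabs (e n) <= 4 ^ K) by (intros n; pose proof (weight_e n); rewrite Rabs_right; lra).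
  split; [|split; [|split]].
  - apply Rmult_le_pos; [apply Rmult_le_pos; lra|lra].
  - intros n. rewrite weight_eq, Rabs_mult. apply Rle_trans with (GL * 4 ^ K).
    apply Rmult_le_compat; auto; apply Rabs_pos.
    replace (GL * 4 ^ K) with (4 ^ K * 1 * GL) by ring. apply Rmult_le_compat_r; [lra|]. apply Rmult_le_compat_l; lra.
  - apply weight_supp.
  - rewrite (rsum_ext _ (fun n => Rabs ((fun n => d n * g0 L r n) (S n) * e (S n) - (fun n => d n * g0 L r n) n * e n))) by (intros; rewrite !weight_eq; auto).
    eapply Rle_trans; [apply (TV_mult (fun n => d n * g0 L r n) e GL (4 ^ K)); auto; [|apply weight_eTV]|].
    + apply (TV_mult d (g0 L r) (Rpower (INR L) (- s)) (INR L ^ (2 * p + 1))); [| |apply weight_dTV|apply weight_cTV].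
      intros n; pose proof (weight_d n); rewrite Rabs_right; lra. intros n; pose proof (weight_c n); rewrite Rabs_right; lra.
    + assert (Hp : 0 < 4 ^ K * GL) by (apply Rmult_lt_0_compat; lra).
      rewrite plus_INR. simpl (INR 1).
      replace ((Rpower (INR L) (- s) * INR L ^ (2 * p + 1) + Rpower (INR L) (- s) * (4 * (INR r + 1) * INR L ^ (2 * p + 1))) * 4 ^ K + GL * 4 ^ K)
        with ((4 * INR r + 6) * (4 ^ K * GL)) by (unfold GL; ring).
      replace (4 ^ K * (4 * INR r + 10) * GL) with ((4 * INR r + 10) * (4 ^ K * GL)) by ring.
      apply Rmult_le_compat_r; lra.
Qed.

Lemma weight_gw_ge0 n : 0 <= gw n.
Proof.
  rewrite weight_eq. pose proof (weight_d n). pose proof (weight_c n). pose proof (weight_e n). repeat apply Rmult_le_pos; lra.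
Qed.

(** One factor for each of [d], [g0] and [e]: from [n^2 < 2 L], from [kernel_coef_lower] with
    [l = L / r], and from [n^2 eta >= 1 / (8 (r + 1))]. *)
Let c0 := Rpower 2 (- s) * (/ INR r) ^ (2 * p + 1) * (/ (16 * INR (r + 1) ^ 2)) ^ K.

Lemma weight_r : 2 <= INR r. Proof. change 2 with (INR 2). apply le_INR. unfold r. lia. Qed.

Lemma weight_c0 : 0 < c0.
Proof.
  pose proof weight_r. unfold c0. apply Rmult_lt_0_compat; [apply Rmult_lt_0_compat|].
  - apply Rpower_pos.
  - apply pow_lt, Rinv_0_lt_compat; lra.
  - apply pow_lt, Rinv_0_lt_compat. rewrite plus_INR. simpl (INR 1). nra.
Qed.

(** As [(8 r H)^2 = 2 L], the window puts [n^2 - L] between [(r - 1) L / r] and [L], which is the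
    range of [kernel_coef_lower] because [2 p + 1 = r - 1]. *)
Lemma weight_low n : (8 * r * H - 2 * H <= n < 8 * r * H)%nat -> c0 * GL <= gw n.
Proof.
  intros Hn. pose proof weight_L as HL. pose proof weight_Lp as HLp. pose proof weight_r as Hr.
  assert (H8 : (L + (2 * p + 1) * (32 * r * (H * H)) <= n * n)%nat).
  { assert (E : (L + (2 * p + 1) * (32 * r * (H * H)) = 64 * r * r * (H * H) - 32 * r * (H * H))%nat).
    { unfold L. replace (2 * p + 1)%nat with (r - 1)%nat by (unfold r; lia). nia. }
    rewrite E. assert ((8 * r * H - 2 * H) * (8 * r * H - 2 * H) <= n * n)%nat by (apply Nat.mul_le_mono; lia). nia. }
  assert (H9 : (n * n < 2 * L)%nat).
  { assert (n * n < (8 * r * H) * (8 * r * H))%nat by (apply Nat.mul_lt_mono; lia). unfold L. nia. }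
  assert (HrL : INR (32 * r * (H * H)) = / INR r * INR L).
  { unfold L. rewrite !mult_INR. field. lra. }
  assert (Hc : (/ INR r * INR L) ^ (2 * p + 1) <= g0 L r n).
  { unfold g0. destruct (Nat.leb_spec L (n * n)); [|lia]. rewrite <- HrL.
    replace r with (S (2 * p + 1)) at 2 by (unfold r; lia). apply kernel_coef_lower; [unfold L, r; nia|lia]. }
  assert (Hd : Rpower 2 (- s) * Rpower (INR L) (- s) <= d n).
  { rewrite Rpower_mult_distr by lra. apply Rpower_neg_anti; [lra|]. rewrite Nat.max_l by lia.
    split; [apply lt_0_INR; lia|]. replace 2 with (INR 2) by (simpl; ring). rewrite <- mult_INR. apply le_INR; lia. }
  assert (Hr1 : INR (r + 1) = INR r + 1) by (rewrite plus_INR; auto).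
  assert (He : (/ (16 * INR (r + 1) ^ 2)) ^ K <= e n).
  { unfold e. apply pow_incr. split; [left; apply Rinv_0_lt_compat; rewrite Hr1; nra|].
    set (u := INR (n * n) * eta).
    assert (Hu1 : u <= 1 / 2).
    { apply weight_phase. unfold B. assert (8 * r * H <= Nat.sqrt ((r + 1) * L))%nat; [|lia]. apply Nat.sqrt_le_square. unfold L. nia. }
    assert (Hu0 : / (8 * INR (r + 1)) <= u).
    { unfold u, eta. apply Rle_trans with (INR L * / (8 * INR (r + 1) * INR L)).
      - right; field; lra.
      - apply Rmult_le_compat_r; [left; apply weight_eta|]. apply le_INR; lia. }
    assert (0 < / (8 * INR (r + 1))) by (apply Rinv_0_lt_compat; lra).
    assert (Hsn : u <= Rabs (sin (PI * u))) by (rewrite <- (Rabs_right u) at 1 by lra; apply sin_pi_ge; rewrite Rabs_right; lra).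
    rewrite (Rmult_assoc PI). fold u. rewrite <- (pow2_abs (sin (PI * u))).
    apply Rle_trans with (4 * (/ (8 * INR (r + 1))) ^ 2); [right; field; lra|].
    apply Rmult_le_compat_l; [lra|]. apply pow_incr. lra. }
  rewrite weight_eq. unfold c0, GL.
  replace (Rpower 2 (- s) * (/ INR r) ^ (2 * p + 1) * (/ (16 * INR (r + 1) ^ 2)) ^ K * (INR L ^ (2 * p + 1) * Rpower (INR L) (- s)))
    with ((Rpower 2 (- s) * Rpower (INR L) (- s)) * (/ INR r * INR L) ^ (2 * p + 1) * (/ (16 * INR (r + 1) ^ 2)) ^ K) by (rewrite Rpow_mult_distr; ring).
  pose proof (Rpower_pos 2 (- s)). pose proof (Rpower_pos (INR L) (- s)).
  assert (0 < / INR r) by (apply Rinv_0_lt_compat; lra).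
  assert (0 <= (/ INR r * INR L) ^ (2 * p + 1)) by (apply pow_le; nra).
  assert (0 <= (/ (16 * INR (r + 1) ^ 2)) ^ K) by (apply pow_le; left; apply Rinv_0_lt_compat; rewrite Hr1; nra).
  apply Rmult_le_compat; auto. apply Rmult_le_pos; nra. apply Rmult_le_compat; auto. nra.
Qed.

Let CV := 4 ^ K * (4 * INR r + 10).
(** Chosen so that [q * harm q <= kapc * H] makes the non-resonant error at most half of the main
    term; the minimum with 1 ensures [q <= H]. *)
Let kapc := Rmin 1 (c0 ^ 2 / (24 * CV ^ 2 * (32 * INR r ^ 2 + 4))).

Lemma weight_CV : 0 < CV.
Proof. pose proof weight_r. apply Rmult_lt_0_compat; [apply pow_lt; lra|lra]. Qed.

Lemma weight_A2_lower q a : (1 <= q)%nat -> Nat.Odd q -> Z.gcd a (Z.of_nat q) = 1%Z ->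
  INR q * harm q <= kapc * INR H ->
  / 2 * (c0 ^ 2 * GL ^ 2 * INR H ^ 2 / INR q) <= A2 gw B (IZR a / INR q).
Proof.
  intros Hq Ho Hg Hk. pose proof weight_c0 as Hc0. pose proof weight_GL as HGL. pose proof weight_CV as HCV. pose proof weight_r as Hr.
  assert (Hqp : 1 <= INR q) by (apply (le_INR 1); auto). pose proof (harm_ge1 q Hq) as Hh.
  assert (HHp : 1 <= INR H) by (apply (le_INR 1); auto).
  assert (HqH : (q <= H)%nat).
  { apply INR_le. pose proof (Rmin_l 1 (c0 ^ 2 / (24 * CV ^ 2 * (32 * INR r ^ 2 + 4)))). fold kapc in H0. nra. }
  assert (HB8 : (8 * r * H < B)%nat).
  { unfold B. assert (8 * r * H <= Nat.sqrt ((r + 1) * L))%nat; [|lia]. apply Nat.sqrt_le_square. unfold L. nia. }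
  pose proof (quadratic_sum_lower gw B (CV * GL) q a H (8 * r * H - 2 * H) (c0 * GL) weight_BV weight_gw_ge0 Hq Ho Hg HqH) as Hl.
  specialize (Hl ltac:(unfold r in *; nia) ltac:(nra)).
  specialize (Hl ltac:(intros n Hn; apply weight_low; unfold r in *; nia)).
  eapply Rle_trans; [|apply Hl].
  assert (HBu : (B <= 16 * (r * r) * H)%nat).
  { pose proof weight_B2 as HB2. assert (2 <= r)%nat by (unfold r; lia).
    assert (HX : (B * B <= (16 * (r * r) * H) * (16 * (r * r) * H))%nat).
    { eapply Nat.le_trans; [apply HB2|]. unfold L.
      replace (4 * ((r + 1) * (32 * r * r * (H * H))))%nat with (128 * (r * r * (H * H)) * (r + 1))%nat by ring.
      replace (16 * (r * r) * H * (16 * (r * r) * H))%nat with (128 * (r * r * (H * H)) * (2 * (r * r)))%nat by ring.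
      apply Nat.mul_le_mono_l. nia. }
    nia. }
  assert (Hsum : INR (2 * B + 1) + INR q <= (32 * INR r ^ 2 + 4) * INR H).
  { replace ((32 * INR r ^ 2 + 4) * INR H) with (INR ((32 * (r * r) + 4) * H)) by (rewrite mult_INR, plus_INR, !mult_INR; simpl; ring).
    rewrite <- plus_INR. apply le_INR. nia. }
  set (D := 32 * INR r ^ 2 + 4) in *. assert (HD : 0 < D) by (unfold D; nra).
  assert (Hk2 : kapc * (24 * CV ^ 2 * D) <= c0 ^ 2).
  { assert (0 < 24 * CV ^ 2 * D) by (apply Rmult_lt_0_compat; auto; nra).
    apply Rle_div_r; auto. unfold kapc. apply Rmin_r. }
  (* the error term is at most half of the main term *)
  assert (Herr : 12 * (CV * GL) ^ 2 * ((INR (2 * B + 1) + INR q) * harm q) <= / 2 * (c0 ^ 2 * GL ^ 2 * INR H ^ 2 / INR q)).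
  { apply Rle_trans with (12 * (CV * GL) ^ 2 * (D * INR H * harm q)).
    - apply Rmult_le_compat_l; [nra|]. apply Rmult_le_compat_r; lra.
    - apply Rmult_le_reg_r with (INR q); [lra|].
      replace (/ 2 * (c0 ^ 2 * GL ^ 2 * INR H ^ 2 / INR q) * INR q) with (/ 2 * GL ^ 2 * INR H * (c0 ^ 2 * INR H)) by (field; lra).
      replace (12 * (CV * GL) ^ 2 * (D * INR H * harm q) * INR q) with (/ 2 * GL ^ 2 * INR H * ((24 * CV ^ 2 * D) * (INR q * harm q))) by field.
      apply Rmult_le_compat_l; [apply Rmult_le_pos; nra|].
      apply Rle_trans with ((24 * CV ^ 2 * D) * (kapc * INR H)).
      + apply Rmult_le_compat_l; [apply Rmult_le_pos; nra|auto].
      + rewrite <- Rmult_assoc, (Rmult_comm (24 * CV ^ 2 * D)). apply Rmult_le_compat_r; lra. }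
  replace ((c0 * GL) ^ 2) with (c0 ^ 2 * GL ^ 2) by ring. lra.
Qed.

(** The phases 0 and [- PI / 2] recover the modulus. Both [1 / L] and [eta] are at most [1 / H^2],
    so the blur [1 / L + K eta] is at most [(K + 1) / H^2]. *)
Lemma weight_A2_upper bet x0 C N a b y : 0 < C -> locpoly s bet x0 C N 0 a -> locpoly s bet x0 C N (- (PI / 2)) b ->
  0 < bet <= 2 * INR p -> (N <= K)%nat -> (K <= H)%nat -> Rabs (y - x0) <= 1 / 2 ->
  A2 gw B y <= 8 * (4 ^ K * C) ^ 2 * (INR L ^ (2 * p + 1)) ^ 2 * Rpower (INR (S K) / INR H ^ 2 + Rabs (y - x0)) (2 * bet).
Proof.
  intros HC Ha Hb Hbet HN HKH Hy. pose proof weight_L as HL. pose proof weight_Lp as HLp. pose proof weight_eta as He.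
  assert (HHp : 1 <= INR H) by (apply (le_INR 1); auto).
  assert (HLH : INR H ^ 2 <= INR L).
  { rewrite <- pow_INR. apply le_INR. unfold L, r. simpl. nia. }
  assert (HeL : eta <= / INR L).
  { unfold eta. apply Rinv_le_contravar; [lra|]. pose proof weight_r. rewrite plus_INR. simpl (INR 1). nra. }
  assert (HeH : / INR L <= / INR H ^ 2) by (apply Rinv_le_contravar; [nra|auto]).
  assert (HKe : INR K * eta <= 1 / 2).
  { assert (INR K <= INR H) by (apply le_INR; auto). pose proof (pos_INR K).
    assert (HL2 : 2 * INR H <= INR L).
    { replace 2 with (INR 2) by (simpl; ring). rewrite <- mult_INR. apply le_INR. unfold L, r. nia. }
    apply Rle_trans with (INR H * / INR L); [apply Rmult_le_compat; lra|].
    apply Rle_div_l; lra. }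
  set (E := Rpower (INR (S K) / INR H ^ 2 + Rabs (y - x0)) bet).
  assert (HU : forall ph c, locpoly s bet x0 C N ph c -> Rabs (FP gw B ph y) <= 2 * (4 ^ K * C) * INR L ^ (2 * p + 1) * E).
  { intros ph c Hc.
    pose proof (transform_upper s bet x0 C N ph c L p K eta y Hs HC Hc HL Hbet HN (Rlt_le _ _ He) ltac:(lra)) as Ht.
    rewrite (iter_diff2_ext K eta _ (fun y => / 2 * FP (fun n => wt s n * g0 L r n) (S (S r * L)) ph y)) in Ht by (intros v; apply Ker_transform; auto).
    rewrite iter_diff2_scal, iter_diff2_FP in Ht.
    assert (EF : FP (fun n => wt s n * g0 L r n * (- (4 * sin (PI * INR (n * n) * eta) ^ 2)) ^ K) (S (S r * L)) ph y = (-1) ^ K * FP gw B ph y).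
    { rewrite <- (FP_supp gw B (S (S r * L))).
      - unfold FP. rewrite <- rsum_scal. apply rsum_ext. intros n _. unfold gw.
        replace (- (4 * sin (PI * INR (n * n) * eta) ^ 2)) with ((-1) * (4 * sin (PI * INR (n * n) * eta) ^ 2)) by ring.
        rewrite (Rpow_mult_distr (-1)). ring.
      - unfold B. pose proof (Nat.sqrt_le_lin ((r + 1) * L)). nia.
      - apply weight_supp. }
    rewrite EF in Ht. rewrite !Rabs_mult, pow_1_abs, Rmult_1_l, (Rabs_right (/ 2)) in Ht by lra.
    assert (HE : Rpower (/ INR L + (Rabs (y - x0) + INR K * eta)) bet <= E).
    { assert (0 < / INR L) by (apply Rinv_0_lt_compat; lra). pose proof (Rabs_pos (y - x0)). pose proof (pos_INR K).
      assert (0 <= INR K * eta) by (apply Rmult_le_pos; lra).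
      apply Rle_Rpower_l; [lra|]. split; [lra|]. rewrite S_INR. unfold Rdiv. rewrite Rmult_plus_distr_r.
      assert (INR K * eta <= INR K * / INR H ^ 2) by (apply Rmult_le_compat_l; lra). lra. }
    assert (0 < 4 ^ K) by (apply pow_lt; lra). assert (0 < INR L ^ (2 * p + 1)) by (apply pow_lt; lra).
    assert (4 ^ K * (C * INR L ^ (2 * p + 1) * Rpower (/ INR L + (Rabs (y - x0) + INR K * eta)) bet) <= 4 ^ K * (C * INR L ^ (2 * p + 1) * E)).
    { apply Rmult_le_compat_l; [lra|]. apply Rmult_le_compat_l; auto. apply Rmult_le_pos; lra. }
    change (2 * S p)%nat with r in Ht. lra. }
  rewrite A2_FP.
  assert (Hsq : forall x M, Rabs x <= M -> x ^ 2 <= M ^ 2).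
  { intros x M Hx. rewrite <- pow2_abs. apply pow_incr. split; [apply Rabs_pos|auto]. }
  pose proof (Hsq _ _ (HU _ _ Ha)). pose proof (Hsq _ _ (HU _ _ Hb)).
  replace (Rpower (INR (S K) / INR H ^ 2 + Rabs (y - x0)) (2 * bet)) with (E ^ 2).
  2:{ unfold E. rewrite <- Rpower_pow by apply Rpower_pos. rewrite Rpower_mult. f_equal. simpl; ring. }
  nra.
Qed.

End Weights.

(** The lower bound at [a/q] is set against the upper bound that regularity at [x0] imposes. The
    kernel factor [L^(2 (2 p + 1))] is common to both and cancels; with [L] proportional to [H^2]
    the rest is a relation between [H], [q] and the distance. *)
Lemma holder_core s bet x0 : 1 / 2 < s -> 0 < bet -> Holder_at bet (Riemann_fn s) x0 ->
  exists kap C D H0, 0 < kap /\ 0 < C /\ 0 < D /\ forall H q a, (H0 <= H)%nat -> (1 <= q)%nat -> Nat.Odd q ->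
    Z.gcd a (Z.of_nat q) = 1%Z -> INR q * harm q <= kap * INR H -> Rabs (IZR a / INR q - x0) <= 1 / 2 ->
    Rpower (INR H) (2 - 4 * s) / INR q <= C * Rpower (D / INR H ^ 2 + Rabs (IZR a / INR q - x0)) (2 * bet).
Proof.
  intros Hs Hb Hh. destruct (Holder_real s bet x0 Hs Hb Hh) as (N & C & c1 & c2 & HC & H1 & H2).
  destruct (nfloor_ex bet) as [p0 Hp0]; [lra|]. set (p := S p0).
  assert (Hp : 0 < bet <= 2 * INR p) by (unfold p; rewrite S_INR; pose proof (pos_INR p0); lra).
  set (r := (2 * S p)%nat). set (K := N).
  set (c0 := Rpower 2 (- s) * (/ INR r) ^ (2 * p + 1) * (/ (16 * INR (r + 1) ^ 2)) ^ K).
  assert (Hc0 : 0 < c0) by (apply (weight_c0 s p K 1); auto).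
  set (CV := 4 ^ K * (4 * INR r + 10)). assert (HCV : 0 < CV) by (apply (weight_CV p K 1); auto).
  assert (Hr : 2 <= INR r) by (apply (weight_r p 1); auto).
  set (kap := Rmin 1 (c0 ^ 2 / (24 * CV ^ 2 * (32 * INR r ^ 2 + 4)))).
  set (RR := Rpower (32 * INR r * INR r) (-2 * s)). assert (HRR : 0 < RR) by apply Rpower_pos.
  assert (H4 : 0 < 4 ^ K) by (apply pow_lt; lra).
  exists kap, (16 * (4 ^ K * C) ^ 2 / (c0 ^ 2 * RR)), (INR (S K)), (S K).
  assert (Hden : 0 < c0 ^ 2 * RR) by (apply Rmult_lt_0_compat; auto; apply pow_lt; auto).
  split; [|split; [|split]].
  - unfold kap. apply Rmin_glb_lt; [lra|]. apply Rdiv_lt_0_compat; [apply pow_lt; auto|].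
    repeat apply Rmult_lt_0_compat; try nra.
  - apply Rdiv_lt_0_compat; auto. apply Rmult_lt_0_compat; [lra|]. apply pow_lt. nra.
  - apply lt_0_INR; lia.
  - intros H q a HH Hq Ho Hg Hk Hx.
    assert (HH1 : (1 <= H)%nat) by lia. assert (HHp : 1 <= INR H) by (apply (le_INR 1); auto).
    assert (Hqp : 1 <= INR q) by (apply (le_INR 1); auto).
    pose proof (weight_A2_lower s p K H Hs HH1 q a Hq Ho Hg Hk) as Hlo.
    pose proof (weight_A2_upper s p K H Hs HH1 bet x0 C N c1 c2 (IZR a / INR q) HC H1 H2 Hp (le_n _) ltac:(lia) Hx) as Hup.
    pose proof (Rle_trans _ _ _ Hlo Hup) as Hc.
    fold r in Hc. fold c0 in Hc.
    set (L := (32 * r * r * (H * H))%nat) in *.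
    assert (HL : INR L = 32 * INR r * INR r * (INR H * INR H)) by (unfold L; rewrite !mult_INR; simpl; ring).
    assert (HLp : 0 < INR L) by (rewrite HL; repeat apply Rmult_lt_0_compat; lra).
    set (E := Rpower (INR (S K) / INR H ^ 2 + Rabs (IZR a / INR q - x0)) (2 * bet)) in *.
    set (LP := INR L ^ (2 * p + 1)) in *. assert (HLP : 0 < LP) by (apply pow_lt; auto).
    assert (EL : Rpower (INR L) (- s) ^ 2 * INR H ^ 2 = RR * Rpower (INR H) (2 - 4 * s)).
    { rewrite <- Rpower_pow by apply Rpower_pos. rewrite Rpower_mult. replace (- s * INR 2) with (-2 * s) by (simpl; ring).
      rewrite HL. rewrite <- !(Rpower_mult_distr (32 * INR r * INR r)) by nra. fold RR.
      rewrite <- Rpower_mult_distr by lra. rewrite <- (Rpower_pow 2) by lra. simpl (INR 2).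
      rewrite !Rmult_assoc, <- !Rpower_plus. f_equal. f_equal. ring. }
    replace (/ 2 * (c0 ^ 2 * (LP * Rpower (INR L) (- s)) ^ 2 * INR H ^ 2 / INR q)) with
      (LP ^ 2 * (/ 2 * (c0 ^ 2 * RR) * (Rpower (INR H) (2 - 4 * s) / INR q))) in Hc.
    2:{ replace (/ 2 * (c0 ^ 2 * (LP * Rpower (INR L) (- s)) ^ 2 * INR H ^ 2 / INR q)) with
         (/ 2 * c0 ^ 2 * LP ^ 2 * (Rpower (INR L) (- s) ^ 2 * INR H ^ 2) / INR q) by (field; lra). rewrite EL. field; lra. }
    replace (8 * (4 ^ K * C) ^ 2 * LP ^ 2 * E) with (LP ^ 2 * (8 * (4 ^ K * C) ^ 2 * E)) in Hc by ring.
    apply Rmult_le_reg_l in Hc; [|apply pow_lt; auto].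
    apply Rmult_le_reg_l with (c0 ^ 2 * RR); auto.
    replace (c0 ^ 2 * RR * (16 * (4 ^ K * C) ^ 2 / (c0 ^ 2 * RR) * E)) with (16 * (4 ^ K * C) ^ 2 * E) by (field; lra).
    lra.
Qed.

Lemma harm_Rpower eps : 0 < eps -> exists M, 0 < M /\ forall n, (1 <= n)%nat -> harm n <= M * Rpower (INR n) eps.
Proof.
  intros He. destruct (poly_pw 1 eps He) as (M & HM & H). exists (2 * M). split; [lra|]. intros n Hn.
  destruct (Nat.log2_spec n ltac:(lia)) as [L1 L2]. set (k := Nat.log2 n) in *.
  eapply Rle_trans; [apply (harm_mono _ (2 ^ S k)); lia|]. eapply Rle_trans; [apply harm_pow2|].
  specialize (H k). rewrite pow_1 in H.
  apply Rle_trans with (2 * INR (S k)). rewrite (S_INR (S k)). assert (1 <= INR (S k)) by (apply (le_INR 1); lia). lra.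
  rewrite Rmult_assoc. apply Rmult_le_compat_l; [lra|]. eapply Rle_trans; [apply H|]. apply Rmult_le_compat_l; [lra|].
  rewrite <- Rpower_2k. apply Rle_Rpower_l; [lra|]. split; [apply lt_0_INR|apply le_INR; auto].
  assert (2 ^ k <> 0)%nat by (apply Nat.pow_nonzero; lia). lia.
Qed.

(* Only odd denominators are allowed because Gauss sums vanish when [q = 2 mod 4]. *)
Definition approx (tau x : R) : Prop :=
  forall Q0 : nat, exists (Q : nat) (a : Z) (q : nat), (Q0 <= Q)%nat /\ (1 <= q <= 2 * Q)%nat /\ Nat.Odd q /\
    Z.gcd a (Z.of_nat q) = 1%Z /\ Rabs (IZR a / INR q - x) <= Rpower (INR Q) (- tau).

Lemma Rpower_unbounded e M : 0 < e -> exists Q0 : nat, forall Q, (Q0 <= Q)%nat -> M < Rpower (INR Q) e.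
Proof.
  intros He. set (x := Rpower (Rmax M 1) (/ e)). assert (Hx : 0 < x) by apply Rpower_pos.
  destruct (nfloor_ex x) as [n Hn]; [lra|]. exists (S n). intros Q HQ.
  assert (x < INR Q). { apply le_INR in HQ. rewrite S_INR in HQ. lra. }
  eapply Rle_lt_trans; [apply (Rmax_l M 1)|]. pose proof (Rmax_r M 1).
  replace (Rmax M 1) with (Rpower x e). apply Rlt_Rpower_l; lra.
  unfold x. rewrite Rpower_mult, Rinv_l by lra. apply Rpower_1. lra.
Qed.

(** With [H] of order [Q^th], the core inequality becomes [Q^ex <= BIG] for arbitrarily large [Q],
    with [ex > 0]. *)
Lemma Holder_at_approx s tau bet x : 1 / 2 < s -> 2 <= tau -> approx tau x -> s - 1 / 2 + / (2 * tau) < bet ->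
  ~ Holder_at bet (Riemann_fn s) x.
Proof.
  intros Hs Ht Hap Hb Hh.
  assert (Hti : 0 < / (2 * tau)) by (apply Rinv_0_lt_compat; lra).
  destruct (holder_core s bet x Hs ltac:(lra) Hh) as (kap & C & D & H0 & Hk & HC & HD & Hcore).
  set (dd := bet - (s - 1 / 2 + / (2 * tau))). assert (Hdd : 0 < dd) by (unfold dd; lra).
  (* [th > tau / 2] gives [1 / H^2 <= Q^(-tau)], and [th >= 1 + eps] lets [H] dominate [q * harm q]
     even if [tau = 2]. The excess in [th] costs [eps * tau * (2 s - 1) = tau * dd], half of the
     gain [2 * tau * dd], so [ex = tau * dd] remains. *)
  set (eps := dd / (2 * s - 1)). assert (Heps : 0 < eps) by (apply Rdiv_lt_0_compat; lra).
  set (th := tau * (1 + eps) / 2). assert (Hth : 1 + eps <= th) by (unfold th; nra).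
  destruct (harm_Rpower (eps / 2)) as (M & HM & Hharm); [lra|].
  set (ex := tau * dd). assert (Hex : 0 < ex) by (unfold ex; nra).
  set (BIG := C * Rpower (D + 1) (2 * bet) * 2 * Rpower 2 (4 * s - 2)).
  destruct (Rpower_unbounded ex BIG Hex) as [Q1 HQ1].
  destruct (Rpower_unbounded (eps / 2) (2 * M * Rpower 2 (eps / 2) / kap) ltac:(lra)) as [Q2 HQ2].
  destruct (Rpower_unbounded th (INR H0) ltac:(lra)) as [Q3 HQ3].
  destruct (Hap (2 + Q1 + Q2 + Q3)%nat) as (Q & a & q & HQ & Hq & Ho & Hg & Hx).
  specialize (HQ1 Q ltac:(lia)). specialize (HQ2 Q ltac:(lia)). specialize (HQ3 Q ltac:(lia)).
  assert (HQp : 2 <= INR Q) by (apply (le_INR 2); lia).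
  set (X := Rpower (INR Q) th). assert (HX : 1 <= X).
  { unfold X. rewrite <- (Rpower_O (INR Q)) by lra. apply Rle_Rpower; lra. }
  destruct (nfloor_ex X) as [n Hn]; [lra|]. set (H := S n).
  assert (HH : X <= INR H <= 2 * X) by (unfold H; rewrite S_INR; lra).
  assert (Hqp : 1 <= INR q) by (apply (le_INR 1); lia).
  assert (HqQ : INR q <= 2 * INR Q) by (replace 2 with (INR 2) by (simpl; ring); rewrite <- mult_INR; apply le_INR; lia).
  specialize (Hcore H q a).
  assert (HQt : Rpower (INR Q) (- tau) <= 1 / 2).
  { apply Rle_trans with (Rpower (INR Q) (- (1))); [apply Rle_Rpower; lra|]. rewrite Rpower_Ropp, Rpower_1 by lra.
    apply Rle_trans with (/ 2); [apply Rinv_le_contravar; lra|lra]. }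
  assert (Hc := Hcore). specialize (Hc ltac:(apply INR_le; apply Rlt_le, Rlt_le_trans with X; [exact HQ3|lra]) ltac:(lia) Ho Hg). clear Hcore.
  assert (Hkap : INR q * harm q <= kap * INR H).
  { assert (Hhq : harm q <= M * (Rpower 2 (eps / 2) * Rpower (INR Q) (eps / 2))).
    { eapply Rle_trans; [apply Hharm; lia|]. apply Rmult_le_compat_l; [lra|]. rewrite Rpower_mult_distr by lra. apply Rle_Rpower_l; lra. }
    pose proof (Rpower_pos 2 (eps / 2)). pose proof (Rpower_pos (INR Q) (eps / 2)). pose proof (harm_ge0 q).
    apply Rle_trans with (2 * INR Q * (M * (Rpower 2 (eps / 2) * Rpower (INR Q) (eps / 2)))); [apply Rmult_le_compat; lra|].
    apply Rle_trans with (kap * (INR Q * (Rpower (INR Q) (eps / 2) * Rpower (INR Q) (eps / 2)))).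
    - assert (E : 2 * M * Rpower 2 (eps / 2) <= kap * Rpower (INR Q) (eps / 2)).
      { apply Rlt_le in HQ2. apply Rle_div_l in HQ2; auto. lra. }
      replace (2 * INR Q * (M * (Rpower 2 (eps / 2) * Rpower (INR Q) (eps / 2)))) with (INR Q * Rpower (INR Q) (eps / 2) * (2 * M * Rpower 2 (eps / 2))) by ring.
      replace (kap * (INR Q * (Rpower (INR Q) (eps / 2) * Rpower (INR Q) (eps / 2)))) with (INR Q * Rpower (INR Q) (eps / 2) * (kap * Rpower (INR Q) (eps / 2))) by ring.
      apply Rmult_le_compat_l; auto. nra.
    - apply Rmult_le_compat_l; [lra|]. rewrite <- Rpower_plus. rewrite <- (Rpower_1 (INR Q)) at 1 by lra.
      rewrite <- Rpower_plus. apply Rle_trans with X; [|lra]. apply Rle_Rpower; lra. }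
  specialize (Hc Hkap ltac:(lra)).
  assert (HXt : / INR H ^ 2 <= Rpower (INR Q) (- tau)).
  { rewrite Rpower_Ropp. apply Rinv_le_contravar; [apply Rpower_pos|].
    apply Rle_trans with (X ^ 2); [|apply pow_incr; lra]. unfold X. rewrite <- Rpower_pow by apply Rpower_pos.
    rewrite Rpower_mult. apply Rle_Rpower; [lra|]. simpl (INR 2). unfold th. nra. }
  assert (Hr : D / INR H ^ 2 + Rabs (IZR a / INR q - x) <= (D + 1) * Rpower (INR Q) (- tau)).
  { rewrite Rmult_plus_distr_r, Rmult_1_l. apply Rplus_le_compat; auto. apply Rmult_le_compat_l; lra. }
  assert (Hhp : 0 < INR H) by lra.
  assert (Hc2 : Rpower (2 * X) (2 - 4 * s) / (2 * INR Q) <= C * (Rpower (D + 1) (2 * bet) * Rpower (INR Q) (- tau * (2 * bet)))).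
  { eapply Rle_trans; [|eapply Rle_trans; [apply Hc|]].
    - unfold Rdiv. apply Rmult_le_compat; [left; apply Rpower_pos|left; apply Rinv_0_lt_compat; lra| |apply Rinv_le_contravar; lra].
      apply Rpower_neg_anti; lra.
    - apply Rmult_le_compat_l; [lra|]. rewrite <- (Rpower_mult (INR Q) (- tau) (2 * bet)), Rpower_mult_distr by (try apply Rpower_pos; lra).
      apply Rle_Rpower_l; [lra|]. split; auto. pose proof (Rabs_pos (IZR a / INR q - x)).
      assert (0 < D / INR H ^ 2) by (apply Rdiv_lt_0_compat; auto; apply pow_lt; auto). lra. }
  rewrite <- Rpower_mult_distr in Hc2 by lra.
  unfold X in Hc2. rewrite Rpower_mult in Hc2.
  assert (Eexp : ex = th * (2 - 4 * s) - 1 + tau * (2 * bet)).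
  { unfold ex, th. replace bet with (dd + (s - 1 / 2 + / (2 * tau))) by (unfold dd; ring). unfold eps. field. lra. }
  assert (E1 : Rpower (INR Q) ex = Rpower (INR Q) (th * (2 - 4 * s)) * / INR Q * Rpower (INR Q) (tau * (2 * bet))).
  { rewrite Eexp. unfold Rminus at 1. rewrite !Rpower_plus, Rpower_Ropp, Rpower_1 by lra. ring. }
  assert (E2 : Rpower (INR Q) (- tau * (2 * bet)) * Rpower (INR Q) (tau * (2 * bet)) = 1).
  { rewrite <- Rpower_plus. replace (- tau * (2 * bet) + tau * (2 * bet)) with 0 by ring. apply Rpower_O; lra. }
  assert (E3 : Rpower 2 (2 - 4 * s) * Rpower 2 (4 * s - 2) = 1).
  { rewrite <- Rpower_plus. replace (2 - 4 * s + (4 * s - 2)) with 0 by ring. apply Rpower_O; lra. }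
  assert (Rpower (INR Q) ex <= BIG); [|lra].
  pose proof (Rpower_pos (INR Q) (tau * (2 * bet))) as P1. pose proof (Rpower_pos 2 (4 * s - 2)) as P2.
  apply Rmult_le_compat_r with (r := Rpower (INR Q) (tau * (2 * bet)) * Rpower 2 (4 * s - 2) * 2) in Hc2; [|nra].
  rewrite E1. unfold BIG.
  replace (Rpower 2 (2 - 4 * s) * Rpower (INR Q) (th * (2 - 4 * s)) / (2 * INR Q) * (Rpower (INR Q) (tau * (2 * bet)) * Rpower 2 (4 * s - 2) * 2))
   with ((Rpower 2 (2 - 4 * s) * Rpower 2 (4 * s - 2)) * (Rpower (INR Q) (th * (2 - 4 * s)) * / INR Q * Rpower (INR Q) (tau * (2 * bet)))) in Hc2 by (field; lra).
  rewrite E3, Rmult_1_l in Hc2. eapply Rle_trans; [apply Hc2|]. right.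
  replace (C * (Rpower (D + 1) (2 * bet) * Rpower (INR Q) (- tau * (2 * bet))) * (Rpower (INR Q) (tau * (2 * bet)) * Rpower 2 (4 * s - 2) * 2))
   with (C * Rpower (D + 1) (2 * bet) * 2 * Rpower 2 (4 * s - 2) * (Rpower (INR Q) (- tau * (2 * bet)) * Rpower (INR Q) (tau * (2 * bet)))) by ring.
  rewrite E2. ring.
Qed.

Lemma exponent_le_approx s tau x : 1 / 2 < s -> 2 <= tau -> approx tau x ->
  Rbar_le (holder_exponent (Riemann_fn s) x) (s - 1 / 2 + / (2 * tau)).
Proof.
  intros Hs Ht Ha. apply (proj2 (Rbar_lub_spec _)). intros z (al & -> & Hh). simpl.
  destruct (Rle_dec al (s - 1 / 2 + / (2 * tau))) as [|Hn]; auto. exfalso.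
  apply (Holder_at_approx s tau al x Hs Ht Ha); auto. lra.
Qed.

(** * Null sets and coverings *)

Definition thin (U : R -> Prop) (r : R) : Prop := forall x y, U x -> U y -> Rabs (x - y) <= r.

Lemma diam_le U r : 0 <= r -> thin U r -> exists d, diam U = Finite d /\ 0 <= d <= r.
Proof.
  intros Hr HU. unfold diam. set (E := fun z : Rbar => _). destruct (Rbar_lub_spec E) as [H1 H2].
  assert (Hl : Rbar_le 0 (Rbar_lub E)) by (apply H1; left; auto).
  assert (Hu : Rbar_le (Rbar_lub E) r).
  { apply H2. intros z [->|(x & y & Hx & Hy & ->)]; simpl; auto. }
  destruct (Rbar_lub E) as [d| |]; simpl in *; try contradiction. exists d; auto.
Qed.

Lemma diam_thin U dl : Rbar_le (diam U) (Finite dl) -> exists d, diam U = Finite d /\ 0 <= d <= dl /\ thin U d.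
Proof.
  unfold diam. set (E := fun z : Rbar => _). destruct (Rbar_lub_spec E) as [H1 H2]. intros Hu.
  assert (Hl : Rbar_le 0 (Rbar_lub E)) by (apply H1; left; auto).
  assert (Ht : forall x y, U x -> U y -> Rbar_le (Rabs (x - y)) (Rbar_lub E)).
  { intros x y Hx Hy. apply H1. right. exists x, y; auto. }
  destruct (Rbar_lub E) as [d| |]; simpl in *; try contradiction. exists d; split; auto.
Qed.

Lemma dpow_ge0 d t : 0 <= dpow d t.
Proof. unfold dpow. destruct Req_EM_T. destruct Req_EM_T; lra. left; apply Rpower_pos. Qed.

Lemma Lim_seq_ge_partial (a : nat -> R) N : (forall n, 0 <= a n) -> Rbar_le (rsum a N) (Lim_seq (sum_n a)).
Proof.
  intros Ha. rewrite <- (Lim_seq_const (rsum a N)). apply Lim_seq_le_loc. exists N. intros n Hn.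
  rewrite rsum_sum_n. apply rsum_mono; auto.
Qed.

(** Vanishing of the Hausdorff measure in real terms: radii instead of [diam], bounded partial sums
    instead of a limit. Radius 0 is allowed and costs 0, so finite covers can be padded. *)
Definition null_cover (t : R) (E : R -> Prop) : Prop :=
  forall eps del, 0 < eps -> 0 < del -> exists (U : nat -> R -> Prop) (r : nat -> R),
    (forall i, 0 <= r i <= del) /\ (forall i, thin (U i) (r i)) /\ (forall x, E x -> exists i, U i x) /\
    (forall N, rsum (fun i => rpow (r i) t) N <= eps).

Lemma rpow_pos_eq x t : 0 < x -> rpow x t = Rpower x t.
Proof. intros; unfold rpow. destruct Rle_dec; auto; lra. Qed.

Lemma rpow_mono x y t : 0 <= t -> 0 <= x <= y -> rpow x t <= rpow y t.
Proof.
  intros Ht Hxy. unfold rpow. destruct (Rle_dec x 0), (Rle_dec y 0); try lra. left; apply Rpower_pos.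
  apply Rle_Rpower_l; lra.
Qed.

Lemma null_cover_measure t E : 0 < t -> null_cover t E -> hausdorff_measure t E = Finite 0.
Proof.
  intros Ht HE. unfold hausdorff_measure. apply Rbar_is_lub_unique.
  assert (Hc : forall dl, 0 < dl -> hausdorff_content t dl E = Finite 0).
  { intros dl Hdl. unfold hausdorff_content. apply Rbar_is_glb_unique. split.
    - intros v (U & Hd & Hcv & ->). apply (Lim_seq_ge_partial _ 0). intros; apply dpow_ge0.
    - intros b Hb.
      assert (H : forall eps, 0 < eps -> Rbar_le b eps).
      { intros eps He. destruct (HE eps dl He Hdl) as (U & r & Hr & Hth & Hcv & Hs).
        eapply Rbar_le_trans; [apply Hb; exists U; split; [|split; [apply Hcv|reflexivity]]|].
        - intros i. destruct (diam_le (U i) (r i) (proj1 (Hr i)) (Hth i)) as (d & -> & Hd). simpl. specialize (Hr i); lra.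
        - rewrite <- (Lim_seq_const eps). apply Lim_seq_le_loc. exists 0%nat. intros n _. rewrite rsum_sum_n.
          eapply Rle_trans; [|apply (Hs (S n))]. apply rsum_le. intros i _.
          destruct (diam_le (U i) (r i) (proj1 (Hr i)) (Hth i)) as (d & -> & Hd). simpl.
          unfold dpow. destruct (Req_EM_T d 0). destruct (Req_EM_T t 0); [lra|apply rpow_ge0].
          rewrite <- rpow_pos_eq by lra. apply rpow_mono; lra. }
      destruct b as [b| |]; simpl in *; auto. apply le_epsilon. intros e He. rewrite Rplus_0_l. apply H; auto.
      apply (H 1); lra. }
  split.
  - intros v (dl & Hdl & ->). rewrite Hc by auto. simpl; lra.
  - intros b Hb. apply Hb. exists 1. split; [lra|]. symmetry; apply Hc; lra.
Qed.

(** The converse, with strictly positive radii: the later construction discards a covering set once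
    the intervals are shorter than its radius, which never happens for radius 0. *)
Lemma measure_null_cover t E : 0 <= t -> hausdorff_measure t E = Finite 0 ->
  0 < t /\ forall eps del, 0 < eps -> 0 < del -> exists (U : nat -> R -> Prop) (r : nat -> R),
    (forall i, 0 < r i <= del) /\ (forall i, thin (U i) (r i)) /\ (forall x, E x -> exists i, U i x) /\
    (forall N, rsum (fun i => Rpower (r i) t) N <= eps).
Proof.
  intros Ht HE.
  assert (Hc : forall dl eps, 0 < dl -> 0 < eps -> exists (U : nat -> R -> Prop),
     (forall i, Rbar_le (diam (U i)) (Finite dl)) /\ (forall x, E x -> exists i, U i x) /\
     (forall N, rsum (fun i => dpow (real (diam (U i))) t) N <= eps)).
  { intros dl eps Hdl Heps. pose proof (proj1 (Rbar_lub_spec (fun v => exists delta : R, 0 < delta /\ v = hausdorff_content t delta E))) as Hub.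
    specialize (Hub (hausdorff_content t dl E)). fold (hausdorff_measure t E) in Hub. rewrite HE in Hub.
    assert (Hle : Rbar_le (hausdorff_content t dl E) 0) by (apply Hub; eauto).
    apply NNPP. intros Hne.
    assert (Rbar_le eps (hausdorff_content t dl E)).
    { unfold hausdorff_content. apply (proj2 (Rbar_glb_spec _)). intros v (U & Hd & Hcv & ->).
      destruct (Rbar_le_lt_dec eps (Lim_seq (sum_n (fun i => dpow (real (diam (U i))) t)))) as [|Hlt]; auto.
      exfalso. apply Hne. exists U. split; auto. split; auto. intros N.
      pose proof (Lim_seq_ge_partial (fun i => dpow (real (diam (U i))) t) N (fun i => dpow_ge0 _ _)) as Hp.
      pose proof (Rbar_le_lt_trans _ _ _ Hp Hlt) as HH. simpl in HH. lra. }
    pose proof (Rbar_le_trans _ _ _ H Hle). simpl in *. lra. }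
  assert (Ht0 : 0 < t).
  (* For [t = 0] every set of a cover, even an empty one, counts 1, so the measure is never 0. *)
  { destruct (Req_dec t 0) as [E0|]; [|lra]. exfalso. destruct (Hc 1 (1 / 2)) as (U & _ & _ & Hs); try lra.
    specialize (Hs 1%nat). simpl in Hs. unfold dpow in Hs. subst t.
    destruct (Req_EM_T (real (diam (U 0%nat))) 0). destruct (Req_EM_T 0 0); lra.
    unfold Rpower in Hs. rewrite Rmult_0_l, exp_0 in Hs. lra. }
  split; auto. intros eps del He Hd.
  destruct (Hc del (eps / 2) Hd ltac:(lra)) as (U & Hdi & Hcv & Hs).
  (* Radii replacing diameters that are too small; their powers add up to at most [eps / 2]. *)
  set (tiny := fun i => Rmin del (Rpower (eps / 2 * (/ 2) ^ (S i)) (/ t))).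
  assert (Htiny : forall i, 0 < tiny i <= del /\ Rpower (tiny i) t <= eps / 2 * (/ 2) ^ (S i)).
  { intros i. assert (0 < eps / 2 * (/ 2) ^ S i) by (apply Rmult_lt_0_compat; [lra|apply pow_lt; lra]).
    assert (0 < tiny i) by (unfold tiny; apply Rmin_glb_lt; auto; apply Rpower_pos).
    split; [split; auto; apply Rmin_l|].
    apply Rle_trans with (Rpower (Rpower (eps / 2 * (/ 2) ^ (S i)) (/ t)) t).
    - apply Rle_Rpower_l; [lra|]. split; auto. apply Rmin_r.
    - rewrite Rpower_mult, Rinv_l, Rpower_1 by lra. lra. }
  exists U, (fun i => Rmax (real (diam (U i))) (tiny i)). split; [|split; [|split]]; auto.
  - intros i. destruct (diam_thin _ _ (Hdi i)) as (d & -> & Hdd & _). simpl. destruct (Htiny i) as [[]].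
    split. eapply Rlt_le_trans; [|apply Rmax_r]; auto. apply Rmax_lub; lra.
  - intros i x y Hx Hy. destruct (diam_thin _ _ (Hdi i)) as (d & -> & Hdd & Hth). simpl.
    eapply Rle_trans; [|apply Rmax_l]. auto.
  - intros N. apply Rle_trans with (rsum (fun i => dpow (real (diam (U i))) t + eps / 2 * (/ 2) ^ (S i)) N).
    + apply rsum_le. intros i _. destruct (diam_thin _ _ (Hdi i)) as (d & -> & Hdd & _). simpl real. destruct (Htiny i) as [[Ha Hb] Hc'].
      pose proof (dpow_ge0 d t). unfold Rmax. destruct Rle_dec as [|Hn].
      * lra.
      * assert (dpow d t = Rpower d t) by (unfold dpow; destruct Req_EM_T; auto; lra).
        pose proof (Rpower_pos (tiny i) t). lra.
    + rewrite rsum_plus, rsum_scal. specialize (Hs N).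
      assert (rsum (fun i => (/ 2) ^ S i) N <= 1).
      { assert (rsum (fun i => (/ 2) ^ S i) N = 1 - (/ 2) ^ N).
        { clear. induction N; simpl; [lra|]. simpl in IHN. rewrite IHN. field. }
        pose proof (pow_lt (/ 2) N ltac:(lra)). lra. }
      assert (eps / 2 * rsum (fun i => (/ 2) ^ S i) N <= eps / 2 * 1) by (apply Rmult_le_compat_l; lra). lra.
Qed.

Lemma lsum_prod {A B} (w : A * B -> R) l1 l2 : lsum w (list_prod l1 l2) = lsum (fun a => lsum (fun b => w (a, b)) l2) l1.
Proof.
  induction l1; [reflexivity|]. change (list_prod (a :: l1) l2) with (map (fun y => (a, y)) l2 ++ list_prod l1 l2).
  rewrite lsum_app, lsum_map, IHl1. reflexivity.
Qed.

(** A pairing code is at least as large as both of its coordinates, so the first [N] codes lie in an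
    [N] by [N] square. *)
Lemma rsum_pairing (w : nat -> nat -> R) N : (forall a b, 0 <= w a b) ->
  rsum (fun j => w (fst (of_nat j)) (snd (of_nat j))) N <= rsum (fun a => rsum (fun b => w a b) N) N.
Proof.
  intros Hw. rewrite <- lsum_rsum. rewrite <- (lsum_map (fun z => w (fst z) (snd z)) of_nat).
  eapply Rle_trans; [apply (lsum_incl _ _ (list_prod (seq 0 N) (seq 0 N)))|].
  - apply NoDup_map_NoDup_ForallPairs; [|apply seq_NoDup]. intros i j _ _ E.
    rewrite <- (cancel_to_of i), <- (cancel_to_of j), E. auto.
  - intros [x y] Hin. apply in_map_iff in Hin. destruct Hin as (j & E & Hj). apply in_seq in Hj.
    pose proof (to_nat_non_decreasing x y). rewrite <- E, cancel_to_of in H.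
    apply in_prod; apply in_seq; lia.
  - intros; auto.
  - rewrite lsum_prod, lsum_rsum. right. apply rsum_ext. intros a _. apply lsum_rsum.
Qed.

(** * Points that are not Diophantine *)

Definition well_approx (tau x : R) : Prop := 0 <= x < 1 /\ ~ exists c, 0 < c /\ dioph tau c x.

(** The easy half of the Jarník-Besicovitch theorem: the [q + 1] fractions of denominator [q] cost
    of order [c^t q^(1 - tau t)], summable as [tau t > 2]. Smallness comes from [c] and not from a
    tail of the series, since these points violate the condition for every [c > 0]. *)
Lemma well_approx_null_cover tau t : 1 <= tau -> 0 < t -> 2 < tau * t -> null_cover t (well_approx tau).
Proof.
  intros Htau Ht Htt eps del He Hd.
  (* With this value [wt s' q = q^(1 - tau t)], so the bound already proved for sums of [wt]
     applies. *)
  set (s' := (tau * t - 1) / 2). assert (Hs' : 1 / 2 < s') by (unfold s'; lra).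
  set (KK := 2 * (1 + / (2 * s' - 1))). assert (HKK : 0 < KK).
  { unfold KK. assert (0 < / (2 * s' - 1)) by (apply Rinv_0_lt_compat; lra). lra. }
  (* At most 1/2 to keep the numerators in [0..q], at most [del / 2] for the radii, and the third
     bound makes the total cost at most [eps]. *)
  set (c := Rmin (Rmin (1 / 2) (del / 2)) (/ 2 * Rpower (eps / KK) (/ t))).
  assert (Hc : 0 < c).
  { unfold c. repeat apply Rmin_glb_lt; try lra. pose proof (Rpower_pos (eps / KK) (/ t)). lra. }
  assert (Hc1 : c <= 1 / 2) by (eapply Rle_trans; [apply Rmin_l|apply Rmin_l]).
  assert (Hc2 : c <= del / 2) by (eapply Rle_trans; [apply Rmin_l|apply Rmin_r]).
  assert (Hc3 : Rpower (2 * c) t * KK <= eps).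
  { assert (Hek : 0 < eps / KK) by (apply Rdiv_lt_0_compat; auto).
    apply Rle_div_r; auto. apply Rle_trans with (Rpower (Rpower (eps / KK) (/ t)) t).
    - apply Rle_Rpower_l; [lra|]. split; [lra|].
      assert (c <= / 2 * Rpower (eps / KK) (/ t)) by apply Rmin_r. lra.
    - rewrite Rpower_mult, Rinv_l, Rpower_1 by lra. lra. }
  assert (Hq1 : forall m, Rpower (INR (S m)) (- tau) <= / INR (S m)).
  { intros m. assert (1 <= INR (S m)) by (apply (le_INR 1); lia).
    rewrite <- (Rpower_1 (INR (S m))) at 2 by lra. rewrite <- Rpower_Ropp. apply Rle_Rpower; lra. }
  set (rad := fun m a => if Nat.leb a (S m) then 2 * c * Rpower (INR (S m)) (- tau) else 0).
  exists (fun j x => let m := fst (of_nat j) in let a := snd (of_nat j) in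
      (a <= S m)%nat /\ Rabs (x - INR a / INR (S m)) < c * Rpower (INR (S m)) (- tau)).
  exists (fun j => rad (fst (of_nat j)) (snd (of_nat j))).
  split; [|split; [|split]].
  - intros j. set (m := fst (of_nat j)). set (a := snd (of_nat j)). unfold rad. destruct Nat.leb; [|lra].
    pose proof (Rpower_pos (INR (S m)) (- tau)). specialize (Hq1 m).
    assert (/ INR (S m) <= 1). { rewrite <- Rinv_1. apply Rinv_le_contravar; [lra|]. apply (le_INR 1); lia. }
    split; [nra|]. nra.
  - intros j x y [Ha Hx] [_ Hy]. unfold rad. apply Nat.leb_le in Ha as ->.
    set (z := INR (snd (of_nat j)) / INR (S (fst (of_nat j)))) in *.
    replace (x - y) with ((x - z) - (y - z)) by ring. unfold Rminus at 1. eapply Rle_trans; [apply Rabs_triang|].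
    rewrite Rabs_Ropp. lra.
  - intros x [Hx Hnd].
    assert (Hex : exists a q, (1 <= q)%nat /\ Rabs (x - IZR a / INR q) < c * Rpower (INR q) (- tau)).
    { apply NNPP. intros Hne. apply Hnd. exists c. split; auto. intros a q Hq.
      apply Rnot_lt_le. intros Hlt. apply Hne. exists a, q; auto. }
    destruct Hex as (a & q & Hq & Hlt). destruct q as [|m]; [lia|].
    assert (HqR : 0 < INR (S m)) by (apply lt_0_INR; lia).
    assert (Hcl : Rabs (x * INR (S m) - IZR a) < c).
    { replace (x * INR (S m) - IZR a) with ((x - IZR a / INR (S m)) * INR (S m)) by (field; lra).
      rewrite Rabs_mult, (Rabs_right (INR (S m))) by lra.
      apply Rlt_le_trans with (c * Rpower (INR (S m)) (- tau) * INR (S m)); [apply Rmult_lt_compat_r; auto|].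
      specialize (Hq1 m). apply Rle_trans with (c * / INR (S m) * INR (S m)).
      apply Rmult_le_compat_r; [lra|]. apply Rmult_le_compat_l; lra. right; field; lra. }
    apply Rabs_lt_between in Hcl.
    assert (Ha0 : (0 <= a)%Z). { apply Z.lt_pred_le. apply lt_IZR. simpl. nra. }
    assert (Ha1 : (a <= Z.of_nat (S m))%Z). { apply Z.lt_succ_r. apply lt_IZR. rewrite succ_IZR, <- INR_IZR_INZ. nra. }
    exists (to_nat (m, Z.to_nat a)). rewrite cancel_of_to. cbn [fst snd]. split; [lia|].
    rewrite (INR_IZR_INZ (Z.to_nat a)), Z2Nat.id by auto. auto.
  - intros N.
    eapply Rle_trans; [apply (rsum_pairing (fun m a => rpow (rad m a) t)); intros; apply rpow_ge0|].
    eapply Rle_trans; [|apply Hc3].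
    assert (Hpos : forall m, 0 < 2 * c * Rpower (INR (S m)) (- tau)) by (intros; pose proof (Rpower_pos (INR (S m)) (- tau)); nra).
    apply Rle_trans with (rsum (fun m => Rpower (2 * c) t * 2 * wt s' (S m)) N).
    + apply rsum_le. intros m _.
      assert (Hm : 0 < INR (S m)) by (apply lt_0_INR; lia).
      assert (Hv : rpow (2 * c * Rpower (INR (S m)) (- tau)) t = Rpower (2 * c) t * Rpower (INR (S m)) (- (tau * t))).
      { rewrite rpow_pos_eq by auto. rewrite <- Rpower_mult_distr by (try apply Rpower_pos; lra). rewrite Rpower_mult. f_equal. f_equal. ring. }
      apply Rle_trans with (INR (S (S m)) * (Rpower (2 * c) t * Rpower (INR (S m)) (- (tau * t)))).
      * apply Rle_trans with (rsum (fun a => if Nat.leb a (S m) then rpow (2 * c * Rpower (INR (S m)) (- tau)) t else 0) (N + S (S m))).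
        -- apply Rle_trans with (rsum (fun a => if Nat.leb a (S m) then rpow (2 * c * Rpower (INR (S m)) (- tau)) t else 0) N).
           ++ right. apply rsum_ext. intros a _. unfold rad. destruct Nat.leb; auto. unfold rpow. destruct Rle_dec; lra.
           ++ apply rsum_mono; [lia|]. intros; destruct Nat.leb; [apply rpow_ge0|lra].
        -- rewrite (rsum_supp _ (S (S m))); [|lia|].
           ++ rewrite Hv. apply rsum_bound. intros i Hi. destruct (Nat.leb_spec i (S m)); [lra|lia].
           ++ intros i Hi. destruct (Nat.leb_spec i (S m)); [lia|auto].
      * unfold wt. replace (-2 * s') with (1 + - (tau * t)) by (unfold s'; field). rewrite Rpower_plus, Rpower_1 by auto.
        pose proof (Rpower_pos (2 * c) t). pose proof (Rpower_pos (INR (S m)) (- (tau * t))).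
        assert (INR (S (S m)) <= 2 * INR (S m)) by (rewrite (S_INR (S m)); assert (1 <= INR (S m)) by (apply (le_INR 1); lia); lra).
        assert (0 < Rpower (2 * c) t * Rpower (INR (S m)) (- (tau * t))) by (apply Rmult_lt_0_compat; auto). nra.
    + rewrite rsum_scal. unfold KK. rewrite <- Rmult_assoc. apply Rmult_le_compat_l; [pose proof (Rpower_pos (2 * c) t); lra|].
      pose proof (wt_sum_bound s' (S N) Hs'). rewrite rsum_Sl, wt_0 in H. lra.
Qed.

Lemma unit_null_cover t : 1 < t -> null_cover t (fun x => 0 <= x < 1).
Proof.
  intros Ht eps del He Hd.
  destruct (Rpower_unbounded (t - 1) (/ eps) ltac:(lra)) as [N1 HN1].
  destruct (nfloor_ex (/ del)) as [N2 HN2]; [left; apply Rinv_0_lt_compat; auto|].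
  set (M := S (N1 + N2)). specialize (HN1 M ltac:(unfold M; lia)).
  assert (HM : 1 <= INR M) by (apply (le_INR 1); unfold M; lia).
  assert (HMd : / INR M <= del).
  { rewrite <- (Rinv_inv del). apply Rinv_le_contravar; [apply Rinv_0_lt_compat; auto|].
    assert (INR (S N2) <= INR M) by (apply le_INR; unfold M; lia). rewrite S_INR in *. lra. }
  assert (HMi : 0 < / INR M) by (apply Rinv_0_lt_compat; lra).
  exists (fun i x => (i < M)%nat /\ INR i <= INR M * x < INR i + 1), (fun i => if Nat.ltb i M then / INR M else 0).
  split; [|split; [|split]].
  - intros i. destruct Nat.ltb; lra.
  - intros i x y [Hi Hx] [_ Hy]. apply Nat.ltb_lt in Hi as ->.
    apply Rmult_le_reg_l with (INR M); [lra|]. rewrite Rinv_r by lra.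
    rewrite <- (Rabs_right (INR M)) at 1 by lra. rewrite <- Rabs_mult. apply Rabs_le. lra.
  - intros x Hx. destruct (nfloor_ex (INR M * x)) as [i Hi]; [nra|]. exists i. split; auto. apply INR_lt. nra.
  - intros N. apply Rle_trans with (rsum (fun i => if Nat.ltb i M then rpow (/ INR M) t else 0) (N + M)).
    + eapply Rle_trans; [right; apply rsum_ext with (g := fun i => if Nat.ltb i M then rpow (/ INR M) t else 0)|].
      * intros i _. destruct Nat.ltb; auto. unfold rpow; destruct Rle_dec; lra.
      * apply rsum_mono; [lia|]. intros; destruct Nat.ltb; [apply rpow_ge0|lra].
    + rewrite (rsum_supp _ M); [|lia|intros i Hi; destruct (Nat.ltb_spec i M); [lia|auto]].
      eapply Rle_trans; [apply rsum_bound with (c := rpow (/ INR M) t)|].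
      * intros i Hi. destruct Nat.ltb; [lra|apply rpow_ge0].
      * rewrite rpow_pos_eq by auto.
        replace (Rpower (/ INR M) t) with (/ INR M * / Rpower (INR M) (t - 1)).
        -- rewrite <- Rmult_assoc, Rinv_r, Rmult_1_l by lra. rewrite <- (Rinv_inv eps). apply Rinv_le_contravar; [|lra].
           apply Rinv_0_lt_compat; auto.
        -- rewrite <- (Rpower_1 (INR M)) at 1 by lra. rewrite <- Rinv_mult, <- Rpower_plus. replace (1 + (t - 1)) with t by ring.
           unfold Rpower. rewrite ln_Rinv by lra. rewrite <- exp_Ropp. f_equal; ring.
Qed.

Lemma null_cover_subset t (E E' : R -> Prop) : (forall x, E x -> E' x) -> null_cover t E' -> null_cover t E.
Proof.
  intros H HE eps del He Hd. destruct (HE eps del He Hd) as (U & r & H1 & H2 & H3 & H4). exists U, r.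
  split; [auto|]. split; [auto|]. split; [|auto]. intros x Hx. apply H3, H, Hx.
Qed.

(** * A Cantor set of approximable points *)

Lemma residue_count (P : nat -> Prop) (Pd : forall i, {P i} + {~ P i}) d n : (1 <= d)%nat ->
  (forall i j, (i < j)%nat -> P i -> P j -> (d <= j - i)%nat) ->
  rsum (fun i => if Pd i then 1 else 0) n <= INR n / INR d + 1.
Proof.
  intros Hd HP. assert (HdR : 0 < INR d) by (apply lt_0_INR; lia).
  (* stronger: count up to [n] is at most [(last + d) / d] with [last] the last element *)
  assert (H : forall n, rsum (fun i => if Pd i then 1 else 0) n = 0 \/
     exists l, (l < n)%nat /\ P l /\ (forall i, (i < n)%nat -> P i -> (i <= l)%nat) /\ rsum (fun i => if Pd i then 1 else 0) n <= INR l / INR d + 1).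
  { clear n. induction n; [left; reflexivity|]. rewrite rsum_S. destruct (Pd n) as [Hn|Hn].
    - right. exists n. split; [lia|]. split; auto. split; [intros; lia|].
      destruct IHn as [->|(l & Hl & HPl & _ & Hb)].
      + assert (0 <= INR n / INR d) by (apply Rdiv_le_0_compat; auto; apply pos_INR). lra.
      + specialize (HP l n Hl HPl Hn). apply le_INR in HP. rewrite minus_INR in HP by lia.
        assert (INR l / INR d + 1 <= INR n / INR d).
        { replace (INR l / INR d + 1) with ((INR l + INR d) / INR d) by (field; lra).
          apply Rmult_le_compat_r; [left; apply Rinv_0_lt_compat; auto|lra]. }
        lra.
    - destruct IHn as [->|(l & Hl & HPl & Hlast & Hb)]; [left; ring|]. right. exists l. split; [lia|]. split; auto.
      split; [|lra]. intros i Hi HPi. destruct (Nat.eq_dec i n) as [->|]; [contradiction|]. apply Hlast; auto; lia. }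
  destruct (H n) as [->|(l & Hl & _ & _ & Hb)].
  - assert (0 <= INR n / INR d) by (apply Rdiv_le_0_compat; auto; apply pos_INR). lra.
  - assert (INR l / INR d <= INR n / INR d).
    { apply Rmult_le_compat_r; [left; apply Rinv_0_lt_compat; auto|]. apply le_INR; lia. }
    lra.
Qed.

(** Telescoping through [1 / (2 x + 1)^2 <= 1 / (4 x) - 1 / (4 (x + 1))]. That the value is below 1
    leaves a positive proportion of coprime pairs in [farey_count]. *)
Lemma inv_sq_sum E : rsum (fun e => / INR (2 * S e + 1) ^ 2) E <= 1 / 4.
Proof.
  assert (H : rsum (fun e => / INR (2 * S e + 1) ^ 2) E <= 1 / 4 - / (4 * INR (S E))).
  { induction E; [simpl; lra|]. rewrite rsum_S.
    assert (HE : 0 < INR (S E)) by (apply lt_0_INR; lia).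
    assert (/ INR (2 * S E + 1) ^ 2 <= / (4 * INR (S E)) - / (4 * INR (S (S E)))).
    { rewrite (S_INR (S E)), plus_INR, mult_INR. simpl (INR 2). simpl (INR 1). set (x := INR (S E)) in *.
      replace (/ (4 * x) - / (4 * (x + 1))) with (/ (4 * x * (x + 1))) by (field; lra).
      apply Rinv_le_contravar; nra. }
    lra. }
  assert (0 < / (4 * INR (S E))) by (apply Rinv_0_lt_compat; assert (0 < INR (S E)) by (apply lt_0_INR; lia); lra). lra.
Qed.

Lemma lsum_filter {A} (f : A -> bool) l : INR (length (filter f l)) = lsum (fun a => if f a then 1 else 0) l.
Proof.
  induction l; [reflexivity|]. simpl filter. unfold lsum in *. simpl. destruct (f a); [cbn [length]; rewrite S_INR|]; rewrite IHl; ring.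
Qed.

(** * Reduced fractions with odd denominator in a short window *)

Section Farey.
Variables (M n : nat) (start : nat -> nat).
Let Q := (2 * M)%nat.
Let den (i : nat) := (Q + 1 + 2 * i)%nat.
Let num (i j : nat) := (start i + j)%nat.
Let good (z : nat * nat) : bool := Nat.eqb (Nat.gcd (num (fst z) (snd z)) (den (fst z))) 1.

(** Union bound: a pair that is not coprime has a common odd divisor [d >= 3], and each [d] spoils
    at most [(M / d + 1) (n / d + 1)] pairs. The squares sum to at most 1/4, the cross terms give
    the harmonic number and the ones give [Q]. *)
Lemma farey_count : (1 <= M)%nat ->
  3 / 4 * (INR M * INR n) - (INR M + INR n) * harm (2 * Q + 1) - INR Q <= INR (length (filter good (list_prod (seq 0 M) (seq 0 n)))).
Proof.
  intros HM. rewrite lsum_filter, lsum_prod, lsum_rsum.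
  set (dv := fun e => (2 * S e + 1)%nat).
  assert (H1 : INR M * INR n <= rsum (fun i => lsum (fun j => if good (i, j) then 1 else 0) (seq 0 n)) M +
     rsum (fun e => rsum (fun i => rsum (fun j => (if Zdivide_dec (Z.of_nat (dv e)) (Z.of_nat (den i)) then 1 else 0) *
                  (if Zdivide_dec (Z.of_nat (dv e)) (Z.of_nat (num i j)) then 1 else 0)) n) M) Q).
  { rewrite rsum_swap. rewrite <- rsum_plus. rewrite <- rsum_const. apply rsum_le. intros i Hi.
    rewrite rsum_swap, lsum_rsum, <- rsum_plus. rewrite <- (Rmult_1_r (INR n)), <- rsum_const. apply rsum_le. intros j Hj.
    set (f := fun e => (if Zdivide_dec (Z.of_nat (dv e)) (Z.of_nat (den i)) then 1 else 0) *
                  (if Zdivide_dec (Z.of_nat (dv e)) (Z.of_nat (num i j)) then 1 else 0)).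
    assert (Hf : forall e, 0 <= f e) by (intros e; unfold f; destruct Zdivide_dec, Zdivide_dec; lra).
    pose proof (rsum_ge0 f Q (fun e _ => Hf e)). fold f.
    unfold good. cbn [fst snd]. destruct (Nat.eqb_spec (Nat.gcd (num i j) (den i)) 1) as [|Hg]; [lra|].
    set (g := Nat.gcd (num i j) (den i)) in *.
    destruct (Nat.gcd_divide_l (num i j) (den i)) as [u Hu]. destruct (Nat.gcd_divide_r (num i j) (den i)) as [v Hv]. fold g in Hu, Hv.
    (* [Q] is even, so the denominators and the gcd are odd; a gcd other than 1 is [2 (e + 1) + 1]
       for some [e], and the denominators below [2 Q] bound [e]. *)
    assert (Hg3 : exists e, g = dv e /\ (e < Q)%nat).
    { assert (Hodd : Nat.odd g = true).
      { destruct (Nat.odd g) eqn:E; auto. exfalso. rewrite <- Nat.negb_even in E. apply Bool.negb_false_iff in E.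
        apply Nat.even_spec in E. destruct E as [w Hw]. unfold den, Q in Hv. rewrite Hw in Hv. nia. }
      apply Nat.odd_spec in Hodd. destruct Hodd as [w Hw]. exists (w - 1)%nat. unfold dv.
      assert (g <= den i)%nat.
      { assert (v <> 0)%nat by (intros ->; unfold den in Hv; lia). rewrite Hv. destruct v; [lia|]. simpl. lia. }
      unfold den, Q in *. lia. }
    destruct Hg3 as (e & He & HeQ).
    assert (f e = 1).
    { unfold f. rewrite <- He. destruct Zdivide_dec as [|Hn]; [destruct Zdivide_dec as [|Hn]; [lra|]|]; exfalso; apply Hn.
      exists (Z.of_nat u). rewrite <- Nat2Z.inj_mul. f_equal; auto.
      exists (Z.of_nat v). rewrite <- Nat2Z.inj_mul. f_equal; auto. }
    pose proof (rsum_le1 f Q e (fun e _ => Hf e) HeQ). lra. }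
  assert (H2 : rsum (fun e => rsum (fun i => rsum (fun j => (if Zdivide_dec (Z.of_nat (dv e)) (Z.of_nat (den i)) then 1 else 0) *
                  (if Zdivide_dec (Z.of_nat (dv e)) (Z.of_nat (num i j)) then 1 else 0)) n) M) Q <=
       rsum (fun e => INR M * INR n * / INR (2 * S e + 1) ^ 2 + (INR M + INR n) * / INR (2 * S e + 1) + 1) Q).
  { apply rsum_le. intros e _. fold (dv e). set (d := dv e).
    assert (Hd1 : (1 <= d)%nat) by (unfold d, dv; lia). assert (HdR : 0 < INR d) by (apply lt_0_INR; lia).
    assert (Hd2 : Z.gcd 2 (Z.of_nat d) = 1%Z).
    { apply Z.bezout_1_gcd. exists (- Z.of_nat (S e))%Z, 1%Z. unfold d, dv. lia. }
    apply Rle_trans with ((INR M / INR d + 1) * (INR n / INR d + 1)); [|right; field; lra].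
    assert (Hn0 : 0 <= INR n / INR d) by (apply Rdiv_le_0_compat; auto; apply pos_INR).
    apply Rle_trans with (rsum (fun i => (if Zdivide_dec (Z.of_nat d) (Z.of_nat (den i)) then 1 else 0) * (INR n / INR d + 1)) M).
    - apply rsum_le. intros i _. rewrite rsum_scal.
      apply Rmult_le_compat_l; [destruct Zdivide_dec; lra|].
      apply (residue_count (fun j => Z.divide (Z.of_nat d) (Z.of_nat (num i j)))); auto.
      intros a b Hab [x Hx] [y Hy]. unfold num in *. assert (Hw : (Z.of_nat d | Z.of_nat (b - a))%Z) by (exists (y - x)%Z; lia).
      apply Z.divide_pos_le in Hw; lia.
    - rewrite rsum_scalr. apply Rmult_le_compat_r; [lra|].
      apply (residue_count (fun i => Z.divide (Z.of_nat d) (Z.of_nat (den i)))); auto.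
      intros a b Hab [x Hx] [y Hy]. unfold den in *.
      assert (Hdiv : (Z.of_nat d | 2 * Z.of_nat (b - a))%Z) by (exists (y - x)%Z; lia).
      apply Z.gauss in Hdiv; [|rewrite Z.gcd_comm; auto]. apply Z.divide_pos_le in Hdiv; lia. }
  rewrite rsum_plus, rsum_plus, !rsum_scal, rsum_const in H2.
  assert (H3 : rsum (fun e => / INR (2 * S e + 1)) Q <= harm (2 * Q + 1)).
  { rewrite (rsum_ext _ (fun e => / INR (S (2 * S e)))) by (intros; do 2 f_equal; lia).
    apply (rsum_inj_le (fun m => / INR (S m)) (fun e => 2 * S e)%nat Q (2 * Q + 1)); try (intros; lia).
    intros; left; apply Rinv_0_lt_compat, lt_0_INR; lia. }
  pose proof (inv_sq_sum Q). pose proof (pos_INR M). pose proof (pos_INR n).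
  assert (INR M * INR n * rsum (fun e => / INR (2 * S e + 1) ^ 2) Q <= INR M * INR n * (1 / 4)) by (apply Rmult_le_compat_l; nra).
  assert ((INR M + INR n) * rsum (fun e => / INR (2 * S e + 1)) Q <= (INR M + INR n) * harm (2 * Q + 1)) by (apply Rmult_le_compat_l; lra).
  lra.
Qed.
End Farey.

Definition fr (z : nat * nat) : R := INR (fst z) / INR (snd z).

(** About [Q / 2] odd denominators with [ell * Q] or more numerators each, three quarters of the
    pairs coprime: the constant 1/8 leaves room for rounding and for the error terms. *)
Definition farey (Q : nat) (ell : R) : Prop :=
  forall u, 0 <= u -> exists l : list (nat * nat), NoDup l /\
   (forall z, In z l -> Nat.Odd (snd z) /\ (Q < snd z <= 2 * Q)%nat /\ Nat.gcd (fst z) (snd z) = 1%nat /\ u <= fr z <= u + ell) /\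
   ell * INR Q ^ 2 / 8 <= INR (length l).

Lemma farey_exists ell : 0 < ell <= 1 -> exists M0, forall M, (M0 <= M)%nat -> farey (2 * M) ell.
Proof.
  intros Hl. destruct (harm_Rpower (1 / 2)) as (Mh & HMh & Hh); [lra|].
  destruct (Rpower_unbounded (1 / 2) (20 * (Mh * Rpower 5 (1 / 2)) / ell) ltac:(lra)) as [M1 HM1].
  destruct (nfloor_ex (2 / ell)) as [M2 HM2]; [left; apply Rdiv_lt_0_compat; lra|].
  exists (S (M1 + M2)). intros M HM u Hu. specialize (HM1 M ltac:(lia)).
  assert (HMp : 1 <= INR M) by (apply (le_INR 1); lia).
  assert (HMl : 2 <= INR M * ell).
  { apply Rle_div_l; [lra|]. assert (INR (S M2) <= INR M) by (apply le_INR; lia). rewrite S_INR in *. lra. }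
  set (Q := (2 * M)%nat). assert (HQ : INR Q = 2 * INR M) by (unfold Q; rewrite mult_INR; auto).
  (* The denominators exceed [Q], so [n <= ell * Q] consecutive numerators, starting at most 1 above
     [den * u], stay below [den * (u + ell)]. *)
  destruct (nfloor_ex (INR Q * ell)) as [n Hn]; [rewrite HQ; nra|].
  set (den := fun i => (Q + 1 + 2 * i)%nat).
  set (start := fun i => S (Z.to_nat (Int_part (INR (den i) * u)))).
  assert (Hst : forall i, INR (den i) * u <= INR (start i) <= INR (den i) * u + 1).
  { intros i. unfold start. assert (0 <= INR (den i) * u) by (apply Rmult_le_pos; auto; apply pos_INR).
    destruct (base_Int_part (INR (den i) * u)) as [B1 B2].
    assert (-1 < Int_part (INR (den i) * u))%Z by (apply lt_IZR; lra).
    rewrite S_INR, (INR_IZR_INZ (Z.to_nat _)), Z2Nat.id by lia. lra. }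
  pose proof (farey_count M n start ltac:(lia)) as Hc. fold Q in Hc.
  set (good := fun z : nat * nat => Nat.eqb (Nat.gcd (start (fst z) + snd z) (Q + 1 + 2 * fst z)) 1) in Hc.
  change (filter _ _) with (filter good (list_prod (seq 0 M) (seq 0 n))) in Hc.
  set (fl := filter good (list_prod (seq 0 M) (seq 0 n))) in *.
  exists (map (fun z => ((start (fst z) + snd z)%nat, den (fst z))) fl). split; [|split].
  - apply NoDup_map_NoDup_ForallPairs.
    + intros [i j] [i' j'] _ _ E. cbn [fst snd] in E. injection E as E1 E2. unfold den in E2.
      assert (i = i') by lia. subst i'. f_equal. lia.
    + unfold fl. apply NoDup_filter.
      assert (HND : forall (l1 l2 : list nat), NoDup l1 -> NoDup l2 -> NoDup (list_prod l1 l2)).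
      { intros l1 l2 H1 H2. induction H1 as [|a l1 Ha H1 IH]; [constructor|].
        change (list_prod (a :: l1) l2) with (map (fun y => (a, y)) l2 ++ list_prod l1 l2).
        apply NoDup_app; auto.
        - apply NoDup_map_NoDup_ForallPairs; auto. intros x y _ _ E; congruence.
        - intros [x y] Hx Hy. apply in_map_iff in Hx. destruct Hx as (w & E & _). apply in_prod_iff in Hy. inversion E; subst. tauto. }
      apply HND; apply seq_NoDup.
  - intros z Hz. apply in_map_iff in Hz. destruct Hz as ([i j] & <- & Hz). apply filter_In in Hz. destruct Hz as [Hz Hg].
    apply in_prod_iff in Hz. destruct Hz as [Hi Hj]. apply in_seq in Hi. apply in_seq in Hj.
    unfold good in Hg. apply Nat.eqb_eq in Hg. unfold fr. cbn [fst snd] in *. unfold den.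
    split; [exists (M + i)%nat; unfold Q; lia|]. split; [unfold Q in *; lia|]. split; [auto|].
    fold (den i). assert (Hd : 0 < INR (den i)) by (apply lt_0_INR; unfold den; lia).
    assert (HdQ : INR Q <= INR (den i)) by (apply le_INR; unfold den; lia).
    specialize (Hst i). rewrite plus_INR. pose proof (pos_INR j).
    assert (INR j <= INR n - 1) by (assert (INR (S j) <= INR n) by (apply le_INR; lia); rewrite S_INR in *; lra).
    split; [apply Rle_div_r; lra|]. apply Rle_div_l; auto. nra.
  - rewrite length_map. eapply Rle_trans; [|apply Hc].
    assert (Hn2 : INR Q * ell / 2 <= INR n) by (rewrite HQ in *; lra).
    assert (Hn3 : INR n <= 2 * INR M) by (rewrite HQ in *; nra).
    assert (Hh2 : 20 * harm (2 * Q + 1) <= ell * INR M).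
    { assert (H5 : harm (2 * Q + 1) <= Mh * (Rpower 5 (1 / 2) * Rpower (INR M) (1 / 2))).
      { eapply Rle_trans; [apply Hh; lia|]. apply Rmult_le_compat_l; [lra|]. rewrite Rpower_mult_distr by lra.
        apply Rle_Rpower_l; [lra|]. split; [apply lt_0_INR; lia|]. rewrite plus_INR, mult_INR, HQ. simpl. lra. }
      apply Rlt_le in HM1. apply Rle_div_l in HM1; [|lra].
      assert (E : Rpower (INR M) (1 / 2) * Rpower (INR M) (1 / 2) = INR M).
      { rewrite <- Rpower_plus. replace (1 / 2 + 1 / 2) with 1 by field. apply Rpower_1; lra. }
      pose proof (Rpower_pos (INR M) (1 / 2)).
      apply Rle_trans with (20 * (Mh * Rpower 5 (1 / 2)) * Rpower (INR M) (1 / 2)); [lra|].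
      apply Rle_trans with (Rpower (INR M) (1 / 2) * ell * Rpower (INR M) (1 / 2)); [apply Rmult_le_compat_r; lra|].
      right. rewrite <- E at 3. ring. }
    assert (Hh1 : 1 <= harm (2 * Q + 1)) by (apply harm_ge1; lia).
    assert (HMn : ell * INR Q ^ 2 / 8 <= INR M * INR n / 2) by (rewrite HQ in *; nra).
    assert ((INR M + INR n) * harm (2 * Q + 1) + INR Q <= 5 * INR M * harm (2 * Q + 1)) by (rewrite HQ in *; nra).
    assert (20 * (5 * INR M * harm (2 * Q + 1)) <= 5 * INR M * (ell * INR M)) by nra.
    assert (ell * INR M <= INR n) by (rewrite HQ in *; lra).
    assert (5 * INR M * (ell * INR M) <= 5 * INR M * INR n) by (apply Rmult_le_compat_l; lra).
    lra.
Qed.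

Lemma fr_sep z z' Q : (1 <= snd z <= 2 * Q)%nat -> (1 <= snd z' <= 2 * Q)%nat ->
  Nat.gcd (fst z) (snd z) = 1%nat -> Nat.gcd (fst z') (snd z') = 1%nat -> z <> z' ->
  / (4 * INR Q ^ 2) <= Rabs (fr z - fr z').
Proof.
  destruct z as [p q], z' as [p' q']. unfold fr. cbn [fst snd]. intros Hq Hq' Hg Hg' Hne.
  assert (Hqp : 0 < INR q) by (apply lt_0_INR; lia). assert (Hqp' : 0 < INR q') by (apply lt_0_INR; lia).
  assert (Hx : (p * q' <> p' * q)%nat).
  { intros E. apply Hne.
    assert (D1 : Nat.divide q q').
    { apply (Nat.gauss q p q'); [exists p'; lia|rewrite Nat.gcd_comm; auto]. }
    assert (D2 : Nat.divide q' q).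
    { apply (Nat.gauss q' p' q); [exists p; lia|rewrite Nat.gcd_comm; auto]. }
    assert (q = q') by (apply Nat.divide_antisym; auto). subst q'. f_equal. nia. }
  assert (H1 : 1 <= Rabs (INR p * INR q' - INR p' * INR q)).
  { rewrite <- !mult_INR, !INR_IZR_INZ, <- minus_IZR, <- abs_IZR. apply IZR_le. lia. }
  replace (INR p / INR q - INR p' / INR q') with ((INR p * INR q' - INR p' * INR q) * / (INR q * INR q')) by (field; lra).
  rewrite Rabs_mult. assert (Hqq : 0 < INR q * INR q') by nra.
  rewrite (Rabs_right (/ _)) by (left; apply Rinv_0_lt_compat; auto).
  apply Rle_trans with (1 * / (INR q * INR q')).
  - rewrite Rmult_1_l. apply Rinv_le_contravar; auto.
    assert (INR q <= 2 * INR Q) by (replace 2 with (INR 2) by auto; rewrite <- mult_INR; apply le_INR; lia).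
    assert (INR q' <= 2 * INR Q) by (replace 2 with (INR 2) by auto; rewrite <- mult_INR; apply le_INR; lia).
    replace (4 * INR Q ^ 2) with ((2 * INR Q) * (2 * INR Q)) by ring. apply Rmult_le_compat; lra.
  - apply Rmult_le_compat_r; auto. left; apply Rinv_0_lt_compat; auto.
Qed.

Lemma gcd_nat_Z p q : Nat.gcd p q = 1%nat -> Z.gcd (Z.of_nat p) (Z.of_nat q) = 1%Z.
Proof.
  intros H. set (g := Z.gcd (Z.of_nat p) (Z.of_nat q)).
  assert (Hd : forall m, (g | Z.of_nat m)%Z -> Nat.divide (Z.to_nat g) m).
  { intros m [a Ha]. assert (Hg : (0 <= g)%Z) by apply Z.gcd_nonneg.
    destruct (Z.eq_dec g 0) as [E|E].
    - rewrite E in *. exists O. lia.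
    - exists (Z.to_nat a). apply Nat2Z.inj. rewrite Nat2Z.inj_mul, !Z2Nat.id by nia. auto. }
  assert (H1 : Nat.divide (Z.to_nat g) 1).
  { rewrite <- H. apply Nat.gcd_greatest; apply Hd; [apply Z.gcd_divide_l|apply Z.gcd_divide_r]. }
  apply Nat.divide_1_r in H1. lia.
Qed.

Lemma sep_count {A} (z : A -> R) (l : list A) sg w : 0 < sg -> 0 <= w -> NoDup l ->
  (forall a b, In a l -> In b l -> a <> b -> sg <= Rabs (z a - z b)) ->
  (forall a b, In a l -> In b l -> Rabs (z a - z b) <= w) -> INR (length l) <= 1 + 2 * w / sg.
Proof.
  intros Hs Hw Hnd Hsep Hwin. assert (H0 : 0 <= 2 * w / sg) by (apply Rdiv_le_0_compat; lra).
  destruct l as [|a0 l0] eqn:El; [simpl; lra|]. rewrite <- El in *.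
  assert (Ha0 : In a0 l) by (rewrite El; left; auto). clear El l0.
  set (v := fun a => (z a - z a0 + w) / sg).
  assert (Hv : forall a, In a l -> 0 <= v a <= 2 * w / sg).
  { intros a Ha. specialize (Hwin a a0 Ha Ha0). apply Rabs_le_between in Hwin. unfold v.
    split; [apply Rdiv_le_0_compat; lra|]. apply Rmult_le_compat_r; [left; apply Rinv_0_lt_compat; auto|lra]. }
  set (box := fun a => Z.to_nat (Int_part (v a))).
  assert (Hbox : forall a, In a l -> INR (box a) <= v a < INR (box a) + 1).
  { intros a Ha. unfold box. destruct (base_Int_part (v a)). specialize (Hv a Ha).
    assert (-1 < Int_part (v a))%Z by (apply lt_IZR; lra). rewrite (INR_IZR_INZ (Z.to_nat _)), Z2Nat.id by lia. lra. }
  destruct (nfloor_ex (2 * w / sg) H0) as [N HN].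
  assert (Hlen : (length l <= S N)%nat).
  { rewrite <- (length_map box), <- (length_seq (S N) 0). apply NoDup_incl_length.
    - apply NoDup_map_NoDup_ForallPairs; auto. intros a b Ha Hb E. apply NNPP. intros Hne.
      specialize (Hsep a b Ha Hb Hne). pose proof (Hbox a Ha). pose proof (Hbox b Hb). rewrite E in H.
      assert (Rabs (v a - v b) < 1) by (apply Rabs_lt_between; lra).
      replace (v a - v b) with ((z a - z b) * / sg) in H2 by (unfold v; field; lra).
      rewrite Rabs_mult, (Rabs_right (/ sg)) in H2 by (left; apply Rinv_0_lt_compat; auto).
      apply Rmult_lt_compat_r with (r := sg) in H2; auto. rewrite Rmult_assoc, Rinv_l in H2 by lra. lra.
    - intros b Hb. apply in_map_iff in Hb. destruct Hb as (a & <- & Ha). apply in_seq.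
      assert (INR (box a) < INR (S N)) by (rewrite S_INR; specialize (Hbox a Ha); specialize (Hv a Ha); lra).
      apply INR_lt in H. lia. }
  apply le_INR in Hlen. rewrite S_INR in Hlen. lra.
Qed.

Lemma lsum_rsum_swap {A} (f : A -> nat -> R) l N :
  lsum (fun a => rsum (f a) N) l = rsum (fun j => lsum (fun a => f a j) l) N.
Proof.
  induction l; simpl; [rewrite rsum_0; auto|]. unfold lsum in *. simpl. rewrite IHl, <- rsum_plus. auto.
Qed.

(* A set [V j] of size [r j] carries the weight [om j], and an interval of level [k] is kept only while the sets
   meeting it have total weight below [mu k]. It has about [ell k * (Q k)^2] children, and [V j] meets at most
   [2 + 8 (Q k)^2 (r j)] of them, so on average, hence for some child, the total weight is below [mu (S k)]. *)
Section Game.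
Variables (tau : R) (ell mu : nat -> R) (Q : nat -> nat).
Hypothesis Htau : 2 <= tau.
Hypothesis HQ1 : forall k, (1 <= Q k)%nat.
Hypothesis Hell : forall k, 0 < ell k.
Hypothesis HellS : forall k, ell (S k) = Rpower (INR (Q k)) (- tau) / 16.
Hypothesis Hhalf : forall k, ell (S k) <= ell k / 2.
Hypothesis Hmu : forall k, 0 < mu k.
Hypothesis HmuS : forall k, mu k = mu (S k) * (ell k * INR (Q k) ^ 2 / 16).
Hypothesis Hfar : forall k, farey (Q k) (ell k / 2).

Variables (V : nat -> R -> Prop) (r om : nat -> R).
Hypothesis Hthin : forall j, thin (V j) (r j).
Hypothesis Hom : forall j, 0 <= om j.
Hypothesis Hcond : forall j k, ell (S k) <= r j < ell k -> (2 + 8 * INR (Q k) ^ 2 * r j) * mu (S k) <= om j.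

Definition meets (j : nat) (u w : R) : Prop := exists x, V j x /\ u <= x <= u + w.
Definition mdec j u w : {meets j u w} + {~ meets j u w} := excluded_middle_informative _.

(** The last clause lets the limit point escape: a set containing it would meet the interval of
    every level, hence be shorter than all of them. *)
Definition load_bounded (k : nat) (u : R) : Prop :=
  0 <= u /\ (forall N, rsum (fun j => if mdec j u (ell k) then om j else 0) N < mu k) /\
  (forall j, meets j u (ell k) -> r j < ell k).

Lemma ell_small k : ell (S k) <= / (16 * INR (Q k) ^ 2).
Proof.
  rewrite HellS. assert (1 <= INR (Q k)) by (apply (le_INR 1); auto).
  rewrite Rinv_mult. unfold Rdiv. rewrite Rmult_comm. apply Rmult_le_compat_l; [lra|].
  rewrite Rpower_Ropp. apply Rinv_le_contravar; [apply pow_lt; lra|].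
  rewrite <- (Rpower_pow 2) by lra. apply Rle_Rpower; auto.
Qed.

(** Pigeonhole on total loads: if every child had load at least [mu (S k)], the sum over the
    children would be at least [mu k], yet each set charges all children together at most [om j]. *)
Lemma step k u : load_bounded k u -> exists z, Nat.Odd (snd z) /\ (1 <= snd z <= 2 * Q k)%nat /\ Nat.gcd (fst z) (snd z) = 1%nat /\
   u <= fr z /\ fr z + ell (S k) <= u + ell k /\ load_bounded (S k) (fr z).
Proof.
  intros (Hu & Hsum & Hr). destruct (Hfar k u Hu) as (l & Hnd & Hl & Hlen).
  (* A set too long for the next level is charged the full threshold [mu (S k)], so a child whose
     load is below the threshold cannot meet it. *)
  set (om' := fun j => if Rlt_dec (r j) (ell (S k)) then om j else mu (S k)).
  set (ind := fun (z : nat * nat) j => if mdec j (fr z) (ell (S k)) then om' j else 0).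
  assert (Hom' : forall j, 0 <= om' j) by (intros j; unfold om'; destruct Rlt_dec; auto; left; auto).
  assert (Hind : forall z j, 0 <= ind z j) by (intros; unfold ind; destruct mdec; auto; lra).
  assert (HQr : 1 <= INR (Q k)) by (apply (le_INR 1); auto).
  assert (HQ2 : 0 < INR (Q k) ^ 2) by (apply pow_lt; lra).
  assert (Hch : forall z, In z l -> u <= fr z /\ fr z + ell (S k) <= u + ell k).
  { intros z Hz. destruct (Hl z Hz) as (_ & _ & _ & Hz2). pose proof (Hhalf k). lra. }
  assert (Hex : exists z, In z l /\ forall N, rsum (ind z) N < mu (S k)).
  { apply NNPP. intros Hne.
    (* One [N] serves all children at once, because their list is finite and the partial sums
       increase. *)
    assert (HN : forall l', incl l' l -> exists N, forall z, In z l' -> mu (S k) <= rsum (ind z) N).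
    { induction l' as [|z l' IH]; intros Hi; [exists 0%nat; intros z []|].
      destruct IH as [N1 HN1]; [intros a Ha; apply Hi; right; auto|].
      assert (exists N2, mu (S k) <= rsum (ind z) N2) as [N2 HN2].
      { apply NNPP. intros Hn. apply Hne. exists z. split; [apply Hi; left; auto|]. intros N. apply Rnot_le_lt. intros HH. apply Hn; eauto. }
      exists (N1 + N2)%nat. intros a [<-|Ha].
      - eapply Rle_trans; [apply HN2|]. apply rsum_mono; auto; lia.
      - eapply Rle_trans; [apply (HN1 a Ha)|]. apply rsum_mono; auto; lia. }
    destruct (HN l (incl_refl l)) as [N HN'].
    assert (Hlow : INR (length l) * mu (S k) <= lsum (fun z => rsum (ind z) N) l).
    { clear - HN'. induction l; [simpl; lra|]. cbn [length]. rewrite S_INR. unfold lsum in *. simpl.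
      specialize (IHl (fun z Hz => HN' z (or_intror Hz))). specialize (HN' a (or_introl eq_refl)). lra. }
    assert (Hup : lsum (fun z => rsum (ind z) N) l <= rsum (fun j => if mdec j u (ell k) then om j else 0) N).
    { rewrite lsum_rsum_swap. apply rsum_le. intros j _.
      assert (Hcnt : lsum (fun z => ind z j) l = INR (length (filter (fun z => if mdec j (fr z) (ell (S k)) then true else false) l)) * om' j).
      { rewrite lsum_filter. clear. unfold lsum, ind. induction l; simpl; [ring|]. rewrite IHl. destruct mdec; ring. }
      set (met := filter (fun z => if mdec j (fr z) (ell (S k)) then true else false) l) in *.
      assert (Hmet : forall z, In z met -> In z l /\ meets j (fr z) (ell (S k))).
      { intros z Hz. apply filter_In in Hz. destruct Hz as [Hz1 Hz2]. destruct mdec; auto. discriminate. }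
      assert (Hmnd : NoDup met) by (apply NoDup_filter; auto).
      destruct (mdec j u (ell k)) as [Hm|Hm].
      - specialize (Hr j Hm). rewrite Hcnt.
        assert (Hrj : 0 <= r j). { destruct Hm as (x & Hx & _). specialize (Hthin j x x Hx Hx). rewrite Rminus_diag, Rabs_R0 in Hthin. auto. }
        assert (Hwin : forall a b, In a met -> In b met -> Rabs (fr a - fr b) <= r j + ell (S k)).
        { intros a b Ha Hb. destruct (Hmet a Ha) as (_ & x & Hx & Hxa). destruct (Hmet b Hb) as (_ & y & Hy & Hyb).
          pose proof (Hthin j x y Hx Hy) as Hxy. apply Rabs_le_between in Hxy. apply Rabs_le. lra. }
        assert (Hsp : forall a b, In a met -> In b met -> a <> b -> / (4 * INR (Q k) ^ 2) <= Rabs (fr a - fr b)).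
        { intros a b Ha Hb Hab. destruct (Hmet a Ha) as [Ha1 _]. destruct (Hmet b Hb) as [Hb1 _].
          destruct (Hl a Ha1) as (_ & Ha2 & Ha3 & _). destruct (Hl b Hb1) as (_ & Hb2 & Hb3 & _). apply fr_sep; auto; lia. }
        pose proof (ell_small k) as Hes.
        (* Children are [1 / (4 Q^2)] apart, while the next length is at most a quarter of this. So
           a short set meets at most one child, and a longer one at most [2 + 8 Q^2 r], which is the
           count in [Hcond]. *)
        unfold om'. destruct (Rlt_dec (r j) (ell (S k))) as [Hsm|Hmid].
        + assert (length met <= 1)%nat.
          { destruct met as [|a [|b met']]; simpl; try lia. exfalso.
            assert (Hab : a <> b) by (inversion Hmnd; subst; intros ->; apply H1; left; auto).
            specialize (Hsp a b (or_introl eq_refl) (or_intror (or_introl eq_refl)) Hab).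
            specialize (Hwin a b (or_introl eq_refl) (or_intror (or_introl eq_refl))).
            assert (/ (16 * INR (Q k) ^ 2) = / (4 * INR (Q k) ^ 2) / 4) by (field; lra).
            assert (0 < / (4 * INR (Q k) ^ 2)) by (apply Rinv_0_lt_compat; lra). lra. }
          apply le_INR in H. simpl (INR 1) in H. specialize (Hom j). nra.
        + apply Rnot_lt_le in Hmid. eapply Rle_trans; [|apply (Hcond j k); split; auto].
          apply Rmult_le_compat_r; [left; auto|].
          pose proof (sep_count fr met (/ (4 * INR (Q k) ^ 2)) (r j + ell (S k))) as Hsc.
          specialize (Hsc ltac:(apply Rinv_0_lt_compat; lra) ltac:(specialize (Hell (S k)); lra) Hmnd Hsp Hwin).
          eapply Rle_trans; [apply Hsc|].
          replace (2 * (r j + ell (S k)) / / (4 * INR (Q k) ^ 2)) with (8 * INR (Q k) ^ 2 * r j + 8 * INR (Q k) ^ 2 * ell (S k)) by (field; lra).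
          assert (8 * INR (Q k) ^ 2 * ell (S k) <= 8 * INR (Q k) ^ 2 * / (16 * INR (Q k) ^ 2)) by (apply Rmult_le_compat_l; lra).
          assert (8 * INR (Q k) ^ 2 * / (16 * INR (Q k) ^ 2) = 1 / 2) by (field; lra). lra.
      - rewrite Hcnt. destruct met as [|z met']; [simpl; lra|]. exfalso. apply Hm.
        destruct (Hmet z (or_introl eq_refl)) as (Hz & x & Hx & Hxz). exists x. split; auto. specialize (Hch z Hz). lra. }
    specialize (Hsum N).
    assert (mu k <= INR (length l) * mu (S k)).
    { rewrite (HmuS k), Rmult_comm. apply Rmult_le_compat_r; [left; auto|]. lra. }
    lra. }
  destruct Hex as (z & Hz & HN). destruct (Hl z Hz) as (Ho & Hq & Hg & _). destruct (Hch z Hz) as [Hc1 Hc2].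
  exists z. split; auto. split; [lia|]. split; auto. split; auto. split; auto.
  assert (Hsmall : forall j, meets j (fr z) (ell (S k)) -> r j < ell (S k)).
  { intros j Hj. apply Rnot_le_lt. intros Hge. specialize (HN (S j)).
    assert (ind z j = mu (S k)).
    { unfold ind, om'. destruct mdec; [|contradiction]. destruct Rlt_dec; lra. }
    pose proof (rsum_le1 (ind z) (S j) j (fun i _ => Hind z i) ltac:(lia)). lra. }
  split; [lra|]. split; auto. intros N. eapply Rle_lt_trans; [|apply (HN N)]. apply rsum_le. intros j _.
  unfold ind, om'. destruct mdec as [Hj|]; [|lra]. specialize (Hsmall j Hj). destruct Rlt_dec; lra.
Qed.

Hypothesis Hrpos : forall j, 0 < r j.
Hypothesis Hr0 : forall j, r j < ell 0.
Hypothesis Hsum0 : forall N, rsum om N < mu 0.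
Hypothesis Hl01 : ell 0%nat < 1.
Hypothesis HQinf : forall k, (k <= Q k)%nat.

(** Dependent choice of children and completeness give the point. The left ends chosen after level 0
    are themselves reduced fractions, so nesting yields the approximation. *)
Lemma cantor_game : exists x, 0 <= x < 1 /\ approx tau x /\ forall j, ~ V j x.
Proof.
  assert (Hinit : load_bounded 0 0).
  { split; [lra|]. split; auto. intros N. eapply Rle_lt_trans; [|apply (Hsum0 N)]. apply rsum_le. intros j _.
    destruct mdec; auto. lra. }
  set (nxt := fun (k : nat) (u : {u | load_bounded k u}) =>
     constructive_indefinite_description _ (step k (proj1_sig u) (proj2_sig u))).
  set (seqn := fix sq (k : nat) : {u | load_bounded k u} :=
     match k with
     | O => exist _ 0 Hinit
     | S k' => exist _ (fr (proj1_sig (nxt k' (sq k'))))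
        (proj2 (proj2 (proj2 (proj2 (proj2 (proj2_sig (nxt k' (sq k'))))))))
     end).
  set (u := fun k => proj1_sig (seqn k)). set (z := fun k => proj1_sig (nxt k (seqn k))).
  assert (Hz : forall k, Nat.Odd (snd (z k)) /\ (1 <= snd (z k) <= 2 * Q k)%nat /\ Nat.gcd (fst (z k)) (snd (z k)) = 1%nat /\
     u k <= fr (z k) /\ fr (z k) + ell (S k) <= u k + ell k).
  { intros k. destruct (proj2_sig (nxt k (seqn k))) as (A1 & A2 & A3 & A4 & A5 & _). unfold z, u. auto. }
  assert (Hus : forall k, u (S k) = fr (z k)) by reflexivity.
  assert (Hinv : forall k, load_bounded k (u k)) by (intros k; exact (proj2_sig (seqn k))).
  assert (Hnest : forall m k, u k <= u (k + m)%nat /\ u (k + m)%nat + ell (k + m)%nat <= u k + ell k).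
  { induction m; intros k. rewrite Nat.add_0_r. lra. rewrite Nat.add_succ_r. specialize (IHm k).
    destruct (Hz (k + m)%nat) as (_ & _ & _ & A4 & A5). rewrite Hus. lra. }
  destruct (completeness (fun y => exists k, y = u k)) as [x [Hx1 Hx2]].
  { exists (ell 0). intros y (k & ->). destruct (Hnest k O) as [_ H]. simpl in H. pose proof (Hell k).
    assert (u O = 0) by reflexivity. lra. }
  { exists (u O). exists O; auto. }
  assert (Hxk : forall k, u k <= x <= u k + ell k).
  { intros k. split; [apply Hx1; eauto|]. apply Hx2. intros y (m & ->).
    destruct (le_lt_dec k m) as [Hkm|Hkm].
    - destruct (Hnest (m - k)%nat k) as [_ H]. replace (k + (m - k))%nat with m in H by lia. pose proof (Hell m). lra.
    - destruct (Hnest (k - m)%nat m) as [H _]. replace (m + (k - m))%nat with k in H by lia. pose proof (Hell k). lra. }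
  assert (Hell0 : forall k, ell k <= ell 0 * (/ 2) ^ k).
  { induction k; simpl; [lra|]. pose proof (Hhalf k). lra. }
  exists x. split; [|split].
  - specialize (Hxk O). assert (u O = 0) by reflexivity. lra.
  - intros Q0. destruct (Hz Q0) as (A1 & A2 & A3 & _). exists (Q Q0), (Z.of_nat (fst (z Q0))), (snd (z Q0)).
    split; [auto|]. split; [lia|]. split; [auto|]. split.
    + apply gcd_nat_Z, A3.
    + rewrite <- INR_IZR_INZ. fold (fr (z Q0)). rewrite <- Hus. specialize (Hxk (S Q0)). rewrite HellS in Hxk.
      pose proof (Rpower_pos (INR (Q Q0)) (- tau)). apply Rabs_le. lra.
  (* At a level whose length is below [r j], the last clause of [load_bounded] is contradicted. *)
  - intros j Hj. destruct (pow_lt_1_zero (/ 2) ltac:(rewrite Rabs_right; lra) (r j) (Hrpos j)) as [k Hk].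
    specialize (Hk k (le_n _)). rewrite Rabs_right in Hk by (apply Rle_ge, pow_le; lra).
    destruct (Hinv k) as (_ & _ & Hr). specialize (Hr j (ex_intro _ x (conj Hj (Hxk k)))).
    specialize (Hell0 k). pose proof (pow_lt (/ 2) k ltac:(lra)). nra.
Qed.
End Game.

(** The condition on [ell] sits under the quantifier so that choosing a witness defines a total
    function. The bound [(1 / ell)^k] makes [ell] negligible against powers of [Q]; [16 / ell]
    ensures that the lengths halve and the loads decrease. *)
Lemma scale_exists (k : nat) (ell : R) : exists Q : nat, 0 < ell < 1 ->
  (1 <= Q)%nat /\ (k <= Q)%nat /\ farey Q (ell / 2) /\ Rpower (/ ell) (INR k) <= INR Q /\ 16 / ell <= INR Q.
Proof.
  destruct (Rlt_dec 0 ell) as [H0|]; [|exists O; lra]. destruct (Rlt_dec ell 1) as [H1|]; [|exists O; lra].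
  destruct (farey_exists (ell / 2)) as [M0 HM0]; [lra|].
  assert (H16 : 0 < 16 / ell) by (apply Rdiv_lt_0_compat; lra).
  pose proof (Rpower_pos (/ ell) (INR k)) as Hp.
  destruct (nfloor_ex (Rpower (/ ell) (INR k) + 16 / ell)) as [n Hn]; [lra|].
  set (M := (M0 + S n + k)%nat). exists (2 * M)%nat. intros _.
  assert (HM : INR (S n) <= INR (2 * M)) by (apply le_INR; unfold M; lia). rewrite S_INR in HM.
  split; [unfold M; lia|]. split; [unfold M; lia|]. split; [apply HM0; unfold M; lia|]. lra.
Qed.

Section Scales.
Variable tau : R.
Hypothesis Htau : 2 <= tau.

Definition scale (k : nat) (ell : R) : nat := proj1_sig (constructive_indefinite_description _ (scale_exists k ell)).
Fixpoint cantor_length (k : nat) : R :=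
  match k with O => 1 / 2 | S k' => Rpower (INR (scale k' (cantor_length k'))) (- tau) / 16 end.
Definition cantor_denom (k : nat) : nat := scale k (cantor_length k).
(** Divided at each level by the number [ell Q^2 / 16] of children that [farey Q (ell / 2)]
    guarantees, like a mass spread evenly over them. *)
Fixpoint cantor_load (k : nat) : R :=
  match k with O => 1 | S k' => cantor_load k' / (cantor_length k' * INR (cantor_denom k') ^ 2 / 16) end.

Lemma scale_spec k ell : 0 < ell < 1 -> (1 <= scale k ell)%nat /\ (k <= scale k ell)%nat /\ farey (scale k ell) (ell / 2) /\
  Rpower (/ ell) (INR k) <= INR (scale k ell) /\ 16 / ell <= INR (scale k ell).
Proof. unfold scale. destruct constructive_indefinite_description as [Q HQ]. exact HQ. Qed.

Lemma cantor_length_S k : cantor_length (S k) = Rpower (INR (cantor_denom k)) (- tau) / 16. Proof. reflexivity. Qed.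

Lemma cantor_length_bound k : 0 < cantor_length k < 1.
Proof.
  induction k; [simpl; lra|]. rewrite cantor_length_S. destruct (scale_spec k _ IHk) as (H1 & _). fold (cantor_denom k) in H1.
  pose proof (Rpower_pos (INR (cantor_denom k)) (- tau)).
  assert (Rpower (INR (cantor_denom k)) (- tau) <= 1).
  { rewrite <- (Rpower_O (INR (cantor_denom k))) by (apply lt_0_INR; lia). apply Rle_Rpower; [apply (le_INR 1); auto|lra]. }
  lra.
Qed.

Lemma cantor_denom_spec k : (1 <= cantor_denom k)%nat /\ (k <= cantor_denom k)%nat /\ farey (cantor_denom k) (cantor_length k / 2) /\
  Rpower (/ cantor_length k) (INR k) <= INR (cantor_denom k) /\ 16 / cantor_length k <= INR (cantor_denom k).
Proof. apply scale_spec, cantor_length_bound. Qed.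

Lemma cantor_denom_ge k : 1 <= INR (cantor_denom k).
Proof. destruct (cantor_denom_spec k) as (H & _). apply (le_INR 1); auto. Qed.

Lemma cantor_length_half k : cantor_length (S k) <= cantor_length k / 2.
Proof.
  rewrite cantor_length_S. pose proof (cantor_length_bound k). pose proof (cantor_denom_ge k). destruct (cantor_denom_spec k) as (_ & _ & _ & _ & H2).
  assert (Rpower (INR (cantor_denom k)) (- tau) <= / INR (cantor_denom k)).
  { rewrite <- (Rpower_1 (INR (cantor_denom k))) at 2 by lra. rewrite <- Rpower_Ropp. apply Rle_Rpower; lra. }
  assert (/ INR (cantor_denom k) <= / (16 / cantor_length k)) by (apply Rinv_le_contravar; auto; apply Rdiv_lt_0_compat; lra).
  assert (/ (16 / cantor_length k) = cantor_length k / 16) by (field; lra). lra.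
Qed.

Lemma cantor_length_decr k m : (k <= m)%nat -> cantor_length m <= cantor_length k.
Proof. induction 1; [lra|]. pose proof (cantor_length_half m). pose proof (cantor_length_bound m). lra. Qed.

Lemma denom_ge1 k : 1 <= cantor_length k * INR (cantor_denom k) ^ 2 / 16.
Proof.
  pose proof (cantor_length_bound k). pose proof (cantor_denom_ge k). destruct (cantor_denom_spec k) as (_ & _ & _ & _ & H2).
  apply Rle_div_l in H2; [|lra]. simpl. nra.
Qed.

Lemma cantor_load_bound k : 0 < cantor_load k <= 1.
Proof.
  induction k; [simpl; lra|]. simpl cantor_load. pose proof (denom_ge1 k). split; [apply Rdiv_lt_0_compat; lra|].
  apply Rle_div_l; lra.
Qed.

Lemma cantor_load_S k : cantor_load k = cantor_load (S k) * (cantor_length k * INR (cantor_denom k) ^ 2 / 16).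
Proof. simpl cantor_load. pose proof (denom_ge1 k). pose proof (cantor_length_bound k). pose proof (cantor_denom_ge k). field. split; lra. Qed.

(** The load is at most of order [1 / (ell_k Q_k^2)], the wanted bound is of order [Q_k^(- tau t)].
    With [a = 2 - tau t > 0] it remains to see [1 / ell_k <= Q_k^a], which follows from
    [Q_k >= ell_k^(-k)] once [k a >= 1]. *)
Lemma cantor_load_elln t : 0 < t -> tau * t < 2 -> exists k0, forall k, (k0 <= k)%nat ->
  cantor_load (S k) <= 16 * Rpower 16 t * Rpower (cantor_length (S k)) t.
Proof.
  intros Ht Htt. set (a := 2 - tau * t). assert (Ha : 0 < a) by (unfold a; lra).
  destruct (nfloor_ex (/ a)) as [n Hn]; [left; apply Rinv_0_lt_compat; auto|].
  exists (S n). intros k Hk. apply le_INR in Hk. rewrite S_INR in Hk.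
  assert (Hka : 1 <= INR k * a).
  { assert (/ a * a = 1) by (field; lra). nra. }
  pose proof (cantor_length_bound k) as Hl. pose proof (cantor_denom_ge k) as HQ. destruct (cantor_denom_spec k) as (_ & _ & _ & HQ1 & _).
  pose proof (cantor_load_bound k). pose proof (denom_ge1 k).
  assert (Hli : 1 <= / cantor_length k) by (rewrite <- Rinv_1; apply Rinv_le_contravar; lra).
  assert (Hq : / cantor_length k <= Rpower (INR (cantor_denom k)) a).
  { apply Rle_trans with (Rpower (Rpower (/ cantor_length k) (INR k)) a).
    - rewrite Rpower_mult. rewrite <- (Rpower_1 (/ cantor_length k)) at 1 by lra. apply Rle_Rpower; auto.
    - apply Rle_Rpower_l; [lra|]. split; [apply Rpower_pos|auto]. }
  assert (Hm : cantor_load (S k) <= 16 * (/ cantor_length k * / INR (cantor_denom k) ^ 2)).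
  { change (cantor_load (S k)) with (cantor_load k / (cantor_length k * INR (cantor_denom k) ^ 2 / 16)). replace (cantor_load k / (cantor_length k * INR (cantor_denom k) ^ 2 / 16)) with (cantor_load k * (16 * (/ cantor_length k * / INR (cantor_denom k) ^ 2))) by (field; split; lra).
    assert (0 < / cantor_length k) by lra. assert (0 < / INR (cantor_denom k) ^ 2) by (apply Rinv_0_lt_compat, pow_lt; lra).
    assert (0 < 16 * (/ cantor_length k * / INR (cantor_denom k) ^ 2)) by (apply Rmult_lt_0_compat; [lra|apply Rmult_lt_0_compat; auto]).
    apply Rle_trans with (1 * (16 * (/ cantor_length k * / INR (cantor_denom k) ^ 2))); [apply Rmult_le_compat_r; lra|lra]. }
  eapply Rle_trans; [apply Hm|]. rewrite (Rmult_assoc 16). apply Rmult_le_compat_l; [lra|].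
  rewrite cantor_length_S. rewrite Rpower_mult_distr by (try lra; apply Rdiv_lt_0_compat; try lra; apply Rpower_pos).
  replace (16 * (Rpower (INR (cantor_denom k)) (- tau) / 16)) with (Rpower (INR (cantor_denom k)) (- tau)) by field.
  rewrite Rpower_mult. replace (- tau * t) with (a + - (2)) by (unfold a; ring). rewrite Rpower_plus, Rpower_Ropp.
  replace (Rpower (INR (cantor_denom k)) 2) with (INR (cantor_denom k) ^ 2) by (rewrite <- Rpower_pow by lra; f_equal; simpl; ring).
  apply Rmult_le_compat_r; auto. left; apply Rinv_0_lt_compat, pow_lt; lra.
Qed.

(** A Frostman condition at all intermediate lengths. The first term follows from the bound at level
    [S k]; the second equals [128 (r / ell_k) mu_k], and [mu_k <= C1 ell_k^t] with [t < 1] gives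
    [(r / ell_k) ell_k^t <= r^t]. Taking [r < rho] forces [k] to be large. *)
Lemma gauge t : 0 < t -> tau * t < 2 -> exists C rho, 0 < C /\ 0 < rho <= cantor_length 0 /\ forall k r,
  cantor_length (S k) <= r < cantor_length k -> r < rho -> (2 + 8 * INR (cantor_denom k) ^ 2 * r) * cantor_load (S k) <= C * Rpower r t.
Proof.
  intros Ht Htt. destruct (cantor_load_elln t Ht Htt) as [k0 Hk0].
  set (C1 := 16 * Rpower 16 t). assert (HC1 : 0 < C1) by (unfold C1; pose proof (Rpower_pos 16 t); lra).
  exists (130 * C1), (cantor_length (S k0)). split; [lra|]. split; [split; [apply cantor_length_bound|apply cantor_length_decr; lia]|].
  intros k r Hr Hrho.
  assert (Hk : (k0 < k)%nat).
  { apply Nat.nle_gt. intros Hle. pose proof (cantor_length_decr (S k) (S k0) ltac:(lia)). lra. }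
  pose proof (cantor_length_bound k) as Hl. pose proof (cantor_length_bound (S k)) as Hl'. pose proof (cantor_denom_ge k) as HQ.
  assert (Ht1 : t < 1) by nra.
  assert (A1 : cantor_load (S k) <= C1 * Rpower r t).
  { eapply Rle_trans; [apply Hk0; lia|]. apply Rmult_le_compat_l; [unfold C1 in *; lra|]. apply Rle_Rpower_l; lra. }
  assert (A2 : cantor_load k <= C1 * Rpower (cantor_length k) t).
  { destruct k as [|k']; [lia|]. apply Hk0. lia. }
  assert (A3 : 8 * INR (cantor_denom k) ^ 2 * r * cantor_load (S k) = 128 * (r / cantor_length k) * cantor_load k).
  { rewrite (cantor_load_S k). field. lra. }
  assert (A4 : r / cantor_length k * Rpower (cantor_length k) t <= Rpower r t).
  { unfold Rdiv. rewrite Rmult_assoc. replace (/ cantor_length k * Rpower (cantor_length k) t) with (/ Rpower (cantor_length k) (1 - t)).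
    - apply Rle_div_l; [apply Rpower_pos|]. rewrite <- (Rpower_1 r) at 1 by lra. replace 1 with (t + (1 - t)) at 1 by ring.
      rewrite Rpower_plus. apply Rmult_le_compat_l; [left; apply Rpower_pos|]. apply Rle_Rpower_l; lra.
    - rewrite <- Rpower_Ropp. replace (- (1 - t)) with (- (1) + t) by ring. rewrite Rpower_plus, Rpower_Ropp, Rpower_1 by lra. auto. }
  assert (0 < r / cantor_length k) by (apply Rdiv_lt_0_compat; lra).
  assert (A5 : r / cantor_length k * cantor_load k <= C1 * Rpower r t).
  { apply Rle_trans with (r / cantor_length k * (C1 * Rpower (cantor_length k) t)); [apply Rmult_le_compat_l; lra|].
    replace (r / cantor_length k * (C1 * Rpower (cantor_length k) t)) with (C1 * (r / cantor_length k * Rpower (cantor_length k) t)) by ring.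
    apply Rmult_le_compat_l; lra. }
  rewrite Rmult_plus_distr_r, A3. lra.
Qed.

(* Countably many sets of dimension below [2/tau] cannot exhaust the Cantor set of [tau]-approximable points. *)
Lemma cantor_main (t : nat -> R) (E : nat -> R -> Prop) :
  (forall n, 0 < t n /\ tau * t n < 2) ->
  (forall n eps del, 0 < eps -> 0 < del -> exists (U : nat -> R -> Prop) (r : nat -> R),
    (forall i, 0 < r i <= del) /\ (forall i, thin (U i) (r i)) /\ (forall x, E n x -> exists i, U i x) /\
    (forall N, rsum (fun i => Rpower (r i) (t n)) N <= eps)) ->
  exists x, 0 <= x < 1 /\ approx tau x /\ forall n, ~ E n x.
Proof.
  intros Ht HE.
  (* The cover of [E n] gets total weight at most [2^(-(n+2))], so all covers together stay below
     the initial load 1. The constant [C] turns the gauge of [E n] into the required weights. *)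
  assert (Hpre : forall n, exists (UrC : (nat -> R -> Prop) * (nat -> R) * R), let U := fst (fst UrC) in let r := snd (fst UrC) in let C := snd UrC in
     0 < C /\ (forall i, 0 < r i < cantor_length 0) /\ (forall i, thin (U i) (r i)) /\ (forall x, E n x -> exists i, U i x) /\
     (forall N, rsum (fun i => C * Rpower (r i) (t n)) N <= (/ 2) ^ S (S n)) /\
     (forall i k, cantor_length (S k) <= r i < cantor_length k -> (2 + 8 * INR (cantor_denom k) ^ 2 * r i) * cantor_load (S k) <= C * Rpower (r i) (t n))).
  { intros n. destruct (Ht n) as [Ht1 Ht2]. destruct (gauge (t n) Ht1 Ht2) as (C & rho & HC & Hrho & Hg).
    assert (Hp : 0 < (/ 2) ^ S (S n)) by (apply pow_lt; lra).
    destruct (HE n ((/ 2) ^ S (S n) / C) (rho / 2)) as (U & r & Hr & Hth & Hcv & Hs); [apply Rdiv_lt_0_compat; auto|lra|].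
    exists (U, r, C). cbn [fst snd]. split; auto. split; [intros i; specialize (Hr i); lra|]. split; auto. split; auto. split.
    - intros N. rewrite rsum_scal, Rmult_comm. apply Rle_div_r; auto.
    - intros i k Hk. apply Hg; auto. specialize (Hr i); lra. }
  destruct (choice _ Hpre) as [F HF]. clear Hpre.
  set (w := fun n i => snd (F n) * Rpower (snd (fst (F n)) i) (t n)).
  assert (Hw : forall n i, 0 <= w n i).
  { intros n i. destruct (HF n) as (HC & _). apply Rmult_le_pos; [lra|left; apply Rpower_pos]. }
  destruct (cantor_game tau cantor_length cantor_load cantor_denom Htau) with
    (V := fun j => fst (fst (F (fst (of_nat j)))) (snd (of_nat j)))
    (r := fun j => snd (fst (F (fst (of_nat j)))) (snd (of_nat j)))
    (om := fun j => w (fst (of_nat j)) (snd (of_nat j))) as (x & Hx & Hap & Hnot).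
  - intros k; apply cantor_denom_spec.
  - intros k; apply cantor_length_bound.
  - apply cantor_length_S.
  - apply cantor_length_half.
  - intros k; apply cantor_load_bound.
  - apply cantor_load_S.
  - intros k; apply cantor_denom_spec.
  - intros j. destruct (HF (fst (of_nat j))) as (_ & _ & H & _). apply H.
  - intros j; apply Hw.
  - intros j k Hk. destruct (HF (fst (of_nat j))) as (_ & _ & _ & _ & _ & H). apply H. auto.
  - intros j. destruct (HF (fst (of_nat j))) as (_ & H & _). apply H.
  - intros j. destruct (HF (fst (of_nat j))) as (_ & H & _). apply H.
  - intros N. eapply Rle_lt_trans; [apply (rsum_pairing w N Hw)|].
    apply Rle_lt_trans with (rsum (fun n => (/ 2) ^ S (S n)) N).
    + apply rsum_le. intros n _. destruct (HF n) as (_ & _ & _ & _ & H & _). apply H.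
    + assert (Eq : rsum (fun n => (/ 2) ^ S (S n)) N = / 2 - (/ 2) ^ S N).
      { induction N; [simpl; lra|]. rewrite rsum_S, IHN. simpl. field. }
      pose proof (pow_lt (/ 2) (S N) ltac:(lra)). simpl cantor_load. lra.
  - simpl. lra.
  - intros k; apply cantor_denom_spec.
  - exists x. split; auto. split; auto. intros n Hn. destruct (HF n) as (_ & _ & _ & Hcv & _).
    destruct (Hcv x Hn) as [i Hi]. apply (Hnot (to_nat (n, i))). rewrite cancel_of_to. exact Hi.
Qed.
End Scales.

(** * Moments of the blocks and Besov exponents *)

Lemma continuous_rpow p x : 0 < p -> continuous (fun t => rpow t p) x.
Proof.
  intros Hp. apply continuity_pt_filterlim. destruct (Rtotal_order x 0) as [H|[->|H]].
  - apply continuity_pt_ext_loc with (fun _ => 0).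
    + exists (mkposreal (- x) ltac:(lra)). intros y Hy. unfold rpow. destruct Rle_dec; auto.
      unfold ball in Hy; simpl in Hy. unfold AbsRing_ball, abs, minus, plus, opp in Hy; simpl in Hy. apply Rabs_lt_between in Hy. lra.
    + apply continuity_pt_const. intros a b; auto.
  - intros eps He. exists (Rpower eps (/ p)). split; [apply Rpower_pos|].
    intros y [_ Hy]. simpl in *. unfold R_dist in *. unfold rpow at 2. destruct (Rle_dec 0 0); [|lra].
    rewrite Rminus_0_r in *. unfold rpow. destruct Rle_dec; [rewrite Rabs_R0; lra|].
    rewrite Rabs_right by (apply Rle_ge; left; apply Rpower_pos). rewrite Rabs_right in Hy by lra.
    replace eps with (Rpower (Rpower eps (/ p)) p) by (rewrite Rpower_mult, Rinv_l, Rpower_1; lra).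
    apply Rlt_Rpower_l; lra.
  - apply continuity_pt_ext_loc with (fun t => Rpower t p).
    + exists (mkposreal x H). intros y Hy. unfold rpow. destruct Rle_dec; auto.
      unfold ball in Hy; simpl in Hy. unfold AbsRing_ball, abs, minus, plus, opp in Hy; simpl in Hy. apply Rabs_lt_between in Hy. lra.
    + apply derivable_continuous_pt. exists (p * Rpower x (p - 1)). apply derivable_pt_lim_power; auto.
Qed.

Lemma A2_ge0 g B y : 0 <= A2 g B y.
Proof. unfold A2. pose proof (pow2_ge_0 (FC g B y)). pose proof (pow2_ge_0 (FS g B y)). lra. Qed.

Lemma A2_expand g B y : A2 g B y =
  rsum (fun i => rsum (fun j => g i * g j * cos (2 * PI * IZR (Z.of_nat (i * i) - Z.of_nat (j * j)) * y + 0)) B) B.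
Proof.
  unfold A2, FC, FS. rewrite <- !Rsqr_pow2; unfold Rsqr. rewrite !rsum_mul, <- rsum_plus.
  apply rsum_ext. intros i _. rewrite <- rsum_plus. apply rsum_ext. intros j _.
  rewrite minus_IZR, <- !INR_IZR_INZ, Rplus_0_r.
  replace (2 * PI * (INR (i * i) - INR (j * j)) * y) with (2 * PI * INR (i * i) * y - 2 * PI * INR (j * j) * y) by ring.
  rewrite cos_minus. ring.
Qed.

Lemma A2_integral g B : is_RInt (A2 g B) 0 1 (rsum (fun i => g i * g i) B).
Proof.
  apply (is_RInt_ext (fun t => rsum (fun i => rsum (fun j => g i * g j * cos (2 * PI * IZR (Z.of_nat (i * i) - Z.of_nat (j * j)) * t + 0)) B) B)).
  - intros t _. rewrite A2_expand. auto.
  - eapply is_RInt_eqR.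
    + apply (is_RInt_rsum (fun i t => rsum (fun j => g i * g j * cos (2 * PI * IZR (Z.of_nat (i * i) - Z.of_nat (j * j)) * t + 0)) B)
        (fun i => rsum (fun j => g i * g j * (if Z.eqb (Z.of_nat (i * i) - Z.of_nat (j * j)) 0 then cos 0 else 0)) B)).
      intros i _. apply (is_RInt_rsum (fun j t => g i * g j * cos (2 * PI * IZR (Z.of_nat (i * i) - Z.of_nat (j * j)) * t + 0))
         (fun j => g i * g j * (if Z.eqb (Z.of_nat (i * i) - Z.of_nat (j * j)) 0 then cos 0 else 0))).
      intros j _. apply (is_RInt_scal (V := R_NormedModule) _ 0 1 (g i * g j)).
      replace 1 with (0 + 1) by ring. apply is_RInt_cos.
    + apply rsum_ext. intros i Hi. rewrite (rsum_ext _ (fun j => if Nat.eqb j i then g i * g i else 0)). apply rsum_delta; auto.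
      intros j _. rewrite cos_0. destruct (Z.eqb_spec (Z.of_nat (i * i) - Z.of_nat (j * j)) 0), (Nat.eqb_spec j i); subst; try ring; try lia.
      exfalso. apply n. nia.
Qed.

Lemma A2_continuous g B x : continuous (A2 g B) x.
Proof.
  apply (continuous_ext (fun t => rsum (fun i => rsum (fun j => g i * g j * cos (2 * PI * IZR (Z.of_nat (i * i) - Z.of_nat (j * j)) * t + 0)) B) B)).
  - intros t. rewrite <- A2_expand. auto.
  - apply continuous_rsum. intros i _. apply continuous_rsum. intros j _.
    apply (ex_derive_continuous (K := R_AbsRing) (V := R_NormedModule)). auto_derive; auto.
Qed.

Definition block_moment (s p : R) (k : nat) : R := RInt (fun x => rpow (sqrt (A2 (gk s k) (Bk k) x)) p) 0 1.

Lemma root_continuous g B p x : 0 < p -> continuous (fun x => rpow (sqrt (A2 g B x)) p) x.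
Proof.
  intros Hp. apply (continuous_comp (fun x => sqrt (A2 g B x)) (fun t => rpow t p)); [|apply continuous_rpow; auto].
  apply (continuous_comp (A2 g B) sqrt); [apply A2_continuous|apply continuous_sqrt].
Qed.

Lemma Lp_block_S s p k : 1 / 2 < s -> Lp_norm p (LP_block (Riemann_fn s) (S k)) = rpow (block_moment s p k) (/ p).
Proof.
  intros Hs. unfold Lp_norm, block_moment. f_equal. apply RInt_ext. intros x _. f_equal.
  rewrite LP_block_Riemann by auto. unfold Cmod; cbn [fst snd]. rewrite A2_FP. auto.
Qed.

Lemma Lp_block_0 s p : 1 / 2 < s -> Lp_norm p (LP_block (Riemann_fn s) 0) = 0.
Proof.
  intros Hs. unfold Lp_norm. rewrite (RInt_ext _ (fun _ => 0)).
  - rewrite RInt_const. unfold scal; simpl; unfold mult; simpl. rewrite Rmult_0_r. unfold rpow. destruct Rle_dec; lra.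
  - intros x _. rewrite LP_block0_Riemann by auto. unfold Cmod; cbn [fst snd].
    replace (0 ^ 2 + 0 ^ 2) with 0 by ring. rewrite sqrt_0. unfold rpow. destruct Rle_dec; lra.
Qed.

Lemma gk_BV s k : 0 <= s -> BV (gk s k) (Bk k) (2 * pw k (- s)).
Proof.
  intros Hs. pose proof (gkj_BV s k 0 Hs) as H. simpl pow in H. simpl (INR 0) in H.
  rewrite Rmult_1_l, Rminus_0_l in H. destruct H as (H1 & H2 & H3 & H4).
  assert (E : forall n, gkj s k 0 n = gk s k n) by (intros; unfold gkj; simpl; ring).
  split; [auto|]. split; [intros n; rewrite <- E; auto|]. split; [intros n Hn; rewrite <- E; auto|].
  rewrite (rsum_ext _ (fun n => Rabs (gkj s k 0 (S n) - gkj s k 0 n))); auto. intros; rewrite !E; auto.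
Qed.

Lemma atan_integral N z : 0 < N -> is_RInt (fun y => N ^ 2 / (1 + (N * (y - z)) ^ 2)) 0 1 (N * (atan (N * (1 - z)) - atan (N * (0 - z)))).
Proof.
  intros HN. assert (Hd : forall y, 1 + (N * (y - z)) ^ 2 <> 0) by (intros y; pose proof (pow2_ge_0 (N * (y - z))); lra).
  eapply is_RInt_eqR.
  - apply (is_RInt_derive (V := R_CompleteNormedModule) (fun y => N * atan (N * (y - z)))).
    + intros y _. auto_derive; auto. specialize (Hd y). field.
      replace (1 + (N * (y - z)) * (N * (y - z))) with (1 + (N * (y - z)) ^ 2) by ring.
      repeat split; try auto. all: simpl in *; try nra.
    + intros y _. apply (ex_derive_continuous (K := R_AbsRing) (V := R_NormedModule)). auto_derive. specialize (Hd y). simpl in *. auto.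
  - unfold minus, plus, opp; simpl. toR. ring.
Qed.

(** The unknown fraction near [y] is replaced by a sum over all fractions. The square of the smaller
    of [N^2 / q] and [1 / (q |b|)] is at most twice [q^(-2) N^4 / (1 + (N^2 b)^2)], which can be
    integrated exactly. *)
Lemma A2_sq_pointwise g B N V y : BV g B V -> (B <= N)%nat -> (1 <= N)%nat -> 0 <= y <= 1 ->
  let K := 100 * V ^ 2 * harm (4 * N) in
  A2 g B y ^ 2 <= 2 * K ^ 2 * INR N ^ 2 +
    4 * K ^ 2 * rsum (fun q => rsum (fun a => / INR (S q) ^ 2 * ((INR N ^ 2) ^ 2 / (1 + (INR N ^ 2 * (y - INR a / INR (S q))) ^ 2))) (S (S q))) (4 * N).
Proof.
  intros Hg HB HN Hy K. destruct (pointwise_bound g B N V y Hg HB HN) as (a & q & Hq & Hb & H1 & H2).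
  fold K in H1, H2. set (b := y - IZR a / INR q) in *.
  assert (HNp : 1 <= INR N) by (apply (le_INR 1); auto). assert (Hqp : 1 <= INR q) by (apply (le_INR 1); lia).
  assert (HK : 0 <= K) by (unfold K; pose proof (pow2_ge_0 V); pose proof (harm_ge0 (4 * N)); nra).
  assert (Hbq : Rabs (INR q * b) <= / 4).
  { rewrite Rabs_mult, (Rabs_right (INR q)) by lra. apply Rle_trans with (INR q * / (4 * INR N * INR q)); [apply Rmult_le_compat_l; lra|].
    replace (INR q * / (4 * INR N * INR q)) with (/ (4 * INR N)) by (field; lra). apply Rinv_le_contravar; lra. }
  assert (Eb : INR q * b = INR q * y - IZR a) by (unfold b; field; lra).
  rewrite Eb in Hbq. apply Rabs_le_between in Hbq.
  assert (Ha0 : (0 <= a)%Z). { apply Z.lt_pred_le. apply lt_IZR. simpl. nra. }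
  assert (Ha1 : (a <= Z.of_nat q)%Z). { apply Z.lt_succ_r. apply lt_IZR. rewrite succ_IZR, <- INR_IZR_INZ. nra. }
  set (t := fun q a => / INR (S q) ^ 2 * ((INR N ^ 2) ^ 2 / (1 + (INR N ^ 2 * (y - INR a / INR (S q))) ^ 2))).
  assert (Ht : forall q a, 0 <= t q a).
  { intros q' a'. unfold t. assert (0 < INR (S q')) by (apply lt_0_INR; lia).
    apply Rmult_le_pos; [left; apply Rinv_0_lt_compat, pow_lt; auto|].
    apply Rdiv_le_0_compat; [apply pow2_ge_0|]. pose proof (pow2_ge_0 (INR N ^ 2 * (y - INR a' / INR (S q')))). lra. }
  assert (Hsum : t (q - 1)%nat (Z.to_nat a) <= rsum (fun q => rsum (fun a => t q a) (S (S q))) (4 * N)).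
  { eapply Rle_trans; [|apply (rsum_le1 (fun q => rsum (fun a => t q a) (S (S q))) (4 * N) (q - 1))].
    - apply (rsum_le1 (fun a => t (q - 1)%nat a)); auto. lia.
    - intros; apply rsum_ge0; auto.
    - lia. }
  assert (Et : t (q - 1)%nat (Z.to_nat a) = / INR q ^ 2 * ((INR N ^ 2) ^ 2 / (1 + (INR N ^ 2 * b) ^ 2))).
  { unfold t. replace (S (q - 1)) with q by lia. rewrite (INR_IZR_INZ (Z.to_nat a)), Z2Nat.id by auto. reflexivity. }
  (* [m] is the smaller of [N^2/q] and [1/(q|b|)] *)
  set (N2 := INR N ^ 2) in *. assert (HN2 : 1 <= N2) by (unfold N2; nra).
  assert (Hm : exists m, 0 <= m /\ A2 g B y <= K * (INR N + m) /\ m ^ 2 <= 2 * t (q - 1)%nat (Z.to_nat a)).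
  { pose proof (pow2_ge_0 (N2 * b)) as Hsq.
    destruct (Rle_dec (N2 * Rabs b) 1) as [Hs|Hl].
    - exists (N2 / INR q). split; [apply Rdiv_le_0_compat; lra|]. split; [auto|]. rewrite Et.
      assert ((N2 * b) ^ 2 <= 1).
      { rewrite <- (pow2_abs (N2 * b)), Rabs_mult, (Rabs_right N2) by lra. pose proof (Rabs_pos b).
        assert (0 <= N2 * Rabs b) by nra. replace 1 with (1 ^ 2) by ring. apply pow_incr; lra. }
      replace ((N2 / INR q) ^ 2) with (/ INR q ^ 2 * (N2 ^ 2)) by (field; lra).
      rewrite <- (Rmult_comm (/ INR q ^ 2 * _)), Rmult_assoc. apply Rmult_le_compat_l; [left; apply Rinv_0_lt_compat, pow_lt; lra|].
      unfold Rdiv. rewrite Rmult_assoc. rewrite <- (Rmult_1_r (N2 ^ 2)) at 1. apply Rmult_le_compat_l; [apply pow2_ge_0|].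
      apply Rmult_le_reg_l with (1 + (N2 * b) ^ 2); [lra|]. rewrite <- Rmult_assoc, Rinv_r by lra. lra.
    - apply Rnot_le_lt in Hl. assert (Hb0 : 0 < Rabs b).
      { destruct (Rabs_pos b) as [|E]; auto. rewrite <- E in Hl. lra. }
      assert (Hqb : 0 < INR q * Rabs b) by (apply Rmult_lt_0_compat; lra).
      exists (/ (INR q * Rabs b)). split; [left; apply Rinv_0_lt_compat; auto|]. split.
      + apply Rmult_le_reg_r with (INR q * Rabs b); auto. eapply Rle_trans; [apply H2|]. right. field. lra.
      + rewrite Et. rewrite <- (pow2_abs (N2 * b)), Rabs_mult, (Rabs_right N2) by lra.
        set (w := N2 * Rabs b) in *.
        assert (Hw : Rabs b = w / N2) by (unfold w; field; lra).
        rewrite Hw. replace ((/ (INR q * (w / N2))) ^ 2) with (/ INR q ^ 2 * (N2 ^ 2 * / w ^ 2)) by (field; lra).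
        rewrite <- (Rmult_comm (/ INR q ^ 2 * _)), Rmult_assoc. apply Rmult_le_compat_l; [left; apply Rinv_0_lt_compat, pow_lt; lra|].
        unfold Rdiv. rewrite Rmult_assoc. apply Rmult_le_compat_l; [apply pow2_ge_0|].
        assert (1 <= w ^ 2) by (replace 1 with (1 ^ 2) by ring; apply pow_incr; lra).
        apply Rmult_le_reg_l with ((1 + w ^ 2) * w ^ 2); [apply Rmult_lt_0_compat; lra|].
        replace ((1 + w ^ 2) * w ^ 2 * / w ^ 2) with (1 + w ^ 2) by (field; lra).
        replace ((1 + w ^ 2) * w ^ 2 * (/ (1 + w ^ 2) * 2)) with (2 * w ^ 2) by (field; lra). lra. }
  destruct Hm as (m & Hm0 & Hm1 & Hm2).
  assert (A2 g B y ^ 2 <= (K * (INR N + m)) ^ 2) by (apply pow_incr; split; [apply A2_ge0|auto]).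
  assert ((INR N + m) ^ 2 <= 2 * INR N ^ 2 + 2 * m ^ 2) by (pose proof (pow2_ge_0 (INR N - m)); nra).
  assert (HK2 : 0 <= K ^ 2) by apply pow2_ge_0.
  rewrite Rpow_mult_distr in H.
  apply Rle_trans with (K ^ 2 * (2 * INR N ^ 2 + 2 * m ^ 2)); [eapply Rle_trans; [apply H|apply Rmult_le_compat_l; auto]|].
  assert (K ^ 2 * m ^ 2 <= K ^ 2 * (2 * rsum (fun q => rsum (fun a => t q a) (S (S q))) (4 * N))) by (apply Rmult_le_compat_l; auto; lra).
  match goal with |- _ <= _ + 4 * K ^ 2 * ?X => change X with (rsum (fun q => rsum (fun a => t q a) (S (S q))) (4 * N)) end.
  fold N2 in H0 |- *. lra.
Qed.

(** Each kernel integrates to at most [PI N^2], and the [q + 1] numerators with weight [1 / q^2]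
    leave a harmonic sum. The 34 is 2 from the constant term plus 4 times 8. *)
Lemma A2_sq_integral g B N V : BV g B V -> (B <= N)%nat -> (1 <= N)%nat ->
  RInt (fun y => A2 g B y ^ 2) 0 1 <= (100 * V ^ 2 * harm (4 * N)) ^ 2 * INR N ^ 2 * (34 * harm (4 * N)).
Proof.
  intros Hg HB HN. set (K := 100 * V ^ 2 * harm (4 * N)). assert (HNp : 1 <= INR N) by (apply (le_INR 1); auto).
  assert (HN2 : 0 < INR N ^ 2) by nra.
  set (l := fun q a => / INR (S q) ^ 2 * (INR N ^ 2 * (atan (INR N ^ 2 * (1 - INR a / INR (S q))) - atan (INR N ^ 2 * (0 - INR a / INR (S q)))))).
  assert (Hint : is_RInt (fun y => plus (2 * K ^ 2 * INR N ^ 2) (scal (4 * K ^ 2)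
      (rsum (fun q => rsum (fun a => / INR (S q) ^ 2 * ((INR N ^ 2) ^ 2 / (1 + (INR N ^ 2 * (y - INR a / INR (S q))) ^ 2))) (S (S q))) (4 * N)))) 0 1
      (plus ((1 - 0) * (2 * K ^ 2 * INR N ^ 2)) (scal (4 * K ^ 2) (rsum (fun q => rsum (fun a => l q a) (S (S q))) (4 * N))))).
  { apply (is_RInt_plus (V := R_NormedModule)). apply (is_RInt_const (V := R_NormedModule)).
    apply (is_RInt_scal (V := R_NormedModule)).
    apply (is_RInt_rsum (fun q y => rsum (fun a => / INR (S q) ^ 2 * ((INR N ^ 2) ^ 2 / (1 + (INR N ^ 2 * (y - INR a / INR (S q))) ^ 2))) (S (S q)))
      (fun q => rsum (fun a => l q a) (S (S q)))).
    intros q _.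
    apply (is_RInt_rsum (fun a y => / INR (S q) ^ 2 * ((INR N ^ 2) ^ 2 / (1 + (INR N ^ 2 * (y - INR a / INR (S q))) ^ 2))) (l q)).
    intros a _. apply (is_RInt_scal (V := R_NormedModule) _ 0 1 (/ INR (S q) ^ 2)). apply atan_integral; auto. }
  eapply Rle_trans; [apply RInt_le with (g := fun y => plus (2 * K ^ 2 * INR N ^ 2) (scal (4 * K ^ 2)
      (rsum (fun q => rsum (fun a => / INR (S q) ^ 2 * ((INR N ^ 2) ^ 2 / (1 + (INR N ^ 2 * (y - INR a / INR (S q))) ^ 2))) (S (S q))) (4 * N))))|].
  - lra.
  - apply ex_RInt_cont. intros x. apply (continuous_ext (fun y => A2 g B y * A2 g B y)). intros t; toR; ring.
    apply (continuous_mult (K := R_AbsRing)); apply A2_continuous.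
  - eexists; apply Hint.
  - intros y Hy. apply (A2_sq_pointwise g B N V y); auto; lra.
  - rewrite (is_RInt_unique _ _ _ _ Hint).
    change ((1 - 0) * (2 * K ^ 2 * INR N ^ 2) + 4 * K ^ 2 * rsum (fun q => rsum (fun a => l q a) (S (S q))) (4 * N) <=
      K ^ 2 * INR N ^ 2 * (34 * harm (4 * N))).
    assert (Hpi : 0 < PI <= 4) by (split; [apply PI_RGT_0|apply PI_4]).
    assert (Hl : rsum (fun q => rsum (fun a => l q a) (S (S q))) (4 * N) <= 8 * INR N ^ 2 * harm (4 * N)).
    { unfold harm. rewrite <- rsum_scal. apply rsum_le. intros q _. assert (Hq : 1 <= INR (S q)) by (apply (le_INR 1); lia).
      eapply Rle_trans; [apply (rsum_bound _ (/ INR (S q) ^ 2 * (INR N ^ 2 * 4)))|].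
      - intros a _. unfold l. apply Rmult_le_compat_l; [left; apply Rinv_0_lt_compat, pow_lt; lra|].
        apply Rmult_le_compat_l; [lra|].
        pose proof (atan_bound (INR N ^ 2 * (1 - INR a / INR (S q)))). pose proof (atan_bound (INR N ^ 2 * (0 - INR a / INR (S q)))). lra.
      - rewrite (S_INR (S q)). apply Rle_trans with ((2 * INR (S q)) * (/ INR (S q) ^ 2 * (INR N ^ 2 * 4))).
        + apply Rmult_le_compat_r; [|lra]. apply Rmult_le_pos; [left; apply Rinv_0_lt_compat, pow_lt; lra|lra].
        + right. field. lra. }
    assert (HH : 1 <= harm (4 * N)) by (apply harm_ge1; lia).
    assert (HK2 : 0 <= K ^ 2) by apply pow2_ge_0.
    assert (K ^ 2 * rsum (fun q => rsum (fun a => l q a) (S (S q))) (4 * N) <= K ^ 2 * (8 * INR N ^ 2 * harm (4 * N))) by (apply Rmult_le_compat_l; auto).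
    assert (0 <= K ^ 2 * INR N ^ 2) by nra.
    assert (K ^ 2 * INR N ^ 2 <= K ^ 2 * INR N ^ 2 * harm (4 * N)) by nra.
    lra.
Qed.

(** For even block index the block starts at the integer [2^j]. The indices up to 5/4 of it are all
    inside, as [25/16 < 2]. Lower bounds along even blocks suffice against a Besov bound, which
    concerns every block. *)
Lemma block_low s j i : 0 <= s -> (2 <= j)%nat -> (i < 2 ^ (j - 2))%nat ->
  (2 ^ j + i < Bk (2 * j))%nat /\ in_block (2 * j) (2 ^ j + i) /\ Rpower 2 (- s) * pw (2 * j) (- s) <= gk s (2 * j) (2 ^ j + i).
Proof.
  intros Hs Hj Hi. set (a := (2 ^ (j - 2))%nat) in *.
  assert (E1 : (2 ^ j = 4 * a)%nat) by (unfold a; replace j with (2 + (j - 2))%nat at 1 by lia; rewrite Nat.pow_add_r; reflexivity).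
  assert (E2 : (2 ^ (2 * j) = 16 * (a * a))%nat).
  { replace (2 * j)%nat with (j + j)%nat by lia. rewrite Nat.pow_add_r, E1. ring. }
  assert (E3 : (2 ^ S (2 * j) = 32 * (a * a))%nat) by (rewrite Nat.pow_succ_r', E2; ring).
  assert (Hin : in_block (2 * j) (2 ^ j + i)) by (unfold in_block; rewrite E1, E2, E3; nia).
  split; [|split; auto].
  - unfold Bk. assert (2 ^ j + i <= Nat.sqrt (2 ^ S (2 * j)))%nat; [|lia]. apply Nat.sqrt_le_square. destruct Hin. lia.
  - rewrite gk_in by auto. rewrite <- Rpower_2k, Rpower_mult_distr; [|lra|apply lt_0_INR; rewrite E2; nia].
    destruct Hin as [H1 H2]. apply Rpower_neg_anti; [lra|]. split; [apply lt_0_INR; nia|].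
    replace 2 with (INR 2) at 1 by auto. rewrite <- mult_INR. apply le_INR. rewrite <- Nat.pow_succ_r'. lia.
Qed.

Lemma pw_half j : (2 <= j)%nat -> INR (2 ^ (j - 2)) = pw (2 * j) (1 / 2) / 4.
Proof.
  intros Hj. assert (E : (2 ^ j = 4 * 2 ^ (j - 2))%nat) by (replace j with (2 + (j - 2))%nat at 1 by lia; rewrite Nat.pow_add_r; reflexivity).
  assert (INR (2 ^ j) = pw (2 * j) (1 / 2)).
  { rewrite pw_nat. unfold pw. f_equal. rewrite mult_INR. simpl (INR 2). field. }
  rewrite <- H, E, mult_INR. simpl (INR 4). field.
Qed.

Lemma I2_lower s j : 0 <= s -> (2 <= j)%nat ->
  Rpower 2 (-2 * s) / 4 * pw (2 * j) (1 / 2 - 2 * s) <= rsum (fun n => gk s (2 * j) n * gk s (2 * j) n) (Bk (2 * j)).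
Proof.
  intros Hs Hj.
  apply Rle_trans with (rsum (fun i => (fun n => gk s (2 * j) n * gk s (2 * j) n) (2 ^ j + i)%nat) (2 ^ (j - 2))).
  - apply Rle_trans with (INR (2 ^ (j - 2)) * ((Rpower 2 (- s) * pw (2 * j) (- s)) * (Rpower 2 (- s) * pw (2 * j) (- s)))).
    + rewrite pw_half by auto. right.
      replace (-2 * s) with (- s + - s) by ring. replace (1 / 2 - 2 * s) with (1 / 2 + (- s + - s)) by field.
      rewrite !pw_plus, Rpower_plus. field.
    + rewrite <- rsum_const. apply rsum_le. intros i Hi. destruct (block_low s j i Hs Hj Hi) as (_ & _ & H).
      pose proof (Rpower_pos 2 (- s)). pose proof (pw_pos (2 * j) (- s)). apply Rmult_le_compat; auto; nra.
  - apply (rsum_inj_le (fun n => gk s (2 * j) n * gk s (2 * j) n) (fun i => 2 ^ j + i)%nat).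
    + intros; lia.
    + intros i Hi. apply (block_low s j i Hs Hj Hi).
    + intros n. pose proof (gk_ge0 s (2 * j) n). nra.
Qed.

Definition fourth_moment (s : R) (k : nat) : R := RInt (fun y => A2 (gk s k) (Bk k) y ^ 2) 0 1.

Lemma fourth_moment_upper s k : 0 <= s -> fourth_moment s k <= 4080000000 * INR (S k) ^ 3 * pw k (1 - 4 * s).
Proof.
  intros Hs. unfold fourth_moment. eapply Rle_trans; [apply (A2_sq_integral _ _ (Bk k) _ (gk_BV s k Hs)); [lia|unfold Bk; lia]|].
  pose proof (harm_Bk k) as Hh. pose proof (harm_ge0 (4 * Bk k)) as Hh0. pose proof (Bk_sqr k) as HB.
  set (h := harm (4 * Bk k)) in *. set (m := INR (S k)) in *.
  assert (Hp : 0 < pw k (- s)) by apply pw_pos. pose proof (pw_pos k 1).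
  replace (pw k (1 - 4 * s)) with (pw k 1 * pw k (- s) ^ 4).
  2:{ rewrite pw_pow, <- pw_plus. f_equal. simpl; ring. }
  (* [5440000 = 100^2 * 2^4 * 34]; the factor 750 that completes the constant is [5^3 * 6], from
     [harm_Bk] and [Bk_sqr]. *)
  replace ((100 * (2 * pw k (- s)) ^ 2 * h) ^ 2 * INR (Bk k) ^ 2 * (34 * h)) with
    (5440000 * pw k (- s) ^ 4 * (h ^ 3 * INR (Bk k) ^ 2)) by ring.
  replace (4080000000 * m ^ 3 * (pw k 1 * pw k (- s) ^ 4)) with (5440000 * pw k (- s) ^ 4 * ((5 * m) ^ 3 * (6 * pw k 1))) by ring.
  apply Rmult_le_compat_l; [apply Rmult_le_pos; [lra|apply pow_le; lra]|].
  apply Rmult_le_compat; auto. apply pow_le; auto. apply pow2_ge_0. apply pow_incr; auto.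
Qed.

(** * Bounds for the Besov exponents *)

Section Lower.
Variables (s p : R).
Hypothesis Hs : 1 / 2 < s.
Hypothesis Hp : 0 < p.

Lemma block_moment_ge0 k : 0 <= block_moment s p k.
Proof.
  unfold block_moment. replace 0 with (RInt (fun _ => 0) 0 1) at 1.
  - apply RInt_le; [lra|apply ex_RInt_cont; intros; apply continuous_const|apply ex_RInt_cont; intros; apply root_continuous; auto|].
    intros; apply rpow_ge0.
  - rewrite RInt_const. unfold scal; simpl; unfold mult; simpl. ring.
Qed.

(** Membership bounds [2^(k sig)] times the moment. If [sig > vs], half of the excess absorbs the
    polynomial factor and the other half still grows. *)
Lemma besov_growth sig vs (A : nat) c : 0 < c ->
  (forall j, (2 <= j)%nat -> c * pw (2 * j) (- vs) <= INR (S (2 * j)) ^ A * block_moment s p (2 * j)) ->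
  in_Besov (sig / p) p (Riemann_fn s) -> sig <= vs.
Proof.
  intros Hc HJ (M & HM). apply Rnot_lt_le. intros Hlt. set (e := sig - vs).
  assert (HMp : exists M1, 0 < M1 /\ forall j, (2 <= j)%nat -> pw (2 * j) sig * block_moment s p (2 * j) <= M1).
  { set (M0 := Rmax M 1). exists (Rpower 2 (- sig) * Rpower M0 p). split; [apply Rmult_lt_0_compat; apply Rpower_pos|].
    intros j Hj. assert (HJ0 : 0 < block_moment s p (2 * j)).
    { specialize (HJ j Hj). pose proof (pw_pos (2 * j) (- vs)).
      assert (0 < INR (S (2 * j)) ^ A) by (apply pow_lt, lt_0_INR; lia).
      destruct (block_moment_ge0 (2 * j)) as [|E]; auto. rewrite <- E in HJ. nra. }
    specialize (HM (S (2 * j))). rewrite Lp_block_S in HM by auto. unfold rpow in HM; destruct Rle_dec; [lra|].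
    assert (HM' : Rpower 2 (INR (S (2 * j)) * (sig / p)) * Rpower (block_moment s p (2 * j)) (/ p) <= M0) by (eapply Rle_trans; [apply HM|apply Rmax_l]).
    pose proof (Rle_Rpower_l _ M0 p (Rlt_le _ _ Hp) (conj (Rmult_lt_0_compat _ _ (Rpower_pos _ _) (Rpower_pos _ _)) HM')) as HM2.
    clear HM'. rename HM2 into HM'.
    rewrite <- Rpower_mult_distr in HM' by apply Rpower_pos. rewrite !Rpower_mult, Rinv_l, Rpower_1 in HM' by lra.
    replace (INR (S (2 * j)) * (sig / p) * p) with (INR (2 * j) * sig + sig) in HM' by (rewrite S_INR; field; lra).
    rewrite Rpower_plus in HM'. fold (pw (2 * j) sig) in HM'.
    apply Rmult_le_reg_l with (Rpower 2 sig); [apply Rpower_pos|].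
    replace (Rpower 2 sig * (Rpower 2 (- sig) * Rpower M0 p)) with (Rpower M0 p).
    lra. rewrite <- Rmult_assoc, <- Rpower_plus. replace (sig + - sig) with 0 by ring. rewrite Rpower_O; lra. }
  destruct HMp as (M1 & HM1 & HB). destruct (poly_pw A (e / 2)) as (M2 & HM2 & HP); [unfold e; lra|].
  destruct (Rpower_unbounded e (M2 * M1 / c) ltac:(unfold e; lra)) as [Q0 HQ0].
  set (j := (2 + Q0)%nat). specialize (HJ j ltac:(unfold j; lia)). specialize (HB j ltac:(unfold j; lia)). specialize (HP (2 * j)%nat).
  assert (Hgrow : M2 * M1 / c < pw (2 * j) (e / 2)).
  { eapply Rlt_le_trans; [apply (HQ0 (2 ^ j)%nat)|].
    - assert (j < 2 ^ j)%nat by (apply Nat.pow_gt_lin_r; lia). unfold j in *; lia.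
    - right. rewrite Rpower_2k. unfold pw. f_equal. rewrite mult_INR. simpl (INR 2). field. }
  apply Rlt_div_l in Hgrow; auto.
  assert (E : pw (2 * j) sig * pw (2 * j) (- vs) = pw (2 * j) (e / 2) * pw (2 * j) (e / 2)).
  { rewrite <- !pw_plus. f_equal. unfold e; field. }
  pose proof (pw_pos (2 * j) sig) as P1. pose proof (pw_pos (2 * j) (- vs)) as P2. pose proof (pw_pos (2 * j) (e / 2)) as P3.
  assert (H1 : c * (pw (2 * j) sig * pw (2 * j) (- vs)) <= INR (S (2 * j)) ^ A * M1).
  { apply Rle_trans with (INR (S (2 * j)) ^ A * (pw (2 * j) sig * block_moment s p (2 * j))).
    - replace (c * (pw (2 * j) sig * pw (2 * j) (- vs))) with (pw (2 * j) sig * (c * pw (2 * j) (- vs))) by ring.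
      replace (INR (S (2 * j)) ^ A * (pw (2 * j) sig * block_moment s p (2 * j))) with (pw (2 * j) sig * (INR (S (2 * j)) ^ A * block_moment s p (2 * j))) by ring.
      apply Rmult_le_compat_l; lra.
    - apply Rmult_le_compat_l; auto. apply pow_le, pos_INR. }
  rewrite E in H1.
  assert (H2 : INR (S (2 * j)) ^ A * M1 <= M2 * pw (2 * j) (e / 2) * M1) by (apply Rmult_le_compat_r; lra).
  nra.
Qed.

(* Near [x = 0] all the terms of a block add up in phase. *)
Lemma block_moment_lower_peak j : (2 <= j)%nat ->
  / 12 * Rpower (/ 8 * Rpower 2 (- s)) p * pw (2 * j) (- (p * (s - 1 / 2) + 1)) <= block_moment s p (2 * j).
Proof.
  intros Hj. set (k := (2 * j)%nat). set (X := pw k 1). assert (HX : 1 <= X) by (apply pw_ge1; lra).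
  set (U := / 8 * Rpower 2 (- s) * pw k (1 / 2 - s)).
  assert (HU : 0 < U) by (unfold U; pose proof (Rpower_pos 2 (- s)); pose proof (pw_pos k (1 / 2 - s)); repeat apply Rmult_lt_0_compat; lra).
  assert (Hcont : forall x, continuous (fun x => rpow (sqrt (A2 (gk s k) (Bk k) x)) p) x) by (intros; apply root_continuous; auto).
  (* In the block [n^2 < 2 X], so for [x <= 1 / (12 X)] the phase is at most [PI / 3] and its cosine
     at least 1/2. *)
  assert (Hix : 0 < / (12 * X) <= 1).
  { split; [apply Rinv_0_lt_compat; lra|]. rewrite <- Rinv_1. apply Rinv_le_contravar; lra. }
  assert (Hpt : forall x, 0 <= x <= / (12 * X) -> Rpower U p <= rpow (sqrt (A2 (gk s k) (Bk k) x)) p).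
  { intros x Hx.
    assert (HFC : U <= FC (gk s k) (Bk k) x).
    { apply Rle_trans with (rsum (fun i => (fun n => / 2 * gk s k n) (2 ^ j + i)%nat) (2 ^ (j - 2))).
      - apply Rle_trans with (INR (2 ^ (j - 2)) * (/ 2 * (Rpower 2 (- s) * pw k (- s)))).
        + rewrite pw_half by auto. fold k. unfold U. right. replace (1 / 2 - s) with (1 / 2 + - s) by ring. rewrite pw_plus. field.
        + rewrite <- rsum_const. apply rsum_le. intros i Hi. destruct (block_low s j i ltac:(lra) Hj Hi) as (_ & _ & H). fold k in H. lra.
      - eapply Rle_trans; [apply (rsum_inj_le (fun n => / 2 * gk s k n) (fun i => 2 ^ j + i)%nat _ (Bk k))|].
        + intros; lia.
        + intros i Hi. apply (block_low s j i ltac:(lra) Hj Hi).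
        + intros n. pose proof (gk_ge0 s k n). lra.
        + apply rsum_le. intros n _. destruct (in_block_dec k n) as [[_ Hn]|Hn]; [|rewrite gk_out by auto; lra].
          rewrite (Rmult_comm (/ 2)). apply Rmult_le_compat_l; [apply gk_ge0|].
          apply lt_INR in Hn. rewrite Nat.pow_succ_r', (mult_INR 2), pw_nat in Hn. fold X in Hn. simpl (INR 2) in Hn.
          replace (/ 2) with (cos (PI / 3)) by (rewrite cos_PI3; field).
          pose proof PI_RGT_0. pose proof (pos_INR (n * n)).
          assert (Hnx : INR (n * n) * x <= / 6).
          { apply Rle_trans with ((2 * X) * / (12 * X)); [apply Rmult_le_compat; lra|]. right; field; lra. }
          assert (0 <= INR (n * n) * x) by (apply Rmult_le_pos; lra).
          apply cos_decr_1; try nra. }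
    assert (HUs : U <= sqrt (A2 (gk s k) (Bk k) x)).
    { rewrite <- (sqrt_pow2 U) by lra. apply sqrt_le_1_alt. unfold A2. pose proof (pow2_ge_0 (FS (gk s k) (Bk k) x)).
      assert (U ^ 2 <= FC (gk s k) (Bk k) x ^ 2) by (apply pow_incr; lra). lra. }
    unfold rpow. destruct Rle_dec; [lra|]. apply Rle_Rpower_l; lra. }
  unfold block_moment. fold k.
  rewrite <- (RInt_Chasles (V := R_CompleteNormedModule) _ 0 (/ (12 * X)) 1) by (apply ex_RInt_cont; auto).
  assert (H1 : RInt (fun _ => Rpower U p) 0 (/ (12 * X)) <= RInt (fun x => rpow (sqrt (A2 (gk s k) (Bk k) x)) p) 0 (/ (12 * X))).
  { apply RInt_le; [lra|apply ex_RInt_cont; intros; apply continuous_const|apply ex_RInt_cont; auto|]. intros x Hx; apply Hpt; lra. }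
  assert (H2 : RInt (fun _ => 0) (/ (12 * X)) 1 <= RInt (fun x => rpow (sqrt (A2 (gk s k) (Bk k) x)) p) (/ (12 * X)) 1).
  { apply RInt_le; [lra|apply ex_RInt_cont; intros; apply continuous_const|apply ex_RInt_cont; auto|]. intros x Hx; apply rpow_ge0. }
  rewrite RInt_const in H1. rewrite RInt_const in H2. unfold scal in H1, H2; simpl in H1, H2; unfold mult in H1, H2; simpl in H1, H2.
  unfold plus; simpl. rewrite Rmult_0_r in H2.
  apply Rle_trans with (/ (12 * X) * Rpower U p); [|lra]. right.
  unfold U. rewrite <- (Rpower_mult_distr (/ 8 * Rpower 2 (- s))) by (try apply pw_pos; pose proof (Rpower_pos 2 (- s)); lra).
  rewrite <- pw_mult. replace (- (p * (s - 1 / 2) + 1)) with ((1 / 2 - s) * p + - (1)) by field. rewrite pw_plus.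
  replace (pw k (- (1))) with (/ X) by (unfold X, pw; rewrite Ropp_mult_distr_r_reverse, Rpower_Ropp; auto).
  field. lra.
Qed.

(** A pointwise inequality between powers, integrated, compares the moments of order 2, [p] and 4;
    the constants may depend on the block. *)
Lemma moment_ineq k c1 c3 c4 : (forall u, 0 <= u -> u ^ 2 <= c1 * rpow u p + (c3 + c4 * u ^ 4)) ->
  rsum (fun n => gk s k n * gk s k n) (Bk k) <= c1 * block_moment s p k + (c3 + c4 * fourth_moment s k).
Proof.
  intros H. rewrite <- (is_RInt_unique _ _ _ _ (A2_integral (gk s k) (Bk k))).
  assert (HI : is_RInt (fun x => plus (scal c1 (rpow (sqrt (A2 (gk s k) (Bk k) x)) p)) (plus c3 (scal c4 (A2 (gk s k) (Bk k) x ^ 2)))) 0 1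
     (plus (scal c1 (block_moment s p k)) (plus ((1 - 0) * c3) (scal c4 (fourth_moment s k))))).
  { apply (is_RInt_plus (V := R_NormedModule)); [|apply (is_RInt_plus (V := R_NormedModule))].
    - apply (is_RInt_scal (V := R_NormedModule)). apply (RInt_correct (V := R_CompleteNormedModule)). apply ex_RInt_cont; intros; apply root_continuous; auto.
    - apply (is_RInt_const (V := R_NormedModule)).
    - apply (is_RInt_scal (V := R_NormedModule)). apply (RInt_correct (V := R_CompleteNormedModule)). apply ex_RInt_cont; intros x.
      apply (continuous_ext (fun y => A2 (gk s k) (Bk k) y * A2 (gk s k) (Bk k) y)). intros t; toR; ring.
      apply (continuous_mult (K := R_AbsRing)); apply A2_continuous. }
  apply Rle_trans with (plus (scal c1 (block_moment s p k)) (plus ((1 - 0) * c3) (scal c4 (fourth_moment s k)))).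
  - rewrite <- (is_RInt_unique _ _ _ _ HI). apply RInt_le; [lra|apply ex_RInt_cont, A2_continuous|eexists; apply HI|].
    intros x _. specialize (H (sqrt (A2 (gk s k) (Bk k) x)) (sqrt_pos _)).
    pose proof (sqrt_sqrt _ (A2_ge0 (gk s k) (Bk k) x)) as Hq. set (u := sqrt (A2 (gk s k) (Bk k) x)) in *.
    change (A2 (gk s k) (Bk k) x <= c1 * rpow u p + (c3 + c4 * A2 (gk s k) (Bk k) x ^ 2)). rewrite <- Hq.
    replace ((u * u) ^ 2) with (u ^ 4) by ring. replace (u * u) with (u ^ 2) by ring. auto.
  - right. change (c1 * block_moment s p k + ((1 - 0) * c3 + c4 * fourth_moment s k) = c1 * block_moment s p k + (c3 + c4 * fourth_moment s k)). ring.
Qed.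

(** The second moment is known from Parseval. For [p >= 2], values below a threshold account for at
    most half of it; for [p < 2], values above a threshold do, by the fourth moment. On the
    remaining values [u^2] is at most a constant times [u^p]. *)
Lemma block_moment_lower_mid : exists c A, 0 < c /\ forall j, (2 <= j)%nat ->
  c * pw (2 * j) (- (p * (s - 1 / 4))) <= INR (S (2 * j)) ^ A * block_moment s p (2 * j).
Proof.
  set (c2 := Rpower 2 (-2 * s) / 4). assert (Hc2 : 0 < c2) by (unfold c2; pose proof (Rpower_pos 2 (-2 * s)); lra).
  assert (Hsq : forall k, pw k (1 / 2 - 2 * s) = pw k (1 / 4 - s) ^ 2) by (intros; rewrite pw_pow; f_equal; simpl; field).
  destruct (Rle_dec 2 p) as [H2|H2].
  (* Makes [del^2] exactly half of the lower bound for the second moment. *)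
  - set (D := sqrt (c2 / 2)). assert (HD : 0 < D) by (apply sqrt_lt_R0; lra).
    assert (HD2 : D ^ 2 = c2 / 2) by (unfold D; apply pow2_sqrt; lra).
    exists (Rpower D p), O. split; [apply Rpower_pos|]. intros j Hj. rewrite pow_O, Rmult_1_l. set (k := (2 * j)%nat).
    set (X := pw k (1 / 4 - s)). assert (HX : 0 < X) by apply pw_pos. set (del := D * X). assert (Hdel : 0 < del) by (apply Rmult_lt_0_compat; auto).
    pose proof (I2_lower s j ltac:(lra) Hj) as HI. fold k c2 in HI. rewrite Hsq in HI. fold X in HI.
    pose proof (moment_ineq k (Rpower del (2 - p)) (del ^ 2) 0) as Hm.
    assert (Hpt : forall u, 0 <= u -> u ^ 2 <= Rpower del (2 - p) * rpow u p + (del ^ 2 + 0 * u ^ 4)).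
    { intros u Hu. rewrite Rmult_0_l, Rplus_0_r. destruct (Rle_dec u del).
      - assert (u ^ 2 <= del ^ 2) by (apply pow_incr; lra). pose proof (Rpower_pos del (2 - p)). pose proof (rpow_ge0 u p). nra.
      - assert (u ^ 2 <= Rpower del (2 - p) * rpow u p); [|pose proof (pow2_ge_0 del); lra].
        unfold rpow. destruct Rle_dec; [lra|]. replace (u ^ 2) with (Rpower u (2 - p) * Rpower u p).
        + apply Rmult_le_compat_r; [left; apply Rpower_pos|]. apply Rpower_neg_anti; lra.
        + rewrite <- Rpower_plus. replace (2 - p + p) with (INR 2) by (simpl; ring). apply Rpower_pow; lra. }
    specialize (Hm Hpt). rewrite Rmult_0_l, Rplus_0_r in Hm.
    assert (Hd2 : del ^ 2 = c2 / 2 * X ^ 2) by (unfold del; rewrite Rpow_mult_distr, HD2; auto).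
    assert (H3 : del ^ 2 <= Rpower del (2 - p) * block_moment s p k) by lra.
    replace (Rpower D p * pw k (- (p * (s - 1 / 4)))) with (Rpower del p).
    2:{ unfold del. rewrite <- Rpower_mult_distr by auto. f_equal. unfold X. rewrite <- pw_mult. f_equal; ring. }
    apply Rmult_le_reg_l with (Rpower del (2 - p)); [apply Rpower_pos|]. rewrite <- Rpower_plus.
    replace (2 - p + p) with (INR 2) by (simpl; ring). rewrite Rpower_pow by auto. auto.
  (* Makes [fourth_moment / T^2] at most half of the second moment bound. The factor [m^2] in [T]
     pays for the logarithms of the fourth moment, and [m^4] bounds its power [2 - p]. *)
  - apply Rnot_le_lt in H2. set (C4 := 4080000000). set (D := sqrt (2 * C4 / c2)).
    assert (HDp : 0 < 2 * C4 / c2) by (apply Rdiv_lt_0_compat; unfold C4; lra).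
    assert (HD : 0 < D) by (apply sqrt_lt_R0; lra). assert (HD2 : D ^ 2 = 2 * C4 / c2) by (unfold D; apply pow2_sqrt; lra).
    exists (c2 / 2 * Rpower D (- (2 - p))), 4%nat. split; [apply Rmult_lt_0_compat; [lra|apply Rpower_pos]|]. intros j Hj. set (k := (2 * j)%nat).
    set (m := INR (S k)). assert (Hm1 : 1 <= m) by (apply (le_INR 1); lia).
    set (X := pw k (1 / 4 - s)). assert (HX : 0 < X) by apply pw_pos.
    set (T := D * m ^ 2 * X). assert (Hmm : 0 < m ^ 2) by (apply pow_lt; lra).
    assert (HT : 0 < T) by (unfold T; apply Rmult_lt_0_compat; auto; apply Rmult_lt_0_compat; auto).
    pose proof (I2_lower s j ltac:(lra) Hj) as HI. fold k c2 in HI. rewrite Hsq in HI. fold X in HI.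
    pose proof (moment_ineq k (Rpower T (2 - p)) 0 (/ T ^ 2)) as Hm.
    assert (Hpt : forall u, 0 <= u -> u ^ 2 <= Rpower T (2 - p) * rpow u p + (0 + / T ^ 2 * u ^ 4)).
    { intros u Hu. rewrite Rplus_0_l. assert (HTi : 0 < / T ^ 2) by (apply Rinv_0_lt_compat, pow_lt; auto).
      assert (Hu4 : 0 <= / T ^ 2 * u ^ 4) by (apply Rmult_le_pos; [lra|apply pow_le; auto]).
      destruct (Rle_dec u T).
      - assert (u ^ 2 <= Rpower T (2 - p) * rpow u p); [|lra].
        unfold rpow. destruct Rle_dec; [replace u with 0 by lra; simpl; lra|]. replace (u ^ 2) with (Rpower u (2 - p) * Rpower u p).
        + apply Rmult_le_compat_r; [left; apply Rpower_pos|]. apply Rle_Rpower_l; lra.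
        + rewrite <- Rpower_plus. replace (2 - p + p) with (INR 2) by (simpl; ring). apply Rpower_pow; lra.
      - assert (T ^ 2 <= u ^ 2) by (apply pow_incr; lra). pose proof (Rpower_pos T (2 - p)). pose proof (rpow_ge0 u p).
        assert (u ^ 2 <= / T ^ 2 * u ^ 4).
        { replace (/ T ^ 2 * u ^ 4) with (u ^ 2 * (u ^ 2 / T ^ 2)) by (field; lra). rewrite <- (Rmult_1_r (u ^ 2)) at 1.
          apply Rmult_le_compat_l; [apply pow2_ge_0|]. apply Rle_div_r; [apply pow_lt; auto|lra]. }
        assert (0 <= Rpower T (2 - p) * rpow u p) by (apply Rmult_le_pos; lra). lra. }
    specialize (Hm Hpt). rewrite Rplus_0_l in Hm.
    assert (H4 : / T ^ 2 * fourth_moment s k <= c2 / 2 * X ^ 2).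
    { pose proof (fourth_moment_upper s k ltac:(lra)) as H4. fold m C4 in H4.
      replace (pw k (1 - 4 * s)) with (X ^ 4) in H4 by (unfold X; rewrite pw_pow; f_equal; simpl; field).
      apply Rmult_le_reg_l with (T ^ 2); [apply pow_lt; auto|]. rewrite <- Rmult_assoc, Rinv_r, Rmult_1_l by (apply pow_nonzero; lra).
      eapply Rle_trans; [apply H4|]. unfold T.
      replace ((D * m ^ 2 * X) ^ 2 * (c2 / 2 * X ^ 2)) with (D ^ 2 * c2 / 2 * m ^ 4 * X ^ 4) by field.
      replace (D ^ 2 * c2 / 2) with C4 by (rewrite HD2; field; lra).
      apply Rmult_le_compat_r; [apply pow_le; lra|]. apply Rmult_le_compat_l; [unfold C4; lra|].
      replace (m ^ 4) with (m ^ 3 * m) by ring. rewrite <- (Rmult_1_r (m ^ 3)) at 1. apply Rmult_le_compat_l; [apply pow_le; lra|auto]. }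
    assert (H5 : c2 / 2 * X ^ 2 <= Rpower T (2 - p) * block_moment s p k) by lra.
    assert (HTp : Rpower T (2 - p) <= Rpower D (2 - p) * m ^ 4 * Rpower X (2 - p)).
    { unfold T. assert (Hm2 : 0 < m ^ 2) by (apply pow_lt; lra).
      rewrite <- (Rpower_mult_distr (D * m ^ 2)), <- (Rpower_mult_distr D) by (auto; apply Rmult_lt_0_compat; auto).
      apply Rmult_le_compat_r; [left; apply Rpower_pos|]. apply Rmult_le_compat_l; [left; apply Rpower_pos|].
      replace (m ^ 4) with ((m ^ 2) ^ 2) by ring. rewrite <- (Rpower_pow 2 (m ^ 2)) by auto. apply Rle_Rpower; [nra|simpl; lra]. }
    assert (H6 : c2 / 2 * X ^ 2 <= Rpower D (2 - p) * m ^ 4 * Rpower X (2 - p) * block_moment s p k).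
    { eapply Rle_trans; [apply H5|]. apply Rmult_le_compat_r; auto. apply block_moment_ge0. }
    replace (pw k (- (p * (s - 1 / 4)))) with (X ^ 2 * Rpower X (- (2 - p))).
    2:{ rewrite <- Rpower_pow by auto. rewrite <- Rpower_plus. unfold X. rewrite <- pw_mult. f_equal. simpl. ring. }
    apply Rmult_le_reg_l with (Rpower D (2 - p) * Rpower X (2 - p)); [apply Rmult_lt_0_compat; apply Rpower_pos|].
    assert (E1 : Rpower D (2 - p) * Rpower D (- (2 - p)) = 1) by (rewrite <- Rpower_plus, Rplus_opp_r; apply Rpower_O; auto).
    assert (E2 : Rpower X (2 - p) * Rpower X (- (2 - p)) = 1) by (rewrite <- Rpower_plus, Rplus_opp_r; apply Rpower_O; auto).
    replace (Rpower D (2 - p) * Rpower X (2 - p) * (c2 / 2 * Rpower D (- (2 - p)) * (X ^ 2 * Rpower X (- (2 - p)))))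
      with (c2 / 2 * X ^ 2 * ((Rpower D (2 - p) * Rpower D (- (2 - p))) * (Rpower X (2 - p) * Rpower X (- (2 - p))))) by ring.
    rewrite E1, E2. lra.
Qed.

Lemma eta_upper : Rbar_le (eta_s s p) (p * (s - 1 / 4)) /\ Rbar_le (eta_s s p) (p * (s - 1 / 2) + 1).
Proof.
  split; apply (proj2 (Rbar_lub_spec _)); intros z (sig & -> & HB); simpl.
  - destruct block_moment_lower_mid as (c & A & Hc & H). apply (besov_growth sig _ A c Hc H HB).
  - apply (besov_growth sig _ 0 (/ 12 * Rpower (/ 8 * Rpower 2 (- s)) p)); auto.
    + apply Rmult_lt_0_compat; [lra|apply Rpower_pos].
    + intros j Hj. rewrite pow_O, Rmult_1_l. apply block_moment_lower_peak; auto.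
Qed.

Lemma in_Besov_blocks sg M : (forall k, Rpower 2 (INR (S k) * sg) * rpow (block_moment s p k) (/ p) <= M) -> in_Besov sg p (Riemann_fn s).
Proof.
  intros H. exists (Rmax 0 M). intros [|k].
  - rewrite Lp_block_0 by auto. rewrite Rmult_0_r. apply Rmax_l.
  - rewrite Lp_block_S by auto. eapply Rle_trans; [apply H|apply Rmax_r].
Qed.

(** Here the supremum is attained: each block is bounded uniformly by its number of terms times
    their size, without logarithms. *)
Lemma eta_lower_triv : Rbar_le (p * (s - 1 / 2)) (eta_s s p).
Proof.
  apply (proj1 (Rbar_lub_spec _)). exists (p * (s - 1 / 2)). split; auto.
  apply (in_Besov_blocks _ (Rpower 2 (s - 1 / 2) * 12)). intros k.
  set (U := 12 * pw k (1 / 2 - s)). assert (HU : 0 < U) by (unfold U; pose proof (pw_pos k (1 / 2 - s)); lra).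
  assert (HJ : block_moment s p k <= Rpower U p).
  { unfold block_moment. replace (Rpower U p) with (RInt (fun _ => Rpower U p) 0 1) by (rewrite RInt_const; unfold scal; simpl; unfold mult; simpl; ring).
    apply RInt_le; [lra|apply ex_RInt_cont; intros; apply root_continuous; auto|apply ex_RInt_cont; intros; apply continuous_const|].
    intros x _. rewrite <- rpow_pos_eq by auto. apply rpow_mono; [lra|]. split; [apply sqrt_pos|].
    rewrite <- (sqrt_pow2 U) by lra. apply sqrt_le_1_alt. rewrite A2_FP.
    pose proof (FP_triv _ _ _ 0 x (gk_BV s k ltac:(lra))) as F1. pose proof (FP_triv _ _ _ (- (PI / 2)) x (gk_BV s k ltac:(lra))) as F2.
    assert (HB : INR (Bk k) * (2 * pw k (- s)) <= U / 2).
    { unfold U. replace (1 / 2 - s) with (1 / 2 + - s) by ring. rewrite pw_plus. pose proof (Bk_le_pw k). pose proof (pw_pos k (- s)). nra. }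
    assert (Hsq : forall x M, Rabs x <= M -> x ^ 2 <= M ^ 2).
    { intros z M Hz. rewrite <- pow2_abs. apply pow_incr. split; [apply Rabs_pos|auto]. }
    pose proof (Hsq _ _ (Rle_trans _ _ _ F1 HB)). pose proof (Hsq _ _ (Rle_trans _ _ _ F2 HB)). nra. }
  assert (Hr : rpow (block_moment s p k) (/ p) <= U).
  { replace U with (rpow (Rpower U p) (/ p)).
    - apply rpow_mono; [left; apply Rinv_0_lt_compat; auto|]. split; [apply block_moment_ge0|auto].
    - rewrite rpow_pos_eq by apply Rpower_pos. rewrite Rpower_mult, Rinv_r, Rpower_1 by lra. auto. }
  replace (p * (s - 1 / 2) / p) with (s - 1 / 2) by (field; lra).
  apply Rle_trans with (Rpower 2 (INR (S k) * (s - 1 / 2)) * U); [apply Rmult_le_compat_l; [left; apply Rpower_pos|auto]|].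
  right. unfold U. rewrite S_INR, Rmult_plus_distr_r, Rpower_plus. fold (pw k (s - 1 / 2)). rewrite Rmult_1_l.
  replace (pw k (s - 1 / 2) * Rpower 2 (s - 1 / 2) * (12 * pw k (1 / 2 - s))) with
    (Rpower 2 (s - 1 / 2) * 12 * (pw k (s - 1 / 2) * pw k (1 / 2 - s))) by ring.
  rewrite <- pw_plus. replace (s - 1 / 2 + (1 / 2 - s)) with 0 by ring. rewrite pw_0. ring.
Qed.
End Lower.

Lemma eta_lower_4 s : 1 / 2 < s -> Rbar_le (4 * s - 1) (eta_s s 4).
Proof.
  intros Hs. assert (H4 : 0 < 4) by lra.
  assert (HJ : forall k, block_moment s 4 k = fourth_moment s k).
  { intros k. unfold block_moment, fourth_moment. apply RInt_ext. intros x _. pose proof (sqrt_pos (A2 (gk s k) (Bk k) x)) as Hq.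
    rewrite <- (sqrt_sqrt _ (A2_ge0 (gk s k) (Bk k) x)) at 2. set (u := sqrt (A2 (gk s k) (Bk k) x)) in *.
    unfold rpow. destruct (Rle_dec u 0). replace u with 0 by lra. toR; ring.
    replace 4 with (INR 4) by (simpl; ring). rewrite Rpower_pow by lra. toR; ring. }
  assert (Hlt : forall sig, sig < 4 * s - 1 -> Rbar_le sig (eta_s s 4)).
  { intros sig Hsig. apply (proj1 (Rbar_lub_spec _)). exists sig. split; auto.
    destruct (poly_pw 3 (4 * s - 1 - sig)) as (M & HM & HP); [lra|].
    set (C := 4080000000 * M). assert (HC : 0 < C) by (unfold C; lra).
    apply (in_Besov_blocks s 4 Hs _ (Rpower 2 (sig / 4) * Rpower C (/ 4))). intros k.
    assert (HB : block_moment s 4 k <= C * pw k (- sig)).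
    { rewrite HJ. eapply Rle_trans; [apply fourth_moment_upper; lra|]. specialize (HP k).
      replace (- sig) with ((4 * s - 1 - sig) + (1 - 4 * s)) by ring. rewrite pw_plus. unfold C.
      pose proof (pw_pos k (1 - 4 * s)).
      replace (4080000000 * M * (pw k (4 * s - 1 - sig) * pw k (1 - 4 * s))) with (4080000000 * (M * pw k (4 * s - 1 - sig)) * pw k (1 - 4 * s)) by ring.
      apply Rmult_le_compat_r; lra. }
    assert (Hpos : 0 < C * pw k (- sig)) by (apply Rmult_lt_0_compat; auto; apply pw_pos).
    apply Rle_trans with (Rpower 2 (INR (S k) * (sig / 4)) * Rpower (C * pw k (- sig)) (/ 4)).
    - apply Rmult_le_compat_l; [left; apply Rpower_pos|]. rewrite <- rpow_pos_eq by auto. apply rpow_mono; [lra|].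
      split; [apply block_moment_ge0; auto|auto].
    - right. rewrite <- Rpower_mult_distr by (auto; apply pw_pos). rewrite <- pw_mult.
      rewrite S_INR, Rmult_plus_distr_r, Rpower_plus, Rmult_1_l. fold (pw k (sig / 4)).
      replace (pw k (sig / 4) * Rpower 2 (sig / 4) * (Rpower C (/ 4) * pw k (- sig * / 4))) with
        (Rpower 2 (sig / 4) * Rpower C (/ 4) * (pw k (sig / 4) * pw k (- sig * / 4))) by ring.
      rewrite <- pw_plus. replace (sig / 4 + - sig * / 4) with 0 by field. rewrite pw_0. ring. }
  destruct (eta_s s 4) as [l| |] eqn:E; simpl in *; auto.
  - apply Rnot_lt_le. intros Hl. specialize (Hlt ((l + (4 * s - 1)) / 2) ltac:(lra)). lra.
  - apply (Hlt (4 * s - 2)). lra.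
Qed.

(** * The spectrum of singularities *)

Lemma null_dim_le (E : R -> Prop) t : 0 < t -> null_cover t E -> Rbar_le (hausdorff_dim E) t.
Proof.
  intros Ht HE. unfold hausdorff_dim. match goal with |- Rbar_le (Rbar_glb ?P) _ => destruct (Rbar_glb_spec P) as [Hlb _] end.
  destruct (classic (exists x, E x)) as [Hex|Hne].
  - apply Hlb. right. split; auto. exists t. split; auto. split; [lra|]. apply null_cover_measure; auto.
  - apply Rbar_le_trans with m_infty; [|simpl; auto]. apply Hlb. left. auto.
Qed.

Definition level_set (s al x : R) : Prop := 0 <= x < 1 /\ holder_exponent (Riemann_fn s) x = Finite al.

(** A [v] strictly between the expected dimension, truncated at 0, and [min 1 t] gives
    [tau = 2 / v >= 2] with [tau t > 2]. Diophantine points for this [tau] have exponent at least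
    [s - 1/2 + v/4 > b], so they are excluded. *)
Lemma low_exponent_null s b t : 1 / 2 < s -> b < s - 1 / 4 -> 0 < t -> 4 * b - 4 * s + 2 < t ->
  null_cover t (fun x => 0 <= x < 1 /\ Rbar_le (holder_exponent (Riemann_fn s) x) b).
Proof.
  intros Hs Hb Ht Hbt. set (d := Rmax 0 (4 * b - 4 * s + 2)).
  assert (Hd : d < Rmin 1 t) by (unfold d; apply Rmax_lub_lt; apply Rmin_glb_lt; lra).
  assert (Hd0 : 0 <= d) by apply Rmax_l. assert (Hd1 : 4 * b - 4 * s + 2 <= d) by apply Rmax_r.
  set (v := (d + Rmin 1 t) / 2). assert (Hv : d < v < Rmin 1 t) by (unfold v; lra).
  pose proof (Rmin_l 1 t). pose proof (Rmin_r 1 t).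
  set (tau := 2 / v). assert (Htau : 2 <= tau) by (unfold tau; apply Rle_div_r; lra).
  assert (Htv : tau * v = 2) by (unfold tau; field; lra).
  apply (null_cover_subset t _ (well_approx tau)); [|apply well_approx_null_cover; try lra; nra].
  intros x [Hx He]. split; auto. intros (c & Hc & Hdi).
  pose proof (exponent_ge_dioph s tau c x Hs Htau Hc Hdi) as Hge.
  pose proof (Rbar_le_trans _ _ _ Hge He) as Hf. simpl in Hf.
  assert (/ (2 * tau) = v / 4) by (unfold tau; field; lra). lra.
Qed.

(** At the end point [al = s - 1/4] the order [tau] would have to be below 2; but there [t > 1], and
    the unit interval itself is null. *)
Lemma spectrum_upper s al t : 1 / 2 < s -> al <= s - 1 / 4 -> 0 < t -> 4 * al - 4 * s + 2 < t -> null_cover t (level_set s al).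
Proof.
  intros Hs Ha Ht Hlt. destruct (Rle_lt_or_eq_dec al (s - 1 / 4) Ha) as [Hl|He].
  - apply (null_cover_subset t _ (fun x => 0 <= x < 1 /\ Rbar_le (holder_exponent (Riemann_fn s) x) al)).
    + intros x [Hx E]. split; auto. rewrite E. simpl; lra.
    + apply low_exponent_null; auto.
  - apply (null_cover_subset t _ (fun x => 0 <= x < 1)). intros x [Hx _]; auto. apply unit_null_cover. lra.
Qed.

(** [Q] bounds the denominator only from above, so the single fraction 0/1 serves for every [Q]. *)
Lemma approx_0 tau : approx tau 0.
Proof.
  intros Q0. exists (S Q0), 0%Z, 1%nat. split; [lia|]. split; [lia|]. split; [exists 0%nat; lia|]. split; [reflexivity|].
  unfold Rdiv. rewrite Rmult_0_l, Rminus_0_r, Rabs_R0. left; apply Rpower_pos.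
Qed.

Lemma exponent_at_0 s : 1 / 2 < s -> holder_exponent (Riemann_fn s) 0 = Finite (s - 1 / 2).
Proof.
  intros Hs. apply Rbar_le_antisym; [|apply exponent_ge_global; auto].
  assert (H : forall eps, 0 < eps <= 1 / 4 -> Rbar_le (holder_exponent (Riemann_fn s) 0) (s - 1 / 2 + eps)).
  { intros eps He. replace eps with (/ (2 * (/ (2 * eps)))) by (field; lra). apply exponent_le_approx; auto; [|apply approx_0].
    rewrite <- (Rinv_inv 2). apply Rinv_le_contravar; lra. }
  destruct (holder_exponent (Riemann_fn s) 0) as [l| |] eqn:E; simpl in *; auto.
  - apply le_epsilon. intros eps He. specialize (H (Rmin eps (1 / 4))).
    pose proof (Rmin_l eps (1 / 4)). pose proof (Rmin_r eps (1 / 4)). assert (0 < Rmin eps (1 / 4)) by (apply Rmin_glb_lt; lra).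
    specialize (H ltac:(lra)). lra.
  - apply (H (1 / 4)). lra.
Qed.

(** A Cantor point of order [tau = 2 / d] has exponent at most [al], and avoiding the countably many
    sets of smaller exponent makes it equal. One more null set [E0] can be avoided for free: the
    empty set gives existence, the level set itself a contradiction. *)
Lemma spectrum_nonempty_and_large s al : 1 / 2 < s -> s - 1 / 2 < al <= s - 1 / 4 ->
  (exists x, level_set s al x) /\ forall t, 0 <= t -> hausdorff_measure t (level_set s al) = Finite 0 -> 4 * al - 4 * s + 2 <= t.
Proof.
  intros Hs Hal. set (d := 4 * al - 4 * s + 2). assert (Hd : 0 < d <= 1) by (unfold d; lra).
  set (tau := 2 / d). assert (Htd : tau * d = 2) by (unfold tau; field; lra).
  assert (Htau : 2 <= tau) by (unfold tau; apply Rle_div_r; lra).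
  (* Points of exponent at most [bn n] have dimension at most [d - 1 / (n + 1)], and [tn n] lies
     strictly between this and [d]; the maximum with [d / 2] keeps it positive. *)
  set (bn := fun n : nat => al - / (4 * INR (S n))). set (tn := fun n => Rmax (d / 2) (d - / (2 * INR (S n)))).
  assert (Hin : forall n, 0 < / INR (S n)) by (intros; apply Rinv_0_lt_compat, lt_0_INR; lia).
  assert (Hi2 : forall n, / (4 * INR (S n)) = / INR (S n) / 4 /\ / (2 * INR (S n)) = / INR (S n) / 2).
  { intros n. assert (INR (S n) <> 0) by (apply not_0_INR; lia). split; field; auto. }
  assert (Htn : forall n, 0 < tn n < d).
  { intros n. unfold tn. destruct (Hi2 n) as [_ ->]. specialize (Hin n). split.
    - apply Rlt_le_trans with (d / 2); [lra|apply Rmax_l].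
    - apply Rmax_lub_lt; lra. }
  set (Bset := fun n x => 0 <= x < 1 /\ Rbar_le (holder_exponent (Riemann_fn s) x) (bn n)).
  assert (HB : forall n, null_cover (tn n) (Bset n)).
  { intros n. unfold Bset. specialize (Htn n). apply low_exponent_null; auto; try lra.
    - unfold bn. destruct (Hi2 n) as [-> _]. specialize (Hin n). lra.
    - apply Rlt_le_trans with (d - / (2 * INR (S n))); [|apply Rmax_r].
      unfold bn, d. destruct (Hi2 n) as [-> ->]. specialize (Hin n). lra. }
  assert (Hmain : forall t0 (E0 : R -> Prop), 0 < t0 < d -> hausdorff_measure t0 E0 = Finite 0 ->
     exists x, level_set s al x /\ ~ E0 x).
  { intros t0 E0 Ht0 HE0.
    destruct (cantor_main tau Htau (fun n => match n with O => t0 | S m => tn m end) (fun n => match n with O => E0 | S m => Bset m end)) as (x & Hx & Hap & Hnot).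
    - intros [|m]. split; [lra|nra]. specialize (Htn m). split; [lra|nra].
    - intros [|m].
      + apply (measure_null_cover t0 E0); auto; lra.
      + apply (measure_null_cover (tn m) (Bset m)). specialize (Htn m); lra. apply null_cover_measure; [apply Htn|apply HB].
    - exists x. split; [|apply (Hnot O)]. split; auto.
      pose proof (exponent_le_approx s tau x Hs Htau Hap) as Hle.
      assert (Ev : s - 1 / 2 + / (2 * tau) = al) by (unfold tau, d in *; field; lra). rewrite Ev in Hle.
      apply Rbar_le_antisym; auto.
      assert (Hgt : forall n, Rbar_lt (bn n) (holder_exponent (Riemann_fn s) x)).
      { intros n. apply Rbar_not_le_lt. intros Hc. apply (Hnot (S n)). split; auto. }
      destruct (holder_exponent (Riemann_fn s) x) as [l| |]; cbn [Rbar_le Rbar_lt] in *; auto.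
      + apply Rnot_lt_le. intros Hl. destruct (nfloor_ex (/ (al - l))) as [n Hn]; [left; apply Rinv_0_lt_compat; lra|].
        specialize (Hgt n). unfold bn in Hgt. destruct (Hi2 n) as [E _]. rewrite E in Hgt.
        assert (/ INR (S n) <= al - l).
        { rewrite <- (Rinv_inv (al - l)). apply Rinv_le_contravar; [apply Rinv_0_lt_compat; lra|]. rewrite S_INR. lra. }
        specialize (Hin n). lra.
      + apply (Hgt O). }
  split.
  - destruct (Hmain (d / 2) (fun _ => False)) as (x & Hx & _); [lra| |exists x; auto].
    apply null_cover_measure; [lra|].
    intros eps del He Hdl. exists (fun _ _ => False), (fun _ => 0). split; [intros; lra|]. split; [intros i x y []|]. split.
    + intros x [].
    + intros N. rewrite rsum_eq0; [lra|]. intros. unfold rpow. destruct Rle_dec; lra.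
  - intros t Ht Hm. apply Rnot_lt_le. intros Hlt. destruct (measure_null_cover t _ Ht Hm) as [Ht0 _].
    destruct (Hmain t (level_set s al)) as (x & Hx & Hn); auto.
Qed.

Lemma spectrum_empty s al : 1 / 2 < s -> al < s - 1 / 2 -> spectrum s al = m_infty.
Proof.
  intros Hs Ha. apply Rbar_is_glb_unique. split; [intros x _; exact I|].
  intros b Hb. apply Hb. left. split; auto. intros (x & _ & Hx).
  pose proof (exponent_ge_global s x Hs) as H. rewrite Hx in H. simpl in H. lra.
Qed.

Lemma spectrum_value s al : 1 / 2 < s -> s - 1 / 2 <= al <= s - 1 / 4 -> spectrum s al = Finite (4 * al - 4 * s + 2).
Proof.
  intros Hs Ha. change (spectrum s al) with (hausdorff_dim (level_set s al)). apply Rbar_le_antisym.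
  - assert (H : forall t, 0 < t -> 4 * al - 4 * s + 2 < t -> Rbar_le (hausdorff_dim (level_set s al)) t).
    { intros t Ht Hlt. apply null_dim_le; auto. apply spectrum_upper; auto; lra. }
    destruct (hausdorff_dim (level_set s al)) as [l| |]; cbn [Rbar_le] in *; auto.
    + apply le_epsilon. intros eps He. apply H; lra.
    + apply (H 2); lra.
  - assert (HE : (exists x, level_set s al x) /\
      forall t, 0 <= t -> hausdorff_measure t (level_set s al) = Finite 0 -> 4 * al - 4 * s + 2 <= t).
    { destruct (Req_EM_T al (s - 1 / 2)) as [->|Hne]; [|apply spectrum_nonempty_and_large; auto; lra].
      split; [exists 0; split; [lra|apply exponent_at_0; auto]|intros; lra]. }
    destruct HE as [Hex Hlow]. unfold hausdorff_dim.
    match goal with |- Rbar_le _ (Rbar_glb ?P) => destruct (Rbar_glb_spec P) as [_ Hglb] end.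
    apply Hglb. intros z [[Hne _]|(_ & t & -> & Ht & Hm)]; [contradiction|]. apply Hlow; auto.
Qed.

Lemma eta_finite s p : 1 / 2 < s -> 0 < p -> exists e, eta_s s p = Finite e /\
  p * (s - 1 / 2) <= e <= p * (s - 1 / 4) /\ e <= p * (s - 1 / 2) + 1.
Proof.
  intros Hs Hp. destruct (eta_upper s p Hs Hp) as [H1 H2]. pose proof (eta_lower_triv s p Hs Hp) as H3.
  destruct (eta_s s p) as [e| |]; cbn [Rbar_le] in *; try contradiction. exists e. auto.
Qed.

Theorem theoremD :
  forall s : R, 1 / 2 < s ->
  forall alpha : R, alpha <= s - 1 / 4 ->
    spectrum s alpha =
    Rbar_glb (fun z => exists p : R, 0 < p /\
       z = Rbar_plus (Rbar_minus (Finite (alpha * p)) (eta_s s p)) (Finite 1)).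
Proof.
  intros s Hs al Hal. symmetry. apply Rbar_is_glb_unique. destruct (Rlt_le_dec al (s - 1 / 2)) as [Hlt|Hge].
  - rewrite spectrum_empty by auto. split; [intros x _; exact I|]. intros b Hb.
    (* Since [eta >= p (s - 1/2)], the expression decreases at least linearly in [p], so no real
       number is a lower bound. *)
    assert (H : forall p, 0 < p -> Rbar_le b (1 - p * (s - 1 / 2 - al))).
    { intros p Hp. destruct (eta_finite s p Hs Hp) as (e & Ee & He & _).
      apply Rbar_le_trans with (Finite (al * p - e + 1)); [|cbn [Rbar_le]; lra].
      apply Hb. exists p. split; auto. rewrite Ee. reflexivity. }
    destruct b as [b| |]; cbn [Rbar_le] in *; auto; [|apply (H 1); lra].
    pose proof (Rabs_pos b). pose proof (Rle_abs (- b)). rewrite Rabs_Ropp in *.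
    specialize (H ((2 + Rabs b) / (s - 1 / 2 - al))).
    replace ((2 + Rabs b) / (s - 1 / 2 - al) * (s - 1 / 2 - al)) with (2 + Rabs b) in H by (field; lra).
    assert (0 < (2 + Rabs b) / (s - 1 / 2 - al)) by (apply Rdiv_lt_0_compat; lra). specialize (H ltac:(auto)). lra.
  - rewrite spectrum_value by lra. split.
    + intros z (p & Hp & ->). destruct (eta_finite s p Hs Hp) as (e & -> & He & He'). cbn.
      (* The upper bounds [p (s - 1/4)] and [p (s - 1/2) + 1] for [eta] coincide at [p = 4]; the
         first serves for [p <= 4] because [al <= s - 1/4], the second beyond because
         [al >= s - 1/2]. *)
      destruct (Rle_dec p 4); nra.
    + intros b Hb. destruct (eta_finite s 4 Hs ltac:(lra)) as (e & Ee & _).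
      pose proof (eta_lower_4 s Hs) as H4. rewrite Ee in H4. cbn [Rbar_le] in H4.
      apply Rbar_le_trans with (Finite (al * 4 - e + 1)); [|cbn [Rbar_le]; lra].
      apply Hb. exists 4. split; [lra|]. rewrite Ee. reflexivity.
Qed.
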